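(* Let $f,g\in\mathrm{LC}_n$ with $0<\int_{\mathbb{R}^n} f\,dx<\infty$ and $g$ not identically zero. Then \[ \delta(f,g)=\int_{\mathbb{R}^n}h_g\,d\mu_f+\int_{\mathbb{S}^{n-1}}h_{K_g}\,d\nu_f , \] where both sides take values in $(-\infty,+\infty]$ (the value $+\infty$ being possible when $g$ is not compactly supported).
   Context: $\mathrm{LC}_n$ denotes the class of upper semi-continuous log-concave functions $f:\mathbb{R}^n\to[0,\infty)$, i.e. $f((1-\lambda)x+\lambda y)\ge f(x)^{1-\lambda}f(y)^\lambda$ for all $x,y$ and $\lambda\in[0,1]$. For $f,g\in\mathrm{LC}_n$: the sup-convolution is $(f\star g)(x)=\sup_{y\in\mathbb{R}^n}f(y)g(x-y)$; for $t>0$, $(t\cdot g)(x)=g(x/t)^t$. The first variation is $\delta(f,g)=\lim_{t\to0^+}\frac{\int f\star(t\cdot g)-\int f}{t}$ (this limit exists in $(-\infty,\infty]$ when $0<\int f<\infty$). The support function of $g$ is $h_g=(-\log g)^*$, where $\varphi^*(x)=\sup_y(\langle x,y\rangle-\varphi(y))$ is the Legendre transform. $K_f=\{x:f(x)>0\}$ is the support of $f$. For a convex set $K$, $h_K(\theta)=\sup_{x\in K}\langle x,\theta\rangle\in(-\infty,\infty]$. Writing $f=e^{-\varphi}$ with $\varphi$ convex, $\mu_f$ is the measure on $\mathbb{R}^n$ given by the push-forward $(\nabla\varphi)_\sharp(f\,dx)$ ($\nabla\varphi$ exists a.e. on $K_f$), and $\nu_f$ is the measure on the unit sphere $\mathbb{S}^{n-1}$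 given by the push-forward $(n_{K_f})_\sharp\big(f\,d\mathcal{H}^{n-1}|_{\partial K_f}\big)$, where $n_{K_f}:\partial K_f\to\mathbb{S}^{n-1}$ is the Gauss map (outer unit normal, defined $\mathcal{H}^{n-1}$-a.e.) and $\mathcal{H}^{n-1}$ is $(n-1)$-dimensional Hausdorff measure. *)

(* Defs.v *)
From HB Require Import structures.
From mathcomp Require Import all_boot all_order all_algebra.
From mathcomp Require Import all_classical all_reals all_analysis.
Set Implicit Arguments. Unset Strict Implicit. Unset Printing Implicit Defensive.
Import Order.TTheory GRing.Theory Num.Theory numFieldNormedType.Exports.
Local Open Scope classical_set_scope.
Local Open Scope ring_scope.

Section euclid.
Variables (R : realType) (n : nat).
Implicit Types x y : 'rV[R]_n.

Definition inner x y : R := \sum_(i < n) x ord0 i * y ord0 i.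
Definition enorm x : R := Num.sqrt (inner x x).
Definition ediam (C : set 'rV[R]_n) : \bar R :=
  ereal_sup [set (enorm (x - y))%:E | x in C & y in C].
End euclid.

(* Lebesgue measure on R^n and Hausdorff measure H^s on R^n, built as         *)
(* Caratheodory restrictions of the usual outer measures                      *)
(*   L^n*(A) = inf { sum_k vol(B_k) | A <= U_k B_k, B_k boxes }               *)
(*   H^s_d(A) = inf { sum_k w_s (diam C_k / 2)^s | A <= U_k C_k,              *)
(*                                                  diam C_k <= d }           *)
(*   H^s(A) = sup_{d > 0} H^s_d(A)                                            *)
(* (covers are countable families of arbitrary subsets; a covering set that   *)
(*  is not admissible gets weight +oo, the empty set gets weight 0).          *)
Section measures.
Variables (R : realType) (n : nat).

(** a copy of R^n in which every set is admissible as a covering set *)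
Definition RnD := 'rV[R]_n.
HB.instance Definition _ := Pointed.on RnD.
HB.instance Definition _ := @isMeasurable.Build default_measure_display RnD
  setT (I : setT set0) (fun _ _ => I) (fun _ _ => I).

Local Open Scope ereal_scope.

Definition hbox (a b : 'rV[R]_n) : set 'rV[R]_n :=
  [set x | forall i, (a ord0 i <= x ord0 i < b ord0 i)%R].

Definition box_gauge (C : set RnD) : \bar R :=
  ereal_inf [set v | (C = set0 /\ v = 0) \/
    exists a b : 'rV[R]_n, (forall i, a ord0 i <= b ord0 i)%R /\
       C = hbox a b /\ v = (\prod_(i < n) (b ord0 i - a ord0 i))%:E].

Lemma box_gauge_ge0 C : 0 <= box_gauge C.
Proof.
apply: le_ereal_inf_tmp => v [[_ ->]//|[a [b [ab [_ ->]]]]].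
by rewrite lee_fin; apply: prodr_ge0 => i _; rewrite subr_ge0.
Qed.

Lemma box_gauge0 : box_gauge set0 = 0.
Proof.
apply/eqP; rewrite eq_le box_gauge_ge0 andbT.
by apply: ereal_inf_lbound; left.
Qed.

Definition lebesgue_outer : set RnD -> \bar R := mu_ext box_gauge.

HB.instance Definition _ := isOuterMeasure.Build R RnD lebesgue_outer
  (mu_ext0 box_gauge0 box_gauge_ge0) (mu_ext_ge0 box_gauge_ge0)
  (le_mu_ext box_gauge) (mu_ext_sigma_subadditive box_gauge_ge0).

(** volume of the unit ball of R^k *)
Fixpoint omega (k : nat) : R :=
  match k with
  | 0%N => 1%R
  | S k' => match k' with
            | 0%N => 2%R
            | S k'' => (2 * pi / k%:R * omega k'')%R
            end
  end.

Lemma omega_ge0 k : (0 <= omega k)%R.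
Proof.
have H : forall k, (0 <= omega k)%R /\ (0 <= omega k.+1)%R.
  elim=> [|m [IH1 IH2]] /=; first by split; rewrite ?ler01 ?ler0n.
  split => //; apply: mulr_ge0 => //.
  by apply: divr_ge0; [apply: mulr_ge0; [|apply: ltW; exact: pi_gt0]|].
by case: (H k).
Qed.

Lemma ediam_ge0 (C : set 'rV[R]_n) : C !=set0 -> 0 <= ediam C.
Proof.
move=> [x Cx]; apply: le_ereal_sup_tmp; exists (enorm (x - x))%:E.
  by exists x => //; exists x.
by rewrite lee_fin /enorm sqrtr_ge0.
Qed.

Definition haus_gauge (s : nat) (d : R) (C : set RnD) : \bar R :=
  if `[< C = set0 >] then 0
  else if ediam C <= d%:E then (omega s * (fine (ediam C) / 2) ^+ s)%:E
  else +oo.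

Lemma haus_gauge_ge0 s d C : 0 <= haus_gauge s d C.
Proof.
rewrite /haus_gauge; case: asboolP => [//|C0]; case: ifP => // _.
rewrite lee_fin; apply: mulr_ge0; first exact: omega_ge0.
apply: exprn_ge0; apply: divr_ge0 => //; apply: fine_ge0.
by apply: ediam_ge0; apply/set0P/eqP.
Qed.

Lemma haus_gauge0 s d : haus_gauge s d set0 = 0.
Proof. by rewrite /haus_gauge; case: asboolP. Qed.

Definition hausdorff_delta (s : nat) (d : R) : set RnD -> \bar R :=
  mu_ext (haus_gauge s d).

Definition hausdorff_outer (s : nat) (A : set RnD) : \bar R :=
  ereal_sup [set hausdorff_delta s d A | d in [set d : R | (0 < d)%R]].

Lemma hausdorff_delta_ge0 s d A : 0 <= hausdorff_delta s d A.
Proof. exact: (mu_ext_ge0 (@haus_gauge_ge0 s d)). Qed.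

Lemma hausdorff_outer_ge0 s A : 0 <= hausdorff_outer s A.
Proof.
apply: le_ereal_sup_tmp; exists (hausdorff_delta s 1 A).
  by exists 1%R => //=.
exact: hausdorff_delta_ge0.
Qed.

Lemma hausdorff_outer0 s : hausdorff_outer s set0 = 0.
Proof.
apply/eqP; rewrite eq_le hausdorff_outer_ge0 andbT.
apply: ge_ereal_sup => _ [d _ <-].
by rewrite /hausdorff_delta (mu_ext0 (haus_gauge0 s d) (@haus_gauge_ge0 s d)).
Qed.

Lemma le_hausdorff_outer s :
  {homo hausdorff_outer s : A B / A `<=` B >-> A <= B}.
Proof.
move=> A B AB; apply: ge_ereal_sup => _ [d d0 <-].
apply: le_ereal_sup_tmp; exists (hausdorff_delta s d B); first by exists d.
exact: le_mu_ext.
Qed.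

Lemma hausdorff_outer_sigma_subadditive s :
  sigma_subadditive (hausdorff_outer s).
Proof.
move=> F; apply: ge_ereal_sup => _ [d d0 <-].
apply: (le_trans (mu_ext_sigma_subadditive (@haus_gauge_ge0 s d) F)).
apply: lee_nneseries => [i _ _|i _]; first exact: hausdorff_delta_ge0.
apply: le_ereal_sup_tmp; exists (hausdorff_delta s d (F i)) => //.
by exists d.
Qed.

HB.instance Definition _ (s : nat) :=
  isOuterMeasure.Build R RnD (hausdorff_outer s)
  (hausdorff_outer0 s) (@hausdorff_outer_ge0 s)
  (@le_hausdorff_outer s) (@hausdorff_outer_sigma_subadditive s).

End measures.

Definition lebesgue_n (R : realType) (n : nat) :
  set (caratheodory_type (@lebesgue_outer R n)) -> \bar R :=
  @lebesgue_outer R n.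

Definition hausdorff (R : realType) (n : nat) (s : nat) :
  set (caratheodory_type (@hausdorff_outer R n s)) -> \bar R :=
  @hausdorff_outer R n s.

Section logconcave.
Variables (R : realType) (n : nat).
Implicit Types (f g : 'rV[R]_n -> R) (x y : 'rV[R]_n).

Definition upper_semicontinuous f :=
  forall x (a : R), f x < a -> \forall y \near x, f y < a.

Definition LC f : Prop :=
  [/\ (forall x, 0 <= f x), upper_semicontinuous f &
      forall x y (l : R), 0 <= l <= 1 ->
        f x `^ (1 - l) * f y `^ l <= f ((1 - l) *: x + l *: y)].

Definition supconv f g (x : 'rV[R]_n) : \bar R :=
  ereal_sup [set (f y * g (x - y))%:E | y in [set: 'rV[R]_n]].

Definition lcscale (t : R) g : 'rV[R]_n -> R := fun x => g (t^-1 *: x) `^ t.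

Definition neglog f (x : 'rV[R]_n) : \bar R :=
  if 0 < f x then (- ln (f x))%:E else +oo%E.

Definition legendre (phi : 'rV[R]_n -> \bar R) (x : 'rV[R]_n) : \bar R :=
  ereal_sup [set ((inner x y)%:E - phi y)%E | y in [set: 'rV[R]_n]].

Definition supp_fun g : 'rV[R]_n -> \bar R := legendre (neglog g).

Definition supp f : set 'rV[R]_n := [set x | 0 < f x].

Definition supp_fun_set (K : set 'rV[R]_n) (th : 'rV[R]_n) : \bar R :=
  ereal_sup [set (inner x th)%:E | x in K].

(** gradient of phi = - log f at x (meaningful where phi is differentiable) *)
Definition grad_neglog f (x : 'rV[R]_n) : 'rV[R]_n :=
  \row_(i < n) ('d (fun y => - ln (f y)) x (delta_mx 0 i : 'rV[R]_n)).

(** points of K_f where grad phi exists (almost every point of K_f) *)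
Definition grad_dom f : set 'rV[R]_n :=
  [set x | interior (supp f) x /\ differentiable (fun y => - ln (f y)) x].

Definition bd (K : set 'rV[R]_n) : set 'rV[R]_n := closure K `\` interior K.

Definition outer_normals (K : set 'rV[R]_n) (x : 'rV[R]_n) : set 'rV[R]_n :=
  [set th | enorm th = 1 /\ forall y, K y -> inner y th <= inner x th].

(** points of the boundary with a unique outer unit normal
    (H^{n-1}-almost every boundary point) *)
Definition gauss_dom (K : set 'rV[R]_n) : set 'rV[R]_n :=
  [set x | bd K x /\ exists th, outer_normals K x = [set th]].

(** Gauss map n_K (junk value 0 outside gauss_dom K) *)
Definition gauss (K : set 'rV[R]_n) (x : 'rV[R]_n) : 'rV[R]_n :=
  xget 0 [set th | outer_normals K x = [set th]].

End logconcave.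

Local Open Scope ereal_scope.

Definition first_var_quot (R : realType) (n : nat) (f g : 'rV[R]_n -> R)
    (t : R) : \bar R :=
  ((\int[@lebesgue_n R n]_x supconv f (lcscale t g) x
    - \int[@lebesgue_n R n]_x (f x)%:E) * (t^-1)%:E).

(** int h_g d(mu_f), mu_f = (grad phi)_# (f dx) *)
Definition int_mu (R : realType) (n : nat) (f : 'rV[R]_n -> R)
    (h : 'rV[R]_n -> \bar R) : \bar R :=
  \int[@lebesgue_n R n]_(x in grad_dom f) (h (grad_neglog f x) * (f x)%:E).

(** int h d(nu_f), nu_f = (n_{K_f})_# (f dH^{n-1}|_{bd K_f}) *)
Definition int_nu (R : realType) (n : nat) (f : 'rV[R]_n -> R)
    (h : 'rV[R]_n -> \bar R) : \bar R :=
  \int[@hausdorff R n n.-1]_(x in gauss_dom (supp f))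
     (h (gauss (supp f) x) * (f x)%:E).

(* Main.v *)
Require Import Defs.
From HB Require Import structures.
From mathcomp Require Import all_boot all_order all_algebra.
From mathcomp Require Import all_classical all_reals all_analysis.
From mathcomp Require Import measurable_realfun ring lra.
Set Implicit Arguments. Unset Strict Implicit. Unset Printing Implicit Defensive.
Import Order.TTheory GRing.Theory Num.Theory numFieldNormedType.Exports.
Local Open Scope classical_set_scope.
Local Open Scope ring_scope.

(** After translating and rescaling, [f >= e] on a ball, so the epigraph of [- ln f] is a convex set absorbing the
    origin, with gauge [J]. Sup-convolution dilates this epigraph along the epigraph of [- ln g]; differentiating its
    volume (for [expR (- s) dx ds]) ray by ray gives an integral of one-sided directional derivatives of [J]. Rays
    meeting the graph of [- ln f] contribute the integral against [mu_f], rays leaving through the walls above the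
    boundary of the support contribute the one against [nu_f]. A general [g] is exhausted by its restrictions to balls,
    with the uniform bound coming from log-concavity in [t] (Prekopa-Leindler). The cone formula for the Hausdorff
    measure rests on the isodiametric inequality, which gives H^n = L^n. *)

(** The obstacle is that the volume derivative along a ray is a one-sided derivative of [J], whereas
    [mu_f] and [nu_f] call for a gradient and for a unique normal. No theorem on almost everywhere
    differentiability of convex functions is invoked. For a single direction [d] the dilation is a
    translation, whose effect on the volume is known exactly; comparing [d] with [- d] shows that
    the two one-sided derivatives cancel on almost every ray, so that the derivative of [J] is a
    linear form there. Its vertical coefficient decides what the ray meets: if it is nonzero the
    horizontal part is proportional to the gradient of [- ln f], if it is zero the horizontal part
    is proportional to the unique outer normal of the support. The vertical translation, tested
    against continuous functions, moreover identifies the image of the ray measure with [f dx], so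
    that no area formula for graphs is involved. Positive and negative parts are carried separately
    to the end: for unbounded [g] only the negative ones are known to be finite. *)

Definition pushm d d' (T1 : measurableType d) (T2 : measurableType d') (R : realFieldType)
    (m : {measure set T1 -> \bar R}) (f : T1 -> T2) (mf : measurable_fun [set: T1] f) :
    {measure set T2 -> \bar R} :=
  measure_function_pushforward__canonical__measure_function_Measure m mf.

Lemma pushmE d d' (T1 : measurableType d) (T2 : measurableType d') (R : realFieldType)
    (m : {measure set T1 -> \bar R}) (f : T1 -> T2) (mf : measurable_fun [set: T1] f) A :
  pushm m mf A = m (f @^-1` A).
Proof. by []. Qed.

(** * Transfer of integrals and the Borel structure of R^n *)

Section integral_transfer.
Local Open Scope ereal_scope.
Context d1 d2 (X : measurableType d1) (Y : measurableType d2) (R : realType).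
Variables (mu : {measure set X -> \bar R}) (nu : {measure set Y -> \bar R}) (phi : X -> Y).
Hypothesis mphi : measurable_fun [set: X] phi.
Hypothesis nuE : forall A, measurable A -> mu (phi @^-1` A) = nu A.

(** The integrands of the theorem are signed and may have integral +oo, so the identity is proved
    for the positive and the negative part separately and then recombined. *)
Lemma integral_transfer (D : set Y) (F : Y -> \bar R) :
  measurable D -> measurable_fun D F ->
  \int[mu]_(x in phi @^-1` D) F (phi x) = \int[nu]_(x in D) F x.
Proof.
move=> mD mF.
have ge0 G : measurable_fun D G -> (forall x, 0 <= G x) ->
    \int[mu]_(x in phi @^-1` D) G (phi x) = \int[nu]_(x in D) G x.
  move=> mG G0; transitivity (\int[pushm mu mphi]_(x in D) G x).
    by apply/esym; apply: (ge0_integral_pushforward mphi mu mD mG) => y _; exact: G0.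
  by apply: eq_measure_integral => A mA _; exact: nuE.
rewrite [LHS]integralE [RHS]integralE; congr (_ - _).
  rewrite -(ge0 (funepos F)); last 2 first.
  - exact: measurable_funepos.
  - by move=> x; exact: funepos_ge0.
  by apply: eq_integral => x _; rewrite -[RHS]/((funepos F \o phi) x) -funepos_comp.
rewrite -(ge0 (funeneg F)); last 2 first.
- exact: measurable_funeneg.
- by move=> x; exact: funeneg_ge0.
by apply: eq_integral => x _; rewrite -[RHS]/((funeneg F \o phi) x) -funeneg_comp.
Qed.
End integral_transfer.

(** The same set function as [lebesgue_measure], registered as a measure for the measurable
    structure of [R] itself instead of [measurableTypeR R]; this is the structure used by the
    coordinates and the products below. *)
Definition leb {R : realType} : set R -> \bar R := @lebesgue_measure R.

Section leb_measure.
Variable R : realType.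
Local Open Scope ereal_scope.
Let leb0 : leb (set0 : set R) = 0. Proof. exact: (measure0 (@lebesgue_measure R)). Qed.
Let leb_ge0 (A : set R) : 0 <= leb A. Proof. exact: (measure_ge0 (@lebesgue_measure R)). Qed.
Let leb_sa : semi_sigma_additive (@leb R).
exact: (@measure_semi_sigma_additive _ _ _ (@lebesgue_measure R)). Qed.
HB.instance Definition _ := isMeasure.Build _ _ _ (@leb R) leb0 leb_ge0 leb_sa.
Let leb_sf : sigma_finite setT (@leb R).
exact: (sigma_finiteT (@lebesgue_measure R)). Qed.
HB.instance Definition _ := @Measure_isSigmaFinite.Build _ _ _ (@leb R) leb_sf.
Lemma leb_itv (i : interval R) : leb [set` i] = (if i.1 < i.2 then i.2 - i.1 else 0).
Proof. exact: lebesgue_measure_itv. Qed.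
Lemma integral_leb (D : set R) (f : R -> \bar R) : measurable D -> measurable_fun D f ->
  \int[leb]_(x in D) f x = \int[@lebesgue_measure R]_(x in D) f x.
Proof.
move=> mD mf; apply: (@integral_transfer _ _ R (measurableTypeR R) R leb (@lebesgue_measure R) id) => //.
Qed.
End leb_measure.

(** A copy of R^n that carries the sigma-algebra generated by the coordinates. Open sets belong to
    it by [open_measurable_rV]. *)
Definition bV (R : realType) (n : nat) := 'rV[R]_n.

Definition coordi (R : realType) (n : nat) (i : 'I_n) (x : 'rV[R]_n) : R := x ord0 i.

Definition borel_display : measure_display. Proof. exact: default_measure_display. Qed.

Section borel_rV.
Variables (R : realType) (n : nat).

HB.instance Definition _ := Pointed.on (bV R n).

Let salg : set (set (bV R n)) := g_sigma_preimage (@coordi R n).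

Let salg0 : salg set0. Proof. exact: sigma_algebra0. Qed.
Let salgC A : salg A -> salg (~` A). Proof. exact: sigma_algebraC. Qed.
Let salgU (F : (set (bV R n))^nat) : (forall i, salg (F i)) -> salg (\bigcup_i (F i)).
exact: sigma_algebra_bigcup. Qed.

HB.instance Definition _ := @isMeasurable.Build borel_display (bV R n) salg salg0 salgC salgU.

Lemma measurable_coordi (i : 'I_n) :
  measurable_fun [set: bV R n] (coordi i : bV R n -> R).
Proof.
move=> _ Y mY; rewrite setTI; apply: sub_sigma_algebra => /=.
rewrite -bigcup_seq/=; exists i => /=; first by rewrite mem_index_enum.
by exists Y => //; rewrite setTI.
Qed.

Lemma measurable_bVP d (T : measurableType d) (f : T -> bV R n) :
  (forall i, measurable_fun [set: T] (fun t => f t ord0 i)) ->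
  measurable_fun [set: T] f.
Proof.
move=> mf; suff : g_sigma_preimage (fun i => @coordi R n i \o f) `<=` measurable.
  by rewrite g_sigma_preimage_comp => prefS _ A mA; apply: prefS; exists A.
apply: smallest_sub; first exact: sigma_algebra_measurable.
case: n => [|m] in f mf *; first by rewrite big_ord0.
rewrite -bigcup_mkord_ord; apply: bigcup_sub => i Ii.
by move=> A [B mB <-]; exact: mf.
Qed.

End borel_rV.

Section rect.
Variables (R : realType).

Section rect0.
Variable n : nat.

Definition rect (J : 'I_n -> set R) : set (bV R n) := [set x | forall i, J i (x ord0 i)].

Lemma measurable_rect J : (forall i, measurable (J i)) -> measurable (rect J).
Proof.
move=> mJ; have -> : rect J = \big[setI/setT]_(i < n) ((@coordi R n i) @^-1` (J i)).
  apply/seteqP; split => x /=.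
    by move=> xJ; elim/big_ind : _ => // i _; exact: xJ.
  by rewrite -bigcap_seq => h i; apply: (h i); rewrite /= mem_index_enum.
elim/big_ind : _ => //; first by move=> A B mA mB; exact: measurableI.
by move=> i _; rewrite -[X in measurable X]setTI; apply: measurable_coordi.
Qed.

Lemma hboxE (a b : 'rV[R]_n) : hbox a b = rect (fun i => `[a ord0 i, b ord0 i[%classic).
Proof. by apply/seteqP; split => x h i; have := h i; rewrite /= in_itv. Qed.

Lemma measurable_hbox (a b : 'rV[R]_n) : measurable (hbox a b : set (bV R n)).
Proof. by rewrite hboxE; apply: measurable_rect => i; exact: measurable_itv. Qed.

Definition hboxes : set (set (bV R n)) := [set A | exists a b, A = hbox a b].

Lemma hboxes_setI : setI_closed hboxes.
Proof.
move=> _ _ [a [b ->]] [c [d ->]].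
exists (\row_i Num.max (a ord0 i) (c ord0 i)), (\row_i Num.min (b ord0 i) (d ord0 i)).
apply/seteqP; split => x /=.
  by move=> [h1 h2] i; rewrite !mxE ge_max lt_min; move: (h1 i) (h2 i) => /andP[-> ->] /andP[-> ->].
by move=> h; split => i; have := h i; rewrite !mxE ge_max lt_min => /andP[/andP[h1 h2] /andP[h3 h4]]; apply/andP.
Qed.

Definition kbox (k : nat) : set (bV R n) := hbox (\row_i (- k%:R)) (\row_i k%:R).

Lemma kbox_cover : \bigcup_k kbox k = setT.
Proof.
apply/seteqP; split => // x _.
pose M := \big[Num.max/0]_(i < n) `|x ord0 i|.
exists (Num.truncn M).+1 => //= i; rewrite !mxE.
have xM : `|x ord0 i| <= M by apply: le_bigmax.
have MM : M < (Num.truncn M).+1%:R by exact: truncnS_gt.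
by have := le_lt_trans xM MM; rewrite ltr_norml => /andP[/ltW -> ->].
Qed.

End rect0.

Lemma measurable_gen_hboxes n : (@measurable _ (bV R n)) = <<s @hboxes n >>.
Proof.
apply/seteqP; split; last first.
  apply: smallest_sub; first exact: sigma_algebra_measurable. by move=> _ [a [b ->]]; exact: measurable_hbox.
apply: smallest_sub; first exact: smallest_sigma_algebra.
case: n => [|m]; first by rewrite big_ord0.
rewrite -bigcup_mkord_ord; apply: bigcup_sub => i Ii.
suff mi (j : 'I_m.+1) : @measurable_fun _ _ (g_sigma_algebraType (@hboxes m.+1)) R setT (@coordi R m.+1 j).
  by move=> A [B mB <-]; exact: mi.
apply: (measurability _ (RGenInftyO.measurableE R)) => _ [_ [c ->] <-].
rewrite setTI.
have -> : coordi j @^-1` [set` `]-oo, c[%R] =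
    \bigcup_k hbox (\row_i (- k%:R)) (\row_i (if i == j then Num.min k%:R c else k%:R)).
  apply/seteqP; split => x /=.
    rewrite in_itv/= => xc. have : (\bigcup_k @kbox m.+1 k) x by rewrite kbox_cover.
    move=> [k _ kx]; exists k => // i1; have := kx i1; rewrite !mxE.
    by case: eqP => // ->; rewrite lt_min => /andP[-> ->].
  by move=> [k _ kx]; have := kx j; rewrite !mxE eqxx lt_min in_itv/= => /and3P[].
apply: bigcupT_measurable => k; apply: sub_sigma_algebra; eexists; eexists; reflexivity.
Qed.

(** Half-open boxes generate the Borel sets and are stable under intersection, and the cubes
    [kbox k] exhaust the space. The product and scaling formulas for [lam] are all checked on boxes
    through this lemma. *)
Lemma hboxes_measure_unique n (m1 m2 : {measure set (bV R n) -> \bar R}) :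
  (forall a b, m1 (hbox a b) = m2 (hbox a b)) ->
  (forall k, (m1 (@kbox n k) < +oo)%E) ->
  forall A, measurable A -> m1 A = m2 A.
Proof.
move=> m12 moo; apply: (measure_unique (@hboxes n) (@kbox n)) => //.
- exact: measurable_gen_hboxes.
- exact: hboxes_setI.
- by move=> k; eexists; eexists; reflexivity.
- exact: kbox_cover.
- by move=> _ [a [b ->]].
Qed.
End rect.

(** * Lebesgue measure on Borel sets: boxes, Fubini, homotheties *)

Section lam.
Variables (R : realType).
Local Open Scope ereal_scope.

Lemma lebesgue_outer_hbox_le n (a b : 'rV[R]_n) : (forall i, a ord0 i <= b ord0 i)%R ->
  lebesgue_outer (hbox a b) <= (\prod_(i < n) (b ord0 i - a ord0 i))%:E.
Proof.
move=> ab; pose F k : set (RnD R n) := if k is 0%N then hbox a b else set0.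
apply: (@le_trans _ _ (\sum_(k <oo) box_gauge (F k))).
  apply: ereal_inf_lbound; exists F => //; split => //. by move=> x hx; exists 0%N.
rewrite (nneseries_split 0 1); last by move=> k _; exact: box_gauge_ge0.
rewrite add0n big_nat1 eseries0; last first.
  by move=> [|k]// _ _; rewrite /F box_gauge0.
rewrite adde0; apply: ereal_inf_lbound; right; exists a, b; split => //.
Qed.

(* an hyperplane cuts every box into two boxes whose volumes add up *)
Lemma halfspace_caratheodory n (j : 'I_n) (c : R) :
  (@lebesgue_outer R n).-caratheodory [set x | x ord0 j < c]%R.
Proof.
apply: le_caratheodory_measurable => X.
apply: le_ereal_inf_tmp => _ [F [_ XF] <-].
set H := [set x | _]%R.
have gauge_split (C : set (RnD R n)) : box_gauge (C `&` H) + box_gauge (C `&` ~` H) <= box_gauge C.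
  apply: le_ereal_inf_tmp => _ [[-> ->]|[a [b [ab [-> ->]]]]].
    by rewrite !set0I box_gauge0 adde0.
  (* [c'] is [c] clamped to the side of the box, so that both halves are again boxes, possibly
     degenerate, when the hyperplane misses the box. *)
  pose c' := Num.max (a ord0 j) (Num.min c (b ord0 j)). have c'b : (a ord0 j <= c' <= b ord0 j)%R.
    by rewrite le_max lexx/= ge_max ab/= ge_min lexx orbT.
  pose u := \row_i (if i == j then c' else b ord0 i) : 'rV[R]_n.
  pose v := \row_i (if i == j then c' else a ord0 i) : 'rV[R]_n. have e1 : hbox a b `&` H = hbox a u.
    apply/seteqP; split => x /=.
      move=> [h xc] i; rewrite !mxE; case: eqP => // ij; subst i.
      have /andP[h1 h2] := h j; rewrite h1/= lt_max lt_min. by move: xc; rewrite /H/= => ->; rewrite h2 orbT.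
    move=> h; split.
      move=> i; have := h i; rewrite !mxE; case: eqP => // ->.
      by move=> /andP[-> /= /lt_le_trans]; apply; case/andP: c'b.
    have := h j; rewrite !mxE eqxx lt_max => /andP[h1 /orP[h2|]].
      by move: (le_lt_trans h1 h2); rewrite ltxx.
    by rewrite lt_min => /andP[].
  have e2 : hbox a b `&` ~` H = hbox v b.
    apply/seteqP; split => x /=.
      move=> [h xc] i; rewrite !mxE; case: eqP => // ij; subst i.
      have /andP[h1 h2] := h j; rewrite h2 andbT ge_max h1/= ge_min.
      by move: xc; rewrite /H/= => /negP; rewrite -leNgt => ->.
    move=> h; split.
      move=> i; have := h i; rewrite !mxE; case: eqP => // ->.
      by move=> /andP[/(le_trans _) h1 ->]; rewrite andbT h1//; case/andP: c'b.
    have := h j; rewrite !mxE eqxx => /andP[h1 h2]; apply/negP; rewrite -leNgt.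
    move: h1; rewrite ge_max ge_min => /andP[_ /orP[//|h3]]. by move: (le_lt_trans h3 h2); rewrite ltxx.
  rewrite e1 e2.
  have -> : (\prod_(i < n) (b ord0 i - a ord0 i))%R =
     (\prod_(i < n) (u ord0 i - a ord0 i) + \prod_(i < n) (b ord0 i - v ord0 i))%R.
    rewrite (bigD1 j)//= [in X in (_ = X + _)%R](bigD1 j)//= [in X in (_ = _ + X)%R](bigD1 j)//=. rewrite !mxE eqxx.
    under [in X in (_ = X + _)%R]eq_bigr do rewrite mxE. under [in X in (_ = _ + X)%R]eq_bigr do rewrite mxE.
    have -> : (\prod_(i < n | i != j) ((if i == j then c' else b ord0 i) - a ord0 i) =
            \prod_(i < n | i != j) (b ord0 i - a ord0 i))%R.
      by apply: eq_bigr => i /negPf ->.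
    have -> : (\prod_(i < n | i != j) (b ord0 i - (if i == j then c' else a ord0 i)) =
            \prod_(i < n | i != j) (b ord0 i - a ord0 i))%R.
      by apply: eq_bigr => i /negPf ->.
    by rewrite -mulrDl; congr (_ * _)%R; ring.
  rewrite EFinD; apply: leeD; apply: ereal_inf_lbound; right.
    exists a, u; split => // i; rewrite mxE; case: eqP => // ->. by case/andP: c'b.
  exists v, b; split => // i; rewrite mxE; case: eqP => // ->. by case/andP: c'b.
apply: (@le_trans _ _ (\sum_(k <oo) (box_gauge (F k `&` H) + box_gauge (F k `&` ~` H)))); last first.
  by apply: lee_nneseries => k _; rewrite ?adde_ge0 ?box_gauge_ge0.
rewrite nneseriesD; [|by move=> *; exact: box_gauge_ge0|by move=> *; exact: box_gauge_ge0].
apply: leeD; apply: ereal_inf_lbound; eexists => //; split => //;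
  rewrite -setI_bigcupl; exact: setSI.
Qed.

(** The half-spaces of [halfspace_caratheodory] generate the Borel sets: every coordinate of the
    identity from the Caratheodory structure is measurable, hence so is the identity. *)
Lemma borel_caratheodory n (A : set (bV R n)) : measurable A ->
  (@lebesgue_outer R n).-caratheodory A.
Proof.
pose M := caratheodory_type (@lebesgue_outer R n).
have idm : measurable_fun [set: M] (id : M -> bV R n).
  apply: measurable_bVP => j.
  apply: (measurability _ (RGenInftyO.measurableE R)) => _ [_ [c ->] <-]. rewrite setTI.
  have -> : (fun t : M => (t : bV R n) ord0 j) @^-1` [set` `]-oo, c[%R] = [set x | x ord0 j < c]%R.
    by apply/seteqP; split => x /=; rewrite in_itv.
  exact: halfspace_caratheodory.
by move=> mA; have := idm measurableT _ mA; rewrite setTI.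
Qed.

Definition lam n : set (bV R n) -> \bar R := @lebesgue_outer R n.

Let lam0 n : lam (set0 : set (bV R n)) = 0. Proof. exact: outer_measure0. Qed.
Let lam_ge0 n (A : set (bV R n)) : 0 <= lam A. Proof. exact: outer_measure_ge0. Qed.
Let lam_sa n : semi_sigma_additive (@lam n).
Proof.
move=> F mF tF mUF; apply: (@caratheodory_measure_sigma_additive _ _ (@lebesgue_outer R n)) => //.
  by move=> i; exact: borel_caratheodory.
exact: borel_caratheodory.
Qed.
HB.instance Definition _ n := isMeasure.Build _ _ _ (@lam n) (lam0 n) (@lam_ge0 n) (@lam_sa n).

Lemma lam_kbox_lty n k : lam (@kbox R n k) < +oo.
Proof.
apply: le_lt_trans (lebesgue_outer_hbox_le _) (ltry _) => i.
by rewrite !mxE ge0_cp.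
Qed.

Let lam_sf n : sigma_finite setT (@lam n).
Proof.
exists (@kbox R n); first by rewrite kbox_cover.
by move=> k; split; [exact: measurable_hbox|exact: lam_kbox_lty].
Qed.
HB.instance Definition _ n := @Measure_isSigmaFinite.Build _ _ _ (@lam n) (lam_sf n).

End lam.

Section vcons.
Variables (R : realType) (m : nat).

Definition vcons (v : 'rV[R]_m) (a : R) : 'rV[R]_m.+1 :=
  \row_i (if unlift ord0 i is Some j then v ord0 j else a).
Definition vtail (x : 'rV[R]_m.+1) : 'rV[R]_m := \row_j x ord0 (lift ord0 j).

Lemma vcons0 v a : vcons v a ord0 ord0 = a.
Proof. by rewrite mxE unlift_none. Qed.
Lemma vconsS v a j : vcons v a ord0 (lift ord0 j) = v ord0 j.
Proof. by rewrite mxE liftK. Qed.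
Lemma vconsK x : vcons (vtail x) (x ord0 ord0) = x.
Proof.
apply/rowP => i; rewrite mxE; case: unliftP => [j ->|->//].
by rewrite mxE.
Qed.

Definition vconsp (p : bV R m * R) : bV R m.+1 := vcons p.1 p.2.

Lemma measurable_vconsp : measurable_fun setT vconsp.
Proof.
apply: measurable_bVP => i; case: (unliftP ord0 i) => [j ->|->].
  apply: (@eq_measurable_fun _ _ _ _ _ ((@coordi R m j : bV R m -> R) \o fst)).
    by move=> p _ /=; rewrite vconsS.
  by apply: measurableT_comp; [exact: measurable_coordi|exact: measurable_fst].
apply: (@eq_measurable_fun _ _ _ _ _ snd); last exact: measurable_snd.
by move=> p _ /=; rewrite vcons0.
Qed.

Lemma rect_vcons (J : 'I_m.+1 -> set R) :
  vconsp @^-1` rect J = @rect R m (fun j => J (lift ord0 j)) `*` J ord0.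
Proof.
apply/seteqP; split => -[v a]/=.
  move=> h; split => /=; last by have := h ord0; rewrite vcons0. by move=> j; have := h (lift ord0 j); rewrite vconsS.
by move=> [h1 h2] i; rewrite mxE; case: unliftP => [j ->|->]//.
Qed.

End vcons.

Section lam_product.
Variable R : realType.
Local Open Scope ereal_scope.

Lemma ereal_prodE (I : finType) (F : I -> R) : (\prod_i (F i)%:E) = ((\prod_i F i)%R)%:E.
Proof. by elim/big_ind2 : _ => // x1 x2 y1 y2 -> ->. Qed.

Let nu m : {measure set (bV R m.+1) -> \bar R} :=
  pushm (@lam R m \x leb)%E (@measurable_vconsp R m).

Let nuE m A : nu m A = (@lam R m \x leb) (@vconsp R m @^-1` A).
by []. Qed.

(** The point is that no cover is cheaper than the box itself. By the induction hypothesis the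
    product measure [nu m] gives boxes their volume; being a measure, it is countably subadditive,
    and so it bounds the cost of any cover from below. *)
Lemma lam_hbox n (a b : 'rV[R]_n) : (forall i, a ord0 i <= b ord0 i)%R ->
  @lam R n (hbox a b) = (\prod_(i < n) (b ord0 i - a ord0 i))%:E.
Proof.
elim: n a b => [|m IH] a b ab.
  (* In dimension 0 the only box is the one-point space, of volume 1 as an empty product; some set
     of the cover is nonempty and therefore has gauge 1. *)
  apply/eqP; rewrite eq_le lebesgue_outer_hbox_le//= big_ord0. apply: le_ereal_inf_tmp => _ [F [_ F1] <-].
  have [|k _ Fk] := F1 0%R; first by case. have -> : 1 = box_gauge (F k).
    apply/eqP; rewrite eq_le; apply/andP; split.
      apply: le_ereal_inf_tmp => v [[Fk0 _]|[c [d [_ [_ ->]]]]]; last by rewrite big_ord0. by move: Fk; rewrite Fk0.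
    apply: ereal_inf_lbound; right; exists 0%R, 0%R; split => //; split; last by rewrite big_ord0.
    apply/seteqP; split => x; first by move=> _ []. by move=> _; rewrite (_ : x = 0%R)//; apply/rowP => -[].
  apply: (le_trans _ (nneseries_lim_ge k.+1 _)); last by move=> *; exact: box_gauge_ge0.
  by rewrite big_nat_recr//= leeDr// sume_ge0// => i _; exact: box_gauge_ge0.
have nubox (c d : 'rV[R]_m.+1) : (forall i, c ord0 i <= d ord0 i)%R ->
    nu m (hbox c d) = (\prod_(i < m.+1) (d ord0 i - c ord0 i))%:E.
  move=> cd; rewrite nuE hboxE rect_vcons product_measure1E//; last first.
    by apply: measurable_rect => i; exact: measurable_itv.
  have -> : rect (fun j => `[c ord0 (lift ord0 j), d ord0 (lift ord0 j)[%classic) = hbox (vtail c) (vtail d).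
    by rewrite hboxE; congr rect; apply/funext => j; rewrite !mxE.
  rewrite [X in X * _]IH; last by move=> i; rewrite !mxE. rewrite [X in _ * X]leb_itv/= big_ord_recl lte_fin.
  rewrite EFinM muleC; congr (_ * _).
    have := cd ord0; rewrite le_eqVlt => /orP[/eqP ->|-> //]. by rewrite ltxx subrr.
  by congr EFin; apply: eq_bigr => i _; rewrite !mxE.
apply/eqP; rewrite eq_le lebesgue_outer_hbox_le//= -nubox//.
apply: le_ereal_inf_tmp => _ [F [_ abF] <-].
(* A covering set of finite gauge is empty or a box, hence Borel; a set of gauge +oo may be any set
   and is replaced by the whole space. *)
pose G k : set (bV R m.+1) := if box_gauge (F k) == +oo then setT else F k.
have mG k : measurable (G k).
  rewrite /G; case: ifPn => // Fk.
  have : exists v, ((F k = set0 /\ v = 0) \/ exists c d : 'rV[R]_m.+1, (forall i, c ord0 i <= d ord0 i)%R /\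
       F k = hbox c d /\ v = (\prod_(i < m.+1) (d ord0 i - c ord0 i))%:E).
    apply: contrapT => /forallNP h; move: Fk; rewrite /box_gauge.
    rewrite (_ : [set v | _] = set0) ?ereal_inf0 ?eqxx//. by apply/seteqP; split => // v /h.
  move=> [v [[-> _]|[c [d [_ [-> _]]]]]]; first exact: measurable0. exact: measurable_hbox.
have GF k : nu m (G k) <= box_gauge (F k).
  rewrite /G; case: ifPn => [/eqP ->|_]; first exact: leey.
  apply: le_ereal_inf_tmp => _ [[-> ->]|[c [d [cd [-> ->]]]]]; first by rewrite measure0. by rewrite nubox.
apply: (@le_trans _ _ (\sum_(k <oo) nu m (G k))); last first.
  by apply: lee_nneseries => // k _; exact: GF.
apply: measure_sigma_subadditive => //; first exact: measurable_hbox.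
apply: subset_trans abF _; apply: subset_bigcup => k _.
by rewrite /G; case: ifP => _ // x.
Qed.

Lemma hbox_eq0 n (a b : 'rV[R]_n) : ~ (forall i, a ord0 i <= b ord0 i)%R -> hbox a b = set0.
Proof.
move=> /existsNP[i /negP]; rewrite -ltNge => ba; apply/seteqP; split => // x /(_ i).
by move=> /andP[h1 /(le_lt_trans h1)]; rewrite ltNge (ltW ba).
Qed.

Lemma lam_vcons m (A : set (bV R m.+1)) : measurable A ->
  lam A = (@lam R m \x leb) (@vconsp R m @^-1` A).
Proof.
rewrite -nuE; apply: hboxes_measure_unique; last exact: lam_kbox_lty.
move=> c d; have [cd|cd] := pselect (forall i, c ord0 i <= d ord0 i)%R; last first.
  by rewrite hbox_eq0// !measure0.
rewrite [LHS]lam_hbox// nuE hboxE rect_vcons product_measure1E//; last first.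
  exact: (measurable_rect (fun i => measurable_itv _)).
have -> : rect (fun j => `[c ord0 (lift ord0 j), d ord0 (lift ord0 j)[%classic) = hbox (vtail c) (vtail d).
  by rewrite hboxE; congr rect; apply/funext => j; rewrite !mxE.
rewrite [X in X * _]lam_hbox; last by move=> i; rewrite !mxE.
rewrite [X in _ * X]leb_itv/= big_ord_recl lte_fin.
rewrite EFinM muleC; congr (_ * _).
  by congr EFin; apply: eq_bigr => i _; rewrite !mxE.
have := cd ord0; rewrite le_eqVlt => /orP[/eqP ->|-> //].
by rewrite ltxx subrr.
Qed.

Lemma lam_rect n (J : 'I_n -> set R) : (forall i, measurable (J i)) ->
  lam (rect J) = \prod_(i < n) leb (J i).
Proof.
elim: n J => [|m IH] J mJ.
  rewrite big_ord0 (_ : rect J = hbox 0%R 0%R) ?lam_hbox ?big_ord0//. by apply/seteqP; split => x _ [].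
rewrite lam_vcons; last by apply: measurable_rect => i; exact: mJ.
rewrite rect_vcons product_measure1E//; last first.
  by apply: measurable_rect => i; exact: mJ.
by rewrite [X in X * _]IH// big_ord_recl muleC.
Qed.

Lemma lam_fubini m (F : bV R m.+1 -> \bar R) : measurable_fun setT F -> (forall x, 0 <= F x) ->
  \int[@lam R m.+1]_x F x = \int[@lam R m]_v \int[leb]_a F (vcons v a).
Proof.
move=> mF F0; rewrite (@eq_measure_integral _ _ _ _ (nu m)); last first.
  by move=> A mA _; exact: lam_vcons.
rewrite [LHS]ge0_integral_pushforward//; last exact: measurable_vconsp.
rewrite preimage_setT fubini_tonelli1//; last by move=> x; exact: F0.
by apply: measurableT_comp => //; exact: measurable_vconsp.
Qed.

Lemma lam_fubini2 m (F : bV R m.+1 -> \bar R) : measurable_fun setT F -> (forall x, 0 <= F x) ->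
  \int[@lam R m.+1]_x F x = \int[leb]_a \int[@lam R m]_v F (vcons v a).
Proof.
move=> mF F0; rewrite (@eq_measure_integral _ _ _ _ (nu m)); last first.
  by move=> A mA _; exact: lam_vcons.
rewrite [LHS]ge0_integral_pushforward//; last exact: measurable_vconsp.
rewrite preimage_setT fubini_tonelli2//; last by move=> x; exact: F0.
by apply: measurableT_comp => //; exact: measurable_vconsp.
Qed.

End lam_product.

Section affine.
Variables (R : realType).
Local Open Scope ereal_scope.

Lemma measurable_affine n (s : R) (c : 'rV[R]_n) :
  measurable_fun [set: bV R n] ((fun x => (s *: x + c)%R) : bV R n -> bV R n).
Proof.
apply: measurable_bVP => i.
apply: (@eq_measurable_fun _ _ _ _ _ (fun x : bV R n => s * coordi i x + c ord0 i)%R).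
  by move=> x _; rewrite !mxE.
apply: measurable_funD => //; apply: measurable_funM => //.
exact: measurable_coordi.
Qed.

Lemma leb_itv_affine (s c a b : R) : s != 0%R -> (a <= b)%R ->
  leb [set y | a <= s * y + c < b]%R = (`|s|^-1 * (b - a))%:E.
Proof.
move=> s0 ab; have [sp|sn|/eqP] := ltgtP s 0%R; last by rewrite (negPf s0).
  have -> : [set y | a <= s * y + c < b]%R = `](b - c) / s, (a - c) / s]%classic%R.
    apply/seteqP; split => y /=; rewrite in_itv/= ltr_ndivrMr// ler_ndivlMr//;
    by move=> /andP[h1 h2]; apply/andP; split; lra.
  rewrite leb_itv/= lte_fin ltr_nM2r ?invr_lt0//.
  rewrite ltr0_norm// ltrD2r; move: ab; rewrite le_eqVlt => /orP[/eqP ->|->].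
    by rewrite ltxx subrr mulr0.
  by rewrite -EFinB; congr EFin; rewrite invrN; ring.
have -> : [set y | a <= s * y + c < b]%R = `[(a - c) / s, (b - c) / s[%classic%R.
  apply/seteqP; split => y /=; rewrite in_itv/= ltr_pdivlMr// ler_pdivrMr//;
  by move=> /andP[h1 h2]; apply/andP; split; lra.
rewrite leb_itv/= lte_fin ltr_pM2r ?invr_gt0//.
rewrite gtr0_norm// ltrD2r; move: ab; rewrite le_eqVlt => /orP[/eqP ->|->].
  by rewrite ltxx subrr mulr0.
by rewrite -EFinB; congr EFin; ring.
Qed.

Lemma lam_affine n (s : R) (c : 'rV[R]_n) (A : set (bV R n)) : s != 0%R -> measurable A ->
  lam ((fun x => (s *: x + c)%R) @^-1` A) = (`|s|^-1 ^+ n)%:E * lam A.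
Proof.
move=> s0; have sge0 : (0 <= `|s|^-1 ^+ n)%R by rewrite exprn_ge0// invr_ge0.
have -> : (`|s|^-1 ^+ n)%:E * lam A = mscale (NngNum sge0) (@lam R n) A by [].
rewrite -(pushmE (@lam R n) (measurable_affine s c)).
move: A; apply: hboxes_measure_unique => [a b|k].
  rewrite /= /mscale/=. have [ab|ab] := pselect (forall i, a ord0 i <= b ord0 i)%R; last first.
    by rewrite /pushforward hbox_eq0// preimage_set0 [lam set0]measure0 mule0.
  rewrite [X in _ * X]lam_hbox// /pushforward.
  have -> : (fun x => s *: x + c)%R @^-1` hbox a b =
     rect (fun i => [set y | a ord0 i <= s * y + c ord0 i < b ord0 i]%R).
    by apply/seteqP; split => x /= h i; have := h i; rewrite !mxE.
  rewrite [LHS]lam_rect; last first.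
    move=> i; have -> : [set y | (a ord0 i <= s * y + c ord0 i < b ord0 i)%R] =
      (fun y => s * y + c ord0 i)%R @^-1` `[a ord0 i, b ord0 i[%classic.
      by apply/seteqP; split => y; rewrite /= in_itv.
    rewrite -[X in measurable X]setTI.
    suff : measurable_fun [set: R] (fun y => s * y + c ord0 i)%R by apply => //; exact: measurable_itv.
    by apply: measurable_funD => //; apply: measurable_funM.
  under eq_bigr do rewrite leb_itv_affine//. rewrite ereal_prodE -EFinM big_split/= prodr_const card_ord. by [].
rewrite /= /pushforward.
have -> : (fun x => s *: x + c)%R @^-1` kbox k =
     rect (fun i => [set y | - k%:R <= s * y + c ord0 i < k%:R]%R).
  by apply/seteqP; split => x /= h i; have := h i; rewrite !mxE.
rewrite [X in X < _]lam_rect; last first.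
  move=> i; have -> : [set y | (- k%:R <= s * y + c ord0 i < k%:R)%R] =
    (fun y => s * y + c ord0 i)%R @^-1` `[(- k%:R)%R, k%:R[%classic. by apply/seteqP; split => y; rewrite /= in_itv.
  rewrite -[X in measurable X]setTI.
  suff : measurable_fun [set: R] (fun y => s * y + c ord0 i)%R by apply => //; exact: measurable_itv.
  by apply: measurable_funD => //; apply: measurable_funM.
under eq_bigr do rewrite leb_itv_affine// ?ge0_cp//.
by rewrite ereal_prodE ltry.
Qed.

Lemma ge0_integral_affine n (s : R) (c : 'rV[R]_n) (F : bV R n -> \bar R) : s != 0%R ->
  measurable_fun setT F -> (forall x, 0 <= F x) ->
  \int[@lam R n]_x F (s *: x + c)%R = (`|s|^-1 ^+ n)%:E * \int[@lam R n]_x F x.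
Proof.
move=> s0 mF F0; have sge0 : (0 <= `|s|^-1 ^+ n)%R by rewrite exprn_ge0// invr_ge0.
transitivity (\int[pushm (@lam R n) (measurable_affine s c)]_x F x).
  by rewrite ge0_integral_pushforward//; exact: measurable_affine.
rewrite (@eq_measure_integral _ _ _ _ (mscale (NngNum sge0) (@lam R n))).
  by rewrite ge0_integral_mscale.
by move=> A mA _; exact: lam_affine.
Qed.

End affine.

Definition cara_measure (R : realType) (T : pointedType) (mu : {outer_measure set T -> \bar R}) :
  {measure set (caratheodory_type mu) -> \bar R} := mu.

(** The integrals of the statement are taken over Caratheodory sigma-algebras. For Borel data this
    replaces them by integrals over the Borel structure, where products and Fubini are available. *)
Lemma integral_caratheodory (R : realType) (T : pointedType) d (Y : measurableType d)
    (mu : {outer_measure set T -> \bar R}) (nu : {measure set Y -> \bar R}) (phi : T -> Y) :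
  (forall A, measurable A -> mu.-caratheodory (phi @^-1` A)) ->
  (forall A, measurable A -> mu (phi @^-1` A) = nu A) ->
  forall (D : set Y) (F : Y -> \bar R), measurable D -> measurable_fun D F ->
  (\int[cara_measure mu]_(x in phi @^-1` D) F (phi x) = \int[nu]_(x in D) F x)%E.
Proof.
move=> mphi nuE D F mD mF.
apply: (@integral_transfer _ _ (caratheodory_type mu) Y R (cara_measure mu)) => //.
by move=> _ A mA; rewrite setTI; exact: mphi.
Qed.

Section lebesgue_n_lam.
Variables (R : realType) (n : nat).
Local Open Scope ereal_scope.

Lemma integral_lebesgue_n (D : set (bV R n)) (F : bV R n -> \bar R) :
  measurable D -> measurable_fun D F ->
  \int[@lebesgue_n R n]_(x in D) F x = \int[@lam R n]_(x in D) F x.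
Proof.
exact: (@integral_caratheodory R (RnD R n) _ (bV R n) (@lebesgue_outer R n) (@lam R n) id
  (@borel_caratheodory R n) (fun _ _ => erefl)).
Qed.
End lebesgue_n_lam.

Section borel_open.
Variables (R : realType) (n : nat).

Lemma nbhs_rVP (x : 'rV[R]_n) (A : set 'rV[R]_n) :
  nbhs x A <-> exists2 e : R, 0 < e & forall y : 'rV[R]_n, (forall i, `|x ord0 i - y ord0 i| < e) -> A y.
Proof.
split.
  move=> /nbhs_ballP[e e0 eA]; exists e => // y xy; apply: eA. by split => // i j; rewrite (ord1 i); exact: xy.
move=> [e e0 eA]; apply/nbhs_ballP; exists e => // y xy; apply: eA => i.
exact: (xy.2 ord0 i).
Qed.

Lemma open_measurable_rV (A : set 'rV[R]_n) : open A -> measurable (A : set (bV R n)).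
Proof.
move=> oA.
pose B (q : {ffun 'I_n -> rat * rat}) : set (bV R n) :=
  rect (fun i => `](ratr (q i).1 : R), (ratr (q i).2 : R)[%classic).
have -> : (A : set (bV R n)) = \bigcup_(q in [set q | B q `<=` A]) B q.
  apply/seteqP; split => x; last by move=> [q /= qA Bx]; exact: qA.
  move=> Ax; have /nbhs_rVP[e e0 eA] : nbhs x A by exact: open_nbhs_nbhs.
  have h (i : 'I_n) : exists q : rat * rat, [/\ x ord0 i - e < ratr q.1, ratr q.1 < x ord0 i,
      x ord0 i < ratr q.2 & ratr q.2 < x ord0 i + e].
    have [q1] := @rat_in_itvoo R (x ord0 i - e) (x ord0 i) ltac:(by rewrite ltrBlDr ltrDl).
    rewrite in_itv/= => /andP[h1 h2]. have [q2] := @rat_in_itvoo R (x ord0 i) (x ord0 i + e) ltac:(by rewrite ltrDl).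
    rewrite in_itv/= => /andP[h3 h4]. by exists (q1, q2).
  have [q qP] := choice h. exists [ffun i => q i].
    move=> y /= By; apply: eA => i; have [q1 q2 q3 q4] := qP i.
    have := By i; rewrite /= in_itv/= ffunE => /andP[y1 y2]. by rewrite ltr_norml; apply/andP; split; lra.
  by move=> i /=; rewrite in_itv/= ffunE; have [_ -> -> _] := qP i.
rewrite bigcup_mkcond; apply: countable_bigcupT_measurable.
  exact: countableP.
by move=> q; case: ifPn => // _; apply: measurable_rect => i; exact: measurable_itv.
Qed.
End borel_open.

Section usc_measurable.
Variables (R : realType) (n : nat).

Lemma closed_measurable_rV (A : set 'rV[R]_n) : closed A -> measurable (A : set (bV R n)).
Proof.
by move=> cA; rewrite -[A]setCK; apply: measurableC; apply: open_measurable_rV; exact: closed_openC.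
Qed.

Lemma usc_measurable (f : 'rV[R]_n -> R) : upper_semicontinuous f ->
  measurable_fun [set: bV R n] (f : bV R n -> R).
Proof.
move=> uf; apply: (measurability _ (RGenInftyO.measurableE R)) => _ [_ [c ->] <-].
rewrite setTI; apply: open_measurable_rV; rewrite openE => x /=.
rewrite in_itv/= => fx; have := uf x c fx; apply: filterS => y /=.
by rewrite in_itv.
Qed.

Lemma continuous_measurable_rV (f : 'rV[R]_n -> R) : continuous f ->
  measurable_fun [set: bV R n] (f : bV R n -> R).
Proof.
move=> cf; apply: usc_measurable => x a fxa.
exact: (cvgr_lt (f x) (cf x)).
Qed.
End usc_measurable.

(** * Layer cake formula and the Prekopa-Leindler inequality *)

Section layer_cake.
Local Open Scope ereal_scope.
Context d (T : measurableType d) (R : realType).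

Lemma measurable_lt_set (f g : T -> R) : measurable_fun setT f -> measurable_fun setT g ->
  measurable [set x | f x < g x]%R.
Proof.
move=> mf mg; rewrite -[X in measurable X]setTI.
have -> : [set x | (f x < g x)%R] = (fun x => f x < g x)%R @^-1` [set true] by [].
by apply: (measurable_fun_ltr mf mg).
Qed.

Lemma measurable_le_set (f g : T -> R) : measurable_fun setT f -> measurable_fun setT g ->
  measurable [set x | f x <= g x]%R.
Proof.
move=> mf mg; have -> : [set x | f x <= g x]%R = ~` [set x | g x < f x]%R.
  by apply/seteqP; split => x /=; rewrite leNgt => /negP.
by apply: measurableC; exact: measurable_lt_set.
Qed.

End layer_cake.

Section layer_cake2.
Local Open Scope ereal_scope.
Context d (T : measurableType d) (R : realType).
Variable mu : {sigma_finite_measure set T -> \bar R}.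
Variable f : T -> R.
Hypothesis mf : measurable_fun setT f.
Let E : set (T * R) := [set z | (0 <= z.2)%R /\ (z.2 < f z.1)%R].

Let mE : measurable E.
Proof.
apply: measurableI.
  by apply: measurable_le_set => //; exact: measurable_snd.
apply: measurable_lt_set; first exact: measurable_snd.
by apply: measurableT_comp => //; exact: measurable_fst.
Qed.

Let mI : measurable_fun setT (fun z : T * R => (\1_E z)%:E : \bar R).
by apply/measurable_EFinP; exact: measurable_indic. Qed.

Let secE (a : R) : (\int[mu]_x (\1_E (x, a))%:E) =
  ((fun a : R => mu [set x | a < f x]%R) \_ (`[0%R : R, +oo[%classic : set R)) a.
Proof.
rewrite patchE; case: ifPn; rewrite mem_setE in_itv/= andbT.
  move=> a0; rewrite -(setIT [set x | (a < f x)%R]) -integral_indic//; last first.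
    by apply: measurable_lt_set.
  apply: eq_integral => x _; rewrite !indicE; congr ((_ : bool)%:R%:E). by apply/idP/idP; rewrite !inE/= ?a0 => -[]//.
rewrite -ltNge => a0; rewrite (eq_integral (cst 0)) ?integral0//.
move=> x _; rewrite indicE memNset//= => -[]/= h.
by rewrite leNgt a0 in h.
Qed.

Lemma measurable_superlevel : measurable_fun (`[0%R : R, +oo[%classic : set R) (fun a => mu [set x | a < f x]%R).
Proof.
apply/(@measurable_restrictT _ _ _ _ (`[0%R : R, +oo[%classic : set R)) => //.
have h0 : forall x : T * R, 0 <= (\1_E x : R)%:E by move=> x; rewrite lee_fin.
have := @measurable_fun_fubini_tonelli_G _ _ T R R mu _ mI h0.
by apply: eq_measurable_fun => a _; rewrite /fubini_G secE.
Qed.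

Lemma layer_cake : (forall x, 0 <= f x)%R ->
  \int[mu]_x (f x)%:E = \int[leb]_(a in `[0%R : R, +oo[%classic) mu [set x | a < f x]%R.
Proof.
move=> f0; rewrite [RHS]integral_mkcond; under [RHS]eq_integral do rewrite -secE.
rewrite -(@fubini_tonelli _ _ T R R mu leb (fun z => (\1_E z)%:E))//.
apply: eq_integral => x _.
transitivity (\int[leb]_y (\1_(`[0%R : R, f x[%classic : set R) y)%:E).
  rewrite integral_indic// setIT [RHS]leb_itv/= lte_fin.
  have := f0 x; rewrite le_eqVlt => /orP[/eqP <-|->]; first by rewrite ltxx. by rewrite -EFinB subr0.
apply: eq_integral => y _; rewrite !indicE; congr ((_ : bool)%:R%:E).
rewrite mem_setE in_itv/=; apply/idP/idP; first by move=> /andP[h1 h2]; rewrite inE.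
by rewrite inE/= => -[-> ->].
Qed.
End layer_cake2.

Section pl1.
Variable R : realType.

Lemma leb_interval (A : set R) : is_interval A -> A !=set0 -> has_ubound A -> has_lbound A ->
  leb A = (sup A - inf A)%:E.
Proof.
move=> iA A0 uA lA; rewrite [in LHS](is_intervalP A).1// leb_itv.
rewrite /Rhull (asboolT lA) (asboolT uA).
rewrite /= lte_fin; case: ltP => //.
rewrite le_eqVlt => /orP[/eqP ->|]; first by rewrite subrr.
have [x Ax] := A0; move/lt_le_trans => /(_ x) h.
have h1 : x <= sup A by apply: ub_le_sup.
have h2 : inf A <= x by apply: ge_inf.
by have := h h2; rewrite ltNge h1.
Qed.

(** The intervals may lack their endpoints, so points at the same relative position [t], strictly
    between 0 and 1, are combined; these combinations sweep out the open interval from [lo] to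
    [hi]. *)
Lemma leb_mink (l : R) (A B C : set R) : 0 < l < 1 -> is_interval A -> is_interval B ->
  A !=set0 -> B !=set0 -> has_ubound A -> has_lbound A -> has_ubound B -> has_lbound B ->
  measurable C -> (forall x y, A x -> B y -> C ((1 - l) * x + l * y)) ->
  ((1 - l)%:E * leb A + l%:E * leb B <= leb C)%E.
Proof.
move=> /andP[l0 l1] iA iB A0 B0 uA lA uB lB mC ABC.
rewrite (leb_interval iA)// (leb_interval iB)// -!EFinM -EFinD.
set a1 := inf A; set a2 := sup A; set b1 := inf B; set b2 := sup B.
have key (D : set R) (iD : is_interval D) (D0 : D !=set0) (uD : has_ubound D) (lD : has_lbound D) (t : R) :
    0 < t < 1 -> D ((1 - t) * inf D + t * sup D).
  move=> /andP[t0 t1]; have [x Dx] := D0. have h1 : x <= sup D by apply: ub_le_sup.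
  have h2 : inf D <= x by apply: ge_inf. have := le_trans h2 h1; rewrite le_eqVlt => /orP[/eqP e|lt].
    have -> : (1 - t) * inf D + t * sup D = x; last by []. have : x = inf D by apply/eqP; rewrite eq_le h2 e h1.
    by move=> ->; rewrite -e; ring.
  have d0 : 0 < sup D - inf D by rewrite subr_gt0. have [u Du uu] : exists2 u, D u & inf D + t * (sup D - inf D) < u.
    have e0 : 0 < (1 - t) * (sup D - inf D) by rewrite mulr_gt0// subr_gt0.
    by have [u Du uu] := sup_adherent e0 (conj D0 uD); exists u => //; lra.
  have [v Dv vv] : exists2 v, D v & v < inf D + t * (sup D - inf D).
    have e0 : 0 < t * (sup D - inf D) by rewrite mulr_gt0.
    by have [v Dv vv] := inf_adherent e0 (conj D0 lD); exists v.
  apply: (iD _ _ Dv Du); apply/andP; split; lra.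
pose lo := (1 - l) * a1 + l * b1; pose hi := (1 - l) * a2 + l * b2.
have -> : (1 - l) * (a2 - a1) + l * (b2 - b1) = hi - lo by rewrite /hi /lo; ring.
have lohi : lo <= hi.
  have [x Ax] := A0; have [y By] := B0.
  have h1 : a1 <= a2 by apply: (@le_trans _ _ x); [exact: ge_inf|exact: ub_le_sup].
  have h2 : b1 <= b2 by apply: (@le_trans _ _ y); [exact: ge_inf|exact: ub_le_sup].
  by rewrite lerD// ler_pM2l// subr_gt0.
have sub : `]lo, hi[%classic `<=` C.
  move=> z /=; rewrite in_itv/= => /andP[z1 z2]. have d0 : 0 < hi - lo by rewrite subr_gt0; exact: lt_trans z2.
  pose t := (z - lo) / (hi - lo). have t01 : 0 < t < 1.
    apply/andP; split; first by rewrite divr_gt0// subr_gt0. by rewrite /t ltr_pdivrMr// mul1r ltrD2r.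
  have := ABC _ _ (key A iA A0 uA lA t t01) (key B iB B0 uB lB t t01).
  suff -> : (1 - l) * ((1 - t) * inf A + t * sup A) + l * ((1 - t) * inf B + t * sup B) = z by [].
  have -> : z = lo + t * (hi - lo) by rewrite /t divfK ?gt_eqF//; ring. by rewrite /hi /lo -/a1 -/a2 -/b1 -/b2; ring.
have : (leb `]lo, hi[%classic <= leb C)%E by apply: le_measure => //; rewrite inE.
rewrite leb_itv/= lte_fin.
by move: lohi; rewrite le_eqVlt => /orP[/eqP ->|->]; rewrite ?ltxx ?subrr.
Qed.

(* Since sup f = sup g = 1, the superlevel sets of f and g at a given level are both empty or both
   nonempty, and then the one-dimensional Brunn-Minkowski inequality for intervals applies. *)
Lemma prekopa_leindler_normalized (l b : R) (f g h : R -> R) : 0 < l < 1 ->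
  measurable_fun setT f -> measurable_fun setT g -> measurable_fun setT h ->
  (forall x, 0 <= f x) -> (forall x, 0 <= g x) -> (forall x, 0 <= h x) ->
  (forall x, f x != 0 -> `|x| <= b) -> (forall x, g x != 0 -> `|x| <= b) ->
  (forall a, 0 <= a -> is_interval [set x | a < f x]) ->
  (forall a, 0 <= a -> is_interval [set x | a < g x]) ->
  (forall x, f x <= 1) -> (forall x, g x <= 1) ->
  (forall a, a < 1 -> exists x, a < f x) -> (forall a, a < 1 -> exists x, a < g x) ->
  (forall x y, Num.min (f x) (g y) <= h ((1 - l) * x + l * y)) ->
  ((1 - l)%:E * \int[leb]_x (f x)%:E + l%:E * \int[leb]_x (g x)%:E <= \int[leb]_x (h x)%:E)%E.
Proof.
move=> l01 mf mg mh f0 g0 h0 bf bg iF iG f1 g1 sf sg fgh.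
have [l0 l1] := andP l01.
have l0' : 0 <= l by exact: ltW.
have l1' : 0 <= 1 - l by rewrite subr_ge0 ltW.
rewrite !layer_cake// -!ge0_integralZl_EFin//; try exact: measurable_superlevel.
rewrite -ge0_integralD//; last 4 first.
- by move=> x _; rewrite mule_ge0// lee_fin subr_ge0 ltW.
- by apply: measurable_funeM; exact: measurable_superlevel.
- by move=> x _; rewrite mule_ge0// lee_fin ltW.
- by apply: measurable_funeM; exact: measurable_superlevel.
have mS (k : R -> R) (a : R) : measurable_fun setT k -> measurable [set x | a < k x].
  by move=> mk; apply: measurable_lt_set.
apply: ge0_le_integral => //.
- by move=> x _; rewrite adde_ge0// mule_ge0// lee_fin ?subr_ge0 ltW.
- by apply: emeasurable_funD; apply: measurable_funeM; exact: measurable_superlevel.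
- exact: measurable_superlevel.
move=> a /=; rewrite in_itv/= andbT => a0.
have bdd k : (forall x, k x != 0 -> `|x| <= b) -> has_ubound [set x | a < k x] /\ has_lbound [set x | a < k x].
  move=> bk; split; [exists b|exists (- b)] => x /= ax;
  have := bk x (lt0r_neq0 (le_lt_trans a0 ax)); by rewrite ler_norml => /andP[].
have [a1|a1] := ltP a 1; last first.
  have e (k : R -> R) : (forall x, k x <= 1) -> [set x | a < k x] = set0.
    by move=> k1; apply/seteqP; split => // x /=; rewrite ltNge (le_trans (k1 x) a1).
  by rewrite e// e// measure0 !mule0 adde0.
have [bf1 bf2] := bdd _ bf; have [bg1 bg2] := bdd _ bg.
apply: leb_mink => //; try exact: mS; try (exact: iF || exact: iG).
- exact: sf.
- exact: sg.
- by move=> x y /= ax ay; apply: lt_le_trans (fgh x y); rewrite lt_min ax.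
Qed.
End pl1.

Section prekopa_leindler.
Variable R : realType.

(** The class in which Prekopa-Leindler is proved: bounded functions supported in a cube. It is
    stable under slicing with the same [B] and [k], and all integrals and marginals are finite in
    it, so real-valued marginals can be used in the induction on the dimension. *)
Definition plok n (f : 'rV[R]_n -> R) (B : R) (k : nat) :=
  [/\ measurable_fun [set: bV R n] (f : bV R n -> R), forall x, 0 <= f x <= B
    & forall x, f x != 0 -> kbox k x].

Definition logconcave n (f : 'rV[R]_n -> R) := forall x y (l : R), 0 <= l <= 1 ->
  f x `^ (1 - l) * f y `^ l <= f ((1 - l) *: x + l *: y).

Lemma measurable_vcons_slice m (s : R) :
  measurable_fun [set: bV R m] ((fun v => vcons v s) : bV R m -> bV R m.+1).
Proof.
apply: measurable_bVP => i; case: (unliftP ord0 i) => [j ->|->].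
  apply: (@eq_measurable_fun _ _ _ _ _ (@coordi R m j : bV R m -> R)).
    by move=> p _ /=; rewrite vconsS.
  exact: measurable_coordi.
apply: (@eq_measurable_fun _ _ _ _ _ (cst s)) => //.
by move=> p _ /=; rewrite vcons0.
Qed.

Lemma vconsD m (v w : 'rV[R]_m) a b c d :
  vcons (c *: v + d *: w) (c * a + d * b) = c *: vcons v a + d *: vcons w b.
Proof. by apply/rowP => i; rewrite !mxE; case: unliftP => [j _|_]; rewrite ?mxE. Qed.

Lemma kbox_vcons m k (v : 'rV[R]_m) s : kbox k (vcons v s) -> kbox k v /\ `|s| <= k%:R.
Proof.
move=> h; split; first by move=> i; have := h (lift ord0 i); rewrite !mxE liftK.
have := h ord0; rewrite !mxE unlift_none => /andP[h1 h2].
by rewrite ler_norml h1 ltW.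
Qed.

Lemma plok_int n (f : 'rV[R]_n -> R) B k : plok f B k ->
  (\int[@lam R n]_x (f x)%:E <= (B * (2 * k%:R) ^+ n)%:E)%E.
Proof.
move=> [mf fB fk].
have B0 : 0 <= B by have /andP[h1] := fB 0; exact: le_trans.
apply: (@le_trans _ _ (\int[@lam R n]_x (B%:E * (\1_(kbox k : set (bV R n)) x)%:E))%E).
  apply: ge0_le_integral => //.
  - by move=> x _; rewrite lee_fin; case/andP: (fB x).
  - exact/measurable_EFinP.
  - apply: measurable_funeM; apply/measurable_EFinP; apply: measurable_indic.
    exact: measurable_hbox.
  - move=> x _; rewrite -EFinM lee_fin indicE.
    have [->|/fk xk] := eqVneq (f x) 0; first by rewrite mulr_ge0. by rewrite mem_set// mulr1; case/andP: (fB x).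
rewrite ge0_integralZl_EFin//; last first.
  by apply/measurable_EFinP; apply: measurable_indic; exact: measurable_hbox.
rewrite integral_indic//; last exact: measurable_hbox.
rewrite setIT EFinM; apply: lee_wpmul2l; first by rewrite lee_fin.
apply: (le_trans (lebesgue_outer_hbox_le _)) => [i|]; first by rewrite !mxE ge0_cp.
rewrite lee_fin (eq_bigr (fun=> 2 * k%:R)); last by move=> i _; rewrite !mxE; ring.
by rewrite prodr_const card_ord.
Qed.

Lemma plok_fin n (f : 'rV[R]_n -> R) B k : plok f B k ->
  (\int[@lam R n]_x (f x)%:E)%E \is a fin_num.
Proof.
move=> pf; rewrite ge0_fin_numE; last first.
  by apply: integral_ge0 => x _; rewrite lee_fin; case: pf => _ /(_ x)/andP[].
exact: le_lt_trans (plok_int pf) (ltry _).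
Qed.

Lemma plok_slice m (f : 'rV[R]_m.+1 -> R) B k s : plok f B k ->
  plok (fun v => f (vcons v s)) B k.
Proof.
move=> [mf fB fk]; split => //.
  by apply: (measurableT_comp mf); exact: measurable_vcons_slice.
by move=> x /fk /kbox_vcons[].
Qed.

Definition marginal m (f : 'rV[R]_m.+1 -> R) (s : R) : R :=
  fine (\int[@lam R m]_v (f (vcons v s))%:E).

Lemma measurable_marginal m (f : 'rV[R]_m.+1 -> R) B k : plok f B k ->
  measurable_fun setT (marginal f).
Proof.
move=> [mf fB fk]; apply: measurableT_comp; first exact: fine_measurable.
have h := @measurable_fun_fubini_tonelli_G _ _ (bV R m) R R (@lam R m) (fun p => (f (vcons p.1 p.2))%:E).
apply: h; last by move=> p; rewrite lee_fin; case/andP: (fB (vcons p.1 p.2)).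
by apply/measurable_EFinP; apply: (measurableT_comp mf); exact: measurable_vconsp.
Qed.

Lemma marginal_ge0 m (f : 'rV[R]_m.+1 -> R) B k s : plok f B k -> 0 <= marginal f s.
Proof.
move=> [mf fB fk]; apply: fine_ge0; apply: integral_ge0 => v _; rewrite lee_fin.
by case/andP: (fB (vcons v s)).
Qed.

Lemma marginal_le m (f : 'rV[R]_m.+1 -> R) B k s : plok f B k ->
  marginal f s <= B * (2 * k%:R) ^+ m.
Proof.
move=> pf; rewrite -lee_fin fineK; last exact: plok_fin (plok_slice s pf).
exact: (plok_int (plok_slice s pf)).
Qed.

Lemma marginal_supp m (f : 'rV[R]_m.+1 -> R) B k s : plok f B k -> marginal f s != 0 -> `|s| <= k%:R.
Proof.
move=> [mf fB fk]; apply: contraNT => ks; apply/eqP.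
rewrite /marginal (eq_integral (cst 0%E)) ?integral0// => v _.
have [->//|/fk /kbox_vcons[_]] := eqVneq (f (vcons v s)) 0.
by rewrite (negPf ks).
Qed.

Lemma marginal_int m (f : 'rV[R]_m.+1 -> R) B k : plok f B k ->
  (\int[@lam R m.+1]_x (f x)%:E = \int[leb]_s (marginal f s)%:E)%E.
Proof.
move=> pf; have [mf fB fk] := pf; rewrite lam_fubini2//; last 2 first.
- exact/measurable_EFinP.
- by move=> x; rewrite lee_fin; case/andP: (fB x).
apply: eq_integral => s _; rewrite fineK//.
exact: plok_fin (plok_slice s pf).
Qed.

Lemma amgm (l a b : R) : 0 < l < 1 -> 0 <= a -> 0 <= b ->
  a `^ (1 - l) * b `^ l <= (1 - l) * a + l * b.
Proof.
move=> /andP[l0 l1] a0 b0; have l1' : 0 < 1 - l by rewrite subr_gt0.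
have := @conjugate_powR R (a `^ (1 - l)) (b `^ l) (1 - l)^-1 l^-1 (powR_ge0 _ _) (powR_ge0 _ _).
rewrite !invr_gt0 !invrK => /(_ l1' l0); rewrite subrK => /(_ erefl).
rewrite -!powRrM !mulfV ?gt_eqF// !powRr1//.
by rewrite [_ * (1 - l)]mulrC [_ * l]mulrC.
Qed.

Lemma le_powR_min (l a b : R) : 0 < l < 1 -> 0 <= a -> 0 <= b ->
  Num.min a b <= a `^ (1 - l) * b `^ l.
Proof.
move=> /andP[l0 l1] a0 b0; have l1' : 0 <= 1 - l by rewrite subr_ge0 ltW.
have h c : 0 <= c -> c `^ (1 - l) * c `^ l = c.
  move=> c0; have [->|cn] := eqVneq c 0; first by rewrite (powR0 (lt0r_neq0 l0)) mulr0.
  by rewrite -powRD ?subrK ?powRr1// cn implybT.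
have := le_total a b => /orP[ab|ba].
  rewrite min_l// -{1}(h a a0) ler_wpM2l ?powR_ge0//. by apply: ge0_ler_powR => //; rewrite ?nnegrE// ltW.
rewrite min_r// -{1}(h b b0) ler_wpM2r ?powR_ge0//.
by apply: ge0_ler_powR => //; rewrite nnegrE.
Qed.

Lemma powRV_mul (l a c : R) : 0 <= a -> 0 < c -> (a / c) `^ l = a `^ l / c `^ l.
Proof. by move=> a0 c0; rewrite powRM// ?invr_ge0 ?ltW// -powR_inv1 ?ltW// -powRrM mulN1r powRN. Qed.

(** Induction on the dimension through the marginals in the first coordinate. The induction
    hypothesis serves twice: on slices of one function it makes superlevel sets of marginals
    intervals, on slices of the three functions it gives the hypothesis of the one-dimensional
    inequality. *)
Theorem prekopa_leindler n (l B : R) (k : nat) (f g h : 'rV[R]_n -> R) : 0 < l < 1 ->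
  plok f B k -> plok g B k -> plok h B k -> logconcave f -> logconcave g ->
  (forall x y, f x `^ (1 - l) * g y `^ l <= h ((1 - l) *: x + l *: y)) ->
  fine (\int[@lam R n]_x (f x)%:E) `^ (1 - l) * fine (\int[@lam R n]_x (g x)%:E) `^ l
    <= fine (\int[@lam R n]_x (h x)%:E).
Proof.
elim: n l f g h => [|m IH] l f g h l01 pf pg ph cf cg fgh.
  have e (u : 'rV[R]_0 -> R) : plok u B k -> fine (\int[@lam R 0]_x (u x)%:E) = u 0.
    move=> pu; rewrite (eq_integral (cst (u 0)%:E)); last first.
      by move=> x _ /=; congr (_%:E); congr u; apply/rowP => -[].
    rewrite integral_cst//= (_ : [set: bV R 0] = hbox 0 0).
      by rewrite [X in (_ * X)%E]lam_hbox// big_ord0 mule1.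
    by apply/seteqP; split => x // _ [].
  by rewrite !e//; apply: le_trans (fgh 0 0) _; rewrite !scaler0 addr0.
have [l0 l1] := andP l01; have l1' : 0 < 1 - l by rewrite subr_gt0.
(* The induction hypothesis with three slices of the same function says that its marginal is
   log-concave; only the shape of the superlevel sets is retained. *)
have qc (u : 'rV[R]_m.+1 -> R) : plok u B k -> logconcave u ->
    forall a, 0 <= a -> is_interval [set s | a < marginal u s].
  move=> pu cu a a0; apply/is_intervalPlt => x y /= ax ay z /andP[xz zy].
  have xy : 0 < y - x by rewrite subr_gt0 (lt_trans xz). pose t := (z - x) / (y - x). have t01 : 0 < t < 1.
    apply/andP; split; first by rewrite divr_gt0// subr_gt0. by rewrite /t ltr_pdivrMr// mul1r ltrD2r.
  have zE : z = (1 - t) * x + t * y.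
    suff -> : z = x + t * (y - x) by ring. by rewrite /t divfK ?gt_eqF//; ring.
  have := IH t _ _ _ t01 (plok_slice x pu) (plok_slice y pu) (plok_slice z pu).
  rewrite -/(marginal u x) -/(marginal u y) -/(marginal u z) => /(_ _ _ _)/(lt_le_trans _); apply.
  - apply: lt_le_trans (le_powR_min t01 _ _); last 2 first.
    + exact: marginal_ge0 pu.
    + exact: marginal_ge0 pu.
    by rewrite lt_min ax.
  - move=> v w s s01; have := cu (vcons v x) (vcons w x) s s01.
    by rewrite -vconsD; congr (_ <= u (vcons _ _)); ring.
  - move=> v w s s01; have := cu (vcons v y) (vcons w y) s s01.
    by rewrite -vconsD; congr (_ <= u (vcons _ _)); ring.
  - move=> v w; have := cu (vcons v x) (vcons w y) t.
    rewrite -vconsD -zE; apply; have /andP[t0 t1] := t01. by rewrite !ltW.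
have mfg s t : marginal f s `^ (1 - l) * marginal g t `^ l <= marginal h ((1 - l) * s + l * t).
  apply: (IH l _ _ _ l01 (plok_slice s pf) (plok_slice t pg) (plok_slice _ ph)).
  - move=> v w r r01; have := cf (vcons v s) (vcons w s) r r01.
    by rewrite -vconsD; congr (_ <= f (vcons _ _)); ring.
  - move=> v w r r01; have := cg (vcons v t) (vcons w t) r r01.
    by rewrite -vconsD; congr (_ <= g (vcons _ _)); ring.
  - by move=> v w; rewrite vconsD.
pose S (u : 'rV[R]_m.+1 -> R) := sup (range (marginal u)).
have hS (u : 'rV[R]_m.+1 -> R) : plok u B k -> has_sup (range (marginal u)).
  move=> pu; split; first by exists (marginal u 0); exists 0.
  by exists (B * (2 * k%:R) ^+ m) => _ [s _ <-]; exact: marginal_le pu.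
have leS (u : 'rV[R]_m.+1 -> R) (s : R) : plok u B k -> marginal u s <= S u.
  by move=> pu; apply: ub_le_sup; [case: (hS u pu)|exists s].
have S0 (u : 'rV[R]_m.+1 -> R) : plok u B k -> 0 <= S u.
  by move=> pu; apply: le_trans (leS u 0 pu); exact: marginal_ge0 pu.
have Sz (u : 'rV[R]_m.+1 -> R) : plok u B k -> S u = 0 -> fine (\int[@lam R m.+1]_x (u x)%:E) = 0.
  move=> pu Su; rewrite (marginal_int pu) (eq_integral (cst 0%E)) ?integral0// => s _.
  by congr (_%:E); apply/eqP; rewrite eq_le (marginal_ge0 _ pu) andbT -Su leS.
have hI : 0 <= fine (\int[@lam R m.+1]_x (h x)%:E).
  by apply: fine_ge0; apply: integral_ge0 => x _; rewrite lee_fin; case: ph => _ /(_ x)/andP[].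
have [/(Sz f pf) ->|Sf] := eqVneq (S f) 0; first by rewrite powR0 ?mul0r ?gt_eqF.
have [/(Sz g pg) ->|Sg] := eqVneq (S g) 0; first by rewrite (powR0 (lt0r_neq0 l0)) mulr0.
have {}Sf : 0 < S f by rewrite lt0r Sf S0.
have {}Sg : 0 < S g by rewrite lt0r Sg S0.
(* The first two marginals are divided by their suprema, as the normalized inequality demands, the
   third by [c]. A minimum is at most a weighted geometric mean, so the hypothesis in terms of
   [Num.min] follows. *)
pose c := S f `^ (1 - l) * S g `^ l.
have c0 : 0 < c by rewrite mulr_gt0// powR_gt0.
have intD (u : 'rV[R]_m.+1 -> R) (d : R) : plok u B k -> 0 < d ->
    (\int[leb]_s (marginal u s / d)%:E = (fine (\int[@lam R m.+1]_x (u x)%:E) / d)%:E)%E.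
  move=> pu d0; under eq_integral do rewrite mulrC EFinM. rewrite ge0_integralZl_EFin//; last 3 first.
  - by move=> s _; rewrite lee_fin; exact: marginal_ge0 pu.
  - by apply/measurable_EFinP; exact: measurable_marginal pu.
  - by rewrite invr_ge0 ltW.
  by rewrite -(marginal_int pu) mulrC EFinM fineK//; exact: plok_fin pu.
have := @prekopa_leindler_normalized R l k%:R (fun s => marginal f s / S f)
  (fun s => marginal g s / S g) (fun s => marginal h s / c) l01.
rewrite !intD// -!EFinM -EFinD lee_fin => N.
have {}N : (1 - l) * (fine (\int[@lam R m.+1]_x (f x)%:E) / S f) +
    l * (fine (\int[@lam R m.+1]_x (g x)%:E) / S g) <= fine (\int[@lam R m.+1]_x (h x)%:E) / c.
  have mdiv (u : 'rV[R]_m.+1 -> R) (d : R) : plok u B k -> measurable_fun setT (fun s => marginal u s / d).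
    by move=> pu; apply: measurable_funM => //; exact: measurable_marginal pu.
  have dge0 (u : 'rV[R]_m.+1 -> R) (d : R) (s : R) : plok u B k -> 0 < d -> 0 <= marginal u s / d.
    by move=> pu d0; rewrite divr_ge0 ?(marginal_ge0 _ pu) ?ltW.
  have sup1 (u : 'rV[R]_m.+1 -> R) : plok u B k -> 0 < S u -> forall a, a < 1 -> exists s, a < marginal u s / S u.
    move=> pu su a a1; have e0 : 0 < (1 - a) * S u by rewrite mulr_gt0// subr_gt0.
    have [_ [s _ <-] us] := sup_adherent e0 (hS u pu).
    by exists s; rewrite ltr_pdivlMr//; move: us; rewrite -/(S u); lra.
  have qc1 (u : 'rV[R]_m.+1 -> R) : plok u B k -> logconcave u -> 0 < S u -> forall a, 0 <= a -> is_interval [set s | a < marginal u s / S u].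
    move=> pu cu su a a0; have -> : [set s | a < marginal u s / S u] = [set s | a * S u < marginal u s].
      by apply/seteqP; split => s /=; rewrite ltr_pdivlMr.
    by apply: qc => //; rewrite mulr_ge0// ltW.
  have le1 (u : 'rV[R]_m.+1 -> R) (s : R) : plok u B k -> 0 < S u -> marginal u s / S u <= 1.
    by move=> pu su; rewrite ler_pdivrMr// mul1r leS.
  have sp (u : 'rV[R]_m.+1 -> R) (d : R) (s : R) : plok u B k -> marginal u s / d != 0 -> `|s| <= k%:R.
    by move=> pu; rewrite mulf_eq0 negb_or => /andP[/(marginal_supp pu)].
  apply: N => //; try (by move=> *; exact: dge0); try (exact: mdiv); try (exact: qc1);
    try (by move=> *; exact: le1); try (exact: sup1).
  - by move=> x; exact: sp.
  - by move=> x; exact: sp.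
  - move=> x y; apply: le_trans (le_powR_min l01 _ _) _; try exact: dge0.
    rewrite !powRV_mul// ?(marginal_ge0 _ pf) ?(marginal_ge0 _ pg)//.
    rewrite mulrACA -invfM -/c; apply: ler_wpM2r; first by rewrite invr_ge0 ltW. exact: mfg.
have If0 (u : 'rV[R]_m.+1 -> R) : plok u B k -> 0 <= fine (\int[@lam R m.+1]_x (u x)%:E).
  by move=> pu; apply: fine_ge0; apply: integral_ge0 => x _; rewrite lee_fin; case: pu => _ /(_ x)/andP[].
(* The normalized inequality is additive; the arithmetic-geometric mean inequality makes it
   multiplicative, and the factor [c] then cancels. *)
have := le_trans (amgm l01 _ _) N.
move=> /(_ (divr_ge0 (If0 _ pf) (ltW Sf)) (divr_ge0 (If0 _ pg) (ltW Sg))).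
by rewrite !powRV_mul ?If0// mulrACA -invfM -/c ler_pM2r ?invr_gt0.
Qed.
End prekopa_leindler.

Lemma measurable_inv_fun (R : realType) d (X : measurableType d) (f : X -> R) :
  measurable_fun setT f -> measurable_fun setT (fun x => (f x)^-1).
Proof.
move=> mf; apply: (@eq_measurable_fun _ _ _ _ _ (fun x => f x * (f x ^+ 2) `^ (-1))).
  move=> x _; rewrite powR_inv1 ?sqr_ge0//.
  by have [->|f0] := eqVneq (f x) 0; rewrite ?mul0r ?invr0// expr2 invfM mulrA mulfV// mul1r.
apply: measurable_funM => //.
apply: (measurableT_comp (f := fun y : R => y `^ (-1)) (g := fun x => f x ^+ 2)).
  exact: measurable_powR.
exact: measurable_funX.
Qed.

(** * Polar integration without a measure on the sphere *)

Section averaging.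
Local Open Scope ereal_scope.
Context d (X : measurableType d) (R : realType).
Variables (mu : {sigma_finite_measure set X -> \bar R}) (sc : R -> X -> X) (D : nat) (N : X -> R).
Hypothesis msc : measurable_fun setT (fun p : X * R => sc p.2 p.1).
Hypothesis scV : forall (l : R) x, (0 < l)%R -> sc l^-1 (sc l x) = x.
Hypothesis scale : forall (l : R) (F : X -> \bar R), (0 < l)%R -> measurable_fun setT F ->
  (forall x, 0 <= F x) -> \int[mu]_x F (sc l x) = (l^-1 ^+ D.+1)%:E * \int[mu]_x F x.
Hypothesis mN : measurable_fun setT N.
Hypothesis NZ : forall (l : R) x, (0 < l)%R -> N (sc l x) = (l * N x)%R.
Hypothesis N0 : mu [set x | N x <= 0]%R = 0.

(** A function k with integral of k(x / l) / l over l > 0 equal to 1: for this choice the integrand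
    is 1 / N x when l < N x and 0 otherwise. It stands in for the normalization by the area of the
    unit sphere. *)
Definition polar_weight (x : X) : R := (if 1 < N x then (N x)^-1 else 0)%R.

Lemma polar_weight_ge0 x : (0 <= polar_weight x)%R.
Proof.
by rewrite /polar_weight; case: ifPn => // h; rewrite invr_ge0 (le_trans ler01)// ltW.
Qed.

Lemma measurable_polar_weight : measurable_fun setT polar_weight.
Proof.
rewrite /polar_weight; apply: measurable_fun_ifT => //.
- exact: measurable_fun_ltr.
- exact: measurable_inv_fun.
Qed.

Variable F : X -> \bar R.
Hypothesis mF : measurable_fun setT F.
Hypothesis F0 : forall x, 0 <= F x.

Let pos : set R := `]0%R, +oo[%classic.

Let posE (l : R) : (l \in pos) = (0 < l)%R.
by rewrite mem_setE in_itv/= andbT. Qed.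

Let mpos (G : X * R -> \bar R) : measurable_fun setT G ->
  measurable_fun setT (fun p => G p * (\1_pos p.2)%:E).
Proof.
move=> mG; apply: emeasurable_funM => //; apply/measurable_EFinP.
apply: (measurableT_comp (f := \1_pos : R -> R)) => //.
by apply: measurable_indic; exact: measurable_itv.
Qed.

Let restr (G : R -> \bar R) : \int[leb]_(l in pos) G l = \int[leb]_l (G l * (\1_pos l)%:E).
Proof.
rewrite integral_mkcond; apply: eq_integral => l _; rewrite patchE indicE.
by case: ifP => _; rewrite ?mule1 ?mule0.
Qed.

Let mscF : measurable_fun setT (fun p : X * R => F (sc p.2 p.1)).
exact: measurableT_comp. Qed.

Let mpw : measurable_fun setT (fun p : X * R => (p.2 ^+ D)%:E * F (sc p.2 p.1)).
Proof.
apply: emeasurable_funM => //; apply/measurable_EFinP.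
by apply: measurable_funX; exact: measurable_snd.
Qed.

(* Averaging the identity int F = l^(D+1) int F(l x) against the weight
   l^(-1) k(x / l), whose integral over l > 0 is 1 for every x with N x > 0. *)
Lemma polar_averaging :
  \int[mu]_x F x = \int[mu]_x ((polar_weight x)%:E *
     \int[leb]_(l in `]0%R, +oo[%classic) ((l ^+ D)%:E * F (sc l x))).
Proof.
have H1 x : (polar_weight x)%:E * \int[leb]_(l in `]0%R, +oo[%classic) ((l ^+ D)%:E * F (sc l x)) =
    \int[leb]_l ((polar_weight x)%:E * (((l ^+ D)%:E * F (sc l x)) * (\1_pos l)%:E)).
  rewrite restr ge0_integralZl_EFin//.
  - move=> l _; rewrite indicE; case: (boolP (l \in pos)); last by rewrite mule0.
    rewrite posE => l0. by rewrite mule1 mule_ge0// lee_fin exprn_ge0// ltW.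
  - by have := measurableT_comp (mpos mpw) (measurable_pair1 x).
  - exact: polar_weight_ge0.
under [RHS]eq_integral do rewrite H1.
have mk : measurable_fun setT (fun p : X * R => (polar_weight p.1)%:E : \bar R).
  apply/measurable_EFinP; apply: (measurableT_comp measurable_polar_weight). exact: measurable_fst.
pose G1 (p : X * R) := (polar_weight p.1)%:E * (((p.2 ^+ D)%:E * F (sc p.2 p.1)) * (\1_pos p.2)%:E).
have mG1 : measurable_fun setT G1 by apply: emeasurable_funM => //; exact: mpos.
have G10 p : 0 <= G1 p.
  rewrite /G1 mule_ge0// ?lee_fin ?polar_weight_ge0// indicE. case: (boolP (p.2 \in pos)); last by rewrite mule0.
  rewrite posE => l0. by rewrite mule1 mule_ge0// lee_fin exprn_ge0// ltW.
rewrite (@fubini_tonelli _ _ X R R mu leb G1)//.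
(* After the substitution y = l x and the exchange of integrals, this is the factor multiplying
   [F y]; its integral over l > 0 is 1 as soon as [N y] is positive. *)
pose w (y : X) (l : R) : R := ((l < N y)%R%:R * (N y)^-1)%R.
have H2 l : \int[mu]_x G1 (x, l) = \int[mu]_y (F y * ((w y l)%:E * (\1_pos l)%:E)).
  rewrite /G1/= indicE; case: (boolP (l \in pos)); last first.
    move=> _; rewrite !integral0_eq// => x _; by rewrite !mule0.
  rewrite posE => l0. pose G (y : X) := (l ^+ D)%:E * ((polar_weight (sc l^-1 y))%:E * F y).
  have mG : measurable_fun setT G.
    apply: measurable_funeM; apply: emeasurable_funM => //; apply/measurable_EFinP.
    apply: (measurableT_comp measurable_polar_weight).
    have mp : measurable_fun setT (fun y : X => (y, l^-1%R)) by exact: measurable_fun_pair.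
    exact: (measurableT_comp msc mp).
  have G0 y : 0 <= G y.
    apply: mule_ge0; first by rewrite lee_fin exprn_ge0// ltW.
    by apply: mule_ge0 => //; rewrite lee_fin polar_weight_ge0.
  transitivity (\int[mu]_x G (sc l x)).
    by apply: eq_integral => x _; rewrite /G scV// mule1 muleCA.
  rewrite scale// -ge0_integralZl_EFin//; last by rewrite exprn_ge0// invr_ge0 ltW.
  apply: eq_integral => y _; rewrite /G mule1 muleA -EFinM exprS -mulrA -exprMn.
  rewrite mulVf ?gt_eqF// expr1n mulr1 muleA -EFinM muleC; congr (_ * _%:E).
  rewrite /polar_weight NZ ?invr_gt0// /w ltr_pdivlMl// mulr1. case: ifPn => h; last by rewrite mul0r mulr0.
  by rewrite mul1r invfM invrK mulrA mulVf ?gt_eqF// mul1r.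
under [RHS]eq_integral do rewrite H2.
have mw : measurable_fun setT (fun p : X * R => w p.1 p.2).
  apply: measurable_funM.
    have mb : measurable_fun setT (fun p : X * R => (p.2 < N p.1)%R).
      apply: measurable_fun_ltr; first exact: measurable_snd. by apply: measurableT_comp => //; exact: measurable_fst.
    have -> : (fun p : X * R => (p.2 < N p.1)%R%:R : R) = (fun p => if (p.2 < N p.1)%R then 1%R else 0%R).
      by apply/funext => p; case: ltP.
    by apply: measurable_fun_ifT.
  apply: (measurableT_comp (measurable_inv_fun mN)); exact: measurable_fst.
pose G2 (p : X * R) := F p.1 * ((w p.1 p.2)%:E * (\1_pos p.2)%:E).
have mG2 : measurable_fun setT G2.
  apply: emeasurable_funM; first by apply: measurableT_comp => //; exact: measurable_fst.
  by apply: (@mpos (fun p => (w p.1 p.2)%:E)); apply/measurable_EFinP.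
have w0 y l : (0 < l)%R -> (0 <= w y l)%R.
  move=> l0; rewrite /w; case: ltP => h; last by rewrite mul0r. by rewrite mul1r invr_ge0 ltW// (lt_trans l0).
have ww0 y l : 0 <= (w y l)%:E * (\1_pos l)%:E.
  rewrite indicE; case: (boolP (l \in pos)); last by rewrite mule0. rewrite posE => l0. by rewrite mule1 lee_fin w0.
have G20 p : 0 <= G2 p by rewrite /G2 mule_ge0.
rewrite -(@fubini_tonelli _ _ X R R mu leb G2)//.
apply: ge0_ae_eq_integral => //.
- exact: (@measurable_fun_fubini_tonelli_F _ _ X R R leb G2).
- by move=> x _; apply: integral_ge0 => l _; exact: G20.
exists [set x | N x <= 0]%R; split => //.
  by apply: measurable_le_set => //.
move=> x /= /not_implyP[_ h]; rewrite leNgt; apply/negP => Nx; apply: h.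
rewrite /G2/= ge0_integralZl//.
  suff -> : \int[leb]_y ((w x y)%:E * (\1_pos y)%:E) = 1 by rewrite mule1.
  transitivity (\int[leb]_y (((N x)^-1)%:E * (\1_(`]0%R, N x[%classic : set R) y)%:E)).
    apply: eq_integral => y _; rewrite /w -!EFinM !indicE; congr EFin. rewrite posE mem_setE in_itv/=.
    by case: (ltP 0%R y) => _; case: (ltP y (N x)) => _ /=; rewrite ?mulr1 ?mulr0 ?mul0r ?mul1r.
  rewrite ge0_integralZl_EFin//.
  - rewrite integral_indic// setIT [X in _ * X]leb_itv/= lte_fin Nx -EFinB subr0 -EFinM.
    by rewrite mulVf// gt_eqF.
  - by apply/measurable_EFinP; exact: measurable_indic.
  - by rewrite invr_ge0 ltW.
by have := measurableT_comp (@mpos (fun p => (w p.1 p.2)%:E) ltac:(by apply/measurable_EFinP)) (measurable_pair1 x).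
Qed.

End averaging.

Section enorm.
Variables (R : realType) (n : nat).
Implicit Types x y z : 'rV[R]_n.

Lemma innerC x y : inner x y = inner y x.
Proof. by apply: eq_bigr => i _; rewrite mulrC. Qed.
Lemma innerDl x y z : inner (x + y) z = inner x z + inner y z.
Proof. by rewrite /inner -big_split/=; apply: eq_bigr => i _; rewrite mxE mulrDl. Qed.
Lemma innerDr x y z : inner z (x + y) = inner z x + inner z y.
Proof. by rewrite !(innerC z) innerDl. Qed.
Lemma innerZl a x y : inner (a *: x) y = a * inner x y.
Proof. by rewrite /inner mulr_sumr; apply: eq_bigr => i _; rewrite mxE mulrA. Qed.
Lemma innerZr a x y : inner x (a *: y) = a * inner x y.
Proof. by rewrite !(innerC x) innerZl. Qed.
Lemma innerNl x y : inner (- x) y = - inner x y.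
Proof. by rewrite -scaleN1r innerZl mulN1r. Qed.
Lemma innerNr x y : inner x (- y) = - inner x y.
Proof. by rewrite !(innerC x) innerNl. Qed.
Lemma innerBl x y z : inner (x - y) z = inner x z - inner y z.
Proof. by rewrite innerDl innerNl. Qed.
Lemma innerBr x y z : inner z (x - y) = inner z x - inner z y.
Proof. by rewrite innerDr innerNr. Qed.
Lemma inner0l x : inner 0 x = 0.
Proof. by rewrite -(scale0r x) innerZl mul0r. Qed.
Lemma inner0r x : inner x 0 = 0.
Proof. by rewrite innerC inner0l. Qed.
Lemma inner_ge0 x : 0 <= inner x x.
Proof. by apply: sumr_ge0 => i _; rewrite -expr2 sqr_ge0. Qed.

Lemma enorm_ge0 x : 0 <= enorm x. Proof. exact: sqrtr_ge0. Qed.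
Lemma enorm_sqr x : enorm x ^+ 2 = inner x x.
Proof. by rewrite sqr_sqrtr// inner_ge0. Qed.
Lemma enormZ a x : enorm (a *: x) = `|a| * enorm x.
Proof. by rewrite /enorm innerZl innerZr mulrA -expr2 sqrtrM ?sqr_ge0// sqrtr_sqr. Qed.
Lemma enormN x : enorm (- x) = enorm x.
Proof. by rewrite -scaleN1r enormZ normrN1 mul1r. Qed.
Lemma enorm0 : enorm (0 : 'rV[R]_n) = 0.
Proof. by rewrite /enorm inner0l sqrtr0. Qed.

Lemma coord_enorm x i : `|x ord0 i| <= enorm x.
Proof.
rewrite -sqrtr_sqr ler_wsqrtr// expr2 /inner (bigD1 i)//= lerDl.
by apply: sumr_ge0 => j _; rewrite -expr2 sqr_ge0.
Qed.

Lemma enorm_eq0 x : enorm x = 0 -> x = 0.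
Proof.
move=> x0; apply/rowP => i; rewrite mxE; apply/eqP; rewrite -normr_le0 -x0.
exact: coord_enorm.
Qed.

Lemma enorm_gt0 x : (0 < enorm x) = (x != 0).
Proof.
rewrite lt0r enorm_ge0 andbT; apply/idP/idP; apply: contra => /eqP; last first.
  by move=> /enorm_eq0 ->.
by move=> ->; rewrite enorm0.
Qed.

Lemma cauchy_schwarz x y : inner x y <= enorm x * enorm y.
Proof.
have [/enorm_eq0 ->|y0] := eqVneq (enorm y) 0; first by rewrite inner0r enorm0 mulr0.
have := inner_ge0 (enorm y ^+ 2 *: x - inner x y *: y).
rewrite innerBl !innerBr !innerZl !innerZr (innerC y x) -!enorm_sqr => h.
have y2 : 0 < enorm y ^+ 2 by rewrite exprn_gt0// lt0r y0 enorm_ge0.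
have {}h : inner x y ^+ 2 <= (enorm x * enorm y) ^+ 2.
  rewrite -(ler_pM2l y2) exprMn.
  by rewrite -subr_ge0; apply: le_trans h _; rewrite le_eqVlt; apply/orP; left; apply/eqP; ring.
apply: le_trans (ler_norm _) _; rewrite -(@ler_pXn2r _ 2)// ?nnegrE ?mulr_ge0 ?enorm_ge0//.
by rewrite real_normK ?num_real.
Qed.

Lemma norm_inner_le x y : `|inner x y| <= enorm x * enorm y.
Proof.
rewrite ler_norml cauchy_schwarz andbT lerNl -innerNl -(enormN x).
exact: cauchy_schwarz.
Qed.

Lemma enormD x y : enorm (x + y) <= enorm x + enorm y.
Proof.
rewrite -(@ler_pXn2r _ 2)// ?nnegrE ?addr_ge0 ?enorm_ge0// sqrrD !enorm_sqr.
rewrite innerDl !innerDr (innerC y x) mulr2n.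
have := cauchy_schwarz x y; lra.
Qed.

Lemma enormB x y : enorm (x - y) <= enorm x + enorm y.
Proof. by rewrite -(enormN y); exact: enormD. Qed.

Lemma enorm_distC x y : enorm (x - y) = enorm (y - x).
Proof. by rewrite -enormN opprB. Qed.

Lemma enorm_triangle x y z : enorm (x - z) <= enorm (x - y) + enorm (y - z).
Proof. by have := enormD (x - y) (y - z); rewrite addrA subrK. Qed.

Lemma enorm_le_coord x (e : R) : 0 <= e -> (forall i, `|x ord0 i| <= e) -> enorm x <= Num.sqrt n%:R * e.
Proof.
move=> e0 h; rewrite -(@ler_pXn2r _ 2)// ?nnegrE ?mulr_ge0 ?sqrtr_ge0 ?enorm_ge0//.
rewrite enorm_sqr exprMn sqr_sqrtr//.
apply: (@le_trans _ _ (\sum_(i < n) e ^+ 2)); last by rewrite sumr_const card_ord mulr_natl.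
by apply: ler_sum => i _; rewrite -expr2 -real_normK ?num_real// lerXn2r ?nnegrE.
Qed.

Lemma nbhs_enormP x (A : set 'rV[R]_n) :
  nbhs x A <-> exists2 e : R, 0 < e & forall y, enorm (x - y) < e -> A y.
Proof.
split.
  move=> /nbhs_rVP[e e0 eA]; exists e => // y xy; apply: eA => i.
  by apply: le_lt_trans xy; have := coord_enorm (x - y) i; rewrite !mxE.
move=> [e e0 eA]; apply/nbhs_rVP.
have sn : 0 < Num.sqrt n%:R + 1 :> R by rewrite ltr_wpDl// sqrtr_ge0.
exists (e / (Num.sqrt n%:R + 1)); first by rewrite divr_gt0.
move=> y h; apply: eA.
apply: (@le_lt_trans _ _ (Num.sqrt n%:R * (e / (Num.sqrt n%:R + 1)))).
  apply: enorm_le_coord; first by rewrite ltW// divr_gt0. by move=> i; rewrite !mxE ltW.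
by rewrite mulrCA gtr_pMr// ltr_pdivrMr// mul1r ltrDl.
Qed.

Lemma enorm_lip_continuous (f : 'rV[R]_n -> R) (L : R) :
  (forall x y, `|f x - f y| <= L * enorm (x - y)) -> continuous f.
Proof.
move=> fL x A /nbhs_ballP[e e0 eA]; apply/nbhs_enormP.
have L0 : 0 < `|L| + 1 by rewrite ltr_wpDl.
exists (e / (`|L| + 1)); first by rewrite divr_gt0.
move=> y; rewrite ltr_pdivlMr// => xy; apply: eA; rewrite /ball/=.
apply: le_lt_trans (fL x y) _; apply: le_lt_trans xy; rewrite mulrC ler_wpM2l ?enorm_ge0//.
by rewrite (le_trans (ler_norm L))// lerDl.
Qed.

Lemma continuous_enorm : continuous (@enorm R n).
Proof.
apply: (@enorm_lip_continuous _ 1) => x y; rewrite mul1r ler_norml; apply/andP; split.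
  by have := enorm_triangle y x 0; rewrite !subr0 enorm_distC; lra.
by have := enorm_triangle x y 0; rewrite !subr0; lra.
Qed.

Lemma continuous_inner z : continuous (inner z).
Proof.
apply: (@enorm_lip_continuous _ (enorm z)) => x y.
by rewrite -innerBr norm_inner_le.
Qed.

Lemma measurable_enorm : measurable_fun [set: bV R n] (@enorm R n : bV R n -> R).
Proof. by apply: continuous_measurable_rV; exact: continuous_enorm. Qed.

Lemma measurable_inner z : measurable_fun [set: bV R n] (inner z : bV R n -> R).
Proof. by apply: continuous_measurable_rV; exact: continuous_inner. Qed.

End enorm.

Section prodm.
Local Open Scope ereal_scope.
Context d1 d2 (T1 : measurableType d1) (T2 : measurableType d2) (R : realType).
Variables (m1 : {sigma_finite_measure set T1 -> \bar R}).
Variables (m2 : {sigma_finite_measure set T2 -> \bar R}).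

(** The product measure under a name of its own, to which a sigma-finite instance can be attached;
    the averaging argument takes a sigma-finite measure. *)
Definition prodm : set (T1 * T2)%type -> \bar R := product_measure1 m1 m2.

Let prodm0 : prodm set0 = 0. Proof. exact: (measure0 (product_measure1 m1 m2)). Qed.
Let prodm_ge0 A : 0 <= prodm A. Proof. exact: (measure_ge0 (product_measure1 m1 m2)). Qed.
Let prodm_sa : semi_sigma_additive prodm.
exact: (@measure_semi_sigma_additive _ _ _ (product_measure1 m1 m2)). Qed.
HB.instance Definition _ := isMeasure.Build _ _ _ prodm prodm0 prodm_ge0 prodm_sa.

Let prodm_sf : sigma_finite setT prodm.
Proof.
have /sigma_finiteP[F [TF ndF Foo]] := sigma_finiteT m1.
have /sigma_finiteP[G [TG ndG Goo]] := sigma_finiteT m2.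
exists (fun n => F n `*` G n).
  rewrite -setXTT TF TG predeqE => -[x y]; split.
    move=> [/= [n _ Fnx] [k _ Gky]]; exists (maxn n k) => //; split.
    - by move: x Fnx; exact/subsetPset/ndF/leq_maxl.
    - by move: y Gky; exact/subsetPset/ndG/leq_maxr.
  by move=> [n _ []/= ? ?]; split; exists n.
move=> k; have [? ?] := Foo k; have [? ?] := Goo k.
split; first exact: measurableX.
by rewrite [X in X < _]product_measure1E// lte_mul_pinfty// ge0_fin_numE.
Qed.
HB.instance Definition _ := @Measure_isSigmaFinite.Build _ _ _ prodm prodm_sf.
End prodm.

Definition lamR (R : realType) (n : nat) := prodm (@lam R n) (@leb R).
Arguments lamR : clear implicits.

Lemma lamR_fubini (R : realType) (n : nat) (F : bV R n * R -> \bar R) :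
  measurable_fun setT F -> (forall z, 0 <= F z)%E ->
  (\int[lamR R n]_z F z = \int[@lam R n]_x \int[leb]_s F (x, s))%E.
Proof. by move=> mF F0; rewrite [LHS]fubini_tonelli1. Qed.

Section polar_instances.
Variable R : realType.
Local Open Scope ereal_scope.

Lemma leb_fubini1 (F : R -> \bar R) : measurable_fun setT F -> (forall a, 0 <= F a) ->
  \int[@lam R 1]_x F (x ord0 ord0) = \int[leb]_a F a.
Proof.
move=> mF F0.
rewrite (@lam_fubini R 0 (fun x => F (x ord0 ord0)))//; last first.
  by apply: (measurableT_comp mF); exact: measurable_coordi.
transitivity (\int[@lam R 0]_v (cst (\int[leb]_a F a) v)).
  by apply: eq_integral => v _ /=; apply: eq_integral => a _; rewrite vcons0.
rewrite integral_cst// (_ : [set: bV R 0] = hbox 0%R 0%R); last first.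
  by apply/seteqP; split => x // _ [].
by rewrite [X in _ * X]lam_hbox// big_ord0 mule1.
Qed.

Lemma ge0_integral_leb_affine (s c : R) (F : R -> \bar R) : s != 0%R ->
  measurable_fun setT F -> (forall x, 0 <= F x) ->
  \int[leb]_x F (s * x + c)%R = (`|s|^-1)%:E * \int[leb]_x F x.
Proof.
move=> s0 mF F0; rewrite -(leb_fubini1 mF F0) -(@leb_fubini1 (fun x => F (s * x + c)%R))//; last first.
  apply: (measurableT_comp mF); apply: measurable_funD => //; exact: measurable_funM.
rewrite -[X in (X)%:E](expr1) -(@ge0_integral_affine R 1 s (const_mx c) (fun x => F (x ord0 ord0)))//.
  by apply: eq_integral => x _; rewrite !mxE.
by apply: (measurableT_comp mF); exact: measurable_coordi.
Qed.

Lemma lam_set0 m : @lam R m.+1 [set 0%R] = 0.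
Proof.
have -> : [set 0%R] = @rect R m.+1 (fun=> [set 0%R]).
  apply/seteqP; split => x /=; first by move=> -> i; rewrite /= mxE. by move=> h; apply/rowP => i; rewrite mxE h.
rewrite lam_rect//.
rewrite big_ord_recl (_ : leb [set 0%R] = 0) ?mul0e//.
have -> : [set 0%R : R] = `[0%R, 0%R]%classic by rewrite set_itv1.
by rewrite leb_itv/= ltxx.
Qed.

Lemma enorm_le0 n : [set x : 'rV[R]_n | enorm x <= 0]%R = [set 0%R].
Proof.
apply/seteqP; split => x /=; last by move=> ->; rewrite enorm0.
by move=> x0; apply: enorm_eq0; apply/eqP; rewrite eq_le x0 enorm_ge0.
Qed.

Lemma measurable_scale n : measurable_fun setT (fun p : bV R n * R => (p.2 *: p.1)%R : bV R n).
Proof.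
apply: measurable_bVP => i.
apply: (@eq_measurable_fun _ _ _ _ _ (fun p : bV R n * R => p.2 * coordi i p.1)%R).
  by move=> p _; rewrite !mxE.
apply: measurable_funM; first exact: measurable_snd.
by apply: (measurableT_comp (@measurable_coordi R n i)); exact: measurable_fst.
Qed.

Definition kw n (x : 'rV[R]_n) : R := @polar_weight _ (bV R n) R (@enorm R n) x.

Lemma kw_ge0 n (x : 'rV[R]_n) : (0 <= kw x)%R. Proof. exact: polar_weight_ge0. Qed.

Lemma measurable_kw n : measurable_fun setT (@kw n : bV R n -> R).
Proof. by apply: measurable_polar_weight; exact: measurable_enorm. Qed.

Lemma polar_lam m (F : bV R m.+1 -> \bar R) : measurable_fun setT F -> (forall x, 0 <= F x) ->
  \int[@lam R m.+1]_x F x = \int[@lam R m.+1]_x ((kw x)%:E *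
     \int[leb]_(l in `]0%R, +oo[%classic) ((l ^+ m)%:E * F (l *: x)%R)).
Proof.
move=> mF F0; apply: (@polar_averaging _ (bV R m.+1) R (@lam R m.+1) (fun l x => (l *: x)%R) m (@enorm R m.+1)) => //.
- exact: measurable_scale.
- by move=> l x l0; rewrite scalerA mulVf ?gt_eqF// scale1r.
- move=> l G l0 mG G0; have := @ge0_integral_affine R m.+1 l 0%R G (lt0r_neq0 l0) mG G0.
  by rewrite gtr0_norm// => <-; apply: eq_integral => x _; rewrite addr0.
- exact: measurable_enorm.
- by move=> l x l0; rewrite enormZ gtr0_norm.
- by rewrite enorm_le0; exact: lam_set0.
Qed.

(** The weight looks at the R^n component only, although the dilation acts on both components. Rays
    in R^n x R thus carry the same weight as their projections to R^n, which is what lets the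
    contribution of the walls be compared with [cone_surface]. *)
Lemma polar_lamR m (F : bV R m.+1 * R -> \bar R) : measurable_fun setT F -> (forall x, 0 <= F x) ->
  \int[lamR R m.+1]_x F x = \int[lamR R m.+1]_z ((kw z.1)%:E *
     \int[leb]_(l in `]0%R, +oo[%classic) ((l ^+ m.+1)%:E * F (l *: z.1, l * z.2)%R)).
Proof.
move=> mF F0.
rewrite [LHS](@polar_averaging _ (bV R m.+1 * R)%type R (lamR R m.+1)
  (fun l z => (l *: z.1, l * z.2)%R) m.+1 (fun z => @enorm R m.+1 z.1)) => //.
- apply: measurable_fun_pair.
    apply: (measurableT_comp (f := fun p : bV R m.+1 * R => (p.2 *: p.1)%R : bV R m.+1)
       (g := fun x : (bV R m.+1 * R) * R => (x.1.1, x.2))); first exact: measurable_scale.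
    apply: measurable_fun_pair; last exact: measurable_snd. by apply: measurableT_comp; exact: measurable_fst.
  apply: measurable_funM; first exact: measurable_snd.
  by apply: measurableT_comp; [exact: measurable_snd|exact: measurable_fst].
- by move=> l [x s] l0/=; rewrite scalerA mulrA mulVf ?gt_eqF// scale1r mul1r.
- move=> l G l0 mG G0.
  have l1 : (`|l^-1| = l^-1)%R by rewrite gtr0_norm// invr_gt0. have nl : (`|l|^-1 = l^-1)%R by rewrite gtr0_norm.
  have li : (0 <= l^-1)%R by rewrite invr_ge0 ltW.
  have msc : measurable_fun setT (fun z : bV R m.+1 * R => G (l *: z.1, l * z.2)%R).
    apply: (measurableT_comp mG); apply: measurable_fun_pair.
      apply: (@measurableT_comp _ _ _ _ _ _ (fun x : bV R m.+1 => (l *: x)%R : bV R m.+1)); last exact: measurable_fst.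
      have := @measurable_affine R m.+1 l 0%R. by apply: eq_measurable_fun => x _; rewrite addr0.
    by apply: measurable_funM => //; exact: measurable_snd.
  rewrite lamR_fubini//. rewrite lamR_fubini//. pose H (x : bV R m.+1) := \int[leb]_s G (x, s).
  have mH : measurable_fun setT H by exact: (@measurable_fun_fubini_tonelli_F _ _ (bV R m.+1) R R leb G).
  have H0 x : 0 <= H x by apply: integral_ge0 => s _; exact: G0.
  transitivity (\int[@lam R m.+1]_x ((l^-1)%:E * H (l *: x)%R)).
    apply: eq_integral => x _; rewrite /=. have mGx : measurable_fun setT (fun s : R => G ((l *: x)%R, s)).
      exact: (measurableT_comp mG (measurable_pair1 _)).
    have := @ge0_integral_leb_affine l 0%R (fun s => G (l *: x, s)%R) (lt0r_neq0 l0) mGx (fun s => G0 _).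
    rewrite nl => <- //. by apply: eq_integral => s _; rewrite addr0.
  have mHl : measurable_fun setT (fun x : bV R m.+1 => H (l *: x)%R).
    apply: (measurableT_comp mH); have := @measurable_affine R m.+1 l 0%R.
    by apply: eq_measurable_fun => x _; rewrite addr0.
  rewrite ge0_integralZl_EFin//. rewrite [in RHS]exprS EFinM -muleA; congr (_ * _).
  have := @ge0_integral_affine R m.+1 l 0%R H (lt0r_neq0 l0) mH H0.
  by rewrite nl => <-; apply: eq_integral => x _; rewrite addr0.
- by apply: measurableT_comp; [exact: measurable_enorm|exact: measurable_fst].
- by move=> l x l0; rewrite enormZ gtr0_norm.
- have -> : [set x : bV R m.+1 * R | enorm x.1 <= 0]%R = [set 0%R] `*` setT.
    apply/seteqP; split => -[x s] /=; last by move=> [-> _]; rewrite enorm0.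
    by move=> h; split => //; have : [set x : bV R m.+1 | enorm x <= 0]%R x by []; rewrite enorm_le0.
  rewrite [LHS]product_measure1E// ?[X in X * _]lam_set0 ?mul0e//.
  by rewrite -enorm_le0; apply: measurable_le_set => //; exact: measurable_enorm.
Qed.

End polar_instances.

(** * Volumes of Euclidean balls *)

Section omega_ball.
Variable R : realType.
Local Open Scope ereal_scope.

Lemma integral_leb_obnd_cbnd (r : R) (f : R -> \bar R) : measurable_fun setT f ->
  \int[leb]_(x in `]r, +oo[%classic) f x = \int[leb]_(x in `[r, +oo[%classic) f x.
Proof.
move=> mf; rewrite !integral_leb//; try exact: measurable_funTS.
by rewrite integral_itv_obnd_cbnd//; exact: measurable_funTS.
Qed.

Lemma integral_expr_itv (m : nat) (u : R) : (0 < u)%R ->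
  \int[leb]_(l in `]0%R, u[%classic) (l ^+ m)%:E = (u ^+ m.+1 / m.+1%:R)%:E.
Proof.
move=> u0; have mX (D : set R) : measurable_fun D (fun l : R => (l ^+ m)%:E).
  by apply/measurable_EFinP; apply: measurable_funX.
rewrite integral_leb; [|exact: measurable_itv|exact: mX].
rewrite integral_itv_bndo_bndc ?integral_itv_obnd_cbnd; [|exact: mX|exact: mX].
pose F (x : R) := (x ^+ m.+1 / m.+1%:R)%R.
have dF (x : R) : is_derive x (1%R : R) F (x ^+ m)%R.
  have h1 : is_derive x (1%R : R) (fun y : R => y ^+ m.+1)%R (m.+1%:R * x ^+ m)%R.
    apply: DeriveDef; first exact: exprn_derivable. by rewrite exp_derive /GRing.scale/= mulr1.
  have -> : F = (m.+1%:R^-1 \*: (fun y : R => y ^+ m.+1))%R.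
    by apply/funext => y /=; rewrite /F mulrC.
  apply: (@is_derive_eq _ _ _ _ _ _ _ _ (is_deriveZ _ h1)). by rewrite /GRing.scale/= mulrA mulVf ?mul1r.
have cF : continuous F.
  by move=> x; apply: differentiable_continuous; apply/derivable1_diffP; case: (dF x).
rewrite (@continuous_FTC2 R (fun l => l ^+ m)%R F)//.
- by rewrite /F expr0n/= mul0r sube0.
- by apply: continuous_subspaceT => x; exact: exprn_continuous.
- split; first by move=> x _; case: (dF x).
    by apply: cvg_at_right_filter; exact: cF.
  by apply: cvg_at_left_filter; exact: cF.
- by move=> x _; rewrite derive1E; case: (dF x).
Qed.

Lemma gauss_tail (l : R) : (0 <= l)%R ->
  \int[leb]_(u in `[l, +oo[%classic) (2 * u * expR (- u ^+ 2))%:E = (expR (- l ^+ 2))%:E.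
Proof.
move=> l0; pose F (x : R) := (- expR (- x ^+ 2))%R.
have dF (x : R) : is_derive x (1%R : R) F (2 * x * expR (- x ^+ 2))%R.
  have h1 : is_derive x (1%R : R) (fun y : R => y ^+ 2)%R (2 * x)%R.
    by apply: is_derive_eq; rewrite /GRing.scale/= mulr1 mulr_natl.
  have h2 := @is_deriveN _ _ _ _ _ _ _ h1. have h3 := @is_derive1_comp R expR _ x _ _ (is_derive_expR _) h2.
  have h4 := @is_deriveN _ _ _ _ _ _ _ h3. apply: (@is_derive_eq _ _ _ _ _ _ _ _ h4). by rewrite mulrN opprK mulrC.
have cF : continuous F.
  by move=> x; apply: differentiable_continuous; apply/derivable1_diffP; case: (dF x).
have ce : continuous (fun x : R => expR (- x ^+ 2)).
  move=> x; apply: continuous_comp; last exact: continuous_expR. by apply: continuousN; exact: exprn_continuous.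
have cf : continuous (fun x : R => (2 * x * expR (- x ^+ 2))%R).
  move=> x; apply: continuousM; last exact: ce. by apply: continuousM => //; exact: cvg_cst.
rewrite integral_leb; [|exact: measurable_itv|]; last first.
  by apply/measurable_EFinP; apply: measurable_funTS; exact: continuous_measurable_fun.
rewrite (@ge0_continuous_FTC2y R _ F l 0%R)//.
- by rewrite sub0e /F EFinN oppeK.
- by move=> x lx; rewrite !mulr_ge0 ?expR_ge0// (le_trans l0).
- exact: continuous_subspaceT.
- rewrite -oppr0; apply: cvgN.
  exact: cvg_gauss_fun.
- by apply: cvg_at_right_filter; exact: cF.
- by move=> x _; rewrite derive1E; case: (dF x).
Qed.

Definition gam (m : nat) : \bar R :=
  \int[leb]_(l in `]0%R, +oo[%classic) (l ^+ m * expR (- l ^+ 2))%:E.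

Let mgauss : measurable_fun setT (fun x : R => expR (- x ^+ 2)).
exact: measurable_gauss_fun. Qed.

Lemma gam0 : gam 0 = (Num.sqrt pi / 2)%:E.
Proof.
rewrite -integral0y_gauss -integral_itv_obnd_cbnd; last first.
  by apply/measurable_EFinP; apply: measurable_funTS.
rewrite /gam integral_leb//.
  by apply: eq_integral => x _; rewrite expr0 mul1r.
by apply/measurable_EFinP; apply: measurable_funTS; apply: measurable_funM.
Qed.

Lemma gam1 : gam 1 = (2^-1)%:E.
Proof.
have := gauss_tail (lexx 0%R); rewrite expr0n/= oppr0 expR0.
have -> : \int[leb]_(u in `[0%R, +oo[%classic) (2 * u * expR (- u ^+ 2))%:E = 2%:E * gam 1.
  have mm : measurable_fun setT (fun u : R => u ^+ 1 * expR (- u ^+ 2))%R.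
    by apply: measurable_funM.
  rewrite /gam -ge0_integralZl_EFin//.
  - rewrite !integral_leb//; last 2 first.
    + by apply: measurable_funeM; apply/measurable_EFinP; apply: measurable_funTS.
    + apply/measurable_EFinP; apply: measurable_funTS; exact: measurable_funM.
    rewrite -integral_itv_obnd_cbnd; last first.
      apply/measurable_EFinP; apply: measurable_funTS; exact: measurable_funM.
    by apply: eq_integral => x _; rewrite -EFinM expr1 mulrA.
  - by move=> x; rewrite /= in_itv/= andbT => x0; rewrite lee_fin mulr_ge0 ?expR_ge0// expr1 ltW.
  - by apply/measurable_EFinP; apply: measurable_funTS.
have g0 : 0 <= gam 1.
  by apply: integral_ge0 => x; rewrite /= in_itv/= andbT => x0; rewrite lee_fin mulr_ge0 ?expR_ge0// expr1 ltW.
case: (gam 1) g0 => [r||]//; last by rewrite mulry gtr0_sg// mul1e.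
by move=> _; rewrite -EFinM => -[h]; congr EFin; lra.
Qed.

(* Tonelli applied to e^(-l^2) = int_(u > l) 2 u e^(-u^2) du *)
Lemma gamSS m : gam m.+2 = ((m.+1)%:R / 2)%:E * gam m.
Proof.
pose pos : set R := `]0%R, +oo[%classic.
have posE (l : R) : (l \in pos) = (0 < l)%R by rewrite mem_setE in_itv/= andbT.
have restr (G : R -> \bar R) : \int[leb]_(l in pos) G l = \int[leb]_l (G l * (\1_pos l)%:E).
  rewrite integral_mkcond; apply: eq_integral => l _; rewrite patchE indicE. by case: ifP => _; rewrite ?mule1 ?mule0.
pose G (p : R * R) : \bar R := if ((0 < p.1) && (p.1 < p.2))%R
  then (p.1 ^+ m * (2 * p.2 * expR (- p.2 ^+ 2)))%:E else 0.
have mG : measurable_fun setT G.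
  rewrite /G; apply: measurable_fun_ifT => //.
    apply: measurable_and; apply: measurable_fun_ltr => //.
  apply/measurable_EFinP; apply: measurable_funM; first exact: measurable_funX.
  apply: measurable_funM; first exact: measurable_funM. exact: (measurableT_comp mgauss (@measurable_snd _ _ R R)).
have G0 p : 0 <= G p.
  rewrite /G; case: ifPn => // /andP[h1 h2]; rewrite lee_fin.
  by rewrite !mulr_ge0 ?exprn_ge0 ?expR_ge0 ?(ltW h1)// ltW// (lt_trans h1).
have := @fubini_tonelli _ _ R R R leb leb G mG G0.
have -> : \int[leb]_x \int[leb]_y G (x, y) = gam m.
  rewrite /gam restr; apply: eq_integral => x _; rewrite indicE posE /G/=.
  case: ltP => x0 /=; last by rewrite mule0 integral0. rewrite mule1 EFinM -(gauss_tail (ltW x0)).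
  rewrite -ge0_integralZl_EFin//; last 3 first.
  - move=> u /=; rewrite in_itv/= andbT => xu.
    by rewrite lee_fin !mulr_ge0 ?expR_ge0// (le_trans (ltW x0)).
  - apply/measurable_EFinP; apply: measurable_funTS; exact: measurable_funM.
  - by rewrite exprn_ge0// ltW.
  rewrite -integral_leb_obnd_cbnd; last first.
    by apply: measurable_funeM; apply/measurable_EFinP; apply: measurable_funM => //; exact: measurable_funM.
  rewrite [RHS]integral_mkcond; apply: eq_integral => u _. by rewrite patchE mem_setE in_itv/= andbT; case: ifP.
have -> : \int[leb]_y \int[leb]_x G (x, y) = (2 / m.+1%:R)%:E * gam m.+2.
  rewrite /gam restr -ge0_integralZl_EFin//; last 2 first.
  - move=> u _; rewrite indicE posE; case: ltP => u0; rewrite ?mule0// mule1 lee_fin.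
    by rewrite mulr_ge0 ?expR_ge0// exprn_ge0// ltW.
  - apply: emeasurable_funM; last by apply/measurable_EFinP; apply: measurable_indic; exact: measurable_itv.
    apply/measurable_EFinP; apply: measurable_funM => //; exact: measurable_funX.
  apply: eq_integral => u _; rewrite indicE posE. case: ltP => u0; last first.
    rewrite !mule0 integral0_eq// => x _; rewrite /G/=; case: ifPn => // /andP[h1 h2].
    by move: (lt_le_trans (lt_trans h1 h2) u0); rewrite ltxx.
  rewrite mule1 -EFinM.
  transitivity (\int[leb]_(x in `]0%R, u[%classic) ((2 * u * expR (- u ^+ 2))%:E * (x ^+ m)%:E)).
    rewrite [RHS]integral_mkcond; apply: eq_integral => x _.
    by rewrite patchE mem_setE in_itv/= /G/=; case: ifP => //; rewrite -EFinM mulrC.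
  rewrite ge0_integralZl_EFin//; last 3 first.
  - by move=> x /=; rewrite in_itv/= => /andP[x0 _]; rewrite lee_fin exprn_ge0// ltW.
  - by apply/measurable_EFinP; apply: measurable_funTS; exact: measurable_funX.
  - by rewrite !mulr_ge0 ?expR_ge0// ltW.
  rewrite integral_expr_itv// -EFinM; congr EFin; rewrite [in RHS]exprS. by field.
move=> ->; rewrite muleA -EFinM (_ : _ * _ = 1)%R ?mul1e//.
by field.
Qed.

(** The first factor does not involve [phi]: it plays the part of the area of the sphere. Its value
    is found afterwards by inserting a Gaussian. *)
Lemma radial_integral (m : nat) (phi : R -> \bar R) :
  measurable_fun setT phi -> (forall r, 0 <= phi r) ->
  \int[@lam R m.+1]_x phi (enorm x) =
  \int[@lam R m.+1]_x ((kw x * (enorm x)^-1 ^+ m.+1)%:E) *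
  \int[leb]_(l in `]0%R, +oo[%classic) ((l ^+ m)%:E * phi l).
Proof.
move=> mphi phi0.
pose pos : set R := `]0%R, +oo[%classic.
have posE (l : R) : (l \in pos) = (0 < l)%R by rewrite mem_setE in_itv/= andbT.
have restr (G : R -> \bar R) : \int[leb]_(l in pos) G l = \int[leb]_l (G l * (\1_pos l)%:E).
  rewrite integral_mkcond; apply: eq_integral => l _; rewrite patchE indicE. by case: ifP => _; rewrite ?mule1 ?mule0.
have mG : measurable_fun setT (fun l : R => (l ^+ m)%:E * phi l * (\1_pos l)%:E).
  apply: emeasurable_funM; last by apply/measurable_EFinP; apply: measurable_indic; exact: measurable_itv.
  by apply: emeasurable_funM => //; apply/measurable_EFinP; exact: measurable_funX.
have G0 l : 0 <= (l ^+ m)%:E * phi l * (\1_pos l)%:E.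
  rewrite indicE posE; case: ltP => l0; rewrite ?mule0// mule1.
  by apply: mule_ge0 => //; rewrite lee_fin exprn_ge0// ltW.
rewrite (@polar_lam R m (fun x => phi (enorm x)))//; last by apply: measurableT_comp => //; exact: measurable_enorm.
rewrite restr -ge0_integralZr//; last 3 first.
- apply/measurable_EFinP; apply: measurable_funM; first exact: measurable_kw.
  by apply: measurable_funX; apply: measurable_inv_fun; exact: measurable_enorm.
- by move=> x _; rewrite lee_fin mulr_ge0 ?kw_ge0// exprn_ge0// invr_ge0 enorm_ge0.
- by apply: integral_ge0 => l _; exact: G0.
apply: eq_integral => x _.
have [x0|x0] := eqVneq (enorm x) 0%R.
  by rewrite /kw /polar_weight x0 ltNge ler01/= mul0r !mul0e.
have {}x0 : (0 < enorm x)%R by rewrite lt0r x0 enorm_ge0.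
rewrite EFinM -muleA; congr (_ * _); rewrite restr.
have := @ge0_integral_leb_affine R (enorm x) 0%R _ (lt0r_neq0 x0) mG G0.
rewrite gtr0_norm// exprSr EFinM -muleA => <-.
rewrite -ge0_integralZl_EFin//.
- apply: eq_integral => l _; rewrite addr0 enormZ !indicE !posE (pmulr_rgt0 _ x0).
  case: ltP => l0; rewrite ?mule0// !mule1 gtr0_norm// muleA -EFinM -exprMn mulrA mulVf ?gt_eqF//.
  by rewrite mul1r [(l * _)%R]mulrC.
- apply: (measurableT_comp mG); apply: measurable_funD => //; exact: measurable_funM.
- by rewrite exprn_ge0// invr_ge0 enorm_ge0.
Qed.

Definition eball n (r : R) : set (bV R n) := [set x | enorm x <= r]%R.

Lemma measurable_eball n r : measurable (@eball n r).
Proof. by apply: measurable_le_set => //; exact: measurable_enorm. Qed.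

Lemma gauss_lam n : \int[@lam R n]_x (expR (- enorm x ^+ 2))%:E = (Num.sqrt pi ^+ n)%:E.
Proof.
have mg k : measurable_fun setT (fun x : bV R k => (expR (- enorm x ^+ 2))%:E).
  by apply/measurable_EFinP; apply: (measurableT_comp mgauss); exact: measurable_enorm.
have mge : measurable_fun setT (fun a : R => (expR (- a ^+ 2))%:E) by exact/measurable_EFinP.
elim: n => [|m IH].
  rewrite (eq_integral (cst 1)); last first.
    by move=> x _ /=; rewrite (_ : x = 0%R) ?enorm0 ?expr0n/= ?oppr0 ?expR0//; apply/rowP => -[].
  rewrite integral_cst// (_ : [set: bV R 0] = hbox 0%R 0%R); last first.
    by apply/seteqP; split => x // _ [].
  by rewrite [X in _ * X]lam_hbox// big_ord0 mule1.
rewrite lam_fubini//.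
transitivity (\int[@lam R m]_v ((expR (- enorm v ^+ 2))%:E * (Num.sqrt pi)%:E)).
  apply: eq_integral => v _. rewrite -integralT_gauss -integral_leb// -ge0_integralZl_EFin ?expR_ge0//; last first.
    by move=> a _; rewrite lee_fin gauss_fun_ge0.
  - apply: eq_integral => a _; rewrite -EFinM -expRD; congr ((expR _)%:E).
    rewrite !enorm_sqr /inner big_ord_recl vcons0 -opprD addrC -expr2; congr (- (_ + _))%R.
    by apply: eq_bigr => j _; rewrite vconsS.
rewrite ge0_integralZr//; last exact: mg.
by rewrite IH -EFinM exprSr.
Qed.

(** The Gaussian, integrated once as a product and once radially, gives [K m * gam m]; the indicator
    of the ball gives [K m / m.+1]. The recursion by steps of two in [omega] is then the one of
    [gamSS], started at dimensions 1 and 2. *)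
Lemma lam_eball1 n : @lam R n (eball 1) = (omega R n)%:E.
Proof.
pose K m := \int[@lam R m.+1]_x ((kw x * (enorm x)^-1 ^+ m.+1)%:E).
have hG m : K m * gam m = (Num.sqrt pi ^+ m.+1)%:E.
  rewrite -gauss_lam (@radial_integral m (fun r => (expR (- r ^+ 2))%:E))//. exact/measurable_EFinP.
have hV m : @lam R m.+1 (eball 1) = K m * (m.+1%:R^-1)%:E.
  rewrite -[X in lam X = _]setIT -integral_indic//; last exact: measurable_eball.
  transitivity (\int[@lam R m.+1]_x ((\1_(`[0%R, 1%R]%classic : set R) (enorm x))%:E : \bar R)).
    apply: eq_integral => x _; rewrite !indicE.
    have -> : (x \in eball 1) = (enorm x <= 1)%R by apply/idP/idP; rewrite inE.
    by rewrite mem_setE in_itv/= enorm_ge0.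
  rewrite (@radial_integral m (fun r => (\1_(`[0%R, 1%R]%classic : set R) r)%:E))//; last first.
    by apply/measurable_EFinP; exact: measurable_indic.
  congr (_ * _); rewrite -[RHS](_ : \int[leb]_(l in `]0%R, 1%R[%classic) (l ^+ m)%:E = _); last first.
    by rewrite integral_expr_itv// expr1n div1r.
  rewrite !integral_leb//; last 2 first.
  - by apply/measurable_EFinP; apply: measurable_funTS; exact: measurable_funX.
  - apply: measurable_funTS; apply: emeasurable_funM; apply/measurable_EFinP.
      exact: measurable_funX.
    exact: measurable_indic.
  rewrite integral_itv_bndo_bndc; last first.
    by apply/measurable_EFinP; apply: measurable_funTS; exact: measurable_funX.
  rewrite integral_mkcond [RHS]integral_mkcond; apply: eq_integral => l _.
  rewrite !patchE !mem_setE !in_itv/= andbT indicE mem_setE in_itv/=. case: ltP => l0 //=; rewrite (ltW l0)/=.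
  by case: leP => _; rewrite ?mule1 ?mule0.
have sp0 : (0 < Num.sqrt pi :> R)%R by rewrite sqrtr_gt0 pi_gt0.
have spp : (Num.sqrt pi ^+ 2 = pi :> R)%R by rewrite sqr_sqrtr// ltW// pi_gt0.
have main m : exists g v : R, [/\ (0 < g)%R, gam m = g%:E, K m = v%:E, gam m.+1 \is a fin_num & 0 < gam m.+1].
  have gfin : forall m, exists g1 g2 : R, [/\ (0 < g1)%R, (0 < g2)%R, gam m = g1%:E & gam m.+1 = g2%:E].
    elim=> [|k [g1 [g2 [g10 g20 e1 e2]]]].
      by exists (Num.sqrt pi / 2)%R, (2^-1)%R; rewrite gam0 gam1; split => //; rewrite divr_gt0.
    exists g2, (k.+1%:R / 2 * g1)%R; rewrite gamSS e1; split => //. by rewrite mulr_gt0// divr_gt0.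
  have [g1 [g2 [g10 g20 e1 e2]]] := gfin m. have := hG m; rewrite e1. have K0 : 0 <= K m.
    by apply: integral_ge0 => x _; rewrite lee_fin mulr_ge0 ?kw_ge0// exprn_ge0// invr_ge0 enorm_ge0.
  case: (K m) K0 => [v||]//; last by rewrite mulyr gtr0_sg// mul1e. by exists g1, v; rewrite e2; split.
have two m : @lam R m.+3 (eball 1) = (2 * pi / m.+3%:R)%:E * @lam R m.+1 (eball 1).
  rewrite !hV; have [g [v [g0 eg ev _ _]]] := main m; have [g' [v' [g'0 eg' ev' _ _]]] := main m.+2.
  move: (hG m) (hG m.+2); rewrite gamSS eg ev ev' -!EFinM => -[h1] [h2]; congr EFin.
  have gn : g != 0%R by rewrite gt_eqF. have -> : (v = Num.sqrt pi ^+ m.+1 / g)%R by rewrite -h1 mulfK.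
  have -> : (v' = Num.sqrt pi ^+ m.+3 / (m.+1%:R / 2 * g))%R.
    by rewrite -h2 mulfK// !mulf_neq0// invr_eq0.
  have -> : (Num.sqrt pi ^+ m.+3 = pi * Num.sqrt pi ^+ m.+1 :> R)%R.
    by rewrite [in LHS]exprS [X in (_ * X)%R]exprS mulrA -expr2 spp.
  have m1 : (m.+1%:R != 0 :> R)%R by rewrite pnatr_eq0. have m3 : (m.+3%:R != 0 :> R)%R by rewrite pnatr_eq0.
  move: m1 m3; set a := (m.+1%:R)%R; set b := (m.+3%:R)%R; set c := (_ ^+ m.+1)%R; move: a b c => a b c m1 m3.
  by field; rewrite gn m1.
have base : @lam R 1 (eball 1) = 2%:E.
  rewrite hV; have [g [v [g0 eg ev _ _]]] := main 0%N.
  move: (hG 0%N); rewrite ev -EFinM; move: eg; rewrite gam0 -EFinM => -[eg] [h]; congr EFin.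
  have : (v * Num.sqrt pi = 2 * Num.sqrt pi)%R by rewrite expr1 in h; move: h; set q := Num.sqrt pi; lra.
  by move/(mulIf (lt0r_neq0 sp0)) => ->; rewrite invr1 mulr1.
have base2 : @lam R 2 (eball 1) = pi%:E.
  rewrite hV; have [g [v [g0 eg ev _ _]]] := main 1%N. move: (hG 1%N); rewrite ev gam1 -EFinM => -[h]; congr EFin.
  by rewrite h spp.
have H m : @lam R m.+1 (eball 1) = (omega R m.+1)%:E /\ @lam R m.+2 (eball 1) = (omega R m.+2)%:E.
  elim: m => [|m [IH1 IH2]]; first by rewrite base base2; split => //; congr EFin; rewrite /=; field.
  by split => //; rewrite two IH1 -EFinM.
case: n => [|m]; last by case: (H m).
rewrite (_ : eball 1 = hbox 0%R 0%R); last first.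
  by apply/seteqP; split => x //=; [move=> _ []|move=> _; rewrite /eball/= (_ : x = 0%R) ?enorm0//; apply/rowP => -[]].
by rewrite [LHS]lam_hbox// big_ord0.
Qed.
End omega_ball.

Section balls.
Variable R : realType.
Local Open Scope ereal_scope.

Lemma measurable_cball n (c : 'rV[R]_n) (r : R) :
  measurable ([set x | enorm (x - c) <= r]%R : set (bV R n)).
Proof.
apply: closed_measurable_rV.
have -> : [set x : 'rV[R]_n | enorm (x - c) <= r]%R = (fun x => enorm (x - c)) @^-1` [set y | y <= r]%R by [].
apply: closed_comp; last exact: closed_le.
move=> x _; apply: (@enorm_lip_continuous _ _ _ 1%R) => y z; rewrite mul1r.
rewrite ler_norml; apply/andP; split.
  by have := enorm_triangle z y c; rewrite (enorm_distC z y); lra.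
by have := enorm_triangle y z c; lra.
Qed.

Lemma lam_cball n (c : 'rV[R]_n) (r : R) : (0 <= r)%R ->
  @lam R n [set x | enorm (x - c) <= r]%R = (omega R n * r ^+ n)%:E.
Proof.
rewrite le_eqVlt => /orP[/eqP <-|r0].
  have -> : [set x : 'rV[R]_n | enorm (x - c) <= 0]%R = [set c].
    apply/seteqP; split => x /= => [h|->]; last by rewrite subrr enorm0.
    apply/eqP; rewrite -subr_eq0; apply/eqP; apply: enorm_eq0. by apply/eqP; rewrite eq_le h enorm_ge0.
  case: n c => [|m] c.
    rewrite expr0 mulr1 /= (_ : [set c] = hbox 0%R 0%R) ?[LHS]lam_hbox ?big_ord0//.
    by apply/seteqP; split => x /=; [move=> _ []|move=> _; apply/rowP => -[]].
  rewrite expr0n/= mulr0. have -> : [set c] = (fun x : bV R m.+1 => (1 *: x + - c)%R) @^-1` [set 0%R].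
    apply/seteqP; split => x /=; rewrite scale1r; first by move=> ->; rewrite subrr.
    by move=> /eqP; rewrite subr_eq0 => /eqP.
  have m0 : measurable ([set 0%R] : set (bV R m.+1)).
    by rewrite -enorm_le0; apply: measurable_le_set => //; exact: measurable_enorm.
  by rewrite [LHS](@lam_affine R m.+1 1%R (- c)%R [set 0%R] (oner_neq0 _) m0) [X in _ * X]lam_set0 mule0.
have -> : [set x | (enorm (x - c) <= r)%R] = (fun x => (r^-1 *: x + - (r^-1 *: c))%R) @^-1` (@eball R n 1).
  apply/seteqP; split => x /=; rewrite /eball/= -scalerBr enormZ gtr0_norm ?invr_gt0//;
  by rewrite ler_pdivrMl ?mulr1.
rewrite [LHS]lam_affine ?invr_eq0 ?gt_eqF//; last exact: measurable_eball.
by rewrite [X in _ * X]lam_eball1 -EFinM gtr0_norm ?invr_gt0// invrK mulrC.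
Qed.

Lemma omega_gt0 n : (0 < omega R n)%R.
Proof.
have H k : (0 < omega R k)%R /\ (0 < omega R k.+1)%R.
  elim: k => [|k [h1 h2]] /=; first by split; rewrite ?ltr01 ?ltr0n. split => //; apply: mulr_gt0 => //.
  by rewrite divr_gt0// mulr_gt0// pi_gt0.
by case: (H n).
Qed.
End balls.

(** * The isodiametric inequality and the identity H^n = L^n *)

Section isodiametric.
Variables (R : realType) (n : nat).
Local Notation indic A := (fun x : 'rV[R]_n => \1_(A : set 'rV[R]_n) x : R).

Lemma plok_indic (A : set 'rV[R]_n) k : measurable (A : set (bV R n)) -> A `<=` kbox k ->
  plok (indic A) 1 k.
Proof.
move=> mA Ak; split.
- exact: measurable_indic.
- by move=> x; rewrite indicE; case: (_ \in _); rewrite ?lexx ?ler01.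
- by move=> x; rewrite indicE; case: (boolP (x \in A)) => [/set_mem /Ak//|_]; rewrite eqxx.
Qed.

Lemma logconcave_indic (A : set 'rV[R]_n) :
  (forall x y (l : R), 0 <= l <= 1 -> A x -> A y -> A ((1 - l) *: x + l *: y)) ->
  logconcave (indic A).
Proof.
move=> cA x y l l01; rewrite !indicE.
have [->|l0] := eqVneq l 0.
  by rewrite subr0 scale1r scale0r addr0 powRr0 mulr1 powRr1.
have [->|l1] := eqVneq l 1.
  by rewrite subrr scale1r scale0r add0r powRr0 mul1r powRr1.
case: (boolP (x \in A)) => [/set_mem Ax|_]; last first.
  by rewrite powR0 ?mul0r// subr_eq0 eq_sym.
case: (boolP (y \in A)) => [/set_mem Ay|_]; last by rewrite (powR0 l0) mulr0.
by rewrite mem_set ?powR1 ?mulr1//; exact: cA.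
Qed.

Lemma int_indic (A : set 'rV[R]_n) : measurable (A : set (bV R n)) ->
  (\int[@lam R n]_x (indic A x)%:E = lam A)%E.
Proof. by move=> mA; rewrite integral_indic// setIT. Qed.

(* C'' below is convex, closed, contains C and has the same diameter; Prekopa-Leindler is then
   applied to the indicators of C'', -C'' and of the ball of radius d / 2. *)
Lemma isodiametric (C : set 'rV[R]_n) (d : R) : 0 <= d ->
  (forall x y, C x -> C y -> enorm (x - y) <= d) ->
  (@lebesgue_outer R n C <= (omega R n * (d / 2) ^+ n)%:E)%E.
Proof.
move=> d0 Cd; have [->|/set0P[c0 Cc0]] := eqVneq C set0.
  by rewrite outer_measure0 lee_fin mulr_ge0 ?omega_ge0// exprn_ge0// divr_ge0.
(* [C2] is the intersection of the closed balls of radius [d] centred in [C1], hence closed and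
   convex. From C <= C2 <= C1 any two points of [C2] are at distance at most [d]. *)
pose C1 : set 'rV[R]_n := [set x | forall c, C c -> enorm (x - c) <= d].
pose C2 : set 'rV[R]_n := [set x | forall c, C1 c -> enorm (x - c) <= d].
have CC1 : C `<=` C1 by move=> x Cx c Cc; exact: Cd.
have CC2 : C `<=` C2 by move=> x Cx c C1c; rewrite enorm_distC; exact: C1c.
have C21 : C2 `<=` C1 by move=> x C2x c /CC1 ?; exact: C2x.
have C2d x y : C2 x -> C2 y -> enorm (x - y) <= d by move=> C2x /C21; exact: C2x.
have clC2 : closed C2.
  have -> : C2 = \bigcap_(c in C1) [set x | enorm (x - c) <= d].
    by apply/seteqP; split => x h c; exact: h.
  apply: closed_bigI => c _.
  have -> : [set x : 'rV[R]_n | enorm (x - c) <= d] = (fun x => enorm (x - c)) @^-1` [set y | y <= d] by [].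
  apply: closed_comp; last exact: closed_le.
  move=> x _; apply: (@enorm_lip_continuous _ _ _ 1) => y z; rewrite mul1r.
  rewrite ler_norml; apply/andP; split.
    by have := enorm_triangle z y c; rewrite (enorm_distC z y); lra.
  by have := enorm_triangle y z c; lra.
have cvx : forall x y (l : R), 0 <= l <= 1 -> C2 x -> C2 y -> C2 ((1 - l) *: x + l *: y).
  move=> x y l /andP[l0 l1] C2x C2y c C1c. have -> : (1 - l) *: x + l *: y - c = (1 - l) *: (x - c) + l *: (y - c).
    by apply/rowP => i; rewrite !mxE; ring.
  apply: le_trans (enormD _ _) _; rewrite !enormZ ger0_norm ?subr_ge0// ger0_norm//.
  have -> : d = (1 - l) * d + l * d by ring. by rewrite lerD// ler_wpM2l// ?subr_ge0// ?C2x ?C2y.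
have mC2 := closed_measurable_rV clC2.
pose k := (Num.truncn (enorm c0 + d)).+1.
have bk (x : 'rV[R]_n) : enorm x <= enorm c0 + d -> kbox k x.
  move=> xd i; rewrite !mxE. have : `|x ord0 i| < k%:R.
    by apply: le_lt_trans (coord_enorm x i) (le_lt_trans xd (truncnS_gt _)).
  by rewrite ltr_norml => /andP[/ltW -> ->].
have C2k : C2 `<=` kbox k.
  move=> x C2x; apply: bk; have := C2d _ _ C2x (CC2 _ Cc0). by have := enorm_triangle x c0 0; rewrite !subr0; lra.
pose N2 : set 'rV[R]_n := (fun x => (-1) *: x + 0) @^-1` C2.
have N2E x : N2 x = C2 (- x) by rewrite /N2 /= scaleN1r addr0.
have mN2 : measurable (N2 : set (bV R n)).
  by rewrite -[X in measurable X]setTI; apply: measurable_affine.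
have N2k : N2 `<=` kbox k.
  move=> x; rewrite N2E => C2x; apply: bk; have := C2d _ _ C2x (CC2 _ Cc0).
  by have := enorm_triangle (- x) c0 0; rewrite !subr0 enormN; lra.
have Bk : [set x : 'rV[R]_n | enorm (x - 0) <= d / 2] `<=` kbox k.
  move=> x /= h; apply: bk; rewrite subr0 in h; have := enorm_ge0 c0; lra.
have h2 : 0 < (2^-1 : R) < 1 by apply/andP; split; lra.
have lcN : logconcave (indic N2).
  apply: logconcave_indic => x y l l01; rewrite !N2E => hx hy. by rewrite opprD -!scalerN; exact: cvx.
have hB : forall x y, indic C2 x `^ (1 - 2^-1) * indic N2 y `^ 2^-1 <=
    indic [set x | enorm (x - 0) <= d / 2] ((1 - 2^-1) *: x + 2^-1 *: y).
  move=> x y; rewrite !indicE.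
  case: (boolP (x \in C2)) => [/set_mem C2x|_]; last by rewrite powR0 ?mul0r// gt_eqF//; lra.
  case: (boolP (y \in N2)) => [/set_mem|_]; last by rewrite (@powR0 _ 2^-1) ?mulr0// gt_eqF//; lra.
  rewrite N2E => C2y; rewrite mem_set ?powR1 ?mulr1//=.
  rewrite subr0 (_ : (1 - 2^-1) *: x + 2^-1 *: y = 2^-1 *: (x - - y)); last first.
    by apply/rowP => i; rewrite !mxE; field.
  by have := C2d _ _ C2x C2y; rewrite enormZ gtr0_norm; lra.
have := @prekopa_leindler R n 2^-1 1 k _ _ _ h2 (plok_indic mC2 C2k) (plok_indic mN2 N2k)
  (plok_indic (measurable_cball 0 (d / 2)) Bk) (logconcave_indic cvx) lcN hB.
rewrite !int_indic//; last exact: measurable_cball.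
rewrite lam_cball ?divr_ge0//=.
have lN : @lam R n N2 = lam C2.
  by rewrite [LHS]lam_affine// ?oppr_eq0 ?oner_eq0// normrN1 invr1 expr1n mul1e.
rewrite lN.
have fC2 : lam (C2 : set (bV R n)) \is a fin_num.
  by rewrite -int_indic//; exact: plok_fin (plok_indic mC2 C2k).
have C20 : 0 <= fine (lam (C2 : set (bV R n))) by apply: fine_ge0; exact: measure_ge0.
rewrite -powRD; last first.
  by rewrite subrK oner_eq0.
rewrite subrK powRr1// => le2.
apply: (@le_trans _ _ (lam (C2 : set (bV R n)))); first exact: le_outer_measure.
by rewrite -(fineK fC2) lee_fin.
Qed.
End isodiametric.

Section outer.
Variable R : realType.
Local Open Scope ereal_scope.

(** Countable subadditivity of [nu] reduces a comparison with a covering construction to its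
    covering sets. The map [Phi] allows covers to be transported, for instance to images of a
    Lipschitz map. *)
Lemma outer_mu_ext_le n (T : Type) (nu : {outer_measure set T -> \bar R})
    (g : set (RnD R n) -> \bar R) (Phi : set 'rV[R]_n -> set T) (c : R) :
  (forall C, 0 <= g C) -> (0 < c)%R -> (forall C, nu (Phi C) <= c%:E * g C) ->
  (forall A (F : nat -> set 'rV[R]_n), A `<=` \bigcup_k F k -> Phi A `<=` \bigcup_k Phi (F k)) ->
  forall A, nu (Phi A) <= c%:E * mu_ext g A.
Proof.
move=> g0 c0 nug cov A; rewrite -lee_pdivrMl//.
apply: le_ereal_inf_tmp => _ [F [_ AF] <-].
rewrite lee_pdivrMl//.
apply: le_trans (le_outer_measure nu _ _ (cov _ _ AF)) _.
apply: le_trans (outer_measure_sigma_subadditive nu (fun k => Phi (F k))) _.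
rewrite -nneseriesZl; last by move=> i _; exact: g0.
apply: lee_nneseries => [i _ _|i _]; first exact: outer_measure_ge0.
exact: nug.
Qed.

Lemma mu_ext_le n (g : set (RnD R n) -> \bar R) : (forall C, 0 <= g C) -> g set0 = 0 ->
  forall A, mu_ext g A <= g A.
Proof.
move=> g0 g00 A; apply: ereal_inf_lbound.
exists (fun k => if k is 0%N then A else set0).
  by split => // x Ax; exists 0%N.
rewrite nneseries_recl; [|by move=> k _; exact: g0|by []].
by rewrite eseries0 ?adde0// => -[]//.
Qed.

HB.instance Definition _ n (s : nat) (d : R) :=
  isOuterMeasure.Build R (RnD R n) (hausdorff_delta s d)
  (mu_ext0 (@haus_gauge0 R n s d) (@haus_gauge_ge0 R n s d)) (mu_ext_ge0 (@haus_gauge_ge0 R n s d))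
  (le_mu_ext (haus_gauge s d)) (mu_ext_sigma_subadditive (@haus_gauge_ge0 R n s d)).

Lemma ediam_leP n (C : set 'rV[R]_n) (d : R) :
  reflect (forall x y, C x -> C y -> (enorm (x - y) <= d)%R) (ediam C <= d%:E).
Proof.
apply: (iffP idP) => [h x y Cx Cy|h].
  rewrite -lee_fin; apply: le_trans h; apply: ereal_sup_ubound. by exists x => //; exists y.
by apply: ge_ereal_sup => _ [x Cx [y Cy <-]]; rewrite lee_fin; exact: h.
Qed.

Lemma ediam_fin n (C : set 'rV[R]_n) (d : R) : C !=set0 -> ediam C <= d%:E ->
  exists2 r : R, (0 <= r <= d)%R & ediam C = r%:E.
Proof.
move=> C0 Cd; have := ediam_ge0 C0.
move: Cd; case: (ediam C) => [r| |]//; rewrite !lee_fin => rd r0.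
by exists r => //; apply/andP.
Qed.

Lemma haus_gauge_le n s (d r : R) (C : set 'rV[R]_n) : (0 <= r <= d)%R ->
  (forall x y, C x -> C y -> (enorm (x - y) <= r)%R) ->
  haus_gauge s d C <= (omega R s * (r / 2) ^+ s)%:E.
Proof.
move=> /andP[r0 rd] h; rewrite /haus_gauge; case: asboolP => [_|/eqP/set0P C0].
  by rewrite lee_fin mulr_ge0 ?omega_ge0// exprn_ge0// divr_ge0.
have /ediam_leP Cr := h.
have [r' /andP[r'0 r'r] e] := ediam_fin C0 Cr.
rewrite e lee_fin (le_trans r'r rd)/= lee_fin ler_wpM2l ?omega_ge0//.
by rewrite lerXn2r ?nnegrE ?divr_ge0// ler_pM2r.
Qed.

Lemma le_hausdorff_delta n s (d d' : R) (A : set (RnD R n)) : (d <= d')%R ->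
  hausdorff_delta s d' A <= hausdorff_delta s d A.
Proof.
move=> dd'; rewrite -[leRHS]mul1e.
apply: (outer_mu_ext_le (nu := [the {outer_measure set _ -> \bar R} of hausdorff_delta s d']) (Phi := id)) => //.
  exact: haus_gauge_ge0.
move=> C; rewrite mul1e; apply: le_trans (mu_ext_le (@haus_gauge_ge0 _ _ s d') (@haus_gauge0 R _ s d') _) _.
rewrite /haus_gauge; case: asboolP => // _.
case: ifPn => // [Cd'|/negP nCd']; first by case: ifPn => // _; rewrite leey.
case: ifPn => // Cd; exfalso; apply: nCd'; apply: le_trans Cd _; by rewrite lee_fin.
Qed.

Lemma hausdorff_delta_le n s (d : R) (A : set (RnD R n)) : (0 < d)%R ->
  hausdorff_delta s d A <= hausdorff_outer s A.
Proof. by move=> d0; apply: ereal_sup_ubound; exists d. Qed.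

Lemma lebesgue_le_hausdorff n (A : set (RnD R n)) : lebesgue_outer A <= hausdorff_outer n A.
Proof.
apply: (le_trans _ (hausdorff_delta_le _ _ ltr01)).
rewrite -[leRHS]mul1e.
apply: (outer_mu_ext_le (nu := [the {outer_measure set _ -> \bar R} of @lebesgue_outer R n]) (Phi := id)) => //.
  exact: haus_gauge_ge0.
move=> C; rewrite mul1e /haus_gauge; case: asboolP => [->|/eqP/set0P C0].
  by rewrite outer_measure0.
case: ifPn => [C1|_]; last by rewrite leey.
have [r /andP[r0 _] e] := ediam_fin C0 C1.
rewrite e/=; apply: isodiametric => //; apply/ediam_leP.
by rewrite e.
Qed.

(** The Lipschitz bound holds on [E] only, so each covering set is cut down to [E] before its image
    is taken. Covers of mesh [d / l] become covers of mesh [d]. *)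
Lemma hausdorff_lipschitz n m s (T : 'rV[R]_n -> 'rV[R]_m) (E : set 'rV[R]_n) (l : R) : (0 < l)%R ->
  (forall x y, E x -> E y -> (enorm (T x - T y) <= l * enorm (x - y))%R) ->
  hausdorff_outer s (T @` E) <= (l ^+ s)%:E * hausdorff_outer s E.
Proof.
move=> l0 TE; apply: ge_ereal_sup => _ [d d0 <-].
have dl : (0 < d / l)%R by rewrite divr_gt0.
apply: (@le_trans _ _ ((l ^+ s)%:E * hausdorff_delta s (d / l) E)); last first.
  by rewrite lee_pmul2l// ?lte_fin ?exprn_gt0// hausdorff_delta_le.
have := @outer_mu_ext_le n _ [the {outer_measure set _ -> \bar R} of @hausdorff_delta R m s d]
   (haus_gauge s (d / l)) (fun C => T @` (C `&` E)) (l ^+ s).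
move=> /(_ _ _ _ _ E); rewrite setIid; apply.
- exact: haus_gauge_ge0.
- by rewrite exprn_gt0.
- move=> C; have [CE|/set0P[x0 [Cx0 Ex0]]] := eqVneq (C `&` E) set0.
    rewrite CE image_set0 outer_measure0 mule_ge0 ?haus_gauge_ge0//. by rewrite lee_fin exprn_ge0// ltW.
  rewrite /haus_gauge; case: asboolP => [C0|_]; first by rewrite C0 in Cx0.
  case: ifPn => [Cd|_]; last by rewrite gt0_muley ?leey// lte_fin exprn_gt0.
  have [|r /andP[r0 rd] e] := ediam_fin _ Cd; first by exists x0.
  apply: le_trans (mu_ext_le (@haus_gauge_ge0 _ _ s d) (@haus_gauge0 R _ s d) _) _.
  have lr : (0 <= l * r <= d)%R by rewrite mulr_ge0 ?(ltW l0)//= mulrC -ler_pdivlMr.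
  apply: le_trans (haus_gauge_le s lr _) _.
    move=> _ _ [x [Cx Ex] <-] [y [Cy Ey] <-]. apply: le_trans (TE _ _ Ex Ey) _; rewrite ler_pM2l//.
    by move: x y Cx Cy {Ex Ey}; apply/ediam_leP; rewrite e.
  by rewrite e/= -EFinM lee_fin -mulrA exprMn mulrCA.
- by move=> A F AF _ [x [/AF[k _ Fx] Ex] <-]; exists k => //; exists x.
Qed.

End outer.

Section haus_le_leb.
Variables (R : realType) (n : nat).
Local Open Scope ereal_scope.
Implicit Types (a b : 'rV[R]_n).

Lemma outer_bigsetU (T : Type) (mu : {outer_measure set T -> \bar R}) (I : Type) (r : seq I)
    (P : pred I) (F : I -> set T) :
  mu (\big[setU/set0]_(i <- r | P i) F i) <= \sum_(i <- r | P i) mu (F i).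
Proof.
elim: r => [|i r IH]; first by rewrite !big_nil outer_measure0.
rewrite !big_cons; case: (P i) => //.
by apply: le_trans (outer_measureU2 _ _ _) _; rewrite leeD2l.
Qed.

Definition cube a (s : R) := hbox a (a + const_mx s)%R.

(** The diameter of a cube of side [s] is bounded crudely by [s * n.+1%:R]. The resulting constant
    is just a starting point for the contraction in [hausdorff_lebesgue]. *)
Lemma cube_le (d s : R) a : (0 < s)%R -> (s * n.+1%:R <= d)%R ->
  hausdorff_delta n d (cube a s) <= (omega R n * (n.+1%:R / 2) ^+ n * s ^+ n)%:E.
Proof.
move=> s0 sd.
apply: le_trans (mu_ext_le (@haus_gauge_ge0 _ _ n d) (@haus_gauge0 R _ n d) _) _.
have h : (0 <= s * n.+1%:R <= d)%R by rewrite sd mulr_ge0// ltW.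
apply: le_trans (haus_gauge_le n h _) _; last first.
  by rewrite lee_fin (mulrC s) mulrAC exprMn mulrA.
move=> x y xQ yQ; apply: le_trans (enorm_le_coord (ltW s0) _) _.
  move=> i; have := xQ i; have := yQ i; rewrite !mxE ler_norml; lra.
rewrite mulrC ler_pM2l//.
rewrite -[leRHS]ger0_norm// -sqrtr_sqr ler_wsqrtr// -natrX ler_nat.
by rewrite expnS expn1 -{1}(mul1n n) leq_mul.
Qed.

Lemma sum_grid_le (w s : R) M : (0 <= w)%R -> (0 < s)%R ->
  (\sum_(k < M) (if k%:R * s < w then s else 0) <= w + s)%R.
Proof.
move=> w0 s0; suff : (\sum_(k < M) (if k%:R * s < w then s else 0) <= w + s /\
   \sum_(k < M) (if k%:R * s < w then s else 0) <= M%:R * s)%R by case.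
elim: M => [|M [IH1 IH2]]; first by rewrite big_ord0; split; lra.
rewrite big_ord_recr/= -natr1; case: ifPn => h; last by rewrite addr0; split => //; lra.
by split; lra.
Qed.

(** A bound linear in [s], in place of continuity of the product. It serves for boxes enlarged by a
    grid step and, with all factors 1, for powers of 1 + s. *)
Lemma prod_shift_le (I : Type) (r : seq I) (w : I -> R) : (forall i, 0 <= w i)%R ->
  exists2 K : R, (0 <= K)%R &
  forall s : R, (0 <= s <= 1)%R -> (\prod_(i <- r) (w i + s) <= \prod_(i <- r) w i + s * K)%R.
Proof.
move=> w0; elim: r => [|i r [K K0 IH]].
  by exists 0%R => // s _; rewrite !big_nil mulr0 addr0.
exists (w i * K + \prod_(i <- r) w i + K)%R.
  by rewrite !addr_ge0 ?mulr_ge0// prodr_ge0.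
move=> s s01; rewrite !big_cons; have /andP[s0 s1] := s01.
apply: (@le_trans _ _ ((w i + s) * (\prod_(i <- r) w i + s * K))%R).
  by apply: ler_wpM2l; [rewrite addr_ge0|exact: IH].
have := w0 i; set P := (\prod_(_ <- _) _)%R => wi.
have : (s * (s * K) <= s * K)%R by rewrite ler_piMl ?mulr_ge0.
nra.
Qed.

(** The box is covered by those cells of a grid of step [s] that start inside it. Their total volume
    is at most the product of the sides each enlarged by [s], and [s] tends to 0. *)
Lemma box_of_cubes (mu : {outer_measure set (RnD R n) -> \bar R}) (c s0 : R) : (0 < c)%R -> (0 < s0)%R ->
  (forall a s, (0 < s <= s0)%R -> mu (cube a s) <= (c * s ^+ n)%:E) ->
  forall a b, (forall i, a ord0 i <= b ord0 i)%R ->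
  mu (hbox a b) <= (c * \prod_(i < n) (b ord0 i - a ord0 i))%:E.
Proof.
move=> c0 s00 hc a b ab; pose w i := (b ord0 i - a ord0 i)%R.
have w0 i : (0 <= w i)%R by rewrite subr_ge0.
have step (s : R) : (0 < s <= s0)%R -> mu (hbox a b) <= (c * \prod_(i < n) (w i + s))%:E.
  move=> ss; have /andP[sp _] := ss. pose M := (\max_(i < n) Num.truncn (w i / s)).+1.
  pose Q (z : {ffun 'I_n -> 'I_M}) := cube (\row_i (a ord0 i + (z i)%:R * s))%R s.
  pose P (z : {ffun 'I_n -> 'I_M}) := [forall i, ((z i)%:R * s < w i)%R].
  apply: (@le_trans _ _ (mu (\big[setU/set0]_(z | P z) Q z))).
    apply: le_outer_measure => x xab; rewrite -bigcup_seq_cond.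
    have tr i : ((Num.truncn ((x ord0 i - a ord0 i) / s))%:R * s <= x ord0 i - a ord0 i <
                 (Num.truncn ((x ord0 i - a ord0 i) / s))%:R * s + s)%R.
      have h : (0 <= (x ord0 i - a ord0 i) / s)%R.
        by rewrite divr_ge0 ?(ltW sp)// subr_ge0; case/andP: (xab i).
      have := truncn_itv h; rewrite -natr1 -ler_pdivlMr// => /andP[-> /=]. by rewrite ltr_pdivrMr// mulrDl mul1r.
    have trM i : (Num.truncn ((x ord0 i - a ord0 i) / s) < M)%N.
      rewrite ltnS; apply: leq_trans (leq_bigmax i); apply: le_truncn.
      rewrite ler_pM2r ?invr_gt0// lerD2r; case/andP: (xab i) => _ /ltW//.
    exists [ffun i => Ordinal (trM i)].
      apply/andP; split; first by rewrite mem_index_enum.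
      apply/forallP => i; rewrite ffunE/=; apply: le_lt_trans (andP (tr i)).1 _.
      by rewrite ltrD2r; case/andP: (xab i).
    by move=> i; rewrite !mxE ffunE/=; have := tr i; lra.
  apply: le_trans (outer_bigsetU _ _ _ _) _.
  apply: (@le_trans _ _ (\sum_(z : {ffun 'I_n -> 'I_M} | P z) (c * s ^+ n)%:E)).
    by apply: lee_sum => z _; exact: hc.
  rewrite sumEFin lee_fin -mulr_sumr ler_pM2l//.
  apply: (@le_trans _ _ (\prod_(i < n) \sum_(k < M) (if k%:R * s < w i then s else 0))%R); last first.
    apply: ler_prod => i _; rewrite sum_grid_le// sumr_ge0// => k _. by case: ifP => // _; exact: ltW.
  rewrite bigA_distr_bigA/= [leLHS]big_mkcond/=; apply: ler_sum => z _. case: ifPn => [/forallP Pz|_].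
    rewrite (eq_bigr (fun _ => s)) => [|i _]; last by rewrite Pz. by rewrite prodr_const card_ord.
  by apply: prodr_ge0 => i _; case: ifP => // _; exact: ltW.
have [K K0 hK] := prod_shift_le (index_enum 'I_n) w0.
apply/lee_addgt0Pr => e e0.
pose s := Num.min s0 (Num.min 1 (e / (c * (K + 1))))%R.
have cK : (0 < c * (K + 1))%R by rewrite mulr_gt0// ltr_wpDl.
have sp : (0 < s)%R by rewrite !lt_min s00 ltr01 divr_gt0.
have ss : (0 < s <= s0)%R by rewrite sp ge_min lexx.
apply: le_trans (step s ss) _.
have s1 : (0 <= s <= 1)%R by rewrite (ltW sp) !ge_min lexx/= orbT.
rewrite -EFinD lee_fin; have := hK s s1 => h.
apply: le_trans (ler_wpM2l (ltW c0) h) _; rewrite mulrDr lerD2l.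
have : (s <= e / (c * (K + 1)))%R by rewrite !ge_min lexx !orbT.
by rewrite ler_pdivlMr//; nra.
Qed.

Lemma outer_le_leb (mu : {outer_measure set (RnD R n) -> \bar R}) (c s0 : R) : (0 < c)%R -> (0 < s0)%R ->
  (forall a s, (0 < s <= s0)%R -> mu (cube a s) <= (c * s ^+ n)%:E) ->
  forall A, mu A <= c%:E * lebesgue_outer A.
Proof.
move=> c0 s00 hc A.
apply: (outer_mu_ext_le (Phi := id)) => //; first exact: box_gauge_ge0.
move=> C; rewrite -lee_pdivrMl//; apply: le_ereal_inf_tmp => v; rewrite lee_pdivrMl//.
move=> [[-> ->]|[a [b [ab [-> ->]]]]]; first by rewrite outer_measure0 mule0.
by rewrite -EFinM; exact: box_of_cubes hc _ _ ab.
Qed.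

Lemma mxE_cube a s i : ((a + const_mx s) ord0 i = a ord0 i + s)%R.
Proof. by rewrite !mxE. Qed.

Lemma lam_cube a s : (0 <= s)%R -> @lam R n (cube a s) = (s ^+ n)%:E.
Proof.
move=> s0; rewrite [LHS]lam_hbox; last by move=> i; rewrite mxE_cube; lra.
congr EFin; rewrite (eq_bigr (fun _ => s)) => [|i _]; last by rewrite mxE_cube; lra.
by rewrite prodr_const card_ord.
Qed.

(* Every small cube contains a ball filling a fixed proportion [th] of it, on which
   the gauge gives the exact volume: this contracts the excess of [c] over 1. *)
Lemma hausdorff_improve (d c : R) : (0 < d)%R -> (0 < c)%R ->
  (forall A, hausdorff_delta n d A <= c%:E * @lebesgue_outer R n A) ->
  let th := (omega R n / 4%:R ^+ n)%R in
  forall A, hausdorff_delta n d A <= (th + c * (1 - th))%:E * @lebesgue_outer R n A.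
Proof.
move=> d0 c0 hc th.
have th0 : (0 < th)%R by rewrite divr_gt0 ?omega_gt0 ?exprn_gt0.
pose B a s : set 'rV[R]_n := [set x | enorm (x - (a + const_mx (s / 2))) <= s / 4%:R]%R.
have BQ a s : (0 < s)%R -> B a s `<=` cube a s.
  move=> s0 x Bx i; have := le_trans (coord_enorm _ i) Bx. by rewrite !mxE ler_norml; lra.
have lB a s : (0 < s)%R -> @lam R n (B a s) = (th * s ^+ n)%:E.
  move=> s0; rewrite [LHS]lam_cball; last by rewrite divr_ge0// ltW.
  by congr EFin; rewrite /th expr_div_n mulrA mulrAC.
have th1 : (th <= 1)%R.
  have : @lam R n (B 0%R 1%R) <= lam (cube 0%R 1%R).
    by apply: le_measure; rewrite ?inE; [exact: measurable_cball|exact: measurable_hbox|exact: BQ].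
  by rewrite lB// [X in _ <= X]lam_cube// lee_fin !expr1n mulr1.
have c'0 : (0 < th + c * (1 - th))%R by rewrite ltr_wpDr// mulr_ge0 ?(ltW c0)//; lra.
pose s0 := (d / n.+1%:R)%R.
have s00 : (0 < s0)%R by rewrite divr_gt0.
apply: (@outer_le_leb _ _ s0) => // a s /andP[sp ss0].
have sd : (s <= d)%R.
  apply: le_trans ss0 _; rewrite ler_pdivrMr// ler_peMr ?(ltW d0)//. by rewrite ler1n.
have mB := measurable_cball (a + const_mx (s / 2))%R (s / 4%:R)%R.
rewrite -(@setDUK _ (B a s) (cube a s)); last exact: BQ.
apply: le_trans (outer_measureU2 _ _ _) _.
rewrite (_ : (_ * s ^+ n)%:E = (th * s ^+ n)%:E + c%:E * (s ^+ n - th * s ^+ n)%:E); last first.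
  by rewrite -EFinM -EFinD; congr EFin; ring.
apply: leeD.
  apply: le_trans (mu_ext_le (@haus_gauge_ge0 _ _ n d) (@haus_gauge0 R _ n d) _) _.
  have h : (0 <= s / 2 <= d)%R by apply/andP; split; lra. apply: le_trans (haus_gauge_le n h _) _.
    move=> x y Bx By; have := enorm_triangle x (a + const_mx (s / 2))%R y.
    by move: Bx By; rewrite /B/= (enorm_distC y); lra.
  rewrite lee_fin /th (_ : s / 2 / 2 = s / 4%:R)%R; last by field. by rewrite expr_div_n mulrA mulrAC.
apply: le_trans (hc _) _; rewrite lee_pmul2l// ?lte_fin//.
have -> : lebesgue_outer (cube a s `\` B a s) = @lam R n (cube a s `\` B a s) by [].
rewrite [leLHS]measureD//=; [|exact: measurable_hbox|].
  rewrite [X in X - _]lam_cube ?(ltW sp)// setIidr; last exact: BQ. by rewrite [X in _ - X]lB.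
by rewrite [ltLHS]lam_cube ?(ltW sp)// ltry.
Qed.

(** For a fixed mesh [d], let c >= 1 be the best constant comparing the premeasure with Lebesgue
    measure; it is finite by the estimate on cubes and it is attained. [hausdorff_improve] replaces
    c by a strictly smaller constant as long as c > 1, so c = 1. *)
Lemma hausdorff_lebesgue (A : set (RnD R n)) : hausdorff_outer n A = lebesgue_outer A.
Proof.
apply/eqP; rewrite eq_le lebesgue_le_hausdorff andbT.
apply: ge_ereal_sup => _ [d d0 <-].
pose th := (omega R n / 4%:R ^+ n)%R.
have th0 : (0 < th)%R by rewrite divr_gt0 ?omega_gt0 ?exprn_gt0.
pose S := [set c : R | (1 <= c)%R /\ forall A, hausdorff_delta n d A <= c%:E * @lebesgue_outer R n A].
have S0 : S !=set0.
  pose c := Num.max 1%R (omega R n * (n.+1%:R / 2) ^+ n)%R. have c0 : (0 < c)%R by rewrite lt_max ltr01.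
  exists c; split; first by rewrite le_max lexx.
  apply: (@outer_le_leb _ _ (d / n.+1%:R)%R) => //; first by rewrite divr_gt0.
  move=> a s /andP[s0 sd]; apply: le_trans (cube_le _ s0 _) _.
    by rewrite -ler_pdivlMr.
  by rewrite lee_fin ler_wpM2r ?exprn_ge0 ?(ltW s0)// le_max lexx orbT.
have Slb : has_lbound S by exists 1%R => c [].
have i1 : (1 <= inf S)%R by apply: lb_le_inf => // c [].
have iS : S (inf S).
  split => // B; have i0 : (0 < inf S)%R by apply: lt_le_trans i1.
  have hS c : S c -> hausdorff_delta n d B <= c%:E * @lebesgue_outer R n B by case.
  have : 0 <= hausdorff_delta n d B := outer_measure_ge0 (@hausdorff_delta R n n d) B.
  have : 0 <= lebesgue_outer B := outer_measure_ge0 (@lebesgue_outer R n) B.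
  move: hS; case: (lebesgue_outer B) => [l| |]; last 2 first.
  - by rewrite gt0_muley ?leey.
  - by [].
  move=> hS; rewrite lee_fin => l0. have [c0 Sc0] := S0; have := hS _ Sc0.
  move: hS; case: (hausdorff_delta n d B) => [h| |]//= hS _ _.
  have {}hS c : S c -> (h <= c * l)%R by move/hS; rewrite -EFinM lee_fin.
  rewrite -EFinM lee_fin; move: l0; rewrite le_eqVlt => /orP[/eqP l0|l0].
    by rewrite -l0 mulr0; have := hS _ Sc0; rewrite -l0 mulr0.
  rewrite -ler_pdivrMr//; apply: lb_le_inf => // c /hS. by rewrite ler_pdivrMr.
have [m1|m1] := leP (inf S) 1%R.
  by have [_ /(_ A)] := iS; rewrite (_ : inf S = 1%R) ?mul1e//; apply/eqP; rewrite eq_le m1.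
have [_ hm] := iS; have := hausdorff_improve d0 (lt_trans ltr01 m1) hm.
rewrite /= -/th => hc'.
(* The maximum keeps the constant in [S], whose members are at least 1. Both of its arguments lie
   strictly below [inf S], a contradiction. *)
have Sc : S (Num.max 1 (th + inf S * (1 - th)))%R.
  split => [|B]; first by rewrite le_max lexx.
  apply: le_trans (hc' B) _; apply: lee_wpmul2r; first exact: outer_measure_ge0. by rewrite lee_fin le_max lexx orbT.
have := ge_inf Slb Sc; rewrite le_max => /orP[h|h]; exfalso; first lra.
nra.
Qed.

End haus_le_leb.

(** * Borel sets are Caratheodory measurable for Hausdorff measure *)

Section hausdorff_borel.
Variables (R : realType) (n s : nat).
Local Open Scope ereal_scope.
Implicit Types A B : set 'rV[R]_n.

(* For d < e a set of diameter <= d cannot meet both A and B, so that every cover of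
   the union splits into a cover of A and a cover of B. *)
Lemma hausdorff_separated A B (e : R) : (0 < e)%R ->
  (forall x y, A x -> B y -> (e <= enorm (x - y))%R) ->
  hausdorff_outer s A + hausdorff_outer s B <= hausdorff_outer s (A `|` B).
Proof.
move=> e0 AB.
have step (d : R) : (0 < d < e)%R -> hausdorff_delta s d A + hausdorff_delta s d B <= hausdorff_delta s d (A `|` B).
  move=> /andP[d0 de]; apply: le_ereal_inf_tmp => _ [F [_ ABF] <-].
  pose G (C : set 'rV[R]_n) k := if `[< F k `&` C !=set0 >] then F k else set0.
  have covG C : C `<=` A `|` B -> hausdorff_delta s d C <= \big[+%E/0]_(0 <= k <oo) haus_gauge s d (G C k).
    move=> CAB; apply: ereal_inf_lbound; exists (G C) => //; split => // x Cx.
    have [k _ Fx] := ABF _ (CAB _ Cx); exists k => //. by rewrite /G asboolT//; exists x.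
  apply: le_trans (leeD (covG A (@subsetUl _ _ _)) (covG B (@subsetUr _ _ _))) _.
  rewrite -nneseriesD; try by move=> i _ _; exact: haus_gauge_ge0.
  apply: lee_nneseries => [i _ _|i _]; first by rewrite adde_ge0// haus_gauge_ge0.
  rewrite /G; case: asboolP => [[x [Fx Ax]]|_]; last first.
    by rewrite haus_gauge0 add0e; case: asboolP => // _; rewrite haus_gauge0 haus_gauge_ge0.
  case: asboolP => [[y [Fy By]]|_]; last by rewrite haus_gauge0 adde0.
  rewrite [leRHS]/haus_gauge; case: asboolP => [F0|_]; first by rewrite F0 in Fx.
  case: ifPn => [/ediam_leP /(_ x y Fx Fy)|_]; last by rewrite leey. by have := AB _ _ Ax By => h1 h2; exfalso; lra.
have ge0 (C : set 'rV[R]_n) d : 0 <= hausdorff_delta s d C := hausdorff_delta_ge0 s d C.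
have bnd d d' : (0 < d)%R -> (0 < d')%R ->
    hausdorff_delta s d A + hausdorff_delta s d' B <= hausdorff_outer s (A `|` B).
  move=> d0 d'0; pose d1 : R := Num.min (e / 2)%R (Num.min d d').
  have d10 : (0 < d1)%R by rewrite !lt_min d0 d'0 divr_gt0. apply: le_trans (hausdorff_delta_le _ _ d10).
  apply: (le_trans (leeD (@le_hausdorff_delta _ _ _ d1 d _ _) (@le_hausdorff_delta _ _ _ d1 d' _ _))).
  - by rewrite !ge_min lexx orbT.
  - by rewrite !ge_min lexx !orbT.
  apply: step; rewrite d10/= gt_min; apply/orP; left; lra.
have [->|HA] := eqVneq (hausdorff_outer s (A `|` B)) +oo; first by rewrite leey.
have fin C : C `<=` A `|` B -> hausdorff_outer s C \is a fin_num.
  move=> /(@le_hausdorff_outer R n s) h; rewrite ge0_fin_numE ?hausdorff_outer_ge0//.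
  by apply: le_lt_trans h _; rewrite lt_neqAle HA leey.
rewrite -leeBrDr ?fin//; apply: ge_ereal_sup => _ [d d0 <-].
have dA : hausdorff_delta s d A \is a fin_num.
  rewrite ge0_fin_numE//; apply: (@le_lt_trans _ _ (hausdorff_outer s A)).
    exact: hausdorff_delta_le.
  by rewrite -ge0_fin_numE ?hausdorff_outer_ge0 ?fin.
rewrite leeBrDr ?fin// addeC -leeBrDr//; apply: ge_ereal_sup => _ [d' d'0 <-].
by rewrite leeBrDr// addeC; exact: bnd.
Qed.

Lemma hausdorff_separated_big (D : nat -> set 'rV[R]_n) :
  (forall i, exists2 e : R, (0 < e)%R & forall x y j, (j > i)%N -> D i x -> D j y -> (e <= enorm (x - y))%R) ->
  \sum_(0 <= i <oo) hausdorff_outer s (D i) <= hausdorff_outer s (\bigcup_i D i).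
Proof.
move=> sep; apply: lime_le; first by apply: is_cvg_nneseries => i _ _; exact: hausdorff_outer_ge0.
apply: nearW => N; rewrite big_mkord.
suff H m : (m <= N)%N -> \sum_(i < m) hausdorff_outer s (D (N - m + i)%N) <= hausdorff_outer s (\bigcup_(i in [set k | N - m <= k]%N) D i).
  have := H N (leqnn N); rewrite subnn => h; apply: le_trans h _.
  by apply: le_hausdorff_outer => x [i _ Dx]; exists i.
elim: m => [|m IH] mN; first by rewrite big_ord0 hausdorff_outer_ge0.
rewrite big_ord_recl addn0.
have e1 i : (N - m.+1 + bump 0 i = N - m + i)%N by rewrite /bump leq0n add1n addnS -addSn subnSK.
under eq_bigr do rewrite /= e1.
apply: le_trans (leeD2l _ (IH (ltnW mN))) _.
have [e e0 he] := sep (N - m.+1)%N.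
apply: le_trans (hausdorff_separated e0 _) _.
  by move=> x y Dx [j /= jN Dy]; apply: (he x y j) => //; rewrite subnSK in jN *.
apply: le_hausdorff_outer => x [Dx|[i /= iN Dx]]; first by exists (N - m.+1)%N => /=.
by exists i => //=; apply: leq_trans iN; rewrite leq_sub2l.
Qed.

Lemma nneseries_even_odd (u : nat -> \bar R) : (forall i, 0 <= u i) ->
  \sum_(0 <= i <oo) u i <= \sum_(0 <= i <oo) u i.*2 + \sum_(0 <= i <oo) u i.*2.+1.
Proof.
move=> u0; apply: lime_le; first by apply: is_cvg_nneseries.
apply: nearW => N; rewrite -nneseriesD//.
apply: (@le_trans _ _ (\sum_(0 <= i < N) (u i.*2 + u i.*2.+1))); last first.
  by apply: nneseries_lim_ge => i _ _; exact: adde_ge0.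
apply: (@le_trans _ _ (\sum_(0 <= i < N.*2) u i)).
  by apply: lee_sum_nneg_natr => //; rewrite -addnn leq_addr.
elim: N => [|N IH]; first by rewrite !big_nil.
by rewrite doubleS !big_nat_recr//= -addeA leeD2r.
Qed.

(** The Caratheodory criterion for metric outer measures. The slabs [D k] approach the hyperplane;
    slabs of the same parity are at positive distance from each other, so the sum of all measures is
    finite and its tail tends to 0. Up to this tail, [X] is cut into two separated pieces [Y k] and
    X minus H. *)
Lemma hausdorff_halfspace (j : 'I_n) (c : R) :
  (@hausdorff_outer R n s).-caratheodory [set x | x ord0 j < c]%R.
Proof.
apply: le_caratheodory_measurable => X; pose H := [set x : 'rV[R]_n | x ord0 j < c]%R.
suff : hausdorff_outer s (X `&` H) + hausdorff_outer s (X `&` ~` H) <= hausdorff_outer s X by [].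
have [XE|XE] := eqVneq (hausdorff_outer s X) +oo; first by rewrite XE leey.
pose q k : R := (c - k.+1%:R^-1)%R.
have q_lt k l : (k < l)%N -> (q k < q l)%R.
  by move=> kl; rewrite /q ltrD2l ltrN2 ltf_pV2 ?posrE ?ltr0n// ltr_nat.
have q_le k l : (k <= l)%N -> (q k <= q l)%R.
  by move=> kl; rewrite /q lerD2l lerN2 lef_pV2 ?posrE ?ltr0n// ler_nat.
pose Y k : set 'rV[R]_n := X `&` [set x | x ord0 j <= q k]%R.
pose D k : set 'rV[R]_n := X `&` [set x | q k < x ord0 j <= q k.+1]%R.
have sepD k l (x y : 'rV[R]_n) : (k.+1 < l)%N -> D k x -> D l y ->
    (q k.+2 - q k.+1 <= enorm (x - y))%R.
  move=> kl [_ /andP[_ xk]] [_ /andP[yl _]].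
  apply: le_trans (coord_enorm _ j); rewrite !mxE distrC; apply: le_trans (ler_norm _). have := q_le _ _ kl; lra.
have q2 k : (0 < q k.+2 - q k.+1)%R by rewrite subr_gt0 q_lt.
have bndD r : (r <= 1)%N -> \sum_(0 <= i <oo) hausdorff_outer s (D (i.*2 + r)%N) <= hausdorff_outer s X.
  move=> r1; apply: le_trans (hausdorff_separated_big (D := fun i => D (i.*2 + r)%N) _) _.
    move=> i; exists (q (i.*2 + r).+2 - q (i.*2 + r).+1)%R => // x y k ik.
    by apply: sepD; rewrite -!addSn leq_add2r -doubleS leq_double.
  by apply: le_hausdorff_outer => x [i _ []].
have XF : hausdorff_outer s X < +oo by rewrite lt_neqAle XE leey.
have sumD : \sum_(0 <= i <oo) hausdorff_outer s (D i) < +oo.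
  apply: le_lt_trans (nneseries_even_odd _) _; first by move=> i; exact: hausdorff_outer_ge0. apply: lte_add_pinfty.
    apply: le_lt_trans XF; have := bndD 0%N isT. by under eq_eseriesr do rewrite addn0.
  apply: le_lt_trans XF; have := bndD 1%N isT. by under eq_eseriesr do rewrite addn1.
have XH k : hausdorff_outer s (X `&` H) <= hausdorff_outer s (Y k) + \sum_(k <= i <oo) hausdorff_outer s (D i).
  rewrite -nneseries_addn; last by move=> i; exact: hausdorff_outer_ge0.
  apply: le_trans (leeD2l _ (@hausdorff_outer_sigma_subadditive R n s (fun i => D (i + k)%N))).
  apply: le_trans (outer_measureU2 (@hausdorff_outer R n s) _ _). apply: le_hausdorff_outer => x [Xx Hx].
  have [xk|kx] := leP (x ord0 j) (q k); first by left. right. have ex : exists i, (x ord0 j <= q i)%R.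
    have h : (0 < c - x ord0 j)%R by rewrite subr_gt0. exists (Num.truncn (c - x ord0 j)^-1).
    have := truncnS_gt (c - x ord0 j)^-1; rewrite /q => h1.
    have : ((Num.truncn (c - x ord0 j)^-1).+1%:R^-1 <= c - x ord0 j)%R.
      by rewrite -[leRHS]invrK lef_pV2 ?posrE ?invr_gt0 ?ltr0n// ltW.
    by move=> h2; rewrite lerBrDr addrC -lerBrDr.
  have := ex_minnP ex; case=> -[|i] xi mini.
    by have := q_le 0%N k (leq0n _); lra.
  have ki : (k <= i)%N.
    rewrite leqNgt; apply/negP => ik; have := q_le _ _ ik; lra.
  exists (i - k)%N => //; rewrite subnK//; split => //=; rewrite xi andbT ltNge. by apply/negP => /mini; rewrite ltnn.
have YH k : hausdorff_outer s (Y k) + hausdorff_outer s (X `&` ~` H) <= hausdorff_outer s X.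
  have qc : (0 < c - q k)%R by rewrite /q opprB addrC subrK invr_gt0. apply: le_trans (hausdorff_separated qc _) _.
    move=> x y [_ /= xq] [_ /negP]; rewrite -leNgt => cy.
    apply: le_trans (coord_enorm _ j); rewrite !mxE distrC; apply: le_trans (ler_norm _); lra.
  by apply: le_hausdorff_outer => x [] [].
have XHc : hausdorff_outer s (X `&` ~` H) \is a fin_num.
  rewrite ge0_fin_numE ?hausdorff_outer_ge0//; apply: le_lt_trans XF. by apply: le_hausdorff_outer => x [].
have key k : hausdorff_outer s (X `&` H) + hausdorff_outer s (X `&` ~` H) <=
    hausdorff_outer s X + \sum_(k <= i <oo) hausdorff_outer s (D i).
  apply: le_trans (leeD2r _ (XH k)) _. by rewrite addeAC; apply: leeD2r; exact: YH.
have : hausdorff_outer s X + \sum_(k <= i <oo) hausdorff_outer s (D i) @[k --> \oo] --> hausdorff_outer s X + 0.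
  apply: cvgeD; [|exact: cvg_cst|].
    by rewrite ge0_adde_def// inE ?hausdorff_outer_ge0.
  by apply: nneseries_tail_cvg => // i _; exact: hausdorff_outer_ge0.
rewrite adde0 => cv; rewrite -(cvg_lim _ cv)//.
apply: lime_ge; first by apply/cvg_ex; eexists; exact: cv.
by apply: nearW => k; exact: key.
Qed.

Lemma borel_hausdorff_caratheodory (A : set (bV R n)) : measurable A ->
  (@hausdorff_outer R n s).-caratheodory A.
Proof.
pose M := caratheodory_type (@hausdorff_outer R n s).
have idm : measurable_fun [set: M] (id : M -> bV R n).
  apply: measurable_bVP => j.
  apply: (measurability _ (RGenInftyO.measurableE R)) => _ [_ [c ->] <-]. rewrite setTI.
  have -> : (fun t : M => (t : bV R n) ord0 j) @^-1` [set` `]-oo, c[%R] = [set x | x ord0 j < c]%R.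
    by apply/seteqP; split => x /=; rewrite in_itv.
  exact: hausdorff_halfspace.
by move=> mA; have := idm measurableT _ mA; rewrite setTI.
Qed.

Definition hm : set (bV R n) -> \bar R := @hausdorff_outer R n s.

Let hm0 : hm (set0 : set (bV R n)) = 0. Proof. exact: outer_measure0. Qed.
Let hm_ge0 (A : set (bV R n)) : 0 <= hm A. Proof. exact: outer_measure_ge0. Qed.
Let hm_sa : semi_sigma_additive hm.
Proof.
move=> F mF tF mUF; apply: (@caratheodory_measure_sigma_additive _ _ (@hausdorff_outer R n s)) => //.
  by move=> i; exact: borel_hausdorff_caratheodory.
exact: borel_hausdorff_caratheodory.
Qed.
HB.instance Definition _ := isMeasure.Build _ _ _ hm hm0 hm_ge0 hm_sa.

Lemma integral_hausdorff (D : set (bV R n)) (F : bV R n -> \bar R) :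
  measurable D -> measurable_fun D F ->
  \int[@hausdorff R n s]_(x in D) F x = \int[hm]_(x in D) F x.
Proof.
exact: (@integral_caratheodory R (RnD R n) _ (bV R n) (@hausdorff_outer R n s) hm id
  borel_hausdorff_caratheodory (fun _ _ => erefl)).
Qed.

End hausdorff_borel.

Import HBNNSimple.

(** * Comparing measures through indicators and countable covers *)

Section transport.
Variables (d d' d0 : measure_display) (X : measurableType d) (Y : measurableType d')
  (Z : measurableType d0) (R : realType).
Variables (mu : {measure set X -> \bar R}) (nu : {measure set Y -> \bar R}).
Variables (D : set X) (E : set Y) (w : X -> R) (v : Y -> R) (p : X -> Z) (q : Y -> Z).
Local Open Scope ereal_scope.
Hypotheses (mD : measurable D) (mE : measurable E) (mw : measurable_fun D w) (mv : measurable_fun E v)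
  (w0 : forall x, D x -> (0 <= w x)%R) (v0 : forall y, E y -> (0 <= v y)%R)
  (mp : measurable_fun D p) (mq : measurable_fun E q).

(** Identities between image measures are proved on indicators; approximation from below by simple
    functions carries them to all nonnegative measurable [f]. No sigma-finiteness enters, which
    matters for Hausdorff measures of lower dimension. *)
Lemma weighted_integral_transfer :
  (forall A, measurable A -> \int[mu]_(x in D) ((w x)%:E * (\1_A (p x))%:E) = \int[nu]_(y in E) ((v y)%:E * (\1_A (q y))%:E)) ->
  forall f, measurable_fun setT f -> (forall z, 0 <= f z) ->
  \int[mu]_(x in D) ((w x)%:E * f (p x)) = \int[nu]_(y in E) ((v y)%:E * f (q y)).
Proof.
move=> H f mf f0.
pose a := nnsfun_approx measurableT mf.
have aE k : \int[mu]_(x in D) ((w x)%:E * (a k (p x))%:E) = \int[nu]_(y in E) ((v y)%:E * (a k (q y))%:E).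
  have split_int (dd : measure_display) (U : measurableType dd) (la : {measure set U -> \bar R})
      (G : set U) (u : U -> R) (r : U -> Z) :
      measurable G -> measurable_fun G u -> (forall x, G x -> (0 <= u x)%R) -> measurable_fun G r ->
      \int[la]_(x in G) ((u x)%:E * (a k (r x))%:E) =
      \sum_(c \in range (a k)) (c%:E * \int[la]_(x in G) ((u x)%:E * (\1_(a k @^-1` [set c]) (r x))%:E)).
    move=> mG mu_ u0 mr. have m1 c : measurable_fun G (fun x => (u x)%:E * (\1_(a k @^-1` [set c]) (r x))%:E).
      apply: emeasurable_funM; apply/measurable_EFinP => //.
      have mI : measurable_fun setT (\1_(a k @^-1` [set c]) : Z -> R) by apply: measurable_indic; rewrite -[X in measurable X]setTI; exact: measurable_funP.
      exact: measurableT_comp.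
    have p1 c x : G x -> 0 <= (u x)%:E * (\1_(a k @^-1` [set c]) (r x))%:E.
      by move=> Gx; rewrite mule_ge0 ?lee_fin ?u0.
    under eq_integral => x _.
      rewrite (fimfunE (a k)) -fsumEFin//. rewrite ge0_mule_fsumr; last first.
        move=> c; rewrite EFinM; have [c0|c0] := leP 0%R c; first by rewrite mule_ge0// lee_fin.
        rewrite indicE; case: (boolP (_ \in _)) => [/set_mem/= e|_]; last by rewrite mule0.
        by move: c0; rewrite -e ltNge fun_ge0.
      over.
    rewrite /= ge0_integral_fsum//; last 2 first.
    - move=> c; under eq_fun do rewrite EFinM muleCA.
      by apply: measurable_funeM.
    - move=> c x Gx; rewrite EFinM muleCA.
      have [c0|c0] := leP 0%R c; first by apply: mule_ge0; [rewrite lee_fin|exact: p1].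
      rewrite indicE; case: (boolP (_ \in _)) => [/set_mem/= e|_]; last by rewrite !mule0.
      by move: c0; rewrite -e ltNge fun_ge0.
    apply: eq_fsbigr => c; rewrite inE => -[z _ cz]. under eq_integral do rewrite EFinM muleCA.
    have c0 : (0 <= c)%R by rewrite -cz fun_ge0. by apply: ge0_integralZl => //; move=> x Gx; exact: p1.
  rewrite split_int// [RHS]split_int//; apply: eq_fsbigr => c _; congr (_ * _).
  by apply: H; rewrite -[X in measurable X]setTI; exact: measurable_funP.
have lim_int (dd : measure_display) (U : measurableType dd) (la : {measure set U -> \bar R})
      (G : set U) (u : U -> R) (r : U -> Z) :
      measurable G -> measurable_fun G u -> (forall x, G x -> (0 <= u x)%R) -> measurable_fun G r ->
      \int[la]_(x in G) ((u x)%:E * (a k (r x))%:E) @[k --> \oo] --> \int[la]_(x in G) ((u x)%:E * f (r x)).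
  move=> mG mu_ u0 mr. have cv x : (a k x)%:E @[k --> \oo] --> f x.
    by apply: (cvg_nnsfun_approx measurableT mf (fun x _ => f0 x)).
  have := @cvg_monotone_convergence _ _ _ la G mG (fun k x => (u x)%:E * (a k (r x))%:E).
  rewrite (@eq_integral _ _ _ la G (fun x => (u x)%:E * f (r x)) (fun x => limn (fun k => (u x)%:E * (a k (r x))%:E))).
    apply.
    - move=> k; apply: emeasurable_funM; apply/measurable_EFinP => //.
      by apply: measurableT_comp mr; exact: measurable_funP.
    - by move=> k x Gx; rewrite mule_ge0 ?lee_fin ?u0 ?fun_ge0.
    - move=> x Gx k l kl; apply: lee_wpmul2l; first by rewrite lee_fin u0.
      rewrite lee_fin; have /lefP := nd_nnsfun_approx measurableT mf kl; exact.
  move=> x /set_mem Gx; rewrite limeMl//.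
    by rewrite (cvg_lim _ (cv (r x))).
  by apply/cvg_ex; eexists; exact: cv.
have := lim_int _ _ mu D w p mD mw w0 mp; under eq_fun do rewrite aE.
move=> /(cvg_unique _ (lim_int _ _ nu E v q mE mv v0 mq)) <- //.
Qed.
End transport.

Section cover.
Variables (d : measure_display) (T : measurableType d) (R : realType).
Local Open Scope ereal_scope.

(** The cover is made disjoint inside [E], and additivity sums up the inequalities on the pieces. It
    is stated for mere set functions so that [m1] may be the volume of a cone over the set, which is
    not given as a measure. *)
Lemma le_of_countable_cover (m1 m2 : set T -> \bar R) (F : nat -> set T) :
  (forall E : nat -> set T, (forall k, measurable (E k)) -> trivIset setT E ->
     m1 (\bigcup_k E k) = \sum_(0 <= k <oo) m1 (E k)) ->
  (forall E : nat -> set T, (forall k, measurable (E k)) -> trivIset setT E ->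
     m2 (\bigcup_k E k) = \sum_(0 <= k <oo) m2 (E k)) ->
  (forall E, measurable E -> 0 <= m1 E) ->
  (forall k, measurable (F k)) ->
  (forall k E, measurable E -> E `<=` F k -> m1 E <= m2 E) ->
  forall E, measurable E -> E `<=` \bigcup_k F k -> m1 E <= m2 E.
Proof.
move=> s1 s2 m10 mF le12 E mE EF.
pose G k := seqDU (fun k => E `&` F k) k.
have mG k : measurable (G k) by apply: measurableD; [exact: measurableI|apply: bigsetU_measurable => i _; exact: measurableI].
have EG : E = \bigcup_k G k.
  rewrite -seqDU_bigcup_eq -setI_bigcupr; apply/esym/setIidPl; exact: EF.
rewrite EG s1//; last exact: trivIset_seqDU.
rewrite s2//; last exact: trivIset_seqDU.
apply: lee_nneseries => [k _ _|k _]; first exact: m10.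
by apply: (le12 k) => // x [[_ Fx] _].
Qed.
End cover.

(** * Minkowski gauges of convex absorbing sets *)

Section gauge.
Variables (R : realType) (V : lmodType R) (C : set V).
Hypothesis Cconv : forall x y (l : R), 0 <= l <= 1 -> C x -> C y -> C ((1 - l) *: x + l *: y).
Hypothesis Cabs : forall v, exists2 d : R, 0 < d & C (d *: v).
Implicit Types (u v : V) (l : R).

(** The Minkowski functional. It is set up over an arbitrary module because it serves twice: for the
    support of [f] in R^n and for the epigraph in R^n x R. *)
Definition gauge v : R := inf [set l : R | 0 < l /\ C (l^-1 *: v)].

Lemma gauge_C0 : C 0.
Proof. by have [d _] := Cabs 0; rewrite scaler0. Qed.

Lemma star_shaped v l : 0 <= l <= 1 -> C v -> C (l *: v).
Proof. by move=> l01 Cv; have := Cconv l01 gauge_C0 Cv; rewrite scaler0 add0r. Qed.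

Let gauge_nonempty v : [set l : R | 0 < l /\ C (l^-1 *: v)] !=set0.
by have [d d0 Cd] := Cabs v; exists d^-1; rewrite /= invr_gt0 invrK. Qed.

Let gauge_lb v : has_lbound [set l : R | 0 < l /\ C (l^-1 *: v)].
by exists 0 => l [/ltW]. Qed.

Lemma gauge_ge0 v : 0 <= gauge v.
Proof. by apply: lb_le_inf => // l [/ltW]. Qed.

Lemma gauge_le v l : 0 < l -> C (l^-1 *: v) -> gauge v <= l.
Proof. by move=> l0 Cl; apply: ge_inf. Qed.

Lemma gauge_lt v l : gauge v < l -> C (l^-1 *: v).
Proof.
move=> gl; have l0 := le_lt_trans (gauge_ge0 v) gl.
have [k [k0 Ck] kl] := inf_lt (gauge_nonempty v) gl.
have -> : l^-1 *: v = (k / l) *: (k^-1 *: v).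
  by rewrite scalerA; congr (_ *: _); field; rewrite !gt_eqF.
apply: star_shaped => //; apply/andP; split; first by rewrite divr_ge0// ltW.
by rewrite ler_pdivrMr// mul1r ltW.
Qed.

Lemma gauge_lt1 v : gauge v < 1 -> C v.
Proof. by move=> /gauge_lt; rewrite invr1 scale1r. Qed.

Lemma gauge_le1 v : C v -> gauge v <= 1.
Proof. by move=> Cv; apply: gauge_le => //; rewrite invr1 scale1r. Qed.

Lemma gauge0 : gauge 0 = 0.
Proof.
apply/eqP; rewrite eq_le gauge_ge0 andbT; apply/ler_addgt0Pr => e e0; rewrite add0r.
by apply: gauge_le => //; rewrite scaler0; exact: gauge_C0.
Qed.

Lemma gaugeZ l v : 0 <= l -> gauge (l *: v) = l * gauge v.
Proof.
rewrite le_eqVlt => /orP[/eqP <-|l0]; first by rewrite scale0r mul0r gauge0.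
have le u k : 0 < k -> gauge (k *: u) <= k * gauge u.
  move=> k0; apply/ler_addgt0Pr => e e0. have h : gauge u < gauge u + e / k by rewrite ltrDl divr_gt0.
  have gu := gauge_lt h. have gk : 0 < gauge u + e / k by apply: le_lt_trans h; exact: gauge_ge0.
  have -> : k * gauge u + e = k * (gauge u + e / k) by field; rewrite gt_eqF.
  apply: gauge_le; first by rewrite mulr_gt0. by rewrite scalerA invfM mulrAC mulVf ?gt_eqF// mul1r.
apply/eqP; rewrite eq_le le//= -ler_pdivlMl//.
rewrite -{1}[v](scalerK (lt0r_neq0 l0)); apply: le; by rewrite invr_gt0.
Qed.

Lemma gaugeD u v : gauge (u + v) <= gauge u + gauge v.
Proof.
apply/ler_addgt0Pr => e e0.
have hu : gauge u < gauge u + e / 2 by rewrite ltrDl divr_gt0.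
have hv : gauge v < gauge v + e / 2 by rewrite ltrDl divr_gt0.
have := gauge_lt hu; have := gauge_lt hv.
have u0 : 0 < gauge u + e / 2 by apply: le_lt_trans hu; exact: gauge_ge0.
have v0 : 0 < gauge v + e / 2 by apply: le_lt_trans hv; exact: gauge_ge0.
set a := gauge u + e / 2 in u0 *; set b := gauge v + e / 2 in v0 *; move=> Cv Cu.
have -> : gauge u + gauge v + e = a + b by rewrite /a /b; field.
have ab : 0 < a + b by exact: addr_gt0.
apply: gauge_le => //.
have -> : (a + b)^-1 *: (u + v) = (1 - b / (a + b)) *: (a^-1 *: u) + (b / (a + b)) *: (b^-1 *: v).
  by rewrite scalerDr !scalerA; congr (_ *: _ + _ *: _); field; rewrite !gt_eqF.
apply: Cconv => //; apply/andP; split; first by rewrite divr_ge0// ltW.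
by rewrite ler_pdivrMr// mul1r lerDr ltW.
Qed.

(** Rational radii present a sublevel set of the gauge as a countable union of dilates of [C]; this
    is how both gauges are shown to be Borel. *)
Lemma gauge_ltP v (a : R) : gauge v < a <-> exists2 r : rat, 0 < (ratr r : R) < a & C ((ratr r)^-1 *: v).
Proof.
split.
  move=> ga; have [r r1] := rat_in_itvoo ga; rewrite in_itv/= in r1.
  have /andP[r2 r3] := r1; exists r; last exact: gauge_lt. by rewrite r3 (le_lt_trans (gauge_ge0 v)).
by move=> [r /andP[r0 ra] /(gauge_le r0) h]; exact: le_lt_trans ra.
Qed.

End gauge.

Section gauge_measurable.
Variables (R : realType).

Lemma measurable_gauge n (C : set 'rV[R]_n) :
  (forall x y (l : R), 0 <= l <= 1 -> C x -> C y -> C ((1 - l) *: x + l *: y)) ->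
  (forall v, exists2 d : R, 0 < d & C (d *: v)) ->
  measurable (C : set (bV R n)) ->
  measurable_fun setT (gauge C : bV R n -> R).
Proof.
move=> Cc Ca mC; apply: (measurability _ (RGenInftyO.measurableE R)) => _ [_ [c ->] <-].
rewrite setTI.
have -> : gauge C @^-1` [set` `]-oo, c[] =
  \bigcup_(r in [set r : rat | 0 < (ratr r : R) < c]) ((fun x => (ratr r)^-1 *: x + 0) @^-1` C).
  apply/seteqP; split => x /=; rewrite in_itv/=.
    by move=> /(gauge_ltP Cc Ca)[r rc Cx]; exists r => //=; rewrite addr0.
  by move=> [r /= rc]; rewrite /= addr0 => Cx; apply/(gauge_ltP Cc Ca); exists r.
rewrite bigcup_mkcond; apply: bigcupT_measurable_rat => r; case: ifPn => // _.
rewrite -[X in measurable X]setTI; exact: measurable_affine.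
Qed.

Lemma measurable_gauge2 n (C : set ('rV[R]_n * R)) :
  (forall x y (l : R), 0 <= l <= 1 -> C x -> C y -> C ((1 - l) *: x + l *: y)) ->
  (forall v, exists2 d : R, 0 < d & C (d *: v)) ->
  measurable (C : set (bV R n * R)%type) ->
  measurable_fun setT (gauge C : bV R n * R -> R).
Proof.
move=> Cc Ca mC; apply: (measurability _ (RGenInftyO.measurableE R)) => _ [_ [c ->] <-].
rewrite setTI.
have -> : gauge C @^-1` [set` `]-oo, c[] =
  \bigcup_(r in [set r : rat | 0 < (ratr r : R) < c]) ((fun x : bV R n * R => ((ratr r)^-1 *: x.1 + 0, (ratr r)^-1 * x.2)) @^-1` C).
  apply/seteqP; split => x /=; rewrite in_itv/=.
    by move=> /(gauge_ltP Cc Ca)[r rc Cx]; exists r => //=; rewrite addr0.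
  by move=> [r /= rc]; rewrite /= addr0 => Cx; apply/(gauge_ltP Cc Ca); exists r.
rewrite bigcup_mkcond; apply: bigcupT_measurable_rat => r; case: ifPn => // _.
rewrite -[X in measurable X]setTI.
have m1 : measurable_fun setT (fun x : bV R n * R => ((ratr r)^-1 *: x.1 + 0 : bV R n)).
  exact: (measurableT_comp (@measurable_affine R n (ratr r)^-1 0) (measurable_fst)).
have m2 : measurable_fun setT (fun x : bV R n * R => (ratr r)^-1 * x.2 : R).
  by apply: measurable_funM => //; exact: measurable_snd.
exact: (measurable_fun_pair m1 m2).
Qed.
End gauge_measurable.

(** * Isometry invariance and the volume of flat cones *)

Section isometries.
Variable R : realType.
Local Open Scope ereal_scope.

(** A lower bound on distances makes [T] injective on [E]; the inverse [S], chosen by [xget], is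
    Lipschitz on the image, and [hausdorff_lipschitz] applies to it. *)
Lemma hausdorff_colipschitz n m s (T : 'rV[R]_n -> 'rV[R]_m) (E : set 'rV[R]_n) (l : R) : (0 < l)%R ->
  (forall x y, E x -> E y -> (enorm (x - y) <= l * enorm (T x - T y))%R) ->
  hausdorff_outer s E <= (l ^+ s)%:E * hausdorff_outer s (T @` E).
Proof.
move=> l0 TE; pose S y := xget 0%R [set x | E x /\ T x = y].
have SP x : E x -> E (S (T x)) /\ T (S (T x)) = T x.
  by move=> Ex; apply: (@xgetPex _ 0%R [set z | E z /\ T z = T x]); exists x.
have SE x : E x -> S (T x) = x.
  move=> Ex; have [Es e] := SP _ Ex; apply/eqP; rewrite -subr_eq0; apply/eqP/enorm_eq0/eqP.
  by rewrite eq_le enorm_ge0 andbT; apply: le_trans (TE _ _ Es Ex) _; rewrite e subrr enorm0 mulr0.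
have -> : hausdorff_outer s E = hausdorff_outer s (S @` (T @` E)).
  congr hausdorff_outer; apply/seteqP; split => [x Ex|_ [_ [x Ex <-] <-]]; last by rewrite SE.
  by exists (T x); [exists x|exact: SE].
apply: hausdorff_lipschitz => // _ _ [x Ex <-] [y Ey <-].
by rewrite !SE//; exact: TE.
Qed.

Lemma hausdorff_isometry n m s (T : 'rV[R]_n -> 'rV[R]_m) (E : set 'rV[R]_n) :
  (forall x y, E x -> E y -> enorm (T x - T y) = enorm (x - y)) ->
  hausdorff_outer s (T @` E) = hausdorff_outer s E.
Proof.
move=> TE; apply/eqP; rewrite eq_le; apply/andP; split.
  have := @hausdorff_lipschitz R n m s T E 1 ltr01; rewrite expr1n mul1e; apply => x y Ex Ey. by rewrite mul1r TE.
have := @hausdorff_colipschitz n m s T E 1 ltr01; rewrite expr1n mul1e; apply => x y Ex Ey.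
by rewrite mul1r TE.
Qed.

(** Reflections are not covered by [lam_affine]. Their invariance is read off from the description
    of [lam] as H^n, which depends on distances alone. *)
Lemma lam_isometry n (T : 'rV[R]_n -> 'rV[R]_n) (A : set 'rV[R]_n) :
  involutive T -> (forall x y, enorm (T x - T y) = enorm (x - y)) -> @lam R n (T @^-1` A) = lam A.
Proof.
move=> TT iT; have -> : T @^-1` A = T @` A.
  by apply/seteqP; split => [x Ax|_ [x Ax <-]]; [exists (T x)|rewrite /= TT].
have e B : @lam R n B = hausdorff_outer n B by rewrite hausdorff_lebesgue.
by rewrite !e; exact: hausdorff_isometry.
Qed.

Definition householder n (w x : 'rV[R]_n) : 'rV[R]_n := (x - (2 * inner x w / inner w w) *: w)%R.

Lemma householder_inner n (w x y : 'rV[R]_n) : inner (householder w x) y = inner x (householder w y).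
Proof. by rewrite /householder innerBl innerBr innerZl innerZr (innerC w y); ring. Qed.

Lemma householderK n (w : 'rV[R]_n) : involutive (householder w).
Proof.
move=> x; have [->|w0] := eqVneq w 0%R; first by rewrite /householder !scaler0 !subr0.
have ww : inner w w != 0%R.
  by apply: contra_neq w0 => h; apply: enorm_eq0; rewrite /enorm h sqrtr0.
rewrite {1}/householder [inner (householder _ _) _]innerBl innerZl.
by rewrite /householder; apply/rowP => i; rewrite !mxE; field.
Qed.

Lemma householder_isometry n (w x y : 'rV[R]_n) : enorm (householder w x - householder w y) = enorm (x - y).
Proof.
have -> : (householder w x - householder w y = householder w (x - y))%R.
  by rewrite /householder innerBl; apply/rowP => i; rewrite !mxE; ring.
by rewrite /enorm householder_inner householderK.
Qed.

Lemma householder_swap n (u v : 'rV[R]_n) : enorm u = 1%R -> enorm v = 1%R -> householder (u - v) u = v.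
Proof.
move=> u1 v1; have uu : inner u u = 1%R by rewrite -enorm_sqr u1 expr1n.
have vv : inner v v = 1%R by rewrite -enorm_sqr v1 expr1n.
have e : (inner (u - v) (u - v) = 2 * inner u (u - v))%R.
  by rewrite !innerBl !innerBr uu vv (innerC v u); ring.
rewrite /householder e; have [h|h] := eqVneq (inner u (u - v)) 0%R.
  have /enorm_eq0/eqP : enorm (u - v) = 0%R by rewrite /enorm e h mulr0 sqrtr0.
  by rewrite subr_eq0 => /eqP ->; rewrite subrr scaler0 subr0.
by rewrite divff ?mulf_neq0// scale1r subKr.
Qed.

Lemma measurable_householder n (w : 'rV[R]_n) : measurable_fun setT (householder w : bV R n -> bV R n).
Proof.
apply: measurable_bVP => i.
apply: (@eq_measurable_fun _ _ _ _ _ (fun x : bV R n => coordi i x - 2 * inner x w / inner w w * w ord0 i)%R).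
  by move=> x _; rewrite !mxE.
apply: measurable_funB; first exact: measurable_coordi.
apply: measurable_funM => //; apply: measurable_funM => //; apply: measurable_funM => //.
have := @measurable_inner R n w; apply: eq_measurable_fun => x _ /=; by rewrite innerC.
Qed.

Lemma measurable_invscale n d (T : measurableType d) (j : T -> R) (q : T -> bV R n) :
  measurable_fun setT j -> measurable_fun setT q -> measurable_fun setT (fun x => ((j x)^-1 *: q x)%R : bV R n).
Proof.
move=> mj mq; apply: measurable_bVP => i.
apply: (@eq_measurable_fun _ _ _ _ _ (fun x => (j x)^-1 * coordi i (q x))%R).
  by move=> x _; rewrite !mxE.
apply: measurable_funM; first exact: measurable_inv_fun.
exact: (measurableT_comp (measurable_coordi i) mq).
Qed.

(** For [S] inside the hyperplane [inner z nu = 1] this is the open cone over [S] with apex 0, the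
    apex being excluded. *)
Definition flat_cone n (nu : 'rV[R]_n) (S : set 'rV[R]_n) : set 'rV[R]_n :=
  [set x | (0 < inner x nu < 1)%R /\ S ((inner x nu)^-1 *: x)%R].

Lemma measurable_innerl n (w : 'rV[R]_n) : measurable_fun setT ((fun x => inner x w) : bV R n -> R).
Proof. by have := @measurable_inner R n w; apply: eq_measurable_fun => x _ /=; rewrite innerC. Qed.

Lemma measurable_flat_cone n (nu : 'rV[R]_n) (S : set 'rV[R]_n) :
  measurable (S : set (bV R n)) -> measurable (flat_cone nu S : set (bV R n)).
Proof.
move=> mS; have mi := measurable_innerl nu.
have mp : measurable_fun setT (fun x : bV R n => ((inner x nu)^-1 *: x)%R : bV R n).
  by apply: measurable_invscale => //; exact: measurable_id.
have -> : flat_cone nu S = [set x | 0 < inner x nu]%R `&` [set x | inner x nu < 1]%R `&`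
     (setT `&` (fun x : bV R n => ((inner x nu)^-1 *: x)%R) @^-1` S).
  by apply/seteqP; split => [x [/andP[]]|x [[h1 h2] [_ ?]]]//; split => //; apply/andP.
apply: measurableI; last exact: mp.
by apply: measurableI; apply: measurable_lt_set.
Qed.

Lemma inner_delta n (x : 'rV[R]_n) i : inner x (delta_mx 0 i)%R = x ord0 i.
Proof.
rewrite /inner (bigD1 i)//= mxE !eqxx mulr1 big1 ?addr0// => k ki.
by rewrite mxE (negbTE ki) andbF mulr0.
Qed.

Lemma enorm_delta n (i : 'I_n) : enorm (delta_mx 0 i : 'rV[R]_n)%R = 1%R.
Proof. by rewrite /enorm inner_delta mxE !eqxx sqrtr1. Qed.

Lemma enorm_vcons m (u v : 'rV[R]_m) (a : R) : enorm (vcons u a - vcons v a) = enorm (u - v).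
Proof.
have e i (x y : 'rV[R]_m.+1) : ((x - y) ord0 i = x ord0 i - y ord0 i)%R by rewrite !mxE.
have e' i (x y : 'rV[R]_m) : ((x - y) ord0 i = x ord0 i - y ord0 i)%R by rewrite !mxE.
rewrite /enorm /inner big_ord_recl !e !vcons0 subrr mul0r add0r; congr Num.sqrt.
by apply: eq_bigr => i _; rewrite !e !vconsS e'.
Qed.

Lemma vconsZ m (c : R) (v : 'rV[R]_m) (a : R) : (c *: vcons v a = vcons (c *: v) (c * a))%R.
Proof. by apply/rowP => i; rewrite /vcons !mxE; case: (unlift ord0 i) => [k|]; rewrite ?mxE. Qed.

(** A cone of height 1 has volume base over dimension: the slice at height a is a dilate of [S'] by
    a, of measure a^m times that of [S'], and a^m integrates to 1 / m.+1 over ]0, 1[. The base is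
    measured by H^m, which is L^m in the coordinates of the hyperplane. *)
Lemma flat_cone0 m (S : set 'rV[R]_m.+1) : measurable (S : set (bV R m.+1)) ->
  (forall z, S z -> z ord0 ord0 = 1%R) ->
  m.+1%:R%:E * lam (flat_cone (delta_mx 0 ord0)%R S) = hausdorff_outer m S.
Proof.
move=> mS S1; pose S' : set 'rV[R]_m := [set v | S (vcons v 1%R)].
have mvc (a : R) : measurable_fun setT ((fun v => vcons v a) : bV R m -> bV R m.+1).
  exact: (measurableT_comp (@measurable_vconsp R m) (measurable_pair2 _)).
have mS' : measurable (S' : set (bV R m)).
  by have := mvc 1%R measurableT _ mS; rewrite setTI.
have -> : hausdorff_outer m S = hausdorff_outer m S'.
  have -> : S = (fun v => vcons v 1%R) @` S'.
    apply/seteqP; split => [z Sz|_ [v Sv <-]]//. have e : vcons (vtail z) 1%R = z by rewrite -(S1 _ Sz) vconsK.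
    by exists (vtail z); rewrite ?/S'/= e.
  by apply: hausdorff_isometry => u v _ _; exact: enorm_vcons.
rewrite hausdorff_lebesgue.
have mC := measurable_flat_cone (delta_mx 0 ord0 : 'rV[R]_m.+1)%R mS.
have -> : lam (flat_cone (delta_mx 0 ord0)%R S) = \int[@lam R m.+1]_x (\1_(flat_cone (delta_mx 0 ord0)%R S) x)%:E.
  by rewrite integral_indic// setIT.
rewrite lam_fubini2//; last by apply/measurable_EFinP; exact: measurable_indic.
rewrite (eq_integral (fun a : R => (if (0 < a < 1)%R then a ^+ m else 0%R)%:E * @lam R m S')); last first.
  move=> a _; have [a01|a01] := ifPn; last first.
    rewrite mul0e; apply: integral0_eq => v _; rewrite indicE memNset// /flat_cone/= inner_delta vcons0.
    by move=> [h _]; rewrite h in a01.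
  have /andP[a0 a1] := a01.
  rewrite (eq_integral (fun v => (\1_((fun v : bV R m => (a^-1 *: v + 0)%R) @^-1` S') v)%:E)); last first.
    move=> v _; congr EFin; rewrite !indicE; congr ((nat_of_bool _)%:R).
    have e : (a^-1 *: vcons v a = vcons (a^-1 *: v + 0) 1)%R by rewrite vconsZ mulVf ?gt_eqF// addr0.
    apply/idP/idP => /set_mem; rewrite /flat_cone/= /S'/= ?inner_delta ?vcons0 ?e.
      by move=> [_ h]; apply/mem_set.
    by move=> h; apply/mem_set => /=; rewrite inner_delta vcons0 e.
  rewrite integral_indic//; last by rewrite -[X in measurable X]setTI; exact: measurable_affine.
  rewrite setIT [LHS]lam_affine ?invr_eq0 ?gt_eqF//. by rewrite normfV invrK gtr0_norm.
have mg : measurable_fun setT (fun a : R => (if 0 < a < 1 then a ^+ m else 0)%R).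
  apply: measurable_fun_ifT; [|by apply: measurable_funX|by []]. by apply: measurable_and; apply: measurable_fun_ltr.
rewrite ge0_integralZr//; last 2 first.
- by apply/measurable_EFinP.
- by move=> a _; case: ifP => // /andP[/ltW a0 _]; rewrite lee_fin exprn_ge0.
have -> : \int[@leb R]_a (if (0 < a < 1)%R then a ^+ m else 0%R)%:E = \int[@leb R]_(a in `]0%R, 1%R[) (a ^+ m)%:E.
  rewrite [RHS]integral_mkcond; apply: eq_integral => a _. by rewrite patchE mem_setE in_itv/=; case: ifP.
by rewrite integral_expr_itv// expr1n muleA -EFinM mulrC mulfVK ?pnatr_eq0// mul1e.
Qed.

(** The Householder reflection exchanging [nu] and the first basis vector preserves both measures
    and reduces the claim to [flat_cone0]. *)
Lemma flat_coneE m (nu : 'rV[R]_m.+1) (S : set 'rV[R]_m.+1) : enorm nu = 1%R ->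
  measurable (S : set (bV R m.+1)) -> (forall z, S z -> inner z nu = 1%R) ->
  m.+1%:R%:E * lam (flat_cone nu S) = hausdorff_outer m S.
Proof.
move=> nu1 mS S1; pose e0 : 'rV[R]_m.+1 := (delta_mx 0 ord0)%R.
pose U := householder (nu - e0).
have Unu : U nu = e0 by apply: householder_swap => //; exact: enorm_delta.
have UK : involutive U := householderK _.
have Ue : U e0 = nu by rewrite -Unu UK.
have iU x y : enorm (U x - U y) = enorm (x - y) by exact: householder_isometry.
have Ui x y : inner (U x) y = inner x (U y) by exact: householder_inner.
have UZ a x : U (a *: x)%R = (a *: U x)%R.
  by rewrite /U /householder innerZl; apply/rowP => i; rewrite !mxE; ring.
have -> : hausdorff_outer m S = hausdorff_outer m (U @` S) by rewrite hausdorff_isometry.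
have US : U @` S = U @^-1` S.
  by apply/seteqP; split => [_ [x Ax <-]|x Ax]; [rewrite /= UK|exists (U x)].
rewrite US -flat_cone0; last 2 first.
- by rewrite -[X in measurable X]setTI; exact: measurable_householder.
- by move=> z /S1; rewrite Ui Unu inner_delta.
congr (_ * _); rewrite -[LHS](lam_isometry _ UK iU); congr lam.
by apply/seteqP; split => x; rewrite /flat_cone/= Ui Unu UZ.
Qed.
End isometries.

(** * Boundary and normals of a convex set containing a ball *)

Section convex_body.
Variables (R : realType) (n : nat) (K : set 'rV[R]_n) (r0 : R).
Hypothesis Kconv : forall x y (l : R), 0 <= l <= 1 -> K x -> K y -> K ((1 - l) *: x + l *: y).
Hypothesis r00 : 0 < r0.
Hypothesis Kball : forall x, enorm x <= r0 -> K x.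
Implicit Types (x y th nu : 'rV[R]_n).

Lemma ball_absorbing v : exists2 d : R, 0 < d & K (d *: v).
Proof.
exists (r0 / (1 + enorm v)); first by rewrite divr_gt0// ltr_wpDr ?enorm_ge0.
have v0 := enorm_ge0 v; apply: Kball; rewrite enormZ ger0_norm; last by rewrite divr_ge0 ?(ltW r00)// addr_ge0.
by rewrite mulrAC ler_pdivrMr ?ltr_wpDr// ler_pM2l//; lra.
Qed.
Let Kabs := ball_absorbing.

Local Notation j := (gauge K).

Lemma gauge_le_enorm x : j x <= enorm x / r0.
Proof.
have [->|x0] := eqVneq x 0; first by rewrite enorm0 mul0r gauge0.
have x1 : 0 < enorm x by rewrite enorm_gt0.
apply: gauge_le; first by rewrite divr_gt0.
by apply: Kball; rewrite enormZ gtr0_norm ?invr_gt0 ?divr_gt0// invf_div divfK ?gt_eqF.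
Qed.

Lemma gauge_lipschitz x y : `|j x - j y| <= r0^-1 * enorm (x - y).
Proof.
have h u v : j u - j v <= r0^-1 * enorm (u - v).
  rewrite lerBlDl (le_trans _ (lerD (lexx (j v)) (_ : j (u - v) <= _)))//.
    by rewrite -{1}(subrK v u) addrC gaugeD.
  by rewrite mulrC; exact: gauge_le_enorm.
by have := h x y; have := h y x; rewrite (enorm_distC y) ler_norml; lra.
Qed.

Lemma continuous_gauge : continuous j.
Proof. exact: enorm_lip_continuous gauge_lipschitz. Qed.

Lemma closure_gauge x : closure K x -> j x <= 1.
Proof.
have clj : closed [set x | j x <= 1].
  rewrite (_ : [set x | j x <= 1] = j @^-1` [set y | y <= 1])//.
  by apply: closed_comp; [move=> z _; exact: continuous_gauge|exact: closed_le].
move=> Kx; have : closure [set x | j x <= 1] x.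
  by apply: closure_subset Kx => z; exact: gauge_le1.
by move/clj.
Qed.

Lemma interior_gauge x : j x < 1 -> interior K x.
Proof.
move=> jx; have : nbhs x [set y | j y < 1].
  have opj : open [set y | j y < 1].
    rewrite (_ : [set x | j x < 1] = j @^-1` [set y | y < 1])//.
    by apply: open_comp; [move=> z _; exact: continuous_gauge|exact: open_lt].
  exact: open_nbhs_nbhs.
by apply: filterS => y; exact: gauge_lt1.
Qed.

Lemma gauge_closure x : j x <= 1 -> closure K x.
Proof.
move=> jx A /nbhs_enormP[e e0 eA].
pose d := Num.min 1 (e / (1 + enorm x)).
have x0 := enorm_ge0 x.
have d0 : 0 < d by rewrite lt_min ltr01 divr_gt0// ltr_wpDr.
have d1 : d <= 1 by rewrite ge_min lexx.
have de : d * (1 + enorm x) <= e.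
  by rewrite -ler_pdivlMr ?ltr_wpDr// ge_min lexx orbT.
exists ((1 - d) *: x); split.
  apply: gauge_lt1 => //; rewrite gaugeZ ?subr_ge0//.
  apply: (@le_lt_trans _ _ (1 - d)); last by rewrite ltrBlDr ltrDl. by rewrite ler_piMr ?subr_ge0.
apply: eA; have -> : x - (1 - d) *: x = d *: x by apply/rowP => i; rewrite !mxE; ring.
by rewrite enormZ gtr0_norm//; apply: lt_le_trans de; rewrite mulrDr ltrDr mulr1.
Qed.

Lemma gauge_interior x : interior K x -> j x < 1.
Proof.
move=> /nbhs_enormP[e e0 eK].
pose d := e / 2 / (1 + enorm x).
have x0 := enorm_ge0 x.
have d0 : 0 < d by rewrite !divr_gt0// ltr_wpDr.
have : K ((1 + d) *: x).
  apply: eK; have -> : x - (1 + d) *: x = (- d) *: x by apply/rowP => i; rewrite !mxE; ring.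
  rewrite enormZ normrN gtr0_norm//. have : d * (1 + enorm x) = e / 2 by rewrite divfK// gt_eqF// ltr_wpDr. nra.
move=> /(gauge_le1); rewrite gaugeZ ?addr_ge0 ?(ltW d0)// => h.
have := gauge_ge0 Kabs x; nra.
Qed.

Lemma bdE : bd K = [set x | j x = 1].
Proof.
apply/seteqP; split => [x [/closure_gauge j1 iK]|x /= j1].
  by apply/eqP; rewrite eq_le j1 leNgt; apply/negP => /interior_gauge.
split; first by apply: gauge_closure; rewrite j1.
by move=> /gauge_interior; rewrite j1 ltxx.
Qed.

Lemma gauss_outer x : gauss_dom K x -> outer_normals K x = [set gauss K x].
Proof. by move=> [_ ex]; exact: (@xgetPex _ 0 [set th | outer_normals K x = [set th]]). Qed.

Lemma gauss_unit x : gauss_dom K x -> enorm (gauss K x) = 1.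
Proof. by move=> /gauss_outer e; have [] : outer_normals K x (gauss K x) by rewrite e. Qed.

(** The point [r0 *: th] of the inner ball lies in [K]. This uniform bound keeps the quantities
    [inner x th], by which later formulas divide, away from 0. *)
Lemma normal_ge_r0 x th : outer_normals K x th -> r0 <= inner x th.
Proof.
move=> [t1 h]; have := h (r0 *: th); rewrite innerZl -enorm_sqr t1 expr1n mulr1; apply.
by apply: Kball; rewrite enormZ t1 mulr1 gtr0_norm.
Qed.

Lemma normal_gauge x th y : outer_normals K x th -> inner y th <= j y * inner x th.
Proof.
move=> nx; have xr := normal_ge_r0 nx; have x0 := lt_le_trans r00 xr; have [_ h] := nx.
rewrite -ler_pdivrMr//; apply/ler_addgt0Pr => e e0.
have jy : j y < j y + e by rewrite ltrDl.
have je : 0 < j y + e by apply: le_lt_trans jy; exact: gauge_ge0.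
have := h _ (gauge_lt Kconv Kabs jy); rewrite innerZl ler_pdivrMr// ler_pdivrMl//.
Qed.

Lemma gauss_gauge x y : gauss_dom K x -> inner y (gauss K x) <= j y * inner x (gauss K x).
Proof. by move=> Gx; apply: normal_gauge; rewrite gauss_outer. Qed.

Lemma gauss_ge_r0 x : gauss_dom K x -> r0 <= inner x (gauss K x).
Proof. by move=> Gx; apply: normal_ge_r0; rewrite gauss_outer. Qed.

Lemma gauss_dom_gauge x : gauss_dom K x -> j x = 1.
Proof. by move=> [+ _]; rewrite bdE. Qed.

Definition normal_in (T : set 'rV[R]_n) : set 'rV[R]_n :=
  [set x | exists2 th, T th & outer_normals K x th].

Lemma closed_sphere : closed [set th : 'rV[R]_n | enorm th = 1].
Proof.
rewrite (_ : [set th | _] = (@enorm R n) @^-1` [set y | y = 1])//.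
by apply: closed_comp; [move=> z _; exact: continuous_enorm|exact: closed_eq].
Qed.

Lemma compact_sphere : compact [set th : 'rV[R]_n | enorm th = 1].
Proof.
apply: bounded_closed_compact; last exact: closed_sphere.
exists 1; split => // M M1 x /= x1; rewrite [leLHS]/Num.norm/= mx_normrE.
apply: bigmax_le => [|[i k] _ /=]; first exact: ltW (lt_trans ltr01 M1).
by rewrite (ord1 i); apply: le_trans (coord_enorm x k) _; rewrite x1 ltW.
Qed.

(** Suppose that no vector of [T] is normal at [x]. Each unit vector of [T] is then refuted strictly
    by some point of [K], and the refutation persists for nearby vectors and points; compactness of
    the sphere makes this uniform near [x]. *)
Lemma closed_normal_in (T : set 'rV[R]_n) : closed T -> closed (normal_in T).
Proof.
move=> cT; rewrite -[normal_in T]setCK; apply: open_closedC; rewrite openE => x nx.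
have cS : compact (T `&` [set th | enorm th = 1]).
  apply: subclosed_compact compact_sphere _; last by move=> th []. by apply: closedI => //; exact: closed_sphere.
have := (compact_near_coveringP _).1 cS _ (nbhs x) (fun x' th => exists2 y, K y & inner x' th < inner y th).
move=> /(_ _ _)/wrap[].
  move=> th [Tth th1]. have [y Ky yx] : exists2 y, K y & inner x th < inner y th.
    apply: contrapT => h; apply: nx; exists th => //; split => // y Ky.
    by rewrite leNgt; apply/negP => ?; apply: h; exists y.
  (* The gap of the strict inequality divided by the rate at which it can close: |y - x| for a
     change of [th], and the norm of [th'], at most 2, for a change of [x]. *)
  pose e := Num.min 1 ((inner y th - inner x th) / (enorm (y - x) + 2 + 1)). have nn := enorm_ge0 (y - x).
  have d0 : 0 < enorm (y - x) + 2 + 1 by lra. have e0 : 0 < e by rewrite lt_min ltr01 divr_gt0// subr_gt0.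
  have e1 : e <= 1 by rewrite ge_min lexx. have ed : e * (enorm (y - x) + 2 + 1) <= inner y th - inner x th.
    by rewrite -ler_pdivlMr// ge_min lexx orbT.
  exists ([set th' | enorm (th - th') < e], [set x' | enorm (x - x') < e]) => /=.
    by split; apply/nbhs_enormP; exists e.
  move=> [th' x'] [/= h1 h2]; exists y => //. have c1 := norm_inner_le (y - x) (th - th').
  have c2 := norm_inner_le (x - x') th'. have t2 : enorm th' <= 2.
    by have := enorm_triangle th' th 0; rewrite !subr0 th1 (enorm_distC th'); lra.
  have a1 : enorm (y - x) * enorm (th - th') <= enorm (y - x) * e by rewrite ler_wpM2l// ltW.
  have a2 : enorm (x - x') * enorm th' <= e * 2.
    by apply: ler_pM; rewrite ?enorm_ge0// ltW.
  move: c1 c2; rewrite !ler_norml !innerBl !innerBr; nra.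
apply: filterS => x' h [th Tth [th1 nth]].
by have [y Ky] := h th (conj Tth th1); rewrite ltNge nth.
Qed.

(** Two distinct normals differ in some coordinate, and two rationals fit between the values there.
    Non-uniqueness is thus a countable union of intersections of closed sets, which makes the domain
    of the Gauss map Borel. *)
Lemma gauss_domE : gauss_dom K = [set x | j x = 1] `&` normal_in setT `\`
  \bigcup_(i in [set: 'I_n]) \bigcup_(p : rat) \bigcup_(q in [set q | p < q])
    (normal_in [set th | th ord0 i <= ratr p] `&` normal_in [set th | ratr q <= th ord0 i]).
Proof.
apply/seteqP; split => [x Gx|x [[jx [th _ nth]] nU]].
  have e := gauss_outer Gx; split.
    by split; [exact: gauss_dom_gauge|exists (gauss K x) => //; rewrite e].
  move=> [i _ [p _ [q /= pq [[t1 /= h1] + [t2 /= h2]]]]]; rewrite e => t1E t2E. move: h1 h2; rewrite t1E t2E => h1 h2.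
  have := le_trans h2 h1; rewrite ler_rat; lra.
split; first by rewrite bdE.
exists th; apply/seteqP; split => [t nt|t ->//] /=.
apply/rowP => i; apply/eqP; rewrite eq_le; apply/andP; split; rewrite leNgt; apply/negP => lt;
have [p /[!in_itv]/andP[p1 p2]] := rat_in_itvoo lt;
have [q /[!in_itv]/andP[q1 q2]] := rat_in_itvoo p2; apply: nU; exists i => //; exists p => //;
exists q => /=; try (by rewrite -(ltr_rat R)).
- by split; [exists th => //=; exact: ltW|exists t => //=; exact: ltW].
- by split; [exists t => //=; exact: ltW|exists th => //=; exact: ltW].
Qed.

Lemma closed_coord_le i (c : R) : closed [set th : 'rV[R]_n | th ord0 i <= c].
Proof.
apply: (@closed_comp _ _ (fun th : 'rV[R]_n => th ord0 i) [set y | y <= c]); last exact: closed_le.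
by move=> z _; exact: coord_continuous.
Qed.

Lemma closed_coord_ge i (c : R) : closed [set th : 'rV[R]_n | c <= th ord0 i].
Proof.
apply: (@closed_comp _ _ (fun th : 'rV[R]_n => th ord0 i) [set y | c <= y]); last exact: closed_ge.
by move=> z _; exact: coord_continuous.
Qed.

Lemma measurable_gauss_dom : measurable (K : set (bV R n)) -> measurable (gauss_dom K : set (bV R n)).
Proof.
move=> mK; rewrite gauss_domE; apply: measurableD.
  apply: measurableI; last by apply: closed_measurable_rV; apply: closed_normal_in; exact: closedT.
  apply: closed_measurable_rV; rewrite (_ : [set x | _] = j @^-1` [set y | y = 1])//.
  by apply: closed_comp; [move=> z _; exact: continuous_gauge|exact: closed_eq].
apply: fin_bigcup_measurable => [|i _]; first exact: finite_finset.
apply: bigcupT_measurable_rat => p; rewrite bigcup_mkcond; apply: bigcupT_measurable_rat => q.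
case: ifP => // _.
apply: measurableI; apply: closed_measurable_rV; apply: closed_normal_in.
  exact: closed_coord_le.
exact: closed_coord_ge.
Qed.

(** [gauss] may be nonzero off [gauss_dom K], for example outside a half-space. Cut to 0 there, it
    is Borel on the whole space. *)
Definition gauss0 x : 'rV[R]_n := if `[< gauss_dom K x >] then gauss K x else 0.

Lemma gauss0E x : gauss_dom K x -> gauss0 x = gauss K x.
Proof. by move=> Gx; rewrite /gauss0 asboolT. Qed.

Lemma measurable_gauss0 : measurable (K : set (bV R n)) -> measurable_fun setT (gauss0 : bV R n -> bV R n).
Proof.
move=> mK; have mG := measurable_gauss_dom mK; apply: measurable_bVP => i.
apply: (measurability _ (RGenCInfty.measurableE R)) => _ [_ [c ->] <-]; rewrite setTI.
have -> : (fun t => gauss0 t ord0 i) @^-1` [set` `[c, +oo[] =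
   (gauss_dom K `&` normal_in [set th | c <= th ord0 i]) `|` (~` gauss_dom K `&` [set _ | c <= 0]).
  apply/seteqP; split => x /=; rewrite in_itv/= andbT /gauss0; case: asboolP => Gx.
  - move=> h; left; split => //; exists (gauss K x) => //; by rewrite gauss_outer.
  - by rewrite mxE => h; right.
  - by case=> [[_ [th /= h]]|[]//]; rewrite gauss_outer// => e; rewrite -e.
  - by rewrite mxE => -[[]//|[]].
apply: measurableU.
  apply: measurableI => //; apply: closed_measurable_rV; apply: closed_normal_in. exact: closed_coord_ge.
apply: measurableI; first exact: measurableC.
have [c0|c0] := boolP (c <= 0).
  by have -> : [set _ : bV R n | true] = setT by apply/seteqP; split.
by have -> : [set _ : bV R n | false] = set0 by apply/seteqP; split.
Qed.

End convex_body.

(** * The cone formula: n vol(cone over E) is the integral of the height of the tangent plane *)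

Section cone_surface.
Variables (R : realType) (m : nat).
Local Notation n := m.+1.
Variables (K : set 'rV[R]_n) (r0 : R).
Hypothesis Kconv : forall x y (l : R), (0 <= l <= 1)%R -> K x -> K y -> K ((1 - l) *: x + l *: y)%R.
Hypothesis r00 : (0 < r0)%R.
Hypothesis Kball : forall x, (enorm x <= r0)%R -> K x.
Hypothesis mK : measurable (K : set (bV R n)).
Implicit Types (x y th nu : 'rV[R]_n).
Let Kabs := ball_absorbing r00 Kball.
Local Notation j := (gauge K).
Local Notation G := (gauss_dom K).
Local Open Scope ereal_scope.

(** Central projection to the boundary. The set [K] may be unbounded, and rays on which the gauge
    vanishes are sent to 0; they are excluded by the condition [0 < j x] below. *)
Definition radial (x : bV R n) : bV R n := ((j x)^-1 *: x)%R.

Let mj : measurable_fun setT (j : bV R n -> R). Proof. exact: measurable_gauge. Qed.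
Let mG : measurable (G : set (bV R n)). Proof. exact: (measurable_gauss_dom Kconv r00 Kball mK). Qed.
Let j0 x : (0 <= j x)%R. Proof. exact: gauge_ge0. Qed.
Let jZ (l : R) x : (0 <= l)%R -> j (l *: x)%R = (l * j x)%R. Proof. exact: gaugeZ. Qed.

Lemma measurable_radial : measurable_fun setT radial.
Proof. by apply: measurable_invscale => //; exact: measurable_id. Qed.

Lemma radialZ (l : R) x : (0 < l)%R -> radial (l *: x)%R = radial x.
Proof.
move=> l0; rewrite /radial jZ ?ltW// invfM scalerA mulrAC mulVf ?mul1r//.
by rewrite gt_eqF.
Qed.

Definition ray_cone (E : set 'rV[R]_n) : set 'rV[R]_n := [set x | (0 < j x < 1)%R /\ E (radial x)].

Lemma measurable_jE (E : set 'rV[R]_n) : measurable (E : set (bV R n)) ->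
  measurable ([set x | (0 < j x)%R /\ E (radial x)] : set (bV R n)).
Proof.
move=> mE; apply: measurableI; first exact: measurable_lt_set.
by rewrite -[X in measurable X]setTI; exact: measurable_radial.
Qed.

Lemma measurable_ray_cone (E : set 'rV[R]_n) : measurable (E : set (bV R n)) ->
  measurable (ray_cone E : set (bV R n)).
Proof.
move=> mE; have -> : ray_cone E = [set x | (0 < j x)%R /\ E (radial x)] `&` [set x | j x < 1]%R.
  by apply/seteqP; split => [x [/andP[]]|x [[h ?] h2]]//; split => //; apply/andP.
by apply: measurableI; [exact: measurable_jE|exact: measurable_lt_set].
Qed.

(** A ray over [E] stays in the cone exactly for l < 1 / j x, and l^m integrates to (1 / j x)^n / n
    over that range. *)
Lemma lam_ray_cone (E : set 'rV[R]_n) : measurable (E : set (bV R n)) ->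
  n%:R%:E * lam (ray_cone E) =
  \int[@lam R n]_(x in [set x | (0 < j x)%R /\ E (radial x)]) (kw x * (j x)^-1 ^+ n)%:E.
Proof.
move=> mE; have mC := measurable_ray_cone mE.
have -> : lam (ray_cone E) = \int[@lam R n]_x (\1_(ray_cone E) x)%:E.
  by rewrite integral_indic// setIT.
rewrite polar_lam//; last by apply/measurable_EFinP; exact: measurable_indic.
pose D := [set x | (0 < j x)%R /\ E (radial x)].
have mD : measurable (D : set (bV R n)) by exact: measurable_jE.
have mw : measurable_fun setT (fun x : bV R n => (kw x * (j x)^-1 ^+ n)%R).
  apply: measurable_funM; first exact: measurable_kw. by apply: measurable_funX; exact: measurable_inv_fun.
rewrite (_ : \int[_]_x _ = \int[@lam R n]_(x in D) ((n%:R^-1)%:E * (kw x * (j x)^-1 ^+ n)%:E)); last first.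
  rewrite [RHS]integral_mkcond; apply: eq_integral => x _; rewrite patchE.
  have e (l : R) : (0 < l)%R -> \1_(ray_cone E) (l *: x)%R =
      if (0 < j x)%R && (l < (j x)^-1)%R && `[< E (radial x) >] then 1%R else 0%R :> R.
    move=> l0; rewrite indicE -[X in (nat_of_bool X)%:R]/(_ \in _).
    case: ifPn => [/andP[/andP[jx lj] /asboolP Ex]|h]; last first.
      rewrite memNset// => -[]; rewrite radialZ// jZ ?ltW// => /andP[h1 h2] Ex; move: h.
      rewrite pmulr_rgt0// in h1; rewrite h1 asboolT// andbT/=. by rewrite -[X in (_ < X)%R]mul1r ltr_pdivlMr// h2.
    rewrite mem_set//; split; last by rewrite radialZ. by rewrite jZ ?ltW// mulr_gt0//= -ltr_pdivlMr// mul1r.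
  case: ifPn => [/set_mem[jx Ex]|nE].
    pose h := fun l : R => (if (l < (j x)^-1)%R then (l ^+ m)%R else 0%R)%:E.
    rewrite (@eq_integral _ _ _ _ _ h); last first.
      move=> l; rewrite mem_setE in_itv/= andbT => l0; rewrite e// jx/= asboolT// andbT /h.
      by case: ifP => _; rewrite -EFinM ?mulr1 ?mulr0.
    have -> : \int[@leb R]_(l in `]0%R, +oo[) h l = \int[@leb R]_(l in `]0%R, ((j x)^-1)%R[) (l ^+ m)%:E.
      rewrite integral_mkcond [RHS]integral_mkcond; apply: eq_integral => l _.
      by rewrite !patchE !mem_setE !in_itv/= andbT /h; case: (ltP 0%R l) => //= _; case: ifP.
    rewrite integral_expr_itv ?invr_gt0// -!EFinM; congr EFin. by rewrite mulrA mulrC.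
  rewrite integral0_eq ?mule0// => l /=; rewrite in_itv/= andbT => l0; rewrite e//.
  case: ifP => [/andP[/andP[jx _] /asboolP Ex]|_]; last by rewrite mule0. by case/negP: nE; apply/mem_set.
rewrite ge0_integralZl//; last 2 first.
- by apply: measurable_funTS; exact/measurable_EFinP.
- by move=> x _; rewrite lee_fin mulr_ge0 ?kw_ge0// exprn_ge0// invr_ge0.
by rewrite muleA -EFinM divff ?pnatr_eq0// mul1e.
Qed.

(* Pieces of the boundary on which points and normals are almost constant: by convexity
   [|<x - y, nu>| <= e |x - y|], so that the central projection onto a hyperplane orthogonal
   to [nu] is almost a homothety. *)
Section piece.
Variables (rho d e c : R) (nu : 'rV[R]_n) (E : set 'rV[R]_n).
Hypotheses (mE : measurable (E : set (bV R n))) (EG : E `<=` G) (d01 : (0 < d < 1)%R).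
Hypotheses (nu1 : enorm nu = 1%R) (rho0 : (0 <= rho)%R) (e0 : (0 < e)%R) (Erho : forall x, E x -> (enorm x <= rho)%R)
  (Enu : forall x, E x -> (enorm (gauss K x - nu) <= e)%R)
  (Ec : forall x, E x -> (`|inner x nu - c| <= e)%R)
  (rc : (r0 <= c)%R) (ed : (e * (1 + rho) <= d * (1 - d) * r0)%R).

Let flat x := ((inner x nu)^-1 *: x)%R.
(** The distortion ratio of a piece: up to the scale [c], the projection [flat] and its inverse have
    Lipschitz constant at most [th], while [inner x nu] stays between (1 - d) c and (1 + d) c. *)
Let th := ((1 + d) / (1 - d))%R.
Let c0 : (0 < c)%R. Proof. exact: lt_le_trans rc. Qed.
Let th0 : (0 < th)%R. Proof. by have /andP[d0 d1] := d01; rewrite /th divr_gt0//; lra. Qed.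
Let edc : (e * (1 + rho) <= d * ((1 - d) * c))%R.
Proof.
have /andP[d0 d1] := d01; apply: le_trans ed _; rewrite -mulrA ler_pM2l//.
by rewrite ler_pM2l// subr_gt0.
Qed.
Let ed2 : (e * rho <= d * ((1 - d) * c))%R.
by apply: le_trans edc; rewrite ler_pM2l// lerDr. Qed.
Let ed1 : (e <= d * c)%R.
Proof.
have /andP[d0 d1] := d01; apply: (@le_trans _ _ (d * ((1 - d) * c)))%R.
  by apply: le_trans edc; rewrite ler_peMr ?lerDl// ltW.
by rewrite ler_pM2l// ler_piMl ?(ltW c0)// gerBl ltW.
Qed.

Let inu x : E x -> ((1 - d) * c <= inner x nu <= (1 + d) * c)%R.
by move=> /Ec; have := ed1; rewrite ler_norml => h /andP[h1 h2]; apply/andP; split; nra. Qed.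

Let dc0 : (0 < (1 - d) * c)%R. Proof. by have /andP[_ d1] := d01; rewrite mulr_gt0// subr_gt0. Qed.

Let inu0 x : E x -> (0 < inner x nu)%R.
by move=> /inu/andP[h _]; exact: lt_le_trans h. Qed.

(** Both points lie on the boundary, so the supporting inequality at each of them bounds the inner
    product from one side; replacing the true normal by [nu] costs e |x - y|. *)
Let tangent x y : E x -> E y -> (`|inner (x - y) nu| <= e * enorm (x - y))%R.
Proof.
have h u v : E u -> E v -> (inner (v - u) nu <= e * enorm (v - u))%R.
  move=> Eu Ev; have := gauss_gauge Kconv r00 Kball v (EG Eu).
  rewrite (gauss_dom_gauge Kconv r00 Kball (EG Ev)) mul1r => h.
  have := norm_inner_le (v - u) (gauss K u - nu); rewrite ler_norml innerBr => /andP[h1 _].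
  have h2 : (enorm (v - u) * enorm (gauss K u - nu) <= enorm (v - u) * e)%R by rewrite ler_wpM2l ?enorm_ge0 ?Enu.
  by move: h h1; rewrite !innerBl; nra.
by move=> Ex Ey; have := h x y Ex Ey; have := h y x Ey Ex; rewrite (enorm_distC y) ler_norml !innerBl; lra.
Qed.

Let flat_diff x y : E x -> E y -> (flat x - flat y =
  ((inner x nu * inner y nu)^-1 * inner y nu) *: (x - y) - ((inner x nu * inner y nu)^-1 * inner (x - y) nu) *: y)%R.
Proof.
move=> Ex Ey; have := inu0 Ex; have := inu0 Ey; rewrite innerBl /flat => h1 h2.
by apply/rowP => i; rewrite !mxE; field; rewrite !gt_eqF.
Qed.

Let flat_upper x y : E x -> E y -> (enorm (flat x - flat y) <= th / c * enorm (x - y))%R.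
Proof.
move=> Ex Ey; rewrite flat_diff//; have ix := inu0 Ex; have iy := inu0 Ey.
apply: le_trans (enormB _ _) _; rewrite !enormZ !normrM.
rewrite [`|(_ * _)^-1|%R]gtr0_norm ?invr_gt0 ?mulr_gt0// [`|inner y nu|%R]gtr0_norm//.
have t := tangent Ex Ey; have n0 := enorm_ge0 (x - y); have ny := Erho Ey; have y0 := enorm_ge0 y.
have /andP[a1 a2] := inu Ex; have /andP[b1 b2] := inu Ey; have /andP[d0 d1] := d01.
rewrite -!mulrA -mulrDr ler_pdivrMl ?mulr_gt0//.
apply: (@le_trans _ _ (inner y nu * enorm (x - y) + e * rho * enorm (x - y)))%R.
  rewrite lerD2l mulrAC; apply: ler_pM => //.
have h : (e * rho <= d * inner y nu)%R by apply: le_trans ed2 _; rewrite ler_pM2l.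
apply: (@le_trans _ _ ((1 + d) * inner y nu * enorm (x - y)))%R.
  by rewrite -mulrDl ler_wpM2r//; lra.
rewrite /th; have : (1 <= inner x nu / ((1 - d) * c))%R by rewrite ler_pdivlMr// mul1r.
move=> h1; rewrite (_ : (inner x nu * inner y nu * _)%R =
  ((1 + d) * inner y nu * enorm (x - y) * (inner x nu / ((1 - d) * c)))%R). by rewrite ler_peMr// !mulr_ge0//; lra.
by field; rewrite !gt_eqF//; lra.
Qed.

Let flat_lower x y : E x -> E y -> (enorm (x - y) <= th * c * enorm (flat x - flat y))%R.
Proof.
move=> Ex Ey; rewrite flat_diff//; have ix := inu0 Ex; have iy := inu0 Ey.
have t := tangent Ex Ey; have n0 := enorm_ge0 (x - y); have ny := Erho Ey; have y0 := enorm_ge0 y.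
have /andP[a1 a2] := inu Ex; have /andP[b1 b2] := inu Ey; have /andP[d0 d1] := d01.
set A := (_ *: (x - y))%R; set B := (_ *: y)%R.
have : (enorm A - enorm B <= enorm (A - B))%R.
  by rewrite lerBlDr; have := enormD (A - B) B; rewrite subrK.
move=> h; apply: (@le_trans _ _ (th * c * (enorm A - enorm B)))%R; last first.
  by rewrite ler_pM2l// mulr_gt0.
rewrite /A /B !enormZ !normrM [`|(_ * _)^-1|%R]gtr0_norm ?invr_gt0 ?mulr_gt0// [`|inner y nu|%R]gtr0_norm//.
rewrite -(mulrA _ (inner y nu)) -(mulrA _ `|_|%R) -mulrBr.
apply: (@le_trans _ _ (th * c * ((inner x nu * inner y nu)^-1 * ((1 - d) * inner y nu * enorm (x - y)))))%R.
  have -> : (th * c * ((inner x nu * inner y nu)^-1 * ((1 - d) * inner y nu * enorm (x - y))) =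
     enorm (x - y) * ((1 + d) * c / inner x nu))%R.
    by rewrite /th; field; rewrite !gt_eqF//; lra.
  by rewrite ler_peMr// ler_pdivlMr// mul1r.
rewrite (ler_pM2l (mulr_gt0 th0 c0)).
have ixy : (0 < (inner x nu * inner y nu)^-1)%R by rewrite invr_gt0 mulr_gt0.
rewrite (ler_pM2l ixy).
have h1 : (e * rho * enorm (x - y) <= d * inner y nu * enorm (x - y))%R.
  by rewrite ler_wpM2r//; apply: le_trans ed2 _; rewrite ler_pM2l.
have : (`|inner (x - y) nu| * enorm y <= e * enorm (x - y) * rho)%R by apply: ler_pM.
lra.
Qed.

Let S : set 'rV[R]_n := flat @` E.

Let SE : S = [set z | inner z nu = 1%R] `&` [set z | (0 < j z)%R /\ E (radial z)].
Proof.
apply/seteqP; split => [_ [x Ex <-]|z [/= z1 [jz Ez]]].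
  have ix := inu0 Ex; have jx := gauss_dom_gauge Kconv r00 Kball (EG Ex).
  split; first by rewrite /= innerZl mulVf// gt_eqF. split; first by rewrite jZ ?invr_ge0 ?ltW// jx mulr1 invr_gt0.
  by rewrite radialZ ?invr_gt0// /radial jx invr1 scale1r.
exists (radial z) => //; rewrite /flat /radial innerZl z1 mulr1 invrK scalerA.
by rewrite divff ?scale1r// gt_eqF.
Qed.

Let mS : measurable (S : set (bV R n)).
Proof.
rewrite SE; apply: measurableI; last exact: measurable_jE.
have -> : [set z | inner z nu = 1%R] = [set z | inner z nu <= 1]%R `&` [set z | 1 <= inner z nu]%R.
  by apply/seteqP; split => [z /= ->|z [/= h1 h2]]; [split|apply/eqP; rewrite eq_le h1].
have mi := measurable_innerl nu.
by apply: measurableI; apply: measurable_le_set.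
Qed.

Let SH : n%:R%:E * lam (flat_cone nu S) = hausdorff_outer m S.
by apply: flat_coneE => // z; rewrite SE => -[]. Qed.

Let scaled (a : R) : (0 < a)%R -> lam ((fun x : bV R n => a^-1 *: x + 0)%R @^-1` flat_cone nu S) =
  (a ^+ n)%:E * lam (flat_cone nu S).
Proof.
move=> a0; rewrite [LHS]lam_affine ?invr_eq0 ?gt_eqF//; last exact: measurable_flat_cone.
by rewrite normfV invrK gtr0_norm.
Qed.

Let m1 := n%:R%:E * lam (ray_cone E).

(** Upper half of a sandwich: the cone over [E] lies between the dilates of the flat cone over [S]
    by (1 - d) c and by (1 + d) c. *)
Let m1_upper : m1 <= (((1 + d) * c) ^+ n * (th / c) ^+ m)%:E * hausdorff_outer m E.
Proof.
have a0 : (0 < (1 + d) * c)%R by have /andP[d0 d1] := d01; rewrite mulr_gt0//; lra.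
apply: (@le_trans _ _ (n%:R%:E * ((((1 + d) * c) ^+ n)%:E * lam (flat_cone nu S)))).
  rewrite lee_pmul2l// -scaled//; apply: le_measure; rewrite ?inE.
  - exact: measurable_ray_cone.
  - rewrite -[X in measurable X]setTI; apply: measurable_affine => //; exact: measurable_flat_cone.
  move=> x [/andP[jx0 jx1] Ex]; rewrite /= addr0.
  have ex : x = (j x *: radial x)%R by rewrite /radial scalerA divff ?scale1r// gt_eqF.
  have ir : inner x nu = (j x * inner (radial x) nu)%R by rewrite {1}ex innerZl.
  have ix := inu0 Ex; have /andP[_ i2] := inu Ex. split; rewrite innerZl ir.
    apply/andP; split; first by rewrite mulr_gt0 ?invr_gt0// mulr_gt0. rewrite ltr_pdivrMl// mulr1.
    apply: lt_le_trans i2; by rewrite gtr_pMl.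
  exists (radial x) => //. have -> : flat (radial x) = (((inner (radial x) nu)^-1 * (j x)^-1) *: x)%R.
    by rewrite /flat {2}/radial scalerA.
  rewrite scalerA; congr (_ *: _)%R; have /andP[d0 _] := d01. by field; rewrite !gt_eqF//; lra.
rewrite muleCA SH EFinM -muleA lee_pmul2l ?lte_fin ?exprn_gt0//.
by apply: hausdorff_lipschitz; [exact: divr_gt0|move=> x y; exact: flat_upper].
Qed.

Let m1_lower : hausdorff_outer m E <= ((th * c) ^+ m / ((1 - d) * c) ^+ n)%:E * m1.
Proof.
have tc : (0 < th * c)%R by rewrite mulr_gt0.
apply: le_trans (hausdorff_colipschitz m tc flat_lower) _.
rewrite EFinM -muleA lee_pmul2l ?lte_fin ?exprn_gt0// -lee_pdivrMl ?invr_gt0 ?exprn_gt0//.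
rewrite invrK -SH muleCA -scaled// lee_pmul2l//; apply: le_measure; rewrite ?inE.
- rewrite -[X in measurable X]setTI; apply: measurable_affine => //; exact: measurable_flat_cone.
- exact: measurable_ray_cone.
move=> x /= []; rewrite addr0 innerZl => /andP[h1 h2]; rewrite scalerA.
have ix : (0 < inner x nu)%R by move: h1; rewrite pmulr_rgt0 ?invr_gt0.
have -> : ((((1 - d) * c)^-1 * inner x nu)^-1 * ((1 - d) * c)^-1 = (inner x nu)^-1)%R.
  by field; rewrite !gt_eqF//; have /andP[_ d1] := d01; lra.
rewrite SE => -[_ [jx Ex]]; rewrite radialZ ?invr_gt0// in Ex.
have jx0 : (0 < j x)%R by move: jx; rewrite jZ ?invr_ge0 ?ltW// pmulr_rgt0 ?invr_gt0.
split => //; rewrite jx0/=.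
have ex : x = (j x *: radial x)%R by rewrite /radial scalerA divff ?scale1r// gt_eqF.
have ir : inner x nu = (j x * inner (radial x) nu)%R by rewrite {1}ex innerZl.
have ixr := inu0 Ex; have /andP[i1 _] := inu Ex.
rewrite -(ltr_pM2r ixr) mul1r -ir; apply: lt_le_trans i1.
by rewrite ltr_pdivrMl// mulr1 in h2.
Qed.

Let inner_gauss x : E x -> ((1 - d) * c <= inner x (gauss0 K x) <= (1 + d) * c)%R.
Proof.
move=> Ex; rewrite gauss0E; last exact: EG.
have := Ec Ex; have := norm_inner_le x (gauss K x - nu); rewrite innerBr.
have h : (enorm x * enorm (gauss K x - nu) <= rho * e)%R.
  by apply: ler_pM; rewrite ?enorm_ge0 ?Erho ?Enu.
have /andP[d0 d1] := d01.
have h' : (e * (1 + rho) <= d * c)%R.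
  apply: le_trans edc _; rewrite ler_pM2l// ler_piMl ?(ltW c0)// gerBl; exact: ltW.
by rewrite !ler_norml; lra.
Qed.

Let m2 := \int[@hm R n m]_(x in E) (inner x (gauss0 K x))%:E.

Let mv : measurable_fun (E : set (bV R n)) (fun x : bV R n => (inner x (gauss0 K x))%:E).
Proof.
apply: measurable_funTS; apply/measurable_EFinP.
apply: measurable_sum => i; apply: measurable_funM; first exact: measurable_coordi.
exact: (measurableT_comp (measurable_coordi i) (measurable_gauss0 Kconv r00 Kball mK)).
Qed.

Let m2_upper : m2 <= ((1 + d) * c)%:E * hausdorff_outer m E.
Proof.
have a0 : (0 <= (1 + d) * c)%R by have /andP[d0 d1] := d01; rewrite mulr_ge0 ?(ltW c0)//; lra.
rewrite -[hausdorff_outer m E]/(@hm R n m E) -integral_cst//; apply: ge0_le_integral => //.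
- move=> x /inner_gauss/andP[h _]; rewrite lee_fin; apply: le_trans h; exact: ltW.
- by move=> x /inner_gauss/andP[_ h]; rewrite lee_fin.
Qed.

Let m2_lower : ((1 - d) * c)%:E * hausdorff_outer m E <= m2.
Proof.
rewrite -[hausdorff_outer m E]/(@hm R n m E) -integral_cst//; apply: ge0_le_integral => //.
- by move=> x _; rewrite lee_fin ltW.
- by move=> x /inner_gauss/andP[h _]; rewrite lee_fin.
Qed.

(** All distortions are bounded by powers of (1 + d) / (1 - d). The exponent n + n is a common crude
    bound, sufficient because [d] tends to 0 afterwards. *)
Lemma piece_m1_le : n%:R%:E * lam (ray_cone E) <=
  (((1 + d) / (1 - d)) ^+ (n + n))%:E * \int[@hm R n m]_(x in E) (inner x (gauss0 K x))%:E.
Proof.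
have /andP[d0 d1] := d01.
apply: le_trans m1_upper _; apply: (@le_trans _ _ ((th ^+ (n + n))%:E * (((1 - d) * c)%:E * hausdorff_outer m E))).
  rewrite muleA; apply: lee_wpmul2r; first exact: hausdorff_outer_ge0. rewrite -EFinM lee_fin -/th.
  have -> : (((1 + d) * c) ^+ n * (th / c) ^+ m = (1 + d) ^+ n * th ^+ m * c)%R.
    have d1n : (1 - d != 0)%R by rewrite gt_eqF// subr_gt0. rewrite !exprMn !exprVn [(c ^+ n)%R]exprS.
    move: (expf_neq0 m d1n) (expf_neq0 m (lt0r_neq0 c0)).
    move: ((1 + d) ^+ n)%R ((1 + d) ^+ m)%R ((1 - d) ^+ m)%R (c ^+ m)%R => A B D C D0 C0. by field; rewrite ?C0 ?D0.
  rewrite exprD mulrA ler_pM2r//. have -> : (th ^+ n * th ^+ n * (1 - d) = th ^+ n * th ^+ m * (1 + d))%R.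
    by rewrite [X in (_ * X * _)%R]exprS /th; field; rewrite gt_eqF// subr_gt0.
  apply: (@le_trans _ _ (th ^+ n * th ^+ m)%R).
    rewrite ler_pM2r ?exprn_gt0// lerXn2r ?nnegrE ?(ltW th0)//; first lra.
    by rewrite /th ler_peMr ?invf_ge1 ?subr_gt0//; lra.
  by rewrite ler_peMr ?mulr_ge0 ?exprn_ge0 ?(ltW th0)//; lra.
by rewrite lee_pmul2l// lte_fin exprn_gt0.
Qed.

Lemma piece_m2_le : \int[@hm R n m]_(x in E) (inner x (gauss0 K x))%:E <=
  (((1 + d) / (1 - d)) ^+ (n + n))%:E * (n%:R%:E * lam (ray_cone E)).
Proof.
have /andP[d0 d1] := d01; have d1' : (0 < 1 - d)%R by rewrite subr_gt0.
apply: le_trans m2_upper _.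
have a0 : (0 < (1 + d) * c)%R by rewrite mulr_gt0//; lra.
apply: (@le_trans _ _ (((1 + d) * c)%:E * (((th * c) ^+ m / ((1 - d) * c) ^+ n)%:E * m1))).
  by rewrite lee_pmul2l.
rewrite muleA; apply: lee_wpmul2r; first by rewrite mule_ge0.
rewrite -EFinM lee_fin -/th.
have -> : ((1 + d) * c * ((th * c) ^+ m / ((1 - d) * c) ^+ n) = th * th ^+ m * ((1 - d)^-1) ^+ m)%R.
  by rewrite !exprMn exprVn ![((_ : R) ^+ n)%R]exprS /th; field; rewrite !expf_neq0 ?gt_eqF.
rewrite -exprS exprD ler_pM2l ?exprn_gt0//.
apply: (@le_trans _ _ (th ^+ m)%R).
  rewrite lerXn2r ?nnegrE ?invr_ge0 ?(ltW th0) ?(ltW d1')//. by rewrite /th ler_peMl ?invr_ge0 ?(ltW d1')//; lra.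
rewrite [leRHS]exprS ler_peMl ?exprn_ge0 ?(ltW th0)// /th.
by rewrite ler_pdivlMr// mul1r; lra.
Qed.

End piece.

Let mg : measurable_fun setT (fun x : bV R n => inner x (gauss0 K x)).
Proof.
apply: measurable_sum => i; apply: measurable_funM; first exact: measurable_coordi.
exact: (measurableT_comp (measurable_coordi i) (measurable_gauss0 Kconv r00 Kball mK)).
Qed.

Let ig0 x : (0 <= inner x (gauss0 K x))%R.
Proof.
rewrite /gauss0; case: asboolP => [Gx|_]; last by rewrite inner0r.
by apply: le_trans (gauss_ge_r0 r00 Kball Gx); exact: ltW.
Qed.

Lemma rat_dense_rV x (e : R) : (0 < e)%R ->
  exists u : {ffun 'I_n -> rat}, (enorm (x - \row_i ratr (u i)) <= e)%R.
Proof.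
move=> e0; have s0 : (0 < Num.sqrt n%:R :> R)%R by rewrite sqrtr_gt0.
pose e' := (e / Num.sqrt n%:R)%R; have e'0 : (0 < e')%R by rewrite divr_gt0.
have /fin_all_exists[u hu] : forall i : 'I_n, exists q : rat, (`|x ord0 i - ratr q| <= e')%R.
  move=> i; have lt : (x ord0 i - e' < x ord0 i + e')%R by lra.
  by have [q] := rat_in_itvoo lt; rewrite in_itv/= => /andP[h1 h2]; exists q; rewrite ler_norml; lra.
exists [ffun i => u i]; apply: le_trans (enorm_le_coord (ltW e'0) _) _.
  by move=> i; rewrite !mxE ffunE.
by rewrite /e' mulrC divfK// gt_eqF.
Qed.

(** The mesh is chosen so that the hypothesis [ed] of a piece becomes an equality. It shrinks with
    the radius [rho], since an error in the normal is multiplied by the distance to the origin. *)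
Let eps (d : R) (rho : nat) := (d * (1 - d) * r0 / (1 + rho%:R))%R.
Let chart (d : R) (k : nat) : set 'rV[R]_n :=
  if @pickle_inv (nat * {ffun 'I_n -> rat} * {ffun 'I_n -> rat})%type k is Some (rho, u, v) then
    G `&` ([set x | enorm x <= rho%:R]%R `&` ([set x | enorm (x - \row_i ratr (u i)) <= eps d rho / 2]%R
      `&` [set x | enorm (gauss0 K x - \row_i ratr (v i)) <= eps d rho / 2]%R))
  else set0.

Let eps0 (d : R) rho : (0 < d < 1)%R -> (0 < eps d rho)%R.
Proof.
move=> /andP[d0 d1]; have r1 : (0 < 1 + rho%:R :> R)%R by rewrite ltr_wpDr.
by apply: divr_gt0 => //; apply: mulr_gt0 => //; rewrite mulr_gt0// subr_gt0.
Qed.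

Let mchart d k : measurable (chart d k : set (bV R n)).
Proof.
rewrite /chart; case: pickle_inv => [[[rho u] v]|]; last exact: measurable0.
apply: measurableI => //; apply: measurableI.
  by apply: measurable_le_set => //; exact: measurable_enorm.
apply: measurableI; first exact: measurable_cball.
rewrite -[X in measurable X]setTI.
have mgs := measurable_gauss0 Kconv r00 Kball mK.
exact: (mgs measurableT _ (measurable_cball _ _)).
Qed.

Let chart_cover (d : R) : (0 < d < 1)%R -> G `<=` \bigcup_k chart d k.
Proof.
move=> d01 x Gx; pose rho := (Num.truncn (enorm x)).+1.
have e0 : (0 < eps d rho / 2)%R by rewrite divr_gt0// eps0.
have [u hu] := rat_dense_rV x e0; have [v hv] := rat_dense_rV (gauss0 K x) e0.
exists (pickle (rho, u, v)) => //; rewrite /chart pickleK_inv; split => //; split => //=.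
by rewrite ltW// truncnS_gt.
Qed.

Let m1 (E : set 'rV[R]_n) := n%:R%:E * lam (ray_cone E).
Let m2 (E : set 'rV[R]_n) := \int[@hm R n m]_(x in E) (inner x (gauss0 K x))%:E.

Let chart_le (d : R) k (E : set 'rV[R]_n) : (0 < d < 1)%R -> measurable (E : set (bV R n)) -> E `<=` chart d k ->
  m1 E <= (((1 + d) / (1 - d)) ^+ (n + n))%:E * m2 E /\ m2 E <= (((1 + d) / (1 - d)) ^+ (n + n))%:E * m1 E.
Proof.
move=> d01 mE EF; have [->|/set0P[x0 Ex0]] := eqVneq E set0.
  rewrite /m1 /m2 integral_set0 mule0 (_ : ray_cone set0 = set0); last by apply/seteqP; split => // x [].
  by rewrite [X in _ * X]measure0 !mule0.
move: EF; rewrite /chart; case: pickle_inv => [[[rho u] v]|]; last by move=> /(_ _ Ex0).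
move=> EF; have e0 := eps0 rho d01.
have EG : E `<=` G by move=> x /EF[].
have Er x : E x -> (enorm x <= rho%:R)%R by move=> /EF[_ []].
have close x : E x -> (enorm (x - x0) <= eps d rho)%R.
  move=> /EF[_ [_ [/= h _]]]; have [_ [_ [/= h0 _]]] := EF _ Ex0.
  by have := enorm_triangle x (\row_i ratr (u i)) x0; rewrite (enorm_distC (\row_i _) x0); lra.
have gclose x : E x -> (enorm (gauss K x - gauss K x0) <= eps d rho)%R.
  move=> Ex; rewrite -!gauss0E; try exact: EG. have [_ [_ [_ /= h]]] := EF _ Ex; have [_ [_ [_ /= h0]]] := EF _ Ex0.
  by have := enorm_triangle (gauss0 K x) (\row_i ratr (v i)) (gauss0 K x0); rewrite (enorm_distC (\row_i _) (gauss0 K x0)); lra.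
have nu1 := gauss_unit (EG _ Ex0).
have Ec x : E x -> (`|inner x (gauss K x0) - inner x0 (gauss K x0)| <= eps d rho)%R.
  move=> Ex; rewrite -innerBl; apply: le_trans (norm_inner_le _ _) _. by rewrite nu1 mulr1 close.
have rc := gauss_ge_r0 r00 Kball (EG _ Ex0).
have ed : (eps d rho * (1 + rho%:R) <= d * (1 - d) * r0)%R.
  by rewrite /eps divfK// gt_eqF// ltr_wpDr.
have rho0 : (0 <= rho%:R :> R)%R by [].
split; first exact: (piece_m1_le mE EG d01 nu1 rho0 e0 Er gclose Ec rc ed).
exact: (piece_m2_le mE EG d01 nu1 rho0 e0 Er gclose Ec rc ed).
Qed.

Let m1_sigma (E : nat -> set (bV R n)) : (forall k, measurable (E k)) -> trivIset setT E ->
  m1 (\bigcup_k E k) = \sum_(0 <= k <oo) m1 (E k).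
Proof.
move=> mE tE; rewrite /m1 (_ : ray_cone _ = \bigcup_k ray_cone (E k)); last first.
  by apply/seteqP; split => [x [h [k _ ?]]|x [k _ [h ?]]]; [exists k|split => //; exists k].
rewrite [X in _ * X]measure_bigcup//=; last 2 first.
- by move=> k _; exact: measurable_ray_cone.
- apply/trivIsetP => i k _ _ ik; apply/seteqP; split => // x [[_ Ei] [_ Ek]].
  by have /trivIsetP/(_ i k I I ik) := tE; rewrite -subset0 => /(_ (radial x)); apply.
under [in X in _ * X]eq_eseriesl do rewrite in_setT.
by rewrite nneseriesZl// => k _; exact: measure_ge0.
Qed.

Let m2_sigma (E : nat -> set (bV R n)) : (forall k, measurable (E k)) -> trivIset setT E ->
  m2 (\bigcup_k E k) = \sum_(0 <= k <oo) m2 (E k).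
Proof.
move=> mE tE; rewrite /m2 ge0_integral_bigcup//; last by move=> x _; rewrite lee_fin.
by apply: measurable_funTS; exact/measurable_EFinP.
Qed.

Let m1_ge0 E : 0 <= m1 E. Proof. by rewrite mule_ge0. Qed.
Let m2_ge0 E : 0 <= m2 E. Proof. by apply: integral_ge0 => x _; rewrite lee_fin. Qed.

Let le_pow_limit (a b : \bar R) N : 0 <= b ->
  (forall d : R, (0 < d < 1)%R -> a <= (((1 + d) / (1 - d)) ^+ N)%:E * b) -> a <= b.
Proof.
case: b => [b| |]; [|by move=> _ _; rewrite leey|by []].
rewrite lee_fin => b0 h; apply/lee_addgt0Pr => e e0.
have [K' K0 hK] := @prod_shift_le R _ (index_enum 'I_N) (fun=> 1%R) (fun=> ler01).
pose s := Num.min 1%R (e / (1 + K' * b))%R.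
have Kb : (0 < 1 + K' * b)%R by rewrite ltr_wpDr// mulr_ge0.
have s0 : (0 < s)%R by rewrite lt_min ltr01 divr_gt0.
have s1 : (s <= 1)%R by rewrite ge_min lexx.
(* This solves (1 + d) / (1 - d) = 1 + s, so that [prod_shift_le] bounds the power. *)
pose d := (s / (2 + s))%R.
have d01 : (0 < d < 1)%R by apply/andP; split; [rewrite divr_gt0//; lra|rewrite ltr_pdivrMr; lra].
apply: le_trans (h d d01) _; rewrite -EFinM -EFinD lee_fin.
have -> : ((1 + d) / (1 - d) = 1 + s)%R by rewrite /d; field; rewrite !gt_eqF//; lra.
have := hK s; rewrite !prodr_const card_ord expr1n (ltW s0) s1 => /(_ isT) hs.
apply: le_trans (ler_wpM2r b0 hs) _; rewrite mulrDl mul1r lerD2l -mulrA.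
have : (s * (1 + K' * b) <= e)%R by rewrite -ler_pdivlMr// ge_min lexx orbT.
by rewrite mulrDr mulr1; lra.
Qed.

(** Both sides are countably additive in [E] and agree on every chart up to the factor ((1 + d) / (1
    - d))^(2n); countably many charts cover the domain of the Gauss map, and [d] is arbitrary. *)
Lemma surface_cone_measure (E : set 'rV[R]_n) : measurable (E : set (bV R n)) -> E `<=` G ->
  n%:R%:E * lam (ray_cone E) = \int[@hm R n m]_(x in E) (inner x (gauss0 K x))%:E.
Proof.
move=> mE EG; apply/eqP; rewrite eq_le; apply/andP; split.
- apply: (@le_pow_limit _ _ (n + n)); first exact: m2_ge0.
  move=> d d01; have q0 : (0 <= ((1 + d) / (1 - d)) ^+ (n + n))%R.
    by have /andP[d0 d1] := d01; rewrite exprn_ge0// divr_ge0; lra.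
  refine (@le_of_countable_cover _ (bV R n) R m1 (fun E : set (bV R n) => (((1 + d) / (1 - d)) ^+ (n + n))%:E * m2 E) (chart d) _ _ _ _ _ E mE _) => //.
  + by move=> F mF tF; rewrite m2_sigma// -nneseriesZl.
  + by move=> k F mF Fk; have [] := chart_le d01 mF Fk.
  + by apply: subset_trans EG _; exact: chart_cover.
- apply: (@le_pow_limit _ _ (n + n)); first exact: m1_ge0.
  move=> d d01; have q0 : (0 <= ((1 + d) / (1 - d)) ^+ (n + n))%R.
    by have /andP[d0 d1] := d01; rewrite exprn_ge0// divr_ge0; lra.
  refine (@le_of_countable_cover _ (bV R n) R m2 (fun E : set (bV R n) => (((1 + d) / (1 - d)) ^+ (n + n))%:E * m1 E) (chart d) _ _ _ _ _ E mE _) => //.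
  + by move=> F mF tF; rewrite m1_sigma// -nneseriesZl.
  + by move=> k F mF Fk; have [] := chart_le d01 mF Fk.
  + by apply: subset_trans EG _; exact: chart_cover.
Qed.

(** The formula for sets turned into one for integrals. The left side is the form in which the rays
    through the walls appear after polar integration and integration over the height. *)
Lemma cone_surface (z : bV R n -> \bar R) : measurable_fun setT z -> (forall x, 0 <= z x) ->
  \int[@lam R n]_(x in [set x | (0 < j x)%R /\ G (radial x)]) ((kw x * (j x)^-1 ^+ n)%:E * z (radial x)) =
  \int[@hm R n m]_(x in G) ((inner x (gauss0 K x))%:E * z x).
Proof.
move=> mz z0; have mw : measurable_fun setT (fun x : bV R n => (kw x * (j x)^-1 ^+ n)%R).
  apply: measurable_funM; first exact: measurable_kw. by apply: measurable_funX; exact: measurable_inv_fun.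
apply: (@weighted_integral_transfer _ _ _ _ _ _ _ (@lam R n) (@hm R n m)
   [set x | (0 < j x)%R /\ G (radial x)] G (fun x => (kw x * (j x)^-1 ^+ n)%R)
   (fun x => inner x (gauss0 K x)) radial id) => //.
- exact: measurable_jE.
- exact: measurable_funTS.
- exact: measurable_funTS.
- by move=> x _; rewrite mulr_ge0 ?kw_ge0// exprn_ge0// invr_ge0.
- by apply: measurable_funTS; exact: measurable_radial.
- move=> A mA; transitivity (n%:R%:E * lam (ray_cone (G `&` A))).
    rewrite lam_ray_cone; last exact: measurableI.
    rewrite integral_mkcond [RHS]integral_mkcond; apply: eq_integral => x _; rewrite !patchE.
    case: ifPn => [/set_mem[jx Gx]|nx].
      rewrite indicE; case: (boolP (radial x \in A)) => [/set_mem Ax|Ax].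
        by rewrite mem_set ?mule1.
      by rewrite mule0 memNset// => -[_ [_ /mem_set]]; exact/negP.
    rewrite ifN//; apply: contra nx => /set_mem[jx [Gx _]]; exact/mem_set.
  rewrite surface_cone_measure; last 2 first.
  + exact: measurableI.
  + by move=> x [].
  rewrite [LHS]integral_mkcond [RHS]integral_mkcond; apply: eq_integral => x _; rewrite !patchE in_setI.
  case: (boolP (x \in G)) => // _; rewrite indicE. by case: (x \in A); rewrite ?mule1 ?mule0.
Qed.

End cone_surface.

(** * One-sided derivatives of a sublinear functional *)

Section directional.
Variables (R : realType) (V : lmodType R) (J : V -> R).
Hypothesis J0 : forall v, 0 <= J v.
Hypothesis JZ : forall (a : R) v, 0 <= a -> J (a *: v) = a * J v.
Hypothesis JD : forall u v, J (u + v) <= J u + J v.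
Implicit Types (z u v w : V) (t a : R).

Definition slope z v t : R := (J (z + t *: v) - J z) / t.
(** Slopes are nondecreasing in t by convexity, so that the infimum is the right derivative at 0; as
    an infimum it needs no existence proof and gives the tangent inequality at once. *)
Definition dirder z v : R := inf [set slope z v t | t in [set t : R | 0 < t]].

Lemma slope_ge z v t : 0 < t -> - J (- v) <= slope z v t.
Proof.
move=> t0; rewrite ler_pdivlMr// mulNr.
have := JD (z + t *: v) (t *: - v); rewrite scalerN addrK -scalerN (JZ _ (ltW t0)); lra.
Qed.

Lemma slope_le z v t : 0 < t -> slope z v t <= J v.
Proof.
by move=> t0; rewrite ler_pdivrMr//; have := JD z (t *: v); rewrite (JZ _ (ltW t0)); lra.
Qed.

Let slope_lb z v : has_lbound [set slope z v t | t in [set t : R | 0 < t]].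
by exists (- J (- v)) => _ [t /= t0 <-]; exact: slope_ge. Qed.

Let slope_ne z v : [set slope z v t | t in [set t : R | 0 < t]] !=set0.
by exists (slope z v 1), 1 => /=. Qed.

Lemma dirder_le z v t : 0 < t -> dirder z v <= slope z v t.
Proof. by move=> t0; apply: ge_inf => //; exists t. Qed.

Lemma le_dirder z v a : (forall t, 0 < t -> a <= slope z v t) -> a <= dirder z v.
Proof. by move=> h; apply: lb_le_inf => // _ [t /= t0 <-]; exact: h. Qed.

Lemma dirder_ge z v : - J (- v) <= dirder z v.
Proof. by apply: le_dirder => t; exact: slope_ge. Qed.

Lemma dirder_leJ z v : dirder z v <= J v.
Proof. by apply: le_trans (dirder_le z v ltr01) _; exact: slope_le. Qed.

Lemma slope_homo z v t t' : 0 < t -> t <= t' -> slope z v t <= slope z v t'.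
Proof.
move=> t0 tt'; have t'0 := lt_le_trans t0 tt'.
rewrite ler_pdivrMr// mulrAC ler_pdivlMr//.
have := JD ((t' - t) *: z) (t *: (z + t' *: v)).
have -> : (t' - t) *: z + t *: (z + t' *: v) = t' *: (z + t *: v).
  by rewrite !scalerDr addrA -scalerDl subrK !scalerA (mulrC t).
rewrite (JZ _ (ltW t'0)) (JZ _ (ltW t0)) (@JZ (t' - t)) ?subr_ge0//; lra.
Qed.

Lemma dirder_cvg z v (e : R) : 0 < e -> exists2 t0 : R, 0 < t0 &
  forall t, 0 < t <= t0 -> slope z v t <= dirder z v + e.
Proof.
move=> e0; have lt : dirder z v < dirder z v + e by rewrite ltrDl.
have [_ [t /= t0 <-] h] := inf_lt (slope_ne z v) lt.
exists t => // t' /andP[t'0 tt']; apply: le_trans (ltW h); exact: slope_homo.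
Qed.

(** By homogeneity the tangent at [z] supports [J] at every point [l *: z] too, so a single
    derivative controls the whole ray. *)
Lemma dirder_ray z v (l t : R) : 0 < l -> 0 < t -> l * J z + t * dirder z v <= J (l *: z + t *: v).
Proof.
move=> l0 t0; have -> : l *: z + t *: v = l *: (z + (t / l) *: v).
  by rewrite scalerDr scalerA mulrCA divff ?mulr1// gt_eqF.
rewrite (JZ _ (ltW l0)); have tl : 0 < t / l by rewrite divr_gt0.
have := dirder_le z v tl; rewrite ler_pdivlMr// -(ler_pM2l l0).
have -> : l * (dirder z v * (t / l)) = t * dirder z v by field; rewrite gt_eqF.
lra.
Qed.

Lemma dirder_subgrad z w : J z + dirder z (w - z) <= J w.
Proof.
have := dirder_le z (w - z) ltr01; rewrite /slope scale1r (addrC z) subrK divr1; lra.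
Qed.

Lemma dirderZ z v a : 0 < a -> dirder z (a *: v) = a * dirder z v.
Proof.
have le a' v' : 0 < a' -> dirder z (a' *: v') <= a' * dirder z v'.
  move=> a0; rewrite -ler_pdivrMl//; apply: le_dirder => t t0.
  rewrite ler_pdivrMl//; have ta : 0 < t / a' by rewrite divr_gt0.
  apply: le_trans (dirder_le _ _ ta) _; rewrite /slope scalerA divfK ?gt_eqF//.
  by rewrite (_ : _ / (t / a') = a' * ((J (z + t *: v') - J z) / t))//; field; rewrite !gt_eqF.
move=> a0; apply/eqP; rewrite eq_le le//= -ler_pdivlMl//.
rewrite -{1}[v](scalerK (lt0r_neq0 a0)); apply: le; by rewrite invr_gt0.
Qed.

Lemma dirderD z u v : dirder z (u + v) <= dirder z u + dirder z v.
Proof.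
apply/ler_addgt0Pr => e e0.
have e2 : 0 < e / 2 by rewrite divr_gt0.
have [s s0 hs] := dirder_cvg z u e2; have [t t0 ht] := dirder_cvg z v e2.
pose r := Num.min s t; have r0 : 0 < r by rewrite lt_min s0.
have hu : slope z u r <= dirder z u + e / 2 by apply: hs; rewrite r0 ge_min lexx.
have hv : slope z v r <= dirder z v + e / 2 by apply: ht; rewrite r0 ge_min lexx orbT.
have r2 : 0 < r / 2 by rewrite divr_gt0.
apply: le_trans (dirder_le z (u + v) r2) _.
suff : slope z (u + v) (r / 2) <= slope z u r + slope z v r by lra.
rewrite /slope -mulrDl ler_pdivrMr// mulrAC [X in _ <= X](_ : _ = 2^-1 * (J (z + r *: u) - J z + (J (z + r *: v) - J z))); last first.
  by field; rewrite gt_eqF.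
have := JD (2^-1 *: (z + r *: u)) (2^-1 *: (z + r *: v)).
have -> : 2^-1 *: (z + r *: u) + 2^-1 *: (z + r *: v) = z + (r / 2) *: (u + v).
  rewrite !scalerDr !scalerA addrACA -scalerDl (_ : 2^-1 + 2^-1 = 1) ?scale1r; last by field. by rewrite (mulrC r).
by rewrite !JZ ?invr_ge0//; lra.
Qed.

Lemma dirder0 z : dirder z 0 = 0.
Proof.
apply/eqP; rewrite eq_le; have h t : 0 < t -> slope z 0 t = 0 by rewrite /slope scaler0 addr0 subrr mul0r.
apply/andP; split; first by have := dirder_le z 0 ltr01; rewrite h.
by apply: le_dirder => t /h ->.
Qed.

Lemma dirder_self z : dirder z z = J z.
Proof.
have h t : 0 < t -> slope z z t = J z.
  move=> t0; have e : z + t *: z = (1 + t) *: z by rewrite scalerDl scale1r.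
  rewrite /slope e JZ ?addr_ge0 ?(ltW t0)//. by field; rewrite gt_eqF.
apply/eqP; rewrite eq_le; apply/andP; split; first by have := dirder_le z z ltr01; rewrite h.
by apply: le_dirder => t /h ->.
Qed.

Lemma dirder_sym z v : 0 <= dirder z v + dirder z (- v).
Proof. by rewrite -[leLHS](dirder0 z) -(subrr v); exact: dirderD. Qed.

Lemma dirderN_of_sym z v : dirder z v + dirder z (- v) = 0 -> forall a, dirder z (a *: v) = a * dirder z v.
Proof.
move=> h a; have [a0|a0|<-] := ltgtP 0 a; first exact: dirderZ; last by rewrite scale0r dirder0 mul0r.
have -> : a *: v = (- a) *: (- v) by rewrite scalerN scaleNr opprK.
rewrite dirderZ ?oppr_gt0//; have -> : dirder z (- v) = - dirder z v by lra.
by rewrite mulrNN.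
Qed.

(* A direction along which the one-sided derivatives match is a direction of linearity of [dirder z]. *)
Lemma dirderD_sym z u v : dirder z v + dirder z (- v) = 0 -> dirder z (u + v) = dirder z u + dirder z v.
Proof.
move=> h; apply/eqP; rewrite eq_le dirderD/=.
by have := dirderD z (u + v) (- v); rewrite addrK; lra.
Qed.

End directional.

(** * Integrals along one ray and polar integration of the epigraph *)

Section ray_integral.
Variable R : realType.
Local Open Scope ereal_scope.

Variable h : R -> R.
Hypothesis h0 : forall l, (0 <= l)%R -> (0 <= h l)%R.
Hypothesis mh : measurable_fun setT h.
Hypothesis bh : forall a, exists B : R, forall l, (0 <= l <= a)%R -> (h l <= B)%R.

Definition ray_int (a : R) : \bar R := \int[@leb R]_(l in `]0%R, a[) (h l)%:E.

Let mhE (D : set R) : measurable_fun D (fun l => (h l)%:E).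
by apply: measurable_funTS; exact/measurable_EFinP. Qed.

Lemma ray_int_fin a : ray_int a \is a fin_num.
Proof.
have [B hB] := bh a.
have h0' : forall l, l \in `]0%R, a[ -> (0 <= h l)%R by move=> l; rewrite in_itv/= => /andP[/ltW/h0].
rewrite ge0_fin_numE; last by apply: integral_ge0 => l /= la; rewrite lee_fin h0'.
apply: (@le_lt_trans _ _ (\int[@leb R]_(l in `]0%R, a[) (Num.max B 0)%:E)).
  apply: ge0_le_integral => //.
  move=> l; rewrite /= in_itv/= => /andP[l0 la]; rewrite lee_fin le_max; apply/orP; left. by apply: hB; rewrite !ltW.
rewrite integral_cst// [X in _ * X]leb_itv/=; case: ifP => _; last by rewrite mule0.
by rewrite -EFinB -EFinM ltry.
Qed.

Lemma ray_int_le a b : (a <= b)%R -> ray_int a <= ray_int b.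
Proof.
move=> ab; apply: ge0_subset_integral => //.
- by move=> l; rewrite /= in_itv/= => /andP[/ltW/h0 ? _]; rewrite lee_fin.
- by move=> l; rewrite /= !in_itv/= => /andP[-> /lt_le_trans]; apply.
Qed.

Lemma ray_int_split a b : (0 < a)%R -> (a <= b)%R ->
  ray_int b = ray_int a + \int[@leb R]_(l in `[a, b[) (h l)%:E.
Proof.
move=> a0 ab; rewrite /ray_int (_ : [set` `]0%R, b[] = [set` `]0%R, a[] `|` [set` `[a, b[]); last first.
  apply/seteqP; split => l /=; rewrite !in_itv/=.
    by move=> /andP[l0 lb]; have [la|la] := ltP l a; [left; rewrite l0|right].
  by case=> /andP[h1 h2]; rewrite ?h1 ?h2 ?andbT/=; [exact: lt_le_trans h2 ab|exact: lt_le_trans a0 h1].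
rewrite ge0_integral_setU//.
- by move=> l /=; rewrite !in_itv/= => -[/andP[/ltW l0 _]|/andP[al _]]; rewrite lee_fin h0//; lra.
- by apply/eqP/seteqP; split => // l /=; rewrite !in_itv/= => -[/andP[_ la] /andP[al _]]; lra.
Qed.

Lemma ray_int_bounds a b (m M : R) : (0 < a)%R -> (a <= b)%R -> (0 <= m)%R -> (0 <= M)%R ->
  (forall l, (a <= l <= b)%R -> (m <= h l <= M)%R) ->
  (m * (b - a) <= fine (ray_int b) - fine (ray_int a) <= M * (b - a))%R.
Proof.
move=> a0 ab m0 M0 hmM.
have e := ray_int_split a0 ab.
have fb := ray_int_fin b; have fa := ray_int_fin a.
have lE : @leb R `[a, b[%classic = (b - a)%:E.
  rewrite [LHS]leb_itv/= lte_fin; case: ltP => // h'. have -> : a = b; last by rewrite subrr.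
  by apply/eqP; rewrite eq_le ab.
have hn l : `[a, b[%classic l -> (m <= h l <= M)%R.
  by rewrite /= in_itv/= => /andP[h1 h2]; apply: hmM; rewrite h1 ltW.
have lo : (m * (b - a))%:E <= \int[@leb R]_(l in `[a, b[) (h l)%:E.
  rewrite EFinM -lE -integral_cst//; apply: ge0_le_integral => //. by move=> l /hn/andP[h1 _]; rewrite lee_fin.
have up : \int[@leb R]_(l in `[a, b[) (h l)%:E <= (M * (b - a))%:E.
  rewrite EFinM -lE -integral_cst//; apply: ge0_le_integral => //.
  - by move=> l /hn/andP[h1 _]; rewrite lee_fin; apply: le_trans h1.
  - by move=> l /hn/andP[_ h1]; rewrite lee_fin.
move: e lo up; rewrite -(fineK fb) -(fineK fa).
case: (\int[_]_(_ in _) _) => [r| |]//=; rewrite -EFinD !lee_fin => -[->] lo up.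
by rewrite addrAC subrr add0r lo up.
Qed.

Lemma ray_int_derive (u : R) : (0 < u)%R -> {for u, continuous h} -> forall e : R, (0 < e)%R ->
  exists2 d : R, (0 < d)%R & forall a, (`|a - u| < d)%R ->
    (`|fine (ray_int a) - fine (ray_int u) - (a - u) * h u| <= e * `|a - u|)%R.
Proof.
move=> u0 cu e e0; have /cvgrPdist_le/(_ e e0) := cu.
move=> /nbhs_ballP[d d0 hd].
exists (Num.min d u) => [|a]; first by rewrite lt_min u0 andbT.
rewrite lt_min => /andP[ad au].
have a0 : (0 < a)%R by move: au; rewrite ltr_norml => /andP[]; lra.
have bnd l : (`|u - l| <= `|a - u|)%R -> (`|h u - h l| <= e)%R.
  by move=> lu; apply: hd; rewrite /ball/=; exact: le_lt_trans lu ad.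
have hu := h0 (ltW u0).
have B l : (Num.min a u <= l <= Num.max a u)%R -> (Num.max 0 (h u - e) <= h l <= h u + e)%R.
  move=> lau; have l0 : (0 <= l)%R by move/andP: lau => [h1 _]; apply: le_trans h1; rewrite le_min !ltW.
  have : (`|u - l| <= `|a - u|)%R.
    move: lau; have [ua|ua] := leP u a => /andP[h1 h2].
      by rewrite [leRHS]ger0_norm ?subr_ge0// ler_norml; lra.
    by rewrite [leRHS]ltr0_norm ?subr_lt0// ler_norml; lra.
  by move=> /bnd; rewrite ler_norml ge_max h0//= => /andP[h1 h2]; apply/andP; split; lra.
have [ua|/ltW ua] := leP u a.
  have := @ray_int_bounds u a (Num.max 0 (h u - e))%R (h u + e)%R u0 ua. move=> /(_ _ _ _)/wrap[|||].
  - by rewrite le_max lexx.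
  - by rewrite addr_ge0// ltW.
  - by move=> l lau; apply: B; rewrite (min_idPr ua) (max_idPl ua).
  rewrite [`|a - u|%R]ger0_norm ?subr_ge0// => /andP[h1 h2].
  have : ((h u - e) * (a - u) <= Num.max 0 (h u - e) * (a - u))%R.
    by rewrite ler_wpM2r ?subr_ge0// le_max lexx orbT.
  by rewrite ler_norml; move=> h3; apply/andP; split; lra.
have := @ray_int_bounds a u (Num.max 0 (h u - e))%R (h u + e)%R a0 ua.
move=> /(_ _ _ _)/wrap[|||].
- by rewrite le_max lexx.
- by rewrite addr_ge0// ltW.
- by move=> l lau; apply: B; rewrite (min_idPl ua) (max_idPr ua).
rewrite [`|a - u|%R]ler0_norm ?subr_le0// => /andP[h1 h2].
have : ((h u - e) * (u - a) <= Num.max 0 (h u - e) * (u - a))%R.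
  by rewrite ler_wpM2r ?subr_ge0// le_max lexx orbT.
by rewrite ler_norml; move=> h3; apply/andP; split; lra.
Qed.

(** The end of the perturbed ray is known from below only up to [eps], because the speed [rho] is a
    supremum that need not be attained. The loss [eps] is fixed in terms of [e] before t tends to 0
    and costs e / 2; the other half pays for the error of differentiability of the primitive. *)
Lemma ray_limit (u rho : R) : (0 < u)%R -> {for u, continuous h} -> forall e : R, (0 < e)%R ->
  exists eps : R, (0 < eps)%R /\ exists2 t0 : R, (0 < t0)%R & forall t I : R, (0 < t < t0)%R ->
    (fine (ray_int (u * (1 + t * (rho - eps)))) <= I <= fine (ray_int (u * (1 + t * rho))))%R ->
    (`|(I - fine (ray_int u)) / t - u * rho * h u| <= e)%R.
Proof.
move=> u0 cu e e0; have hu := h0 (ltW u0).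
pose eps := Num.min 1%R (e / (2 * (u * h u + 1)))%R.
have uh : (0 <= u * h u)%R by rewrite mulr_ge0// ltW.
have eps0 : (0 < eps)%R by rewrite lt_min ltr01 divr_gt0//; lra.
have eps1 : (eps <= 1)%R by rewrite ge_min lexx.
have epse : (eps * (2 * (u * h u + 1)) <= e)%R by rewrite -ler_pdivlMr ?ge_min ?lexx ?orbT//; lra.
have r0 := normr_ge0 rho.
pose eta := (e / (2 * (u * (`|rho| + 1) + 1)))%R.
have ur : (0 <= u * (`|rho| + 1))%R by rewrite mulr_ge0 ?(ltW u0)//; lra.
have eta0 : (0 < eta)%R by rewrite divr_gt0//; lra.
have etae : (eta * (2 * (u * (`|rho| + 1) + 1)) = e)%R by rewrite divfK// gt_eqF//; lra.
have [d d0 hd] := ray_int_derive u0 cu eta0.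
exists eps; split => //; exists (d / (u * (`|rho| + 1) + 1))%R; first by rewrite divr_gt0//; lra.
move=> t I /andP[t0 td]; have td' : (t * (u * (`|rho| + 1) + 1) < d)%R by rewrite -ltr_pdivlMr//; lra.
have close r : (`|r| <= `|rho| + 1)%R -> (`|u * (1 + t * r) - u| < d /\
    `|u * (1 + t * r) - u| <= t * (u * (`|rho| + 1)))%R.
  move=> rr; have -> : (u * (1 + t * r) - u = t * u * r)%R by ring. rewrite normrM gtr0_norm ?mulr_gt0//.
  have le : (t * u * `|r| <= t * (u * (`|rho| + 1)))%R by rewrite -mulrA ler_pM2l// ler_pM2l. by split => //; lra.
have [c1 c1'] : (`|u * (1 + t * rho) - u| < d /\ `|u * (1 + t * rho) - u| <= t * (u * (`|rho| + 1)))%R by apply: close; lra.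
have [c2 c2'] : (`|u * (1 + t * (rho - eps)) - u| < d /\ `|u * (1 + t * (rho - eps)) - u| <= t * (u * (`|rho| + 1)))%R.
  by apply: close; apply: le_trans (ler_normB _ _) _; rewrite (gtr0_norm eps0); lra.
have := hd _ c1; have := hd _ c2.
have k1 : (eta * `|u * (1 + t * rho) - u| <= eta * (t * (u * (`|rho| + 1))))%R by rewrite ler_pM2l.
have k2 : (eta * `|u * (1 + t * (rho - eps)) - u| <= eta * (t * (u * (`|rho| + 1))))%R by rewrite ler_pM2l.
rewrite !ler_norml => /andP[a1 a2] /andP[b1 b2] /andP[i1 i2].
have et : (t * (eta * (u * (`|rho| + 1))) <= t * (e / 2))%R by rewrite ler_pM2l//; lra.
have ee : (t * (eps * (u * h u)) <= t * (e / 2))%R by rewrite ler_pM2l//; nra.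
rewrite lerBrDr lerBlDr ler_pdivlMr// ler_pdivrMr//; apply/andP; split; lra.
Qed.

End ray_integral.

Section subgraph.
Variables (R : realType) (m : nat).
Local Notation n := m.+1.
Local Open Scope ereal_scope.

Lemma exp_tail (u : R) : \int[leb]_(s in `[u, +oo[%classic) (expR (- s))%:E = (expR (- u))%:E.
Proof.
pose F (x : R) := (- expR (- x))%R.
have dF (x : R) : is_derive x (1%R : R) F (expR (- x))%R.
  have h1 : is_derive x (1%R : R) (fun y : R => - y)%R (- 1)%R by apply: is_deriveN.
  have h3 := @is_derive1_comp R expR _ x _ _ (is_derive_expR _) h1. have h4 := @is_deriveN _ _ _ _ _ _ _ h3.
  apply: (@is_derive_eq _ _ _ _ _ _ _ _ h4). by rewrite mulrN opprK mulr1.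
have cF : continuous F.
  by move=> x; apply: differentiable_continuous; apply/derivable1_diffP; case: (dF x).
have cf : continuous (fun x : R => expR (- x)).
  move=> x; apply: continuous_comp; last exact: continuous_expR. by apply: continuousN; exact: cvg_id.
rewrite integral_leb; [|exact: measurable_itv|]; last first.
  by apply/measurable_EFinP; apply: measurable_funTS; exact: continuous_measurable_fun.
rewrite (@ge0_continuous_FTC2y R _ F u 0%R)//.
- by rewrite sub0e /F EFinN oppeK.
- exact: continuous_subspaceT.
- by rewrite -oppr0; apply: cvgN; exact: cvgr_expR.
- by apply: cvg_at_right_filter; exact: cF.
- by move=> x _; rewrite derive1E; case: (dF x).
Qed.

Lemma measurable_expRN : measurable_fun setT (fun s : R => expR (- s)).
Proof. by apply: measurableT_comp => //; exact: measurable_expR. Qed.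

Lemma expRN_lt (s g : R) : (0 < g)%R -> (expR (- s) < g)%R = (- ln g < s)%R.
Proof. by move=> g0; rewrite -{1}(lnK g0) ltr_expR ltrNl. Qed.

(** A layer cake with the measure e^(-s) ds: the heights above - ln g have total mass g. The value g
    = 0 is included, with no height at all. In this way the integral of a function becomes the
    weighted volume of its epigraph. *)
Lemma exp_layer (g : R) : (0 <= g)%R ->
  \int[@leb R]_s (if (expR (- s) < g)%R then expR (- s) else 0)%:E = g%:E.
Proof.
rewrite le_eqVlt => /orP[/eqP <-|g0].
  by apply: integral0_eq => s _; rewrite ltNge expR_ge0.
transitivity (\int[leb]_(s in `](- ln g)%R, +oo[%classic) (expR (- s))%:E).
  rewrite [RHS]integral_mkcond; apply: eq_integral => s _.
  by rewrite patchE mem_setE in_itv/= andbT expRN_lt//; case: ifP.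
rewrite integral_leb_obnd_cbnd; last by apply/measurable_EFinP; exact: measurable_expRN.
by rewrite exp_tail opprK lnK.
Qed.

(** The Jacobian is l^n and not l^m, because the rays live in R^n x R, of dimension n + 1. The test
    function [xi] is evaluated at the horizontal component. *)
Definition ray_dens (xi : bV R n -> R) (z : bV R n * R) (l : R) : R :=
  (l ^+ n * (xi (l *: z.1) * expR (- (l * z.2))))%R.

Definition ray_mass (xi G : bV R n -> R) (z : bV R n * R) : \bar R :=
  \int[@leb R]_(l in `]0%R, +oo[) (if (expR (- (l * z.2)) < G (l *: z.1))%R then ray_dens xi z l else 0)%:E.

Lemma measurable_dilate : measurable_fun setT (fun p : (bV R n * R) * R => (p.2 *: p.1.1, p.2 * p.1.2)%R : bV R n * R).
Proof.
apply: measurable_fun_pair.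
  apply: (measurableT_comp (f := fun p : bV R n * R => (p.2 *: p.1)%R : bV R n)
    (g := fun x : (bV R n * R) * R => (x.1.1, x.2))); first exact: measurable_scale.
  apply: measurable_fun_pair; last exact: measurable_snd. by apply: measurableT_comp; exact: measurable_fst.
apply: measurable_funM; first exact: measurable_snd.
by apply: measurableT_comp; [exact: measurable_snd|exact: measurable_fst].
Qed.

Variables (xi G : bV R n -> R).
Hypotheses (mxi : measurable_fun setT xi) (xi0 : forall x, (0 <= xi x)%R).
Hypotheses (mG : measurable_fun setT G) (G0 : forall x, (0 <= G x)%R).

Let Phi (z : bV R n * R) : R := if (expR (- z.2) < G z.1)%R then (xi z.1 * expR (- z.2))%R else 0%R.

Let mPhi : measurable_fun setT Phi.
Proof.
have me : measurable_fun setT (fun z : bV R n * R => expR (- z.2)).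
  exact: (measurableT_comp measurable_expRN measurable_snd).
apply: measurable_fun_ifT; [|apply: measurable_funM => //|exact: measurable_cst].
  apply: measurable_fun_ltr => //; exact: (measurableT_comp mG measurable_fst).
exact: (measurableT_comp mxi measurable_fst).
Qed.

Let Phi0 z : (0 <= Phi z)%R.
by rewrite /Phi; case: ifP => // _; rewrite mulr_ge0 ?expR_ge0. Qed.

Let ray_massE z : ray_mass xi G z = \int[leb]_(l in `]0%R, +oo[%classic) ((l ^+ n)%:E * (Phi (l *: z.1, l * z.2)%R)%:E).
Proof.
apply: eq_integral => l _; rewrite -EFinM /Phi/=; case: ifP => _; last by rewrite mulr0.
by rewrite /ray_dens.
Qed.

Lemma measurable_ray_mass : measurable_fun setT (ray_mass xi G).
Proof.
pose H (p : (bV R n * R) * R) : \bar R := (if (0 < p.2)%R then p.2 ^+ n * Phi (p.2 *: p.1.1, p.2 * p.1.2) else 0)%:E.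
have H0 p : 0 <= H p.
  by rewrite /H lee_fin; case: ifP => // /ltW p0; rewrite mulr_ge0 ?exprn_ge0.
have mH : measurable_fun setT H.
  apply/measurable_EFinP; apply: measurable_fun_ifT; [|apply: measurable_funM|exact: measurable_cst].
  - by apply: measurable_fun_ltr => //; exact: measurable_snd.
  - by apply: measurable_funX; exact: measurable_snd.
  - exact: (measurableT_comp mPhi measurable_dilate).
have := @measurable_fun_fubini_tonelli_F _ _ (bV R n * R)%type R R leb H mH H0.
apply: eq_measurable_fun => z _; rewrite ray_massE /fubini_F [RHS]integral_mkcond.
by apply: eq_integral => l _; rewrite /H patchE mem_setE in_itv/= andbT; case: ifP => //; rewrite EFinM.
Qed.

Lemma ray_mass_ge0 z : 0 <= ray_mass xi G z.
Proof.
rewrite ray_massE; apply: integral_ge0 => l; rewrite /= in_itv/= andbT => /ltW l0.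
by rewrite mule_ge0// lee_fin ?exprn_ge0.
Qed.

Lemma subgraph_polar : \int[@lam R n]_x (xi x * G x)%:E =
  \int[lamR R n]_z ((kw z.1)%:E * ray_mass xi G z).
Proof.
transitivity (\int[lamR R n]_z (Phi z)%:E).
  rewrite lamR_fubini//; last 1 first.
    by apply/measurable_EFinP.
  apply: eq_integral => x _. rewrite EFinM -(exp_layer (G0 x)) -ge0_integralZl//; last 3 first.
  - apply/measurable_EFinP; apply: measurable_fun_ifT; [|exact: measurable_expRN|exact: measurable_cst].
    by apply: measurable_fun_ltr => //; exact: measurable_expRN.
  - by move=> s _; rewrite lee_fin; case: ifP => // _; exact: expR_ge0.
  - by rewrite lee_fin.
  by apply: eq_integral => s _; rewrite /Phi/= -EFinM; case: ifP => //; rewrite mulr0.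
rewrite polar_lamR//; last 1 first.
  by apply/measurable_EFinP.
by apply: eq_integral => z _; rewrite ray_massE.
Qed.

Lemma ray_dens_ge0 z l : (0 <= l)%R -> (0 <= ray_dens xi z l)%R.
Proof. by move=> l0; rewrite !mulr_ge0 ?exprn_ge0 ?expR_ge0. Qed.

Let md z : measurable_fun setT (fun l : R => ((l *: z.1)%R, (l * z.2)%R) : bV R n * R).
Proof.
have := measurableT_comp measurable_dilate (@measurable_pair1 _ _ (bV R n * R)%type R z).
exact.
Qed.

Lemma measurable_ray_dens z : measurable_fun setT (ray_dens xi z).
Proof.
apply: measurable_funM; first exact: measurable_funX.
apply: measurable_funM; first exact: (measurableT_comp mxi (measurableT_comp measurable_fst (md z))).
by apply: (measurableT_comp measurable_expRN); exact: (measurableT_comp measurable_snd (md z)).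
Qed.

Lemma ray_mass_between (z : bV R n * R) (a b : R) :
  (forall l, (0 < l < a)%R -> (expR (- (l * z.2)) < G (l *: z.1))%R) ->
  (forall l, (0 < l)%R -> (expR (- (l * z.2)) < G (l *: z.1))%R -> (l <= b)%R) ->
  ray_int (ray_dens xi z) a <= ray_mass xi G z <= ray_int (ray_dens xi z) b.
Proof.
move=> ha hb.
have rd0 := ray_dens_ge0 z.
have mrd := measurable_ray_dens z.
have mcond : measurable_fun setT (fun l : R => if (expR (- (l * z.2)) < G (l *: z.1))%R then ray_dens xi z l else 0%R).
  apply: measurable_fun_ifT => //. apply: measurable_fun_ltr.
    by apply: (measurableT_comp measurable_expRN); exact: (measurableT_comp measurable_snd (md z)).
  exact: (measurableT_comp mG (measurableT_comp measurable_fst (md z))).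
apply/andP; split.
  rewrite /ray_int /ray_mass integral_mkcond [leRHS]integral_mkcond; apply: ge0_le_integral => //.
  - by move=> l _; rewrite patchE mem_setE in_itv/=; case: ifP => // /andP[/ltW/rd0 ? _]; rewrite lee_fin.
  - apply/(measurable_restrictT _ _).1 => //; apply: measurable_funTS; exact/measurable_EFinP.
  - apply/(measurable_restrictT _ _).1 => //; apply: measurable_funTS; exact/measurable_EFinP.
  move=> l _; rewrite !patchE !mem_setE !in_itv/= andbT; case: ifPn => [/andP[l0 la]|_].
    by rewrite l0 ha// l0.
  by case: ifP => // /ltW/rd0 h; rewrite lee_fin; case: ifP.
apply: (@le_trans _ _ (\int[@leb R]_(l in `]0%R, b]) (ray_dens xi z l)%:E)); last first.
  rewrite /ray_int !integral_leb//; try (by apply: measurable_funTS; exact/measurable_EFinP).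
  by rewrite integral_itv_bndo_bndc//; apply: measurable_funTS; exact/measurable_EFinP.
rewrite /ray_mass integral_mkcond [leRHS]integral_mkcond; apply: ge0_le_integral => //.
- by move=> l _; rewrite patchE mem_setE in_itv/= andbT; case: ifP => // /ltW/rd0 h; rewrite lee_fin; case: ifP.
- apply/(measurable_restrictT _ _).1 => //; apply: measurable_funTS; exact/measurable_EFinP.
- apply/(measurable_restrictT _ _).1 => //; apply: measurable_funTS; exact/measurable_EFinP.
move=> l _; rewrite !patchE !mem_setE !in_itv/= andbT; case: (ltP 0%R l) => //= l0.
case: ifPn => [/(hb _ l0) ->//|_].
by case: ifP => // _; rewrite lee_fin rd0// ltW.
Qed.

End subgraph.

(** * Geometry of the dilated epigraph *)

Section machine_geometry.
Variables (R : realType) (m : nat).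
Local Notation n := m.+1.
Local Notation V := ('rV[R]_n * R)%type.
Variables (F : 'rV[R]_n -> R) (r0 b : R).

(** The strict epigraph of - ln F, written so that points with F = 0, where - ln F is +oo, have no
    height above them. The lower bound [F2] puts the origin in its interior. *)
Definition epigraph : set V := [set z | expR (- z.2) < F z.1].
Local Notation C := epigraph.
Hypothesis Cconv : forall x y (l : R), 0 <= l <= 1 -> C x -> C y -> C ((1 - l) *: x + l *: y).
Hypothesis mF : measurable_fun setT (F : bV R n -> R).
Hypothesis r00 : 0 < r0.
Hypothesis F2 : forall x, enorm x <= r0 -> expR 1 <= F x.
Hypothesis FB : forall x, F x <= expR b.
Implicit Types (z v d : V) (t l : R).

Lemma epigraph_absorbing v : exists2 d : R, 0 < d & C (d *: v).
Proof.
pose d := Num.min (r0 / (1 + enorm v.1)) (2^-1 / (1 + `|v.2|)).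
have e1 : 0 < 1 + enorm v.1 by rewrite ltr_wpDr ?enorm_ge0.
have e2 : 0 < 1 + `|v.2| by rewrite ltr_wpDr.
have d0 : 0 < d by rewrite lt_min !divr_gt0.
exists d => //; rewrite /epigraph/=; apply: (@lt_le_trans _ _ (expR 1)).
  rewrite ltr_expR; apply: le_lt_trans (ler_norm _) _; rewrite normrN normrM gtr0_norm//.
  have : d * (1 + `|v.2|) <= 2^-1 by rewrite -ler_pdivlMr// ge_min lexx orbT. by rewrite mulrDr mulr1; lra.
apply: F2; rewrite enormZ gtr0_norm//.
have : d * (1 + enorm v.1) <= r0 by rewrite -ler_pdivlMr// ge_min lexx.
by rewrite mulrDr mulr1; lra.
Qed.
Let Cabs := epigraph_absorbing.

Local Notation J := (gauge C).

Lemma measurable_epigraph : measurable (C : set (bV R n * R)%type).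
Proof.
apply: (@measurable_lt_set _ (bV R n * R)%type R (fun z => expR (- z.2)) (fun z => F z.1)).
  exact: (measurableT_comp (@measurable_expRN R) measurable_snd).
exact: (measurableT_comp mF measurable_fst).
Qed.

Lemma measurable_J : measurable_fun setT (J : bV R n * R -> R).
Proof. by apply: measurable_gauge2 => //; exact: measurable_epigraph. Qed.

Lemma J_ge0 z : 0 <= J z. Proof. exact: gauge_ge0. Qed.
Lemma JZ l z : 0 <= l -> J (l *: z) = l * J z. Proof. exact: gaugeZ. Qed.
Lemma JD z v : J (z + v) <= J z + J v. Proof. exact: gaugeD. Qed.
Lemma lt1_epigraph z : J z < 1 -> C z. Proof. exact: gauge_lt1. Qed.
Lemma epigraph_le1 z : C z -> J z <= 1. Proof. exact: gauge_le1. Qed.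

Lemma J_up (s : R) : 0 <= s -> J (0, s) = 0.
Proof.
move=> s0; apply/eqP; rewrite eq_le J_ge0 andbT; apply/ler_addgt0Pr => e e0; rewrite add0r.
apply: gauge_le => //; rewrite /epigraph/= scaler0.
apply: (@lt_le_trans _ _ (expR 1)); last by apply: F2; rewrite enorm0 ltW.
rewrite ltr_expR; apply: (@le_lt_trans _ _ 0) => //.
by rewrite oppr_le0 mulr_ge0// invr_ge0 ltW.
Qed.

(** An upper bound on [F] bounds the heights of the epigraph from below. This controls the growth of
    e^(-s) along rays going down, and hence the domination below. *)
Lemma J_lb z : - (b * J z) <= z.2.
Proof.
apply/ler_addgt0Pr => e e0.
have b0 : 0 <= b.
  have : expR 1 <= expR b by apply: le_trans (F2 _) (FB 0); rewrite enorm0 ltW. by rewrite ler_expR; lra.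
pose k := J z + e / (b + 1); have k0 : J z < k by rewrite ltrDl divr_gt0// ltr_wpDl.
have kp : 0 < k by apply: le_lt_trans k0; exact: J_ge0.
have := gauge_lt Cconv Cabs k0; rewrite /epigraph/= => h.
have := lt_le_trans h (FB _); rewrite ltr_expR -mulrN ltr_pdivrMl//.
have : b * (e / (b + 1)) <= e by rewrite mulrCA ler_piMr ?(ltW e0)// ler_pdivrMr ?ltr_wpDl//; lra.
rewrite /k; set q := e / (b + 1); nra.
Qed.

Lemma dirder_J_up z : dirder J z (0, 1) <= 0.
Proof. by apply: le_trans (dirder_leJ JZ JD z _) _; rewrite J_up. Qed.

Variables (D : set V) (M : R) (d0 : V).
Hypotheses (DM : forall d, D d -> J d <= M) (Dd0 : D d0) (d0M : J (- d0) <= M).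

Definition shifted t : set V := [set z | exists2 d, D d & C (z - t *: d)].
(** The speed at which the exit point of the ray through [z] moves: to first order 1 / J z is
    multiplied by 1 + t rho. For differentiable [J] it is the support function of [D] at the
    derivative of [J]. The upper estimate [shifted_upper] is exact for all t, the lower one loses an
    arbitrary [e]. *)
Definition rho z : R := sup [set - dirder J z (- d) | d in D].

Let rho_has_sup z : has_sup [set - dirder J z (- d) | d in D].
Proof.
split; first by exists (- dirder J z (- d0)), d0.
exists M => _ [d Dd <-]; apply: le_trans (DM Dd).
by have := dirder_ge JZ JD z (- d); rewrite (opprK d) lerNl.
Qed.

Lemma le_rho z d : D d -> - dirder J z (- d) <= rho z.
Proof. by move=> Dd; apply: ub_le_sup; [case: (rho_has_sup z)|exists d]. Qed.

Lemma rho_leM z : rho z <= M.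
Proof.
apply: ge_sup; first by case: (rho_has_sup z).
move=> _ [d Dd <-]; apply: le_trans (DM Dd).
by have := dirder_ge JZ JD z (- d); rewrite (opprK d) lerNl.
Qed.

Lemma shifted_upper z t l : 0 < J z -> 0 < t -> 0 < l -> shifted t (l *: z) ->
  l <= (J z)^-1 * (1 + t * rho z).
Proof.
move=> Jz t0 l0 [d Dd /epigraph_le1]; rewrite -scalerN => h.
have := dirder_ray JZ JD z (- d) l0 t0 => h2.
rewrite ler_pdivlMl// mulrC; have := le_rho z Dd; have := le_trans h2 h.
move=> h3 h4; have : t * - dirder J z (- d) <= t * rho z by rewrite ler_pM2l.
lra.
Qed.

Lemma shifted_lower z t l : 0 < t -> 0 < l -> l * J z + t * M < 1 -> shifted t (l *: z).
Proof.
move=> t0 l0 h; exists d0 => //; apply: lt1_epigraph; apply: le_lt_trans h.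
apply: le_trans (JD _ _) _; rewrite JZ ?(ltW l0)// -scalerN JZ ?(ltW t0)//.
by rewrite lerD2l ler_pM2l.
Qed.

Lemma shifted_lower_eps z (e : R) : 0 < J z -> 0 < e -> exists2 t0 : R, 0 < t0 &
  forall t l, 0 < t < t0 -> 0 < l < (J z)^-1 * (1 + t * (rho z - e)) -> shifted t (l *: z).
Proof.
move=> Jz e0; have e2 : 0 < e / 2 by rewrite divr_gt0.
have [_ [d Dd <-] hd] := sup_adherent e2 (rho_has_sup z).
rewrite -/(rho z) in hd; have [tau tau0 htau] := dirder_cvg JZ JD z (- d) e2.
have Jd := J_ge0 (- d).
exists (Num.min (tau / (2 * J z)) (1 / (2 * (J (- d) + 1)))).
  by rewrite lt_min !divr_gt0// mulr_gt0//; lra.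
move=> t l /andP[t0]; rewrite lt_min => /andP[t1 t2] /andP[l0 l1].
exists d => //; apply: lt1_epigraph; rewrite -scalerN.
have lJ : l * J z < 1 + t * (rho z - e) by move: l1; rewrite ltr_pdivlMl// mulrC.
(* Well inside the epigraph a crude bound suffices. Otherwise [l] is bounded below, t / l is at most
   [tau], and the estimate of the slope applies. *)
have [ll|ll] := leP (l * J z) (1 / 2).
  apply: le_lt_trans (JD _ _) _; rewrite !JZ ?(ltW l0) ?(ltW t0)//.
  have : t * (2 * (J (- d) + 1)) < 1 by rewrite -ltr_pdivlMr//; lra. by nra.
have tl : 0 < t / l <= tau.
  rewrite divr_gt0//= ler_pdivrMr//. have : t * (2 * J z) < tau by rewrite -ltr_pdivlMr// mulr_gt0. by move: ll; nra.
have := htau _ tl; have /andP[tl0 _] := tl; rewrite ler_pdivrMr// => hs.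
have -> : l *: z + t *: - d = l *: (z + (t / l) *: - d).
  by rewrite [RHS]scalerDr scalerA mulrCA divff ?mulr1// gt_eqF.
rewrite JZ ?(ltW l0)//.
have : l * (J (z + (t / l) *: - d) - J z) <= l * ((dirder J z (- d) + e / 2) * (t / l)) by rewrite ler_pM2l.
have -> : l * ((dirder J z (- d) + e / 2) * (t / l)) = t * (dirder J z (- d) + e / 2) by field; rewrite gt_eqF.
have : t * (dirder J z (- d) + e / 2) < t * (e - rho z) by rewrite ltr_pM2l//; lra.
lra.
Qed.

End machine_geometry.

(** * Differentiation of the volume of a dilated epigraph *)

Section machine.
Variables (R : realType) (m : nat).
Local Notation n := m.+1.
Local Notation V := ('rV[R]_n * R)%type.
Variables (F : 'rV[R]_n -> R) (r0 b : R).
Local Notation C := (epigraph F).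
Hypothesis Cconv : forall x y (l : R), (0 <= l <= 1)%R -> C x -> C y -> C ((1 - l) *: x + l *: y)%R.
Hypothesis mF : measurable_fun setT (F : bV R n -> R).
Hypothesis F0 : forall x, (0 <= F x)%R.
Hypothesis r00 : (0 < r0)%R.
Hypothesis F2 : forall x, (enorm x <= r0)%R -> (expR 1 <= F x)%R.
Hypothesis FB : forall x, (F x <= expR b)%R.
Local Notation J := (gauge C).
Local Open Scope ereal_scope.
Hypothesis intF : \int[@lam R n]_x (F x)%:E < +oo.
Variables (xi : 'rV[R]_n -> R).
Hypotheses (cxi : continuous xi) (xi01 : forall x, (0 <= xi x <= 1)%R).
Variables (D : set V) (M : R) (d0 : V).
Hypotheses (DM : forall d, D d -> (J d <= M)%R) (Dd0 : D d0) (d0M : (J (- d0) <= M)%R).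
Variable Ft : R -> 'rV[R]_n -> R.
Hypothesis mFt : forall t, (0 < t)%R -> measurable_fun setT (Ft t : bV R n -> R).
Hypothesis Ft0 : forall t x, (0 < t)%R -> (0 <= Ft t x)%R.
Hypothesis FtE : forall t (z : V), (0 < t)%R -> (expR (- z.2) < Ft t z.1)%R <-> shifted F D t z.
Local Notation rho := (rho F D).

Let Cabs := epigraph_absorbing r00 F2.
Let J0 := J_ge0 r00 F2.
Let JZ' := JZ Cconv r00 F2.
Let mJ : measurable_fun setT (J : bV R n * R -> R) := measurable_J Cconv mF r00 F2.
Let mxi : measurable_fun setT (xi : bV R n -> R) := continuous_measurable_rV cxi.
Let xi0 x : (0 <= xi x)%R. Proof. by case/andP: (xi01 x). Qed.
Let M0 : (0 <= M)%R. Proof. exact: le_trans (J0 d0) (DM Dd0). Qed.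
Let one : bV R n -> R := fun=> 1%R.
Let mone : measurable_fun setT one. Proof. exact: measurable_cst. Qed.
Let one0 x : (0 <= one x)%R. Proof. by []. Qed.

Let u (z : V) : R := ((J z)^-1)%R.
Let u0 (z : V) : (0 < J z)%R -> (0 < u z)%R. Proof. by rewrite invr_gt0. Qed.

Let mass0 (et : bV R n -> R) (z : V) : measurable_fun setT et -> (forall x, (0 <= et x)%R) -> (0 < J z)%R ->
  ray_mass et F z = ray_int (ray_dens et z) (u z).
Proof.
move=> met et0 Jz; apply/eqP; rewrite eq_le andbC; apply: ray_mass_between => //.
  move=> l /andP[l0 lu]; apply: (@lt1_epigraph _ _ F r0 Cconv r00 F2 (l *: z)%R).
  by rewrite JZ' ?(ltW l0)// -ltr_pdivlMr// mul1r.
move=> l l0 h; have := epigraph_le1 (h : C (l *: z)%R); rewrite JZ' ?(ltW l0)//.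
by rewrite -ler_pdivlMr// mul1r.
Qed.

Let dens_bd (et : bV R n -> R) (z : V) (a : R) : (forall x, (0 <= et x <= 1)%R) ->
  forall l, (0 <= l <= a)%R -> (ray_dens et z l <= a ^+ n * expR (a * `|z.2|))%R.
Proof.
move=> e01 l /andP[l0 la]; have a0 := le_trans l0 la.
apply: ler_pM; rewrite ?exprn_ge0 ?mulr_ge0 ?expR_ge0//; first by case/andP: (e01 (l *: z.1)%R).
  by rewrite lerXn2r ?nnegrE.
have /andP[e0 e1] := e01 (l *: z.1)%R.
apply: (@le_trans _ _ (1 * expR (a * `|z.2|)))%R; last by rewrite mul1r.
apply: ler_pM; rewrite ?expR_ge0// ler_expR; apply: le_trans (ler_norm _) _.
by rewrite normrN normrM ger0_norm// ler_wpM2r.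
Qed.

Let dens_ex (et : bV R n -> R) (z : V) : (forall x, (0 <= et x <= 1)%R) ->
  forall a, exists B : R, forall l, (0 <= l <= a)%R -> (ray_dens et z l <= B)%R.
Proof. by move=> e01 a; exists (a ^+ n * expR (a * `|z.2|))%R; exact: dens_bd. Qed.

Let one01 x : (0 <= one x <= 1)%R. Proof. by rewrite /one ler01 lexx. Qed.

Let rfin (et : bV R n -> R) (z : V) a : measurable_fun setT et -> (forall x, (0 <= et x <= 1)%R) ->
  ray_int (ray_dens et z) a \is a fin_num.
Proof.
move=> met e01; have e0 x : (0 <= et x)%R by case/andP: (e01 x).
apply: ray_int_fin; [by move=> l l0; exact: ray_dens_ge0|exact: measurable_ray_dens|exact: dens_ex].
Qed.

Let massF_fin (et : bV R n -> R) (z : V) : measurable_fun setT et -> (forall x, (0 <= et x <= 1)%R) -> (0 < J z)%R ->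
  ray_mass et F z \is a fin_num.
Proof. by move=> met e01 Jz; rewrite mass0// ?rfin// => x; case/andP: (e01 x). Qed.

Let I (t : R) := ray_mass xi (Ft t).
Let I0 := ray_mass xi F.
Let I1 := ray_mass one F.

Let FtE' t z l : (0 < t)%R -> (expR (- (l * z.2)) < Ft t (l *: z.1))%R <-> shifted F D t (l *: z)%R.
by move=> t0; exact: (FtE (l *: z)%R t0). Qed.

Let I_between t z (a : R) : (0 < t)%R -> (0 < J z)%R ->
  (forall l, (0 < l < a)%R -> shifted F D t (l *: z)%R) ->
  ray_int (ray_dens xi z) a <= I t z <= ray_int (ray_dens xi z) (u z * (1 + t * rho z))%R.
Proof.
move=> t0 Jz ha; apply: ray_mass_between => //.
- exact: mFt.
- by move=> l /ha; rewrite FtE'.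
- move=> l l0 /(FtE' _ _ t0) h; exact: (shifted_upper Cconv r00 F2 DM Dd0 Jz t0 l0 h).
Qed.

Let I_bound t z : (0 < t)%R -> (0 < J z)%R ->
  ray_int (ray_dens xi z) (u z * (1 - t * M))%R <= I t z <= ray_int (ray_dens xi z) (u z * (1 + t * M))%R.
Proof.
move=> t0 Jz; have := @I_between t z (u z * (1 - t * M))%R t0 Jz.
move=> /(_ _)/wrap[].
  move=> l /andP[l0 l1]; apply: (shifted_lower Cconv r00 F2 Dd0 d0M t0 l0).
  by move: l1; rewrite /u ltr_pdivlMl// mulrC; lra.
move=> /andP[-> h]; apply: le_trans h _; apply: ray_int_le.
- by move=> l l0; exact: ray_dens_ge0.
- exact: measurable_ray_dens.
by rewrite ler_pM2l ?u0// lerD2l ler_pM2l//; exact: (rho_leM Cconv r00 F2 DM Dd0).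
Qed.

Let I_fin t z : (0 < t)%R -> (0 < J z)%R -> I t z \is a fin_num.
Proof.
move=> t0 Jz; have /andP[_ h] := I_bound t0 Jz.
rewrite ge0_fin_numE; last by apply: ray_mass_ge0 => // x; exact: Ft0.
by apply: le_lt_trans h _; rewrite -ge0_fin_numE ?rfin//; apply: integral_ge0 => l /=;
  rewrite in_itv/= => /andP[/ltW l0 _]; rewrite lee_fin ray_dens_ge0.
Qed.

(** A ray of gauge 0 never leaves the epigraph, nor its dilates with t M < 1, so it contributes
    nothing to the derivative. *)
Let I_flat t z : (0 < t)%R -> (t * M < 1)%R -> J z = 0%R -> I t z = I0 z.
Proof.
move=> t0 tM Jz; apply: eq_integral => l; rewrite mem_setE in_itv/= andbT => l0.
have -> : (expR (- (l * z.2)) < Ft t (l *: z.1))%R.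
  by apply/FtE' => //; apply: (shifted_lower Cconv r00 F2 Dd0 d0M t0 l0); rewrite Jz mulr0 add0r.
have -> // : (expR (- (l * z.2)) < F (l *: z.1))%R.
by apply: (@lt1_epigraph _ _ F r0 Cconv r00 F2 (l *: z)%R); rewrite JZ' ?(ltW l0)// Jz mulr0.
Qed.

(** Origin of the factors: the ends of the ray differ by at most 2 t M u; l^n is at most (3 u / 2)^n
    there; 4^(n+1) comes from comparing with l >= u / 4 on an interval of length u / 4; the
    exponentials lose e^(3 b / 2) and e^(b / 2). *)
Let K : R := (2 * M * (3%:R / 2) ^+ n * 4%:R ^+ n.+1 * expR (2 * b))%R.

Let K0 : (0 <= K)%R.
Proof.
rewrite /K; apply: mulr_ge0; last exact: expR_ge0.
apply: mulr_ge0; last by rewrite exprn_ge0.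
by apply: mulr_ge0; [apply: mulr_ge0|rewrite exprn_ge0// divr_ge0].
Qed.

(** Both masses differ on the part of the ray between u / 2 and 3 u / 2 only. The density there is
    comparable to the one on [u / 4, u / 2], up to a constant, because the exponent is controlled by
    [J_lb]; so the difference quotient is dominated by the undisturbed mass, which is integrable. *)
Let I_dom t z : (0 < t)%R -> (t * M <= 2^-1)%R -> (0 < J z)%R ->
  (`|fine (I t z) - fine (I0 z)| <= t * (K * fine (I1 z)))%R.
Proof.
move=> t0 tM Jz; have up := u0 Jz.
have lb : (- b <= z.2 * u z)%R.
  by have := J_lb Cconv r00 F2 FB z; rewrite /u ler_pdivlMr// mulNr.
have b0 : (0 <= b)%R.
  have : (expR 1 <= expR b)%R by apply: le_trans (F2 _) (FB 0%R); rewrite enorm0 ltW. by rewrite ler_expR; lra.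
have tM0 : (0 <= t * M)%R by rewrite mulr_ge0// ltW.
pose E : R := expR (- (u z * z.2 / 2)).
have E0 : (0 < E)%R by exact: expR_gt0.
pose Bd : R := ((3%:R / 2 * u z) ^+ n * (expR (3%:R / 2 * b) * E))%R.
have Bd0 : (0 <= Bd)%R by rewrite !mulr_ge0 ?exprn_ge0 ?expR_ge0 ?mulr_ge0// ltW.
have dens_up l : (u z / 2 <= l <= 3%:R / 2 * u z)%R -> (0 <= ray_dens xi z l <= Bd)%R.
  move=> /andP[l1 l2]; have l0 : (0 <= l)%R by lra.
  rewrite ray_dens_ge0//=; apply: ler_pM; rewrite ?exprn_ge0 ?mulr_ge0 ?expR_ge0//.
    by rewrite lerXn2r ?nnegrE// mulr_ge0// ltW.
  have /andP[x0 x1] := xi01 (l *: z.1)%R. rewrite -[X in (_ <= X)%R]mul1r; apply: ler_pM; rewrite ?expR_ge0//.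
  rewrite -expRD ler_expR; have [s0|s0] := leP 0%R z.2.
    have : (u z / 2 * z.2 <= l * z.2)%R by rewrite ler_wpM2r.
    have : (0 <= 3%:R / 2 * b)%R by apply: mulr_ge0 => //; lra. lra.
  have : (3%:R / 2 * u z * z.2 <= l * z.2)%R by rewrite ler_wnM2r// ltW.
  have : (u z * z.2 <= 0)%R by rewrite nmulr_lle0// ltW. lra.
have dens_lo l : (u z / 4%:R <= l <= u z / 2)%R ->
    ((u z / 4%:R) ^+ n * (expR (- (b / 2)) * E) <= ray_dens one z l <= Num.max 0 ((u z / 2) ^+ n * expR (u z / 2 * `|z.2|)))%R.
  move=> /andP[l1 l2]; have l0 : (0 <= l)%R by lra.
  apply/andP; split; last by rewrite le_max; apply/orP; right; apply: dens_bd => //; rewrite l0.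
  rewrite /ray_dens mul1r; apply: ler_pM; rewrite ?exprn_ge0 ?mulr_ge0 ?expR_ge0//; try lra.
    by rewrite lerXn2r ?nnegrE//; lra.
  rewrite -expRD ler_expR; have [s0|s0] := leP 0%R z.2.
    have : (l * z.2 <= u z / 2 * z.2)%R by rewrite ler_wpM2r. lra.
  have : (l * z.2 <= 0)%R by rewrite mulr_ge0_le0// ltW. by move: lb; rewrite (mulrC z.2); lra.
have h0x (et : bV R n -> R) : (forall x, (0 <= et x <= 1)%R) -> forall l, (0 <= l)%R -> (0 <= ray_dens et z l)%R.
  by move=> e01 l l0; apply: ray_dens_ge0 => // x; case/andP: (e01 x).
have i1 : ((u z / 4%:R) ^+ n.+1 * (expR (- (b / 2)) * E) <= fine (I1 z))%R.
  have := @ray_int_bounds _ (ray_dens one z) (h0x one one01) (measurable_ray_dens mone z) (dens_ex z one01)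
    (u z / 4%:R)%R (u z / 2)%R ((u z / 4%:R) ^+ n * (expR (- (b / 2)) * E))%R (Num.max 0 ((u z / 2) ^+ n * expR (u z / 2 * `|z.2|)))%R.
  move=> /(_ _ _ _ _ dens_lo)/wrap[||||].
  - by rewrite divr_gt0.
  - by lra.
  - by rewrite !mulr_ge0 ?exprn_ge0 ?expR_ge0 ?divr_ge0// ltW.
  - by rewrite le_max lexx.
  move=> /andP[h _]. have h2 : (fine (ray_int (ray_dens one z) (u z / 2)) <= fine (I1 z))%R.
    rewrite /I1 mass0//; apply: fine_le; rewrite ?rfin//; apply: ray_int_le.
    - exact: h0x.
    - exact: measurable_ray_dens.
    - lra.
  have h3 : (0 <= fine (ray_int (ray_dens one z) (u z / 4%:R)))%R.
    apply: fine_ge0; apply: integral_ge0 => l /=; rewrite in_itv/= => /andP[/ltW l0 _]. by rewrite lee_fin h0x.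
  have h4 : (fine (ray_int (ray_dens one z) (u z / 2)) - fine (ray_int (ray_dens one z) (u z / 4%:R)) <= fine (I1 z))%R.
    by rewrite lerBlDr; apply: le_trans h2 _; rewrite lerDl.
  rewrite exprS (_ : (_ * _ * _)%R = ((u z / 4%:R) ^+ n * (expR (- (b / 2)) * E) * (u z / 2 - u z / 4%:R))%R).
    exact: le_trans h h4.
  by move: ((u z / 4%:R) ^+ n)%R (expR _ * E)%R => P Q; field.
have /andP[A1 A2] := I_bound t0 Jz.
have A3 : ray_int (ray_dens xi z) (u z * (1 - t * M))%R <= I0 z.
  rewrite /I0 mass0//; apply: ray_int_le; [exact: h0x|exact: measurable_ray_dens|].
  by rewrite ler_piMr ?(ltW up)//; lra.
have A4 : I0 z <= ray_int (ray_dens xi z) (u z * (1 + t * M))%R.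
  rewrite /I0 mass0//; apply: ray_int_le; [exact: h0x|exact: measurable_ray_dens|].
  by rewrite ler_peMr ?(ltW up)//; lra.
have fI := I_fin t0 Jz; have fI0 : I0 z \is a fin_num by exact: massF_fin.
have {A1}A1 := fine_le (rfin _ _ mxi xi01) fI A1.
have {A2}A2 := fine_le fI (rfin _ _ mxi xi01) A2.
have {A3}A3 := fine_le (rfin _ _ mxi xi01) fI0 A3.
have {A4}A4 := fine_le fI0 (rfin _ _ mxi xi01) A4.
have := @ray_int_bounds _ (ray_dens xi z) (h0x xi xi01) (measurable_ray_dens mxi z) (dens_ex z xi01)
    (u z * (1 - t * M))%R (u z * (1 + t * M))%R 0%R Bd.
move=> /(_ _ _ (lexx _) Bd0 _)/wrap[|||].
- by rewrite mulr_gt0//; lra.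
- by rewrite ler_pM2l//; lra.
- move=> l /andP[l1 l2]; apply: dens_up; apply/andP; split.
    apply: le_trans l1; rewrite ler_pM2l//; lra.
  by apply: le_trans l2 _; rewrite mulrC ler_pM2r//; lra.
move=> /andP[_ B1].
have B2 : (Bd * (u z * (1 + t * M) - u z * (1 - t * M)) = t * (K * ((u z / 4%:R) ^+ n.+1 * (expR (- (b / 2)) * E))))%R.
  rewrite /Bd /K [((u z / 4%:R) ^+ n.+1)%R]expr_div_n exprMn [(u z ^+ n.+1)%R]exprS.
  have -> : expR (2 * b) = (expR (3%:R / 2 * b) / expR (- (b / 2)))%R by rewrite -expRN -expRD; congr expR; lra.
  have := expR_gt0 (- (b / 2)); have : (4%:R ^+ n.+1 != 0 :> R)%R by rewrite expf_neq0// pnatr_eq0.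
  move: ((3%:R / 2) ^+ n)%R (u z ^+ n)%R (4%:R ^+ n.+1)%R (expR (3%:R / 2 * b)) (expR (- (b / 2))) => a1 a2 a3 a4 a5 a30 a50.
  by field; rewrite a30 gt_eqF.
have B3 : (t * (K * ((u z / 4%:R) ^+ n.+1 * (expR (- (b / 2)) * E))) <= t * (K * fine (I1 z)))%R.
  by rewrite ler_pM2l// ler_wpM2l.
by rewrite ler_norml; lra.
Qed.

(** The directions whose rays leave the epigraph; the whole derivative is concentrated on them. *)
Definition ray_shell : set (bV R n * R)%type := [set z | (0 < J z)%R].
Local Notation A := ray_shell.
Definition ray_deriv (z : V) : R := (kw z.1 * (u z * rho z * ray_dens xi z (u z)))%R.

Let mA : measurable (A : set (bV R n * R)%type).
exact: (measurable_lt_set (measurable_cst _) mJ). Qed.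

Let mkw : measurable_fun setT (fun z : bV R n * R => kw z.1).
exact: (measurableT_comp (@measurable_kw R n) measurable_fst). Qed.

Let T (t : R) (z : V) : R := ((fine (I t z) - fine (I0 z)) / t)%R.

Let T_cvg z : (0 < J z)%R -> forall e : R, (0 < e)%R -> exists2 t0 : R, (0 < t0)%R & forall t, (0 < t < t0)%R ->
  (`|T t z - u z * rho z * ray_dens xi z (u z)| <= e)%R.
Proof.
move=> Jz e e0; have up := u0 Jz.
have h0x l : (0 <= l)%R -> (0 <= ray_dens xi z l)%R by move=> l0; apply: ray_dens_ge0.
have cd : {for (u z), continuous (ray_dens xi z)}.
  apply: (@continuousM R R _ _ (u z)); first exact: exprn_continuous. apply: (@continuousM R R _ _ (u z)).
    apply: (@continuous_comp _ _ _ (fun l : R => (l *: z.1)%R) xi); last exact: cxi. exact: (@scalel_continuous).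
  apply: (@continuous_comp _ _ _ (fun l : R => (- (l * z.2))%R) (@expR R)); last exact: continuous_expR.
  by apply: continuousN; apply: continuousM; [exact: cvg_id|exact: cvg_cst].
have [eps [eps0 [t0 t00 h]]] := ray_limit h0x (measurable_ray_dens mxi z) (dens_ex z xi01) (rho z) up cd e0.
have [t1 t10 h1] := shifted_lower_eps Cconv r00 F2 DM Dd0 Jz eps0.
exists (Num.min t0 t1); first by rewrite lt_min t00.
move=> t /andP[tp]; rewrite lt_min => /andP[tt0 tt1].
have t0t : (0 < t < t1)%R by rewrite tp.
have /andP[B1 B2] := I_between tp Jz (fun l => h1 t l t0t).
have fI := I_fin tp Jz.
rewrite /T /I0 mass0//; apply: h; first by rewrite tp.
by rewrite !fine_le// ?rfin.
Qed.

(** The weighted difference quotient, set to 0 for larger t so that the domination by [g] holds for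
    every t > 0. *)
Let f (t : R) (z : bV R n * R) : \bar R := if (t * M <= 2^-1)%R then (kw z.1 * T t z)%:E else 0.
Let g (z : bV R n * R) : \bar R := (kw z.1 * (K * fine (I1 z)))%:E.

Let mfI (t : R) : (0 < t)%R -> measurable_fun A (fun z : bV R n * R => fine (I t z)).
Proof.
move=> t0; apply: measurable_funTS; apply: measurableT_comp; first exact: fine_measurable.
by apply: measurable_ray_mass => //; exact: mFt.
Qed.

Let mfI0 (et : bV R n -> R) : measurable_fun setT et -> (forall x, (0 <= et x)%R) ->
  measurable_fun A (fun z : bV R n * R => fine (ray_mass et F z)).
Proof.
move=> met et0; apply: measurable_funTS; apply: measurableT_comp; first exact: fine_measurable.
exact: measurable_ray_mass.
Qed.

Let mf (t : R) : (0 < t)%R -> measurable_fun A (f t : bV R n * R -> \bar R).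
Proof.
move=> t0; rewrite /f; case: (t * M <= 2^-1)%R; last exact: measurable_cst.
apply/measurable_EFinP; apply: measurable_funM; first exact: measurable_funTS.
apply: measurable_funM => //; apply: measurable_funB; [exact: mfI|exact: mfI0].
Qed.

Let mass_int (et : bV R n -> R) : measurable_fun setT et -> (forall x, (0 <= et x <= 1)%R) ->
  (lamR R n).-integrable A (fun z => (kw z.1 * fine (ray_mass et F z))%:E).
Proof.
move=> met e01; have e0 x : (0 <= et x)%R by case/andP: (e01 x).
apply/integrableP; split.
  apply/measurable_EFinP; apply: measurable_funM; [exact: measurable_funTS|exact: mfI0].
have -> : \int[lamR R n]_(z in A) `|(kw z.1 * fine (ray_mass et F z))%:E| =
    \int[lamR R n]_(z in A) ((kw z.1)%:E * ray_mass et F z).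
  apply: eq_integral => z /set_mem Jz; rewrite -(fineK (massF_fin met e01 Jz)) -EFinM/= ger0_norm//.
  rewrite mulr_ge0 ?kw_ge0// fine_ge0//; exact: ray_mass_ge0.
have mkI : measurable_fun setT (fun z : bV R n * R => (kw z.1)%:E * ray_mass et F z).
  by apply: emeasurable_funM; [exact/measurable_EFinP|exact: measurable_ray_mass].
apply: (@le_lt_trans _ _ (\int[lamR R n]_z ((kw z.1)%:E * ray_mass et F z))).
  apply: ge0_subset_integral => //. by move=> z _; rewrite mule_ge0 ?lee_fin ?kw_ge0// ray_mass_ge0.
rewrite -subgraph_polar//; apply: le_lt_trans intF; apply: ge0_le_integral => //.
- by move=> x _; rewrite lee_fin mulr_ge0.
- by apply/measurable_EFinP; apply: measurable_funM.
- exact/measurable_EFinP.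
- by move=> x _; rewrite lee_fin ler_piMl//; case/andP: (e01 x).
Qed.

Let g_int : (lamR R n).-integrable A g.
Proof.
have := integrableZl mA K (mass_int mone one01).
by apply: eq_integrable => // z _; rewrite /g -EFinM mulrCA.
Qed.

Let f_le t z : (0 < t)%R -> A z -> `|f t z| <= g z.
Proof.
move=> t0 Jz; rewrite /f /g; case: ifPn => tM; last first.
  rewrite abse0 lee_fin mulr_ge0 ?kw_ge0// mulr_ge0//; last by rewrite fine_ge0//; exact: ray_mass_ge0.
rewrite /= lee_fin normrM ger0_norm ?kw_ge0// ler_wpM2l ?kw_ge0//.
rewrite /T normrM normfV (gtr0_norm t0) ler_pdivrMr// mulrC.
exact: I_dom.
Qed.

Let f_int t : (0 < t)%R -> (lamR R n).-integrable A (f t).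
Proof.
move=> t0; apply: le_integrable g_int => //; first exact: mf.
move=> z Az; apply: le_trans (f_le t0 Az) _; exact: lee_abs.
Qed.

Let f_cvg (tk : nat -> R) z : (forall k, (0 < tk k)%R) -> tk k @[k --> \oo] --> (0 : R)%R -> A z ->
  f (tk k) z @[k --> \oo] --> (ray_deriv z)%:E.
Proof.
move=> tk0 tkl Jz; apply/fine_cvgP; split.
  by apply: nearW => k; rewrite /f; case: ifP.
apply/cvgrPdist_le => e e0; have k0 := kw_ge0 z.1.
have e1 : (0 < e / (kw z.1 + 1))%R by rewrite divr_gt0// ltr_wpDl.
have [t0 t00 h] := T_cvg Jz e1.
have M1 : (0 < M + 1)%R by rewrite ltr_wpDl.
have : (0 < Num.min t0 (2^-1 / (M + 1)))%R by rewrite lt_min t00 divr_gt0.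
move/cvgrPdist_lt : tkl => tkl /tkl; apply: filterS => k.
rewrite sub0r normrN gtr0_norm// lt_min => /andP[kt0 kM].
have tM : (tk k * M <= 2^-1)%R by move: kM; rewrite ltr_pdivlMr// mulrDr mulr1; have := tk0 k; lra.
rewrite /= /f tM /ray_deriv/= -mulrBr normrM ger0_norm// distrC.
have := h (tk k); rewrite (tk0 k) kt0 => /(_ isT) h'.
apply: le_trans (ler_wpM2l k0 h') _.
by rewrite mulrCA ler_piMr ?(ltW e0)// ler_pdivrMr ?ltr_wpDl//; lra.
Qed.

Let m_deriv : measurable_fun A (fun z : bV R n * R => (ray_deriv z)%:E).
Proof.
pose tk k : R := (k.+1%:R^-1)%R.
apply: (@emeasurable_fun_cvg _ _ _ A (fun k => f (tk k) : bV R n * R -> \bar R)).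
  by move=> k; apply: mf; rewrite invr_gt0.
by move=> z Az; apply: f_cvg => //; [move=> k; rewrite invr_gt0|exact: cvg_harmonic].
Qed.

Let f_dct (tk : nat -> R) : (forall k, (0 < tk k)%R) -> tk k @[k --> \oo] --> (0 : R)%R ->
  (lamR R n).-integrable A (fun z => (ray_deriv z)%:E) /\
  \int[lamR R n]_(z in A) f (tk k) z @[k --> \oo] --> \int[lamR R n]_(z in A) (ray_deriv z)%:E.
Proof.
move=> tk0 tkl.
have [] := @dominated_convergence _ _ R (lamR R n) A mA (fun k => f (tk k)) (fun z => (ray_deriv z)%:E) g.
- by move=> k; exact: mf.
- exact: m_deriv.
- by apply: aeW => z Az; exact: f_cvg.
- exact: g_int.
- by apply: aeW => z k Az; exact: f_le.
- by move=> h1 _ h2; split.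
Qed.

Lemma ray_deriv_integrable : (lamR R n).-integrable A (fun z => (ray_deriv z)%:E).
Proof.
have p k : (0 < (k.+1%:R^-1 : R))%R by rewrite invr_gt0.
by have [] := f_dct p (@cvg_harmonic R).
Qed.

Lemma integral_F_fin : \int[@lam R n]_x (xi x * F x)%:E \is a fin_num.
Proof.
rewrite ge0_fin_numE; last by apply: integral_ge0 => x _; rewrite lee_fin mulr_ge0.
apply: le_lt_trans intF; apply: ge0_le_integral => //.
- by move=> x _; rewrite lee_fin mulr_ge0.
- by apply/measurable_EFinP; apply: measurable_funM.
- exact/measurable_EFinP.
- by move=> x _; rewrite lee_fin ler_piMl//; case/andP: (xi01 x).
Qed.

Let split_int t : (0 < t)%R -> (t * M <= 2^-1)%R ->
  \int[@lam R n]_x (xi x * Ft t x)%:E = \int[@lam R n]_x (xi x * F x)%:E + t%:E * \int[lamR R n]_(z in A) f t z.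
Proof.
move=> t0 tM.
have split (G : bV R n -> R) : measurable_fun setT G -> (forall x, (0 <= G x)%R) ->
    \int[@lam R n]_x (xi x * G x)%:E =
    \int[lamR R n]_(z in ~` A) ((kw z.1)%:E * ray_mass xi G z) + \int[lamR R n]_(z in A) ((kw z.1)%:E * ray_mass xi G z).
  move=> mG G0; rewrite subgraph_polar// -(setUCl A) ge0_integral_setU//.
  - exact: measurableC.
  - rewrite setUCl; apply: emeasurable_funM; [exact/measurable_EFinP|exact: measurable_ray_mass].
  - by move=> z _; rewrite mule_ge0 ?lee_fin ?kw_ge0// ray_mass_ge0.
  - by apply/disj_setPS => z [].
rewrite (split (Ft t)) => [|//|x]; [|exact: mFt|exact: Ft0].
rewrite (split F mF F0) -addeA; congr (_ + _).
  apply: eq_integral => z /set_mem nA; congr (_ * _); apply: (I_flat t0); first lra.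
  by apply/eqP; rewrite eq_le J0 andbT leNgt; apply/negP.
have -> : \int[lamR R n]_(z in A) ((kw z.1)%:E * ray_mass xi (Ft t) z) =
   \int[lamR R n]_(z in A) ((kw z.1 * fine (I0 z))%:E + t%:E * f t z).
  apply: eq_integral => z /set_mem Jz; rewrite /f tM -[ray_mass xi (Ft t) z]/(I t z) -(fineK (I_fin t0 Jz)) -!EFinM -EFinD.
  by congr EFin; rewrite /T; field; rewrite gt_eqF.
rewrite integralD//; [|exact: mass_int|exact: integrableZl (f_int t0)].
rewrite integralZl//; last exact: f_int.
congr (_ + _); apply: eq_integral => z /set_mem Jz.
by rewrite EFinM fineK// massF_fin.
Qed.

Lemma machine_fin t : (0 < t)%R -> (t * M <= 2^-1)%R -> \int[@lam R n]_x (xi x * Ft t x)%:E \is a fin_num.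
Proof.
move=> t0 tM; rewrite split_int// fin_numD integral_F_fin fin_numM//.
exact: integrable_fin_num (f_int t0).
Qed.

Lemma machine_cvg :
  ((fine (\int[@lam R n]_x (xi x * Ft t x)%:E) - fine (\int[@lam R n]_x (xi x * F x)%:E)) / t)%R @[t --> 0^'+]
  --> fine (\int[lamR R n]_(z in A) (ray_deriv z)%:E).
Proof.
have M1 : (0 < M + 1)%R by rewrite ltr_wpDl.
apply: (@cvg_trans _ ((fine (\int[lamR R n]_(z in A) f t z)) @[t --> (0 : R)^'+])).
  apply: near_eq_cvg; near=> t. have t0 : (0 < t)%R by near: t; exact: nbhs_right_gt. have tM : (t * M <= 2^-1)%R.
    have : (t < 2^-1 / (M + 1))%R by near: t; apply: nbhs_right_lt; rewrite divr_gt0.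
    by rewrite ltr_pdivlMr// mulrDr mulr1; lra.
  have fi : \int[lamR R n]_(z in A) f t z \is a fin_num by exact: integrable_fin_num (f_int t0).
  have -> := split_int t0 tM; rewrite -(fineK integral_F_fin) -(fineK fi) -EFinM -EFinD /=.
  by rewrite addrAC subrr add0r mulrAC divff ?mul1r// gt_eqF.
apply/cvg_at_rightP => tk [tk0 tkl].
have [_ h] := f_dct tk0 tkl.
apply: fine_cvg; rewrite fineK//.
exact: integrable_fin_num ray_deriv_integrable.
Unshelve. all: by end_near. Qed.

End machine.

(** * Normalizing a log-concave function of finite positive integral *)

Section convex_ball.
Variable R : realType.
Local Open Scope ereal_scope.

Definition convex_rV n (A : set 'rV[R]_n) := forall x y (l : R), (0 <= l <= 1)%R -> A x -> A y -> A ((1 - l) *: x + l *: y)%R.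

Lemma leb_set1 (a : R) : @leb R [set a] = 0.
Proof.
have -> : [set a] = `[a, a]%classic by rewrite set_itv1.
by rewrite [LHS]leb_itv/= ltxx.
Qed.

(** Induction on the dimension. Two parallel slices of positive measure contain cubes by induction,
    and convex combinations of these two cubes contain a cube halfway between them. *)
Lemma convex_cube n (A : set 'rV[R]_n) : convex_rV A -> measurable (A : set (bV R n)) ->
  0 < @lam R n A -> exists c : 'rV[R]_n, exists2 r : R, (0 < r)%R &
  forall y : 'rV[R]_n, (forall i, `|y ord0 i - c ord0 i| <= r)%R -> A y.
Proof.
elim: n A => [|n IH] A cA mA A0.
  have [A00|/set0P[x Ax]] := eqVneq A set0; first by move: A0; rewrite A00 [X in _ < X]measure0 ltxx.
  exists x, 1%R => // y _; suff -> : y = x by []. by apply/rowP => -[].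
pose S (a : R) : set 'rV[R]_n := [set v | A (vcons v a)].
have mvc (a : R) : measurable_fun setT ((fun v => vcons v a) : bV R n -> bV R n.+1).
  exact: (measurableT_comp (@measurable_vconsp R n) (measurable_pair2 _)).
have mS a : measurable (S a : set (bV R n)) by have := mvc a measurableT _ mA; rewrite setTI.
have cS a : convex_rV (S a).
  move=> x y l l01 Sx Sy; have := cA _ _ l l01 Sx Sy; rewrite -vconsD.
  by have -> : ((1 - l) * a + l * a = a)%R by ring.
have lE : lam A = \int[@leb R]_a lam (S a).
  have -> : lam A = \int[@lam R n.+1]_x (\1_A x)%:E by rewrite integral_indic// setIT.
  rewrite lam_fubini2//; last by apply/measurable_EFinP; exact: measurable_indic. apply: eq_integral => a _.
  have -> : lam (S a) = \int[@lam R n]_v (\1_(S a) v)%:E by rewrite integral_indic// setIT.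
  by apply: eq_integral => v _; rewrite !indicE; congr ((nat_of_bool _)%:R%:E); apply/idP/idP => /set_mem h; exact/mem_set.
(* If at most one slice had positive measure, Fubini would give measure 0, a single level being
   negligible. *)
have [a1 [a2 [a12 [p1 p2]]]] : exists a1 a2 : R, (a1 < a2)%R /\ 0 < @lam R n (S a1) /\ 0 < @lam R n (S a2).
  apply: contrapT => no. have [a1 p1] : exists a1, 0 < @lam R n (S a1).
    apply: contrapT => h; move: A0; rewrite lE integral0_eq ?ltxx// => a _.
    by apply/eqP; rewrite eq_le measure_ge0 andbT leNgt; apply/negP => ?; apply: h; exists a.
  have z a : a != a1 -> @lam R n (S a) = 0.
    move=> aa; apply/eqP; rewrite eq_le measure_ge0 andbT leNgt; apply/negP => pa.
    by apply: no; have [lt|lt|e] := ltgtP a a1; [exists a, a1|exists a1, a|move: aa; rewrite e eqxx].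
  move: A0; rewrite lE (_ : \int[_]_a _ = 0) ?ltxx//. transitivity (\int[@leb R]_(a in [set a1]) lam (S a)).
    rewrite [RHS]integral_mkcond; apply: eq_integral => a _; rewrite patchE.
    case: ifPn => //; rewrite notin_setE/= => /eqP aa; exact: z.
  transitivity (\int[@leb R]_(a in [set a1]) cst (lam (S a1)) a).
    by apply: eq_integral => a /set_mem ->.
  by rewrite integral_cst// [X in _ * X](leb_set1 a1) mule0.
have [c1 [r1 r10 h1]] := IH _ (cS a1) (mS a1) p1.
have [c2 [r2 r20 h2]] := IH _ (cS a2) (mS a2) p2.
pose w : 'rV[R]_n := (c2 - c1)%R.
pose r := Num.min r1 r2; have r0 : (0 < r)%R by rewrite lt_min r10.
pose W := (1 + enorm w)%R; have W0 : (0 < W)%R by rewrite ltr_wpDr ?enorm_ge0.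
pose q := (a2 - a1)%R; have q0 : (0 < q)%R by rewrite subr_gt0.
(* The first bound keeps the level of [y] between [a1] and [a2]; the last lets the centre of the
   interpolated cube drift by at most r / 2 with the level; the middle one leaves the other r / 2 to
   the point. *)
pose rh := (Num.min (q / 2) (Num.min (r / 2) (r * q / (2 * W))))%R.
have rh0 : (0 < rh)%R by rewrite !lt_min !divr_gt0 ?mulr_gt0.
exists (vcons (c1 + 2^-1 *: w)%R ((a1 + a2) / 2)%R), rh => // y hy.
pose a := y ord0 ord0; pose l := ((a - a1) / q)%R.
have ha : (`|a - (a1 + a2) / 2| <= rh)%R by have := hy ord0; rewrite vcons0.
have k1 : (rh <= q / 2)%R by rewrite ge_min lexx.
have k2 : (rh <= r / 2)%R by rewrite !ge_min lexx orbT.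
have k3 : (rh <= r * q / (2 * W))%R by rewrite !ge_min lexx !orbT.
have l01 : (0 <= l <= 1)%R.
  move: ha; rewrite ler_norml /l => /andP[b1 b2]; apply/andP; split.
    by apply: divr_ge0; [move: k1; rewrite /q; lra|exact: ltW].
  by rewrite ler_pdivrMr// mul1r; move: k1; rewrite /q; lra.
have lh : (`|l - 2^-1| * enorm w <= r / 2)%R.
  have -> : (l - 2^-1 = (a - (a1 + a2) / 2) / q)%R by rewrite /l /q; field; rewrite subr_eq0 gt_eqF.
  rewrite normrM normfV (gtr0_norm q0). apply: (@le_trans _ _ (r / (2 * W) * enorm w))%R.
    rewrite ler_wpM2r ?enorm_ge0// ler_pdivrMr//; apply: le_trans ha (le_trans k3 _). by rewrite mulrAC.
  have ww := enorm_ge0 w. have -> : (r / (2 * W) * enorm w = r / 2 * (enorm w / W))%R by field; rewrite gt_eqF.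
  by rewrite ler_piMr ?divr_ge0 ?(ltW r0)// ler_pdivrMr// mul1r /W; lra.
pose e : 'rV[R]_n := (vtail y - (c1 + l *: w))%R.
have he i : (`|e ord0 i| <= r)%R.
  have -> : (e ord0 i = (vtail y ord0 i - (c1 + 2^-1 *: w) ord0 i) - (l - 2^-1) * w ord0 i)%R.
    by rewrite !mxE; ring.
  apply: le_trans (ler_normB _ _) _; rewrite normrM.
  have : (`|l - 2^-1| * `|w ord0 i| <= `|l - 2^-1| * enorm w)%R by rewrite ler_wpM2l// coord_enorm.
  have := hy (lift ord0 i); rewrite vconsS.
  have -> : y ord0 (lift ord0 i) = vtail y ord0 i by rewrite -{1}(vconsK y) vconsS. lra.
have he1 (d : 'rV[R]_n) i : (`|(d + e) ord0 i - d ord0 i| <= r)%R.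
  have -> : ((d + e) ord0 i - d ord0 i = e ord0 i)%R by rewrite [(d + e)%R ord0 i]mxE addrAC subrr add0r. exact: he.
have A1 : A (vcons (c1 + e)%R a1) by apply: h1 => i; apply: le_trans (he1 _ i) _; rewrite ge_min lexx.
have A2 : A (vcons (c2 + e)%R a2) by apply: h2 => i; apply: le_trans (he1 _ i) _; rewrite ge_min lexx orbT.
have := cA _ _ l l01 A1 A2; rewrite -vconsD.
have -> : ((1 - l) * a1 + l * a2 = a)%R.
  by rewrite /l /q; field; rewrite subr_eq0 gt_eqF.
have -> : ((1 - l) *: (c1 + e) + l *: (c2 + e) = vtail y)%R.
  by rewrite /e /w; apply/rowP => i; rewrite !mxE; ring.
by rewrite vconsK.
Qed.

End convex_ball.

Section normalization.
Variables (R : realType) (n : nat) (f : 'rV[R]_n -> R).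
Hypothesis lf : LC f.
Local Open Scope ereal_scope.

Lemma LC_ge0 x : (0 <= f x)%R. Proof. by case: lf. Qed.

Lemma LC_measurable : measurable_fun setT (f : bV R n -> R).
Proof. by case: lf => _ uf _; exact: usc_measurable. Qed.

Lemma LC_superlevel_convex (a : R) : (0 <= a)%R -> convex_rV [set x | (a < f x)%R].
Proof.
move=> a0 x y l /andP[l0 l1] /= fx fy; have [_ _ /(_ x y l)] := lf.
rewrite l0 l1 => /(_ isT) h; apply: lt_le_trans h.
have lx := le_lt_trans a0 fx; have ly := le_lt_trans a0 fy.
have [->|l0'] := eqVneq l 0%R; first by rewrite subr0 powRr1 ?powRr0 ?mulr1// ltW.
have [->|l1'] := eqVneq l 1%R; first by rewrite subrr powRr0 mul1r powRr1// ltW.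
have lp : (0 < l)%R by rewrite lt0r l0'.
have lq : (0 < 1 - l)%R by rewrite subr_gt0 lt_neqAle l1'.
have -> : a = (a `^ (1 - l) * a `^ l)%R.
  have [->|an] := eqVneq a 0%R; first by rewrite (powR0 l0') mulr0. by rewrite -powRD ?subrK ?powRr1// an implybT.
apply: ltr_pM; rewrite ?powR_ge0//; apply: gt0_ltr_powR => //; rewrite nnegrE//; exact: ltW.
Qed.

Hypothesis f_pos : 0 < \int[@lam R n]_x (f x)%:E.
Hypothesis f_fin : \int[@lam R n]_x (f x)%:E < +oo.

Lemma LC_ball : exists d : R, exists c : 'rV[R]_n, exists r : R, [/\ (0 < d)%R, (0 < r)%R &
  forall y, (enorm (y - c) <= r)%R -> (d < f y)%R].
Proof.
have [k hk] : exists k : nat, 0 < @lam R n [set x | (k.+1%:R^-1 < f x)%R].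
  apply: contrapT => no; move: f_pos; rewrite layer_cake//; last 2 first.
  - exact: LC_measurable.
  - exact: LC_ge0.
  rewrite (_ : \int[_]_(a in _) _ = 0) ?ltxx//. have mf (a : R) : measurable ([set x | (a < f x)%R] : set (bV R n)).
    exact: (measurable_lt_set (measurable_cst _) LC_measurable).
  have nul : @lam R n [set x | (0 < f x)%R] = 0.
    apply/negligibleP; first exact: mf. have -> : [set x | (0 < f x)%R] = \bigcup_k [set x | (k.+1%:R^-1 < f x)%R].
      apply/seteqP; split => [x /= fx|x [k _ /=]]; last by apply: le_lt_trans; rewrite invr_ge0.
      exists (Num.truncn (f x)^-1) => //=; rewrite -[ltRHS]invrK ltf_pV2 ?posrE ?invr_gt0//. exact: truncnS_gt.
    apply: negligible_bigcup => k; apply/negligibleP; first exact: mf.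
    apply/eqP; rewrite eq_le measure_ge0 andbT leNgt; apply/negP => ha; apply: no. by exists k.
  apply: integral0_eq => a; rewrite /= in_itv/= andbT => a0.
  apply/eqP; rewrite eq_le measure_ge0 andbT -nul; apply: le_measure; rewrite ?inE; [exact: mf|exact: mf|].
  by move=> x /=; exact: le_lt_trans.
have d0 : (0 < (k.+1%:R^-1 : R))%R by rewrite invr_gt0.
have mA : measurable ([set x | (k.+1%:R^-1 < f x)%R] : set (bV R n)).
  exact: (measurable_lt_set (measurable_cst _) LC_measurable).
have [c [r r0 h]] := convex_cube (LC_superlevel_convex (ltW d0)) mA hk.
exists k.+1%:R^-1%R, c, r; split => // y yc; apply: h => i.
by have := coord_enorm (y - c) i; rewrite !mxE => h'; exact: le_trans h' yc.
Qed.

(** If f is at least d on a ball, then by log-concavity it is at least sqrt(f(x) d) on a ball of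
    half the radius, centred midway between x and the first centre. The volume of that ball does not
    depend on x and the integral is finite, which bounds f(x). *)
Lemma LC_bounded : exists B : R, forall x, (f x <= B)%R.
Proof.
have [d [c [r [d0 r0 h]]]] := LC_ball.
have fin : \int[@lam R n]_x (f x)%:E \is a fin_num.
  by rewrite ge0_fin_numE ?f_fin//; apply: integral_ge0 => x _; rewrite lee_fin LC_ge0.
pose I := fine (\int[@lam R n]_x (f x)%:E); pose v := (omega R n * (r / 2) ^+ n)%R.
have v0 : (0 < v)%R by rewrite mulr_gt0 ?omega_gt0// exprn_gt0// divr_gt0.
exists ((I / v) ^+ 2 / d)%R => x.
have [fx0|fx0] := leP (f x) 0%R.
  by apply: le_trans fx0 _; rewrite divr_ge0 ?sqr_ge0// ltW.
pose s := Num.sqrt (f x * d).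
have s0 : (0 < s)%R by rewrite sqrtr_gt0 mulr_gt0.
pose y0 : 'rV[R]_n := (2^-1 *: (x + c))%R.
have ball y : (enorm (y - y0) <= r / 2)%R -> (s <= f y)%R.
  move=> yy; pose w := (2 *: y - x)%R. have wc : (enorm (w - c) <= r)%R.
    have -> : (w - c = 2 *: (y - y0))%R by rewrite /w /y0; apply/rowP => i; rewrite !mxE; field.
    by rewrite enormZ gtr0_norm//; lra.
  have dw := h _ wc; have [_ _ /(_ x w 2^-1%R)] := lf. have -> : ((1 - 2^-1) *: x + 2^-1 *: w = y)%R.
    by rewrite /w; apply/rowP => i; rewrite !mxE; field.
  have l01 : (0 <= (2^-1 : R) <= 1)%R by apply/andP; split; lra.
  move=> /(_ l01); apply: le_trans; rewrite (_ : 1 - 2^-1 = 2^-1 :> R)%R; last by field.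
  rewrite -powRM ?LC_ge0// powR12_sqrt; last by rewrite mulr_ge0 ?LC_ge0. by rewrite ler_wsqrtr// ler_pM2l// ltW.
have sv : (s * v <= I)%R.
  rewrite -lee_fin fineK//; have r2 : (0 <= r / 2)%R by lra. have mb := measurable_cball y0 (r / 2)%R.
  rewrite EFinM /v -(lam_cball y0 r2) -integral_cst//.
  apply: (@le_trans _ _ (\int[@lam R n]_(y in [set y | (enorm (y - y0) <= r / 2)%R]) (f y)%:E)).
    apply: ge0_le_integral => //.
    - by move=> y _; rewrite lee_fin ltW.
    - by apply/measurable_EFinP; apply: measurable_funTS; exact: LC_measurable.
  apply: ge0_subset_integral => //.
  - by apply/measurable_EFinP; exact: LC_measurable.
  - by move=> y _; rewrite lee_fin LC_ge0.
have : (s ^+ 2 <= (I / v) ^+ 2)%R.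
  have sI : (s <= I / v)%R by rewrite ler_pdivlMr.
  by rewrite lerXn2r// nnegrE ?(ltW s0)//; exact: le_trans (ltW s0) sI.
by rewrite sqr_sqrtr ?mulr_ge0 ?(ltW fx0) ?(ltW d0)// ler_pdivlMr.
Qed.

Lemma LC_normalize : exists c : 'rV[R]_n, exists a r b : R, [/\ (0 < a)%R, (0 < r)%R,
  (forall y, (enorm y <= r)%R -> (expR 1 <= a * f (c + y))%R) &
  (forall y, (a * f (c + y) <= expR b)%R)].
Proof.
have [d [c [r [d0 r0 h]]]] := LC_ball; have [B hB] := LC_bounded.
have a0 : (0 < expR 1 / d :> R)%R by rewrite divr_gt0 ?expR_gt0.
(* The factor e / d lifts the lower bound d on the ball to e, as [F2] requires; the upper bound
   itself serves as exponent because e^b >= 1 + b. *)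
exists c, (expR 1 / d)%R, r, (expR 1 / d * Num.max B 0)%R; split => //.
  move=> y yr; rewrite mulrAC ler_pdivlMr// ler_pM2l ?expR_gt0// ltW//. by apply: h; rewrite addrAC subrr add0r.
move=> y; apply: (@le_trans _ _ (expR 1 / d * Num.max B 0))%R.
  by rewrite ler_pM2l// le_max hB.
by apply: le_trans (expR_ge1Dx _); rewrite lerDr.
Qed.

(** Strictness survives at l = 0 as well, which is why the two endpoint cases are separated: for l >
    0 the strict inequality at the second point is enough. *)
Lemma LC_epigraph_convex c (a : R) : (0 < a)%R -> let C := [set z : 'rV[R]_n * R | (expR (- z.2) < a * f (c + z.1))%R] in
  forall x y (l : R), (0 <= l <= 1)%R -> C x -> C y -> C ((1 - l) *: x + l *: y)%R.
Proof.
move=> a0 /= [x s] [y t] l /andP[l0 l1] /= fx fy.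
have px : (0 < f (c + x))%R by rewrite -(pmulr_rgt0 _ a0); apply: le_lt_trans fx; exact: expR_ge0.
have py : (0 < f (c + y))%R by rewrite -(pmulr_rgt0 _ a0); apply: le_lt_trans fy; exact: expR_ge0.
have [_ _ /(_ (c + x) (c + y) l)%R] := lf; rewrite l0 l1 => /(_ isT).
have -> : ((1 - l) *: (c + x) + l *: (c + y) = c + ((1 - l) *: x + l *: y))%R.
  by apply/rowP => i; rewrite !mxE; ring.
move=> h; apply: lt_le_trans (_ : _ < a * (f (c + x) `^ (1 - l) * f (c + y) `^ l))%R _; last by rewrite ler_pM2l.
have -> : (a * (f (c + x) `^ (1 - l) * f (c + y) `^ l) =
    expR (ln a + ((1 - l) * ln (f (c + x)) + l * ln (f (c + y)))))%R.
  by rewrite /powR !gt_eqF// -expRD [in RHS]expRD lnK ?posrE.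
rewrite ltr_expR.
have lnE z : (0 < f z)%R -> (ln (a * f z) = ln a + ln (f z))%R by move=> ?; rewrite lnM// posrE.
have ex : (- s < ln a + ln (f (c + x)))%R by rewrite -lnE// -ltr_expR lnK// posrE mulr_gt0.
have ey : (- t < ln a + ln (f (c + y)))%R by rewrite -lnE// -ltr_expR lnK// posrE mulr_gt0.
have [l00|lp] := eqVneq l 0%R; first by rewrite /GRing.scale/= l00 !subr0; lra.
have lp' : (0 < l)%R by rewrite lt0r lp.
have : (l * - t < l * (ln a + ln (f (c + y))))%R by rewrite ltr_pM2l.
have : ((1 - l) * - s <= (1 - l) * (ln a + ln (f (c + x))))%R by rewrite ler_wpM2l ?subr_ge0// ltW.
by rewrite /GRing.scale/=; lra.
Qed.

End normalization.

(** * Differentiability of - ln f through decay rates *)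

Section ascent.
Variables (R : realType) (n : nat) (f : 'rV[R]_n -> R).
Hypothesis lf : LC f.
Implicit Types x v : 'rV[R]_n.

(* [f] decays at rate at most [al] along [v]; by log-concavity one witness [t] controls all smaller ones *)
Definition decays f' x v (al : R) := exists2 t : R, 0 < t & f' x * expR (- (t * al)) <= f' (x + t *: v).
Local Notation up := (decays f).

Lemma decaysW x v al be : al <= be -> up x v al -> up x v be.
Proof.
move=> ab [t t0 h]; exists t => //; apply: le_trans h.
by rewrite ler_wpM2l ?(LC_ge0 lf)// ler_expR lerN2 ler_wpM2l// ltW.
Qed.

Lemma LC_decay x v al (t0 t : R) : 0 < t <= t0 -> f x * expR (- (t0 * al)) <= f (x + t0 *: v) ->
  f x * expR (- (t * al)) <= f (x + t *: v).
Proof.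
move=> /andP[tp tt] h; have t00 : 0 < t0 := lt_le_trans tp tt.
have [fx|fx] := leP (f x) 0.
  have -> : f x = 0 by apply/eqP; rewrite eq_le fx (LC_ge0 lf). by rewrite mul0r (LC_ge0 lf).
have [_ _ /(_ x (x + t0 *: v) (t / t0))] := lf.
have -> : (1 - t / t0) *: x + (t / t0) *: (x + t0 *: v) = x + t *: v.
  by apply/rowP => i; rewrite !mxE; field; rewrite gt_eqF.
have l01 : 0 <= t / t0 <= 1 by rewrite divr_ge0 ?(ltW tp) ?(ltW t00)//= ler_pdivrMr// mul1r.
move=> /(_ l01); apply: le_trans.
have : (f x * expR (- (t0 * al))) `^ (t / t0) <= f (x + t0 *: v) `^ (t / t0).
  by have /andP[? _] := l01; apply: ge0_ler_powR => //; rewrite nnegrE ?(LC_ge0 lf)// mulr_ge0 ?expR_ge0 ?(LC_ge0 lf).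
have e0 : 0 <= f x `^ (1 - t / t0) by exact: powR_ge0.
move/(ler_wpM2l e0); apply: le_trans.
have [p ->] : exists p, f x = expR p by exists (ln (f x)); rewrite lnK ?posrE.
rewrite -!expRD -!expRM -!expRD ler_expR le_eqVlt; apply/orP; left; apply/eqP.
by field; rewrite gt_eqF.
Qed.

Lemma decays_opp x v al be : 0 < f x -> up x v al -> up x (- v) be -> 0 <= al + be.
Proof.
move=> fx [t t0 ht] [s s0 hs].
pose r := Num.min t s; have r0 : 0 < r by rewrite lt_min t0.
have h1 : f x * expR (- (r * al)) <= f (x + r *: v) by apply: LC_decay ht; rewrite r0 ge_min lexx.
have h2 : f x * expR (- (r * be)) <= f (x + r *: - v) by apply: LC_decay hs; rewrite r0 ge_min lexx orbT.
have [_ _ /(_ (x + r *: v) (x + r *: - v) 2^-1)] := lf.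
have -> : (1 - 2^-1) *: (x + r *: v) + 2^-1 *: (x + r *: - v) = x.
  by apply/rowP => i; rewrite !mxE; field.
have l01 : 0 <= (2^-1 : R) <= 1 by apply/andP; split; lra.
have i2 : 1 - 2^-1 = 2^-1 :> R by field.
move=> /(_ l01); rewrite i2 => h.
have k1 : (f x * expR (- (r * al))) `^ 2^-1 * (f x * expR (- (r * be))) `^ 2^-1 <= f x.
  apply: le_trans h; apply: ler_pM; rewrite ?powR_ge0//; apply: ge0_ler_powR; rewrite ?nnegrE ?mulr_ge0 ?expR_ge0 ?(LC_ge0 lf)//; lra.
have [p Ep] : exists p, f x = expR p by exists (ln (f x)); rewrite lnK ?posrE.
move: k1; rewrite Ep -!expRD -!expRM -!expRD ler_expR => k1.
by rewrite -(pmulr_rge0 _ r0); lra.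
Qed.

Lemma decaysP x v al : up x v al <-> exists k : nat, f x * expR (- (k.+1%:R^-1 * al)) <= f (x + k.+1%:R^-1 *: v).
Proof.
split=> [[t t0 h]|[k h]]; last by exists k.+1%:R^-1.
exists (Num.truncn t^-1); apply: LC_decay h; rewrite invr_gt0 ltr0n/=.
by rewrite -[leRHS]invrK lef_pV2 ?posrE ?invr_gt0// ltW// truncnS_gt.
Qed.

Lemma measurable_decays v al : measurable ([set x | up x v al] : set (bV R n)).
Proof.
have -> : [set x | up x v al] = \bigcup_k [set x | f x * expR (- (k.+1%:R^-1 * al)) <= f (x + k.+1%:R^-1 *: v)].
  apply/seteqP; split => x /=; first by move=> /decaysP[k h]; exists k. by move=> [k _ h]; apply/decaysP; exists k.
apply: bigcupT_measurable => k.
apply: (@measurable_le_set _ (bV R n) R (fun x => f x * expR (- (k.+1%:R^-1 * al))) (fun x => f (x + k.+1%:R^-1 *: v))).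
  by apply: measurable_funM; [exact: LC_measurable|exact: measurable_cst].
have -> : (fun x : 'rV[R]_n => f (x + k.+1%:R^-1 *: v)) = f \o (fun x : 'rV[R]_n => (1 : R) *: x + k.+1%:R^-1 *: v).
  by apply/funext => x /=; rewrite scale1r.
apply: (measurableT_comp (f := f : bV R n -> R)); first exact: LC_measurable.
exact: measurable_affine.
Qed.

Lemma LC_jensen N (y : nat -> 'rV[R]_n) (c : nat -> R) : (forall i, expR (c i) <= f (y i)) ->
  expR (N.+1%:R^-1 * \sum_(i < N.+1) c i) <= f (N.+1%:R^-1 *: \sum_(i < N.+1) y i).
Proof.
move=> h; elim: N => [|N IH]; first by rewrite !big_ord_recl !big_ord0 !addr0 invr1 mul1r scale1r.
have N0 : (N.+1%:R : R) != 0 by rewrite pnatr_eq0.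
have N1 : (N.+2%:R : R) != 0 by rewrite pnatr_eq0.
rewrite big_ord_recr [in leRHS]big_ord_recr /=.
set S := \sum_(i < N.+1) c i; set Y := \sum_(i < N.+1) y i.
have [_ _ /(_ (N.+1%:R^-1 *: Y) (y N.+1) N.+2%:R^-1)] := lf.
have NS : N.+2%:R = 1 + N.+1%:R :> R by rewrite -natr1 addrC.
have l01 : 0 <= (N.+2%:R^-1 : R) <= 1 by rewrite invr_ge0 ler0n/= invf_le1 ?ltr0n// ler1n.
have -> : (1 - N.+2%:R^-1) *: (N.+1%:R^-1 *: Y) + N.+2%:R^-1 *: y N.+1 = N.+2%:R^-1 *: (Y + y N.+1).
  rewrite scalerA scalerDr; congr (_ *: _ + _); move: N0 N1; rewrite NS.
  by move: (N.+1%:R) => a ? ?; field; apply/andP.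
move=> /(_ l01); apply: le_trans; have /andP[l0 l1] := l01.
have -> : N.+2%:R^-1 * (S + c N.+1) = (1 - N.+2%:R^-1) * (N.+1%:R^-1 * S) + N.+2%:R^-1 * c N.+1.
  by move: N0 N1; rewrite NS; move: (N.+1%:R) => a ? ?; field; apply/andP.
rewrite expRD (mulrC (1 - _)) (expRM (_ * S)) (mulrC _ (c _)) (expRM (c _)).
by apply: ler_pM; rewrite ?powR_ge0//; apply: ge0_ler_powR; rewrite ?nnegrE ?expR_ge0 ?(LC_ge0 lf)// ?subr_ge0.
Qed.

End ascent.

Section gradient.
Variables (R : realType) (m : nat).
Local Notation n := m.+1.
Variable f : 'rV[R]_n -> R.
Hypothesis lf : LC f.
Implicit Types x v nu : 'rV[R]_n.
Local Notation e_ i := (delta_mx 0 i : 'rV[R]_n).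
Local Notation phi := (fun y : 'rV[R]_n => - ln (f y)).

(** Two-sided differentiability of - ln f' along the coordinate axes, with partial derivatives [nu],
    stated without logarithms. For log-concave functions it is equivalent to differentiability at an
    interior point of the support, see [slopesP], and it has a countable description. *)
Definition slopes f' x nu := 0 < f' x /\ forall i (eta : R), 0 < eta ->
  decays f' x (e_ i) (nu ord0 i + eta) /\ decays f' x (- e_ i) (- nu ord0 i + eta).

(** The point x + w is the average of the n points x + n w_i e_i, so Jensen turns the rates along
    the axes into a lower bound in all directions. The factor n in those points explains the radius
    t / n. *)
Lemma slopes_expand x nu : slopes f x nu -> forall eta : R, 0 < eta -> exists2 d : R, 0 < d & forall w : 'rV[R]_n,
  (forall i, `|w ord0 i| <= d) -> f x * expR (- (inner nu w + eta * \sum_i `|w ord0 i|)) <= f (x + w).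
Proof.
move=> [fx h] eta eta0.
have n0 : 0 < (n%:R : R) by rewrite ltr0n.
have [t t0 ht] : exists2 t : R, 0 < t & forall i, f x * expR (- (t * (nu ord0 i + eta))) <= f (x + t *: e_ i) /\
    f x * expR (- (t * (- nu ord0 i + eta))) <= f (x + t *: - e_ i).
  have /choice[T hT] : forall i, exists t : R, 0 < t /\ (f x * expR (- (t * (nu ord0 i + eta))) <= f (x + t *: e_ i) /\
    f x * expR (- (t * (- nu ord0 i + eta))) <= f (x + t *: - e_ i)).
    move=> i; have [[t t0 ht] [s s0 hs]] := h i eta eta0. have r0 : 0 < Num.min t s by rewrite lt_min t0.
    by exists (Num.min t s); split => //; split; [apply: (LC_decay lf) ht|apply: (LC_decay lf) hs]; rewrite r0 ge_min lexx ?orbT.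
  pose t := \big[Num.min/1]_i T i.
  have t0 : 0 < t by apply: (big_ind (fun t : R => 0 < t)) => // [a b a0 b0|i _]; rewrite ?lt_min ?a0//; case: (hT i).
  exists t => // i; have [_ [h1 h2]] := hT i.
  by split; [apply: (LC_decay lf) h1|apply: (LC_decay lf) h2]; rewrite t0/= /t (bigD1 i)//= ge_min lexx.
exists (t / n%:R); first by rewrite divr_gt0.
move=> w wt.
pose c (i : nat) := ln (f x) - n%:R * (nu ord0 (inord i) * w ord0 (inord i) + eta * `|w ord0 (inord i)|).
pose y (i : nat) : 'rV[R]_n := x + (n%:R * w ord0 (inord i)) *: e_ (inord i).
have := @LC_jensen _ _ f lf m y c; rewrite /c /y.
have -> : n%:R^-1 * \sum_(i < n) (ln (f x) - n%:R * (nu ord0 (inord i) * w ord0 (inord i) + eta * `|w ord0 (inord i)|)) =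
    ln (f x) - (inner nu w + eta * \sum_i `|w ord0 i|).
  suff -> : \sum_(i < n) (ln (f x) - n%:R * (nu ord0 (inord i) * w ord0 (inord i) + eta * `|w ord0 (inord i)|)) =
    n%:R * (ln (f x) - (inner nu w + eta * \sum_i `|w ord0 i|)) by rewrite mulKf// gt_eqF.
  rewrite mulrBr mulr_natl sumrB sumr_const card_ord -mulr_sumr big_split/= -mulr_sumr.
  by congr (_ - _ * (_ + _ * _)); apply: eq_bigr => i _; rewrite inord_val.
have -> : n%:R^-1 *: \sum_(i < n) (x + (n%:R * w ord0 (inord i)) *: e_ (inord i)) = x + w.
  rewrite big_split/= sumr_const card_ord scalerDr -[x *+ n]scaler_nat scalerA mulVf ?gt_eqF// scale1r; congr (_ + _).
  rewrite [RHS]row_sum_delta scaler_sumr; apply: eq_bigr => i _. by rewrite inord_val scalerA mulKf ?gt_eqF.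
rewrite expRD lnK ?posrE//; apply => i; rewrite expRD lnK ?posrE//.
set j := inord i; have [h1 h2] := ht j; have wj := wt j.
have [->|w0] := eqVneq (w ord0 j) 0; first by rewrite normr0 !mulr0 addr0 scale0r addr0 !mulr0 oppr0 expR0 mulr1.
have tw : 0 < n%:R * `|w ord0 j| <= t by rewrite mulr_gt0 ?normr_gt0//= mulrC -ler_pdivlMr.
have [wn|wp] := ltP (w ord0 j) 0.
  have := LC_decay lf tw h2; rewrite ltr0_norm//.
  have -> : (n%:R * - w ord0 j) *: - e_ j = (n%:R * w ord0 j) *: e_ j by rewrite scalerN -scaleNr mulrN opprK.
  by congr (_ * expR _ <= _); ring.
have := LC_decay lf tw h1; rewrite ger0_norm//.
by congr (_ * expR _ <= _); ring.
Qed.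

(** [slopes_expand] bounds f from below at x + w and at x - w. Log-concavity at their midpoint x
    converts the second bound into an upper bound at x + w. *)
Lemma slopes_taylor x nu : slopes f x nu -> forall eta : R, 0 < eta -> exists2 d : R, 0 < d & forall w : 'rV[R]_n,
  (`|w| <= d) -> 0 < f (x + w) /\ `|- ln (f (x + w)) + ln (f x) - inner nu w| <= eta * `|w|.
Proof.
move=> sl eta eta0; have fx := sl.1; have n0 : 0 < (n%:R : R) by rewrite ltr0n.
have [d d0 h] := slopes_expand sl (divr_gt0 eta0 n0).
exists d => // w wd.
have cw i : `|w ord0 i| <= `|w| by rewrite [leRHS]/Num.norm/= mx_normrE; exact: (le_bigmax _ (fun ij : 'I_1 * 'I_n => `|w ij.1 ij.2|) (ord0, i)).
have S0 : eta / n%:R * \sum_i `|w ord0 i| <= eta * `|w|.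
  rewrite -mulrA ler_pM2l// ler_pdivrMl//; apply: le_trans (ler_sum _ (fun i _ => cw i)) _.
  by rewrite sumr_const card_ord mulr_natl.
have up1 := h w (fun i => le_trans (cw i) wd).
have up2 : f x * expR (- (inner nu (- w) + eta / n%:R * \sum_i `|w ord0 i|)) <= f (x - w).
  have := h (- w); rewrite (eq_bigr (fun i => `|w ord0 i|)); last by move=> i _; rewrite !mxE normrN.
  by apply => i; rewrite mxE normrN; exact: le_trans (cw i) wd.
have p1 : 0 < f (x + w) by apply: lt_le_trans up1; rewrite mulr_gt0 ?expR_gt0.
have p2 : 0 < f (x - w) by apply: lt_le_trans up2; rewrite mulr_gt0 ?expR_gt0.
split => //.
have [_ _ /(_ (x + w) (x - w) 2^-1)] := lf.
have -> : (1 - 2^-1) *: (x + w) + 2^-1 *: (x - w) = x by apply/rowP => i; rewrite !mxE; field.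
have l01 : 0 <= (2^-1 : R) <= 1 by apply/andP; split; lra.
have i2 : 1 - 2^-1 = 2^-1 :> R by field.
move=> /(_ l01); rewrite i2.
have iN : inner nu (- w) = - inner nu w by rewrite /inner -sumrN; apply: eq_bigr => i _; rewrite mxE mulrN.
move: up1 up2; rewrite iN; set S := eta / _ * _ in S0 *.
have [p Ep] : exists p, f x = expR p by exists (ln (f x)); rewrite lnK ?posrE.
have [q Eq] : exists q, f (x + w) = expR q by exists (ln (f (x + w))); rewrite lnK ?posrE.
have [q' Eq'] : exists q, f (x - w) = expR q by exists (ln (f (x - w))); rewrite lnK ?posrE.
rewrite Ep Eq Eq' -!expRM -!expRD !ler_expR !expRK => u1 u2 u3.
by rewrite ler_norml; apply/andP; split; lra.
Qed.

Lemma slopes_grad x nu : slopes f x nu -> grad_dom f x /\ grad_neglog f x = nu.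
Proof.
move=> sl; have fx := sl.1.
pose df (w : 'rV[R]_n) : R := inner nu w.
have dfl : linear df.
  move=> a u v; rewrite /df /inner scaler_sumr -big_split; apply: eq_bigr => i _ /=. by rewrite !mxE mulrDr mulrCA.
pose L := GRing.isLinear.Build R 'rV[R]_n R _ df dfl.
pose dl : {linear 'rV[R]_n -> R} := HB.pack df L.
have dc : continuous dl.
  exact: continuous_inner.
have ex : phi \o shift x = cst (phi x) + dl +o_ (0 : 'rV[R]_n) id.
  apply/eqaddoP => eta eta0; have [d d0 h] := slopes_taylor sl eta0.
  apply/nbhs_ballP; exists d => //= w; rewrite -ball_normE /= sub0r normrN => wd.
  have [_] := h w (ltW wd); change (`|- ln (f (x + w)) + ln (f x) - inner nu w| <= eta * `|w| ->
    `|- ln (f (w + x)) - (- ln (f x) + inner nu w)| <= eta * `|w|).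
  by rewrite (addrC x); congr (`|_| <= _); ring.
have D := diff_unique dc ex.
have dd : differentiable phi x by apply/diff_locallyP; rewrite D.
split; last first.
  apply/rowP => i; rewrite mxE D /= /df /inner (bigD1 i)//= big1 ?addr0; first by rewrite mxE !eqxx mulr1.
  by move=> j ji; rewrite mxE eqxx/= (negbTE ji) mulr0.
split => //; have [d d0 h] := slopes_taylor sl ltr01.
apply/nbhs_ballP; exists d => //= y; rewrite -ball_normE /= => yd.
have [] := h (y - x); first by rewrite distrC ltW.
by rewrite addrC subrK.
Qed.

Lemma grad_slopes x : grad_dom f x -> slopes f x (grad_neglog f x).
Proof.
move=> [ix dx]; have fx : 0 < f x by exact: (interior_subset ix).
split => // i eta eta0.
have key v : decays f x v ('d phi x v + eta).
  have /diff_locallyP[_ /eqaddoP] := dx. have v1 : 0 < `|v| + 1 by rewrite ltr_wpDl.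
  move=> /(_ (eta / (`|v| + 1)) (divr_gt0 eta0 v1)) /nbhs_ballP[d /= d0 hd].
  have /nbhs_ballP[r /= r0 hr] : nbhs x (supp f) := ix.
  pose t := Num.min d r / 2 / (`|v| + 1); have q0 : 0 < Num.min d r by rewrite lt_min d0.
  have t0 : 0 < t by rewrite !divr_gt0. have tv : `|t *: v| < Num.min d r.
    have vv := normr_ge0 v; rewrite normrZ gtr0_norm// /t.
    have -> : Num.min d r / 2 / (`|v| + 1) * `|v| = Num.min d r / 2 * (`|v| / (`|v| + 1)) by field; rewrite gt_eqF.
    apply: (@le_lt_trans _ _ (Num.min d r / 2)); last by lra.
    by rewrite ler_piMr ?divr_ge0 ?(ltW q0)// ler_pdivrMr// mul1r; lra.
  move: tv; rewrite lt_min => /andP[tvd tvr].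
  have ft : 0 < f (x + t *: v) by apply: hr; rewrite -ball_normE /= opprD addrA subrr add0r normrN.
  exists t => //; have := hd (t *: v); rewrite -ball_normE /= sub0r normrN => /(_ tvd).
  change (`|- ln (f (t *: v + x)) - (- ln (f x) + 'd phi x (t *: v))| <= eta / (`|v| + 1) * `|t *: v| ->
    f x * expR (- (t * ('d phi x v + eta))) <= f (x + t *: v)).
  have -> : 'd phi x (t *: v) = t * 'd phi x v by rewrite linearZ. rewrite (addrC (t *: v)) => h.
  have : eta / (`|v| + 1) * `|t *: v| <= t * eta.
    have vv := normr_ge0 v; rewrite normrZ gtr0_norm//.
    have -> : eta / (`|v| + 1) * (t * `|v|) = t * (eta * (`|v| / (`|v| + 1))) by field; rewrite gt_eqF.
    by rewrite ler_pM2l// ler_piMr ?(ltW eta0)// ler_pdivrMr// mul1r; lra.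
  move/(le_trans h); rewrite ler_norml => /andP[_ hu].
  have [p Ep] : exists p, f x = expR p by exists (ln (f x)); rewrite lnK ?posrE.
  have [q Eq] : exists q, f (x + t *: v) = expR q by exists (ln (f (x + t *: v))); rewrite lnK ?posrE.
  by move: hu; rewrite Ep Eq -expRD ler_expR !expRK; lra.
split; first by have := key (e_ i); rewrite mxE.
by have := key (- e_ i); rewrite mxE raddfN.
Qed.

Lemma slopesP x nu : slopes f x nu <-> grad_dom f x /\ grad_neglog f x = nu.
Proof. by split=> [/slopes_grad//|[/grad_slopes + <-]]. Qed.

(** At each scale 1 / (k+1) a rational rate must be admissible for both orientations of every axis.
    Conversely the infimum of the admissible rates is the partial derivative, the opposite
    orientation keeping it from being -oo. *)
Lemma grad_domE : grad_dom f = [set x | 0 < f x] `&` \bigcap_(k : nat) \bigcap_(i : 'I_n) \bigcup_(r : rat)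
  ([set x | decays f x (e_ i) (ratr r + k.+1%:R^-1)] `&` [set x | decays f x (- e_ i) (- ratr r + k.+1%:R^-1)]).
Proof.
apply/seteqP; split => x.
  move=> /grad_slopes[fx h]; split => // k _ i _. have k0 : 0 < (k.+1%:R^-1 / 2 : R) by rewrite divr_gt0.
  have aux1 (a b c : R) : 0 < c / 2 -> a < b -> a + c / 2 <= b + c by move=> *; lra.
  have aux2 (a b c : R) : b < a + c / 2 -> - a + c / 2 <= - b + c by move=> *; lra.
  have [r] := rat_in_itvoo (ltr_pwDr k0 (lexx (grad_neglog f x ord0 i))).
  rewrite in_itv/= => /andP[r1 r2]; have [h1 h2] := h i _ k0. exists r => //; split.
    by apply: (decaysW lf _ h1); apply: aux1.
  by apply: (decaysW lf _ h2); apply: aux2.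
move=> [fx h]; suff /choice[nu hnu] : forall i, exists a : R, forall eta : R, 0 < eta ->
    decays f x (e_ i) (a + eta) /\ decays f x (- e_ i) (- a + eta).
  by apply: (@proj1 _ (grad_neglog f x = \row_i nu i)); apply/slopesP; split => // i eta; rewrite mxE; exact: hnu.
move=> i; pose U := [set a : R | decays f x (e_ i) a].
have Ui : has_inf U.
  have [r _ [h1 h2]] := h 0%N I i I; split; first by exists (ratr r + 1%:R^-1).
  by exists (- (- ratr r + 1%:R^-1)) => a /= ua; have := decays_opp lf fx ua h2; lra.
exists (inf U) => eta eta0; split.
  by have [a Ua /ltW ha] := inf_adherent eta0 Ui; exact: decaysW ha Ua.
have e2 : 0 < eta / 2 by rewrite divr_gt0.
have [r _ [h1 h2]] := h (Num.truncn (eta / 2)^-1) I i I.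
set kk := _%:R^-1 in h1 h2; have kk2 : kk <= eta / 2.
  by rewrite -[leRHS]invrK lef_pV2 ?posrE ?invr_gt0// ltW// truncnS_gt.
apply: decaysW h2 => //; have : inf U <= ratr r + kk by apply: ge_inf => //; case: Ui.
lra.
Qed.

Lemma measurable_grad_dom : measurable (grad_dom f : set (bV R n)).
Proof.
rewrite grad_domE; apply: measurableI.
  exact: (measurable_lt_set (measurable_cst _) (LC_measurable lf)).
apply: bigcapT_measurable => k.
apply: fin_bigcap_measurable => [|i _]; first exact: finite_finset.
apply: bigcupT_measurable_rat => r.
by apply: measurableI; exact: measurable_decays.
Qed.

Lemma measurable_grad : measurable_fun setT
  ((fun x => if x \in grad_dom f then grad_neglog f x else 0) : bV R n -> bV R n).
Proof.
apply: measurable_bVP => i.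
have -> : (fun x : bV R n => (if x \in grad_dom f then grad_neglog f x else 0) ord0 i) =
   (fun x : bV R n => grad_neglog f x ord0 i) \_ (grad_dom f).
  by apply/funext => x; rewrite patchE; case: ifP => // _; rewrite mxE.
apply/measurable_restrict; [exact: measurable_grad_dom|exact: measurableT|rewrite setTI].
apply: (measurable_fun_cvg (h := fun k (x : bV R n) => k.+1%:R * (ln (f x) - ln (f (x + k.+1%:R^-1 *: e_ i))))).
  move=> k; apply: measurable_funTS; apply: measurable_funM => //; apply: measurable_funB.
    exact: (measurableT_comp (@measurable_ln R) (LC_measurable lf)).
  apply: (measurableT_comp (@measurable_ln R)).
  have -> : (fun x : 'rV[R]_n => f (x + k.+1%:R^-1 *: e_ i)) = f \o (fun x : 'rV[R]_n => (1 : R) *: x + k.+1%:R^-1 *: e_ i).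
    by apply/funext => x /=; rewrite scale1r.
  by apply: (measurableT_comp (f := f : bV R n -> R)); [exact: LC_measurable|exact: measurable_affine].
move=> x gx; have sl := grad_slopes gx; apply/cvgrPdist_le => eta eta0.
have [d d0 h] := slopes_taylor sl eta0.
have de : `|e_ i| <= 1 :> R.
  rewrite [leLHS]/Num.norm/= mx_normrE; apply: bigmax_le => // -[j k] _ /=.
  by rewrite mxE; case: (_ && _); rewrite ?normr1 ?normr0.
have [N hN] : exists N : nat, N.+1%:R^-1 <= d by exists (Num.truncn d^-1); rewrite -[leRHS]invrK lef_pV2 ?posrE ?invr_gt0// ltW// truncnS_gt.
exists N => // k /= Nk; have k0 : 0 < (k.+1%:R : R) by [].
have kN : `|k.+1%:R^-1 *: e_ i| <= (k.+1%:R^-1 : R).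
  by rewrite normrZ gtr0_norm ?invr_gt0// ler_piMr// invr_ge0 ltW.
have [] := h (k.+1%:R^-1 *: e_ i).
  by apply: le_trans kN (le_trans _ hN); rewrite lef_pV2 ?posrE// ler_nat.
move=> _; have -> : inner (grad_neglog f x) (k.+1%:R^-1 *: e_ i) = k.+1%:R^-1 * grad_neglog f x ord0 i. by rewrite innerZr inner_delta.
move=> h1; have := ler_wpM2l (ltW k0) (le_trans h1 (ler_wpM2l (ltW eta0) kN)).
rewrite mulrCA mulfV ?gt_eqF// mulr1 -{1}(gtr0_norm k0) -normrM; congr (_ <= _).
by rewrite -normrN; congr (`|_|); field; rewrite gt_eqF.
Qed.

End gradient.

(** * Measurability of support functions; continuous approximation of boxes *)

Section support_functions.
Variables (R : realType) (n : nat).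
Local Open Scope ereal_scope.

(** A supremum of affine functions is lower semicontinuous: its strict superlevel sets are unions of
    open half-spaces, whatever the size of the index set. *)
Lemma measurable_sup_inner (T : Type) (P : set T) (y : T -> 'rV[R]_n) (c : T -> R) :
  measurable_fun setT ((fun x => ereal_sup [set (inner (y w) x + c w)%:E | w in P]) : bV R n -> \bar R).
Proof.
apply: (measurability _ (ErealGenOInfty.measurableE R)) => _ [_ [a ->]] <-; rewrite setTI.
apply: open_measurable_rV; rewrite preimage_itvoy.
have -> : [set x | a%:E < ereal_sup [set (inner (y w) x + c w)%:E | w in P]] =
    \bigcup_(w in P) [set x | a%:E < (inner (y w) x + c w)%:E].
  apply/seteqP; split => x /=; last by move=> [w Pw h]; apply: lt_le_trans h _; apply: ereal_sup_ubound; exists w.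
  by move=> /ereal_sup_gt[_ [w Pw <-] h]; exists w.
apply: bigcup_open => w _.
have -> : [set x | a%:E < (inner (y w) x + c w)%:E] = (fun x => inner (y w) x + c w)%R @^-1` [set z | (a < z)%R].
  by apply/seteqP; split => x /=; rewrite lte_fin.
apply: open_comp; last exact: open_gt.
have H : continuous (fun x => inner (y w) x + c w)%R.
  apply: (@enorm_lip_continuous _ _ _ (enorm (y w))) => x z.
  by rewrite opprD addrACA subrr addr0 -innerBr norm_inner_le.
by move=> x _; exact: H.
Qed.
End support_functions.

Section density.
Local Open Scope ereal_scope.
Context d d' (X : measurableType d) (Z : measurableType d') (R : realType).

(** Packages the image under [q] of the measure with density [w], so that uniqueness of measures on
    boxes can be applied in [graph_identity]. *)
Lemma density_measure (mu : {measure set X -> \bar R}) (D : set X) (w : X -> R) (q : X -> Z) :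
  measurable D -> measurable_fun D w -> (forall x, D x -> (0 <= w x)%R) -> measurable_fun D q ->
  exists m : {measure set Z -> \bar R}, forall A, measurable A -> m A = \int[mu]_(x in D) ((w x)%:E * (\1_A (q x))%:E).
Proof.
move=> mD mw w0 mq.
pose M (A : set Z) := \int[mu]_(x in D `&` q @^-1` A) (w x)%:E.
have ME A : M A = \int[mu]_(x in D) ((w x)%:E * (\1_A (q x))%:E).
  rewrite /M integral_mkcondr; apply: eq_integral => x _; rewrite patchE indicE.
  have -> : (x \in q @^-1` A) = (q x \in A) by []. by case: ifP => _; rewrite ?mule1 ?mule0.
have M0 : M set0 = 0 by rewrite /M preimage_set0 setI0 integral_set0.
have Mge A : 0 <= M A by apply: integral_ge0 => x [Dx _]; rewrite lee_fin w0.
have Ms : semi_sigma_additive M.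
  move=> F mF tF mUF; rewrite {2}/M preimage_bigcup setI_bigcupr ge0_integral_bigcup//.
  - by apply: is_cvg_nneseries => i _ _; exact: Mge.
  - by move=> k; exact: mq.
  - apply: (measurable_funS mD); last exact/measurable_EFinP.
    by move=> x [k _ []].
  - by move=> x [k _ [Dx _]]; rewrite lee_fin w0.
  - apply/trivIsetP => i j _ _ ij; have /trivIsetP/(_ i j I I ij) := tF.
    by rewrite setIACA setIid -(preimage_setI q) => ->; rewrite preimage_set0 setI0.
pose B := isMeasure.Build _ Z R M M0 Mge Ms.
pose m : {measure set Z -> \bar R} := HB.pack M B.
by exists m => A _; exact: ME.
Qed.

End density.

Section ramps.
Variables (R : realType) (n : nat).

(** Continuous, with value 1 from 0 on and, for k > 0, value 0 below - 1 / k. The limit is the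
    indicator of x >= 0 including the value at 0, as half-open boxes demand. *)
Definition ramp (k : nat) (x : R) : R := Num.max 0 (Num.min 1 (1 + k%:R * x)).
Definition box_ramp k (a b x : 'rV[R]_n) : R :=
  \prod_i (ramp k (x ord0 i - a ord0 i) * (1 - ramp k (x ord0 i - b ord0 i))).

Lemma ramp01 k x : 0 <= ramp k x <= 1.
Proof. by rewrite /ramp le_max lexx/= ge_max ler01 ge_min lexx. Qed.

Lemma ramp_lipschitz k x y : `|ramp k x - ramp k y| <= k%:R * `|x - y|.
Proof.
rewrite -[X in _ <= X * _](@ger0_norm _ k%:R)// -normrM mulrBr /ramp.
move: (k%:R * x) (k%:R * y) => p q.
have E u : exists2 v : R, Num.max 0 (Num.min 1 (1 + u)) = v &
    (u <= -1 /\ v = 0) \/ (-1 <= u /\ u <= 0 /\ v = 1 + u) \/ (0 <= u /\ v = 1).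
  have [u0|u0] := leP 0 u; first by exists 1; [rewrite min_l ?max_r//; lra|right; right].
  have [u1|u1] := leP u (-1); first by exists 0; [rewrite min_r ?max_l//; lra|left].
  exists (1 + u); first by rewrite min_r ?max_r//; lra. by right; left; split; [exact: ltW|split; [exact: ltW|]].
have [v1 -> h1] := E p; have [v2 -> h2] := E q.
have l1 := ler_norm (p - q); have l2 := ler_norm (- (p - q)); rewrite normrN in l2.
rewrite ler_norml; apply/andP.
by move: h1 h2 => [[? ->]|[[? [? ->]]|[? ->]]] [[? ->]|[[? [? ->]]|[? ->]]]; split; lra.
Qed.

Lemma ramp_near x : \forall k \near \oo, ramp k x = (0 <= x)%R%:R.
Proof.
have [x0|x0] := leP 0 x.
  by apply: nearW => k; rewrite /ramp min_l ?max_r// lerDl mulr_ge0.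
exists (Num.truncn (- x)^-1).+1 => // k /= kx.
rewrite /ramp max_l// ge_min; apply/orP; right.
have : (- x)^-1 < k%:R by apply: lt_le_trans (truncnS_gt _) _; rewrite ler_nat.
by rewrite -[ltLHS]mul1r ltr_pdivrMr ?oppr_gt0//; lra.
Qed.

Lemma box_ramp01 k a b x : 0 <= box_ramp k a b x <= 1.
Proof.
have h i : 0 <= ramp k (x ord0 i - a ord0 i) * (1 - ramp k (x ord0 i - b ord0 i)) <= 1.
  have /andP[p0 p1] := ramp01 k (x ord0 i - a ord0 i); have /andP[q0 q1] := ramp01 k (x ord0 i - b ord0 i).
  by rewrite mulr_ge0 ?subr_ge0//= mulr_ile1 ?subr_ge0// gerBl.
rewrite /box_ramp prodr_ge0/=; last by move=> i _; case/andP: (h i).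
by apply: prodr_ile1 => i _; exact: h.
Qed.

Lemma continuous_box_ramp k a b : continuous (box_ramp k a b).
Proof.
have cr c i : continuous (fun x : 'rV[R]_n => ramp k (x ord0 i - c)).
  apply: (@enorm_lip_continuous _ _ _ k%:R) => x y; apply: le_trans (ramp_lipschitz _ _ _) _.
  have := coord_enorm (x - y) i; rewrite !mxE => h. by rewrite ler_wpM2l// opprB addrA subrK.
pose g i (x0 : 'rV[R]_n) := ramp k (x0 ord0 i - a ord0 i) * (1 - ramp k (x0 ord0 i - b ord0 i)).
have cg i : continuous (g i).
  have cR : continuous (fun x : 'rV[R]_n => 1 - ramp k (x ord0 i - b ord0 i)).
    apply: (@enorm_lip_continuous _ _ _ k%:R) => x y; rewrite opprB addrC addrA subrK.
    apply: le_trans (ramp_lipschitz _ _ _) _; have := coord_enorm (x - y) i; rewrite !mxE => h.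
    by rewrite ler_wpM2l// opprB addrA subrK distrC.
  by move=> x; exact: (continuousM (cr _ _ x) (cR x)).
rewrite (_ : box_ramp k a b = fun x0 => \prod_i g i x0)//; elim: (index_enum _) => [|i s IH].
  have -> : (fun x0 => \prod_(i <- [::]) g i x0) = cst 1 by apply/funext => x0; rewrite big_nil.
  exact: cst_continuous.
have -> : (fun x0 => \prod_(j <- i :: s) g j x0) = (fun x0 => g i x0 * \prod_(j <- s) g j x0) by apply/funext => x0; rewrite big_cons.
by move=> x; apply: (continuousM (cg i x) (IH x)).
Qed.

Lemma box_ramp_cvg a b x : box_ramp k a b x @[k --> \oo] --> (\1_(hbox a b) x : R).
Proof.
have -> : \1_(hbox a b) x = \prod_i ((0 <= x ord0 i - a ord0 i)%R%:R * (1 - (0 <= x ord0 i - b ord0 i)%R%:R)) :> R.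
  rewrite indicE; have [/set_mem h|h] := boolP (x \in hbox a b).
    rewrite big1// => i _; have /andP[h1 h2] := h i. by rewrite !subr_ge0 h1 (leNgt (b _ _)) h2/= subr0 mulr1.
  have /existsP[i hi] : [exists i, ~~ (a ord0 i <= x ord0 i < b ord0 i)].
    by rewrite -negb_forall; apply: contra h => /forallP h; apply/mem_set.
  rewrite (bigD1 i)//= [X in X * _](_ : _ = 0) ?mul0r//.
  move: hi; rewrite negb_and -!ltNge !subr_ge0 -leNgt => /orP[h1|h1]; first by rewrite leNgt h1 mul0r.
  by rewrite h1 subrr mulr0.
apply: cvg_near_cst.
have : \forall k \near \oo, forall i, ramp k (x ord0 i - a ord0 i) = (0 <= x ord0 i - a ord0 i)%R%:R /\
    ramp k (x ord0 i - b ord0 i) = (0 <= x ord0 i - b ord0 i)%R%:R.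
  by apply: filter_forall => i; near=> k; split; near: k; exact: ramp_near.
by apply: filterS => k h; apply: eq_bigr => i _; have [-> ->] := h i.
Unshelve. all: by end_near. Qed.

Lemma box_ramp_integral d (X : measurableType d) (mu : {measure set X -> \bar R}) (D : set X) (v : X -> R) (q : X -> bV R n) a b :
  measurable D -> (forall x, 0 <= v x) -> mu.-integrable D (fun x => (v x)%:E) -> measurable_fun D q ->
  (\int[mu]_(x in D) ((v x)%:E * (box_ramp k a b (q x))%:E))%E @[k --> \oo] --> (\int[mu]_(x in D) ((v x)%:E * (\1_(hbox a b) (q x))%:E))%E.
Proof.
move=> mD v0 iv mq; have mv : measurable_fun D (fun x => (v x)%:E) by case/integrableP: iv.
have H1 k : measurable_fun D (fun x => (v x)%:E * (box_ramp k a b (q x))%:E)%E.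
  apply: emeasurable_funM => //; apply/measurable_EFinP.
  apply: (measurableT_comp (f := box_ramp k a b : bV R n -> R)) => //.
  by apply: continuous_measurable_rV; exact: continuous_box_ramp.
have H2 : measurable_fun D (fun x => (v x)%:E * (\1_(hbox a b) (q x))%:E)%E.
  apply: emeasurable_funM => //; apply/measurable_EFinP.
  apply: (measurableT_comp (f := \1_(hbox a b) : bV R n -> R)) => //.
  by apply: measurable_indic; exact: measurable_hbox.
have H3 : {ae mu, forall x, D x -> (v x)%:E * (box_ramp k a b (q x))%:E @[k --> \oo] --> (v x)%:E * (\1_(hbox a b) (q x))%:E}%E.
  apply: aeW => x _; rewrite -EFinM; apply: cvg_EFin; first exact: nearW.
  by apply: cvgM; [exact: cvg_cst|exact: box_ramp_cvg].
have H4 : {ae mu, forall x k, D x -> `|(v x)%:E * (box_ramp k a b (q x))%:E| <= (v x)%:E}%E.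
  apply: aeW => x k _; have /andP[q0 q1] := box_ramp01 k a b (q x).
  by rewrite -EFinM gee0_abs lee_fin ?mulr_ge0// ler_piMr.
by have [] := dominated_convergence mD H1 H2 H3 iv H4.
Qed.

End ramps.

Lemma expR_quotient (R : realType) (a : R) : ((expR (t * a) - 1) / t) @[t --> (0 : R)^'+] --> a.
Proof.
apply/cvgrPdist_le => e e0.
have a1 : 0 < 2 * (a ^+ 2 + `|a| + 1) by have := sqr_ge0 a; have := normr_ge0 a; lra.
near=> t.
have t0 : 0 < t by near: t; exact: nbhs_right_gt.
have ta : t * (2 * (a ^+ 2 + `|a| + 1)) < Num.min e 1.
  rewrite -ltr_pdivlMr//; near: t; apply: nbhs_right_lt. by rewrite divr_gt0// lt_min e0 ltr01.
move: ta; rewrite lt_min => /andP[te t1].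
have a2 := sqr_ge0 a; have aa := ler_norm a; have a3 := normr_ge0 a.
have xa : t * a <= t * `|a| by rewrite ler_pM2l.
have x1 : t * a < 2^-1 by have : 0 <= t * a ^+ 2; [by rewrite mulr_ge0// ltW|lra].
have lo := expR_ge1Dx (t * a); have hi := expR_ge1Dx (- (t * a)).
rewrite -normrN ger0_norm opprB; last by rewrite subr_ge0 ler_pdivlMr//; lra.
rewrite lerBlDr ler_pdivrMr//.
have E : expR (t * a) * (1 - t * a) <= 1.
  apply: (@le_trans _ _ (expR (t * a) * expR (- (t * a)))); first by rewrite ler_pM2l ?expR_gt0.
  by rewrite -expRD subrr expR0.
have u0 : 0 < 1 - t * a by lra.
have : expR (t * a) <= (1 - t * a)^-1 by rewrite -[leRHS]mul1r ler_pdivlMr.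
have : (1 - t * a)^-1 - 1 <= t * (a + 2 * (t * a ^+ 2)).
  rewrite lerBlDr -[leLHS]mul1r ler_pdivrMr//.
  have : 0 <= (t * a) ^+ 2 * (1 - 2 * (t * a)) by rewrite mulr_ge0 ?sqr_ge0//; lra. by nra.
have : t * (a + 2 * (t * a ^+ 2)) <= t * (a + e).
  rewrite ler_pM2l// lerD2l; apply: le_trans (ltW te). have : 0 <= t * `|a| by rewrite mulr_ge0// ltW. lra.
lra.
Unshelve. all: by end_near. Qed.

Record tame (R : realType) m (F : 'rV[R]_m.+1 -> R) (r0 b : R) : Prop := Tame {
  tame_conv : forall x y (l : R), 0 <= l <= 1 -> epigraph F x -> epigraph F y -> epigraph F ((1 - l) *: x + l *: y);
  tame_meas : measurable_fun setT (F : bV R m.+1 -> R);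
  tame_ge0 : forall x, 0 <= F x;
  tame_r0 : 0 < r0;
  tame_lb : forall x, enorm x <= r0 -> expR 1 <= F x;
  tame_ub : forall x, F x <= expR b;
  tame_int : (\int[@lam R m.+1]_x (F x)%:E < +oo)%E }.

(** * Translations: symmetric derivatives and the measure f dx *)

Section graph_identity.
Variables (R : realType) (m : nat).
Local Notation n := m.+1.
Local Notation V := ('rV[R]_n * R)%type.
Variables (F : 'rV[R]_n -> R) (r0 b : R).
Hypothesis tF : tame F r0 b.
Let Cconv := tame_conv tF.
Let mF := tame_meas tF.
Let F0 := tame_ge0 tF.
Let r00 := tame_r0 tF.
Let F2 := tame_lb tF.
Let FB := tame_ub tF.
Let intF := tame_int tF.
Local Notation C := (epigraph F).
Local Notation J := (gauge C).
Local Notation A := (ray_shell F).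
Local Open Scope ereal_scope.

Let J0 := J_ge0 r00 F2.
Let JZ' := JZ Cconv r00 F2.
Let JD' := JD Cconv r00 F2.
Let mJ : measurable_fun setT (J : bV R n * R -> R) := measurable_J Cconv mF r00 F2.

(** The part of the ray derivative that is common to all dilations: by [ray_derivE] only the speed
    [rho] and the test function at [foot z] remain. The foot is the horizontal component of the exit
    point. *)
Definition ray_weight (z : V) : R := (kw z.1 * ((J z)^-1 * ((J z)^-1 ^+ n * expR (- ((J z)^-1 * z.2)))))%R.
Definition foot (z : V) : 'rV[R]_n := ((J z)^-1 *: z.1)%R.

Lemma ray_derivE xi (D : set V) z : ray_deriv F xi D z = (ray_weight z * rho F D z * xi (foot z))%R.
Proof. by rewrite /ray_deriv /ray_weight /ray_dens /foot; ring. Qed.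

Lemma ray_weight_ge0 z : (0 <= ray_weight z)%R.
Proof. by rewrite /ray_weight !mulr_ge0 ?kw_ge0 ?exprn_ge0 ?invr_ge0 ?J0 ?expR_ge0. Qed.

Let mu' : measurable_fun setT ((fun z : bV R n * R => (J z)^-1)%R) := measurable_inv_fun mJ.

Lemma measurable_ray_weight : measurable_fun setT (ray_weight : bV R n * R -> R).
Proof.
apply: measurable_funM; first exact: (measurableT_comp (@measurable_kw R n) measurable_fst).
apply: measurable_funM; first exact: mu'.
apply: measurable_funM; first exact: (measurable_funX n mu').
apply: (measurableT_comp (@measurable_expRN R)).
by apply: measurable_funM; [exact: mu'|exact: measurable_snd].
Qed.

Lemma measurable_foot : measurable_fun setT (foot : bV R n * R -> bV R n).
Proof.
apply: (measurableT_comp (@measurable_scale R n) (_ : measurable_fun setT (fun z : bV R n * R => (z.1, (J z)^-1)%R))).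
by apply/measurable_fun_pairP; split; [exact: measurable_fst|exact: mu'].
Qed.

Lemma measurable_ray_shell : measurable (A : set (bV R n * R)).
Proof. exact: (@measurable_lt_set _ (bV R n * R)%type R (fun=> 0%R) J). Qed.

Lemma measurable_dirder (v : V) : measurable_fun setT ((fun z => dirder J z v) : bV R n * R -> R).
Proof.
apply: (measurable_fun_cvg (h := fun k (z : bV R n * R) => slope J z v (k.+1%:R^-1)%R)) => [k|z _].
  apply: measurable_funM => //; apply: measurable_funB => //.
  have -> : (fun z : bV R n * R => J (z + k.+1%:R^-1 *: v)%R) = J \o
      (fun z : bV R n * R => ((1 : R) *: z.1 + (k.+1%:R^-1 *: v.1 : 'rV[R]_n), z.2 + k.+1%:R^-1 * v.2)%R).
    by apply/funext => z /=; rewrite scale1r.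
  apply: (measurableT_comp (f := J : bV R n * R -> R)); first exact: mJ. apply/measurable_fun_pairP; split.
    exact: (measurableT_comp (@measurable_affine R n 1%R _) measurable_fst).
  by apply: measurable_funD => //; exact: measurable_snd.
apply/cvgrPdist_le => e e0; have [t0 t00 h] := dirder_cvg JZ' JD' z v e0.
exists (Num.truncn t0^-1) => // k /= Nk; have k0 : (0 < (k.+1%:R^-1 : R))%R by rewrite invr_gt0.
have kt : (k.+1%:R^-1 <= t0)%R.
  rewrite -[leRHS]invrK lef_pV2 ?posrE ?invr_gt0//; apply: le_trans (ltW (truncnS_gt _)) _. by rewrite ler_nat ltnS.
have := h (k.+1%:R^-1)%R; rewrite k0 kt => /(_ isT) h1.
have := dirder_le JZ' JD' z v k0 => h2.
by rewrite ler_norml; apply/andP; split; lra.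
Qed.

Section one_direction.
Variable (d : V) (xi : 'rV[R]_n -> R).
Hypotheses (cxi : continuous xi) (xi01 : forall x, (0 <= xi x <= 1)%R).
Let Ft (t : R) x := (F (x - t *: d.1) * expR (- (t * d.2)))%R.

Let Ft0 t x : (0 < t)%R -> (0 <= Ft t x)%R.
by move=> _; rewrite mulr_ge0 ?expR_ge0. Qed.

Let mshift (t : R) : measurable_fun setT ((fun x => F (x - t *: d.1)%R) : bV R n -> R).
Proof.
have -> : (fun x : 'rV[R]_n => F (x - t *: d.1)%R) = F \o (fun x : 'rV[R]_n => (1 : R) *: x + (- (t *: d.1)))%R.
  by apply/funext => x /=; rewrite scale1r.
by apply: (measurableT_comp (f := F : bV R n -> R)) => //; exact: measurable_affine.
Qed.

Let mFt t : (0 < t)%R -> measurable_fun setT (Ft t : bV R n -> R).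
by move=> _; apply: measurable_funM. Qed.

Let FtE t (z : V) : (0 < t)%R -> (expR (- z.2) < Ft t z.1)%R <-> shifted F [set d] t z.
Proof.
move=> t0; have E : (expR (- (z.2 - t * d.2)) = expR (- z.2) * expR (t * d.2))%R by rewrite -expRD opprB addrC.
have -> : (expR (- z.2) < Ft t z.1)%R = (expR (- (z.2 - t * d.2)) < F (z.1 - t *: d.1))%R.
  rewrite E /Ft [expR (- (t * _))]expRN; have := expR_gt0 (t * d.2)%R; move: (expR (t * d.2)) => q q0.
  by rewrite ltr_pdivlMr.
by split=> [h|[_ -> h]]; [exists d|].
Qed.

Let MM := Num.max (J d) (J (- d)).
Let DM : forall d', [set d] d' -> (J d' <= MM)%R. Proof. by move=> _ ->; rewrite le_max lexx. Qed.
Let dM : (J (- d) <= MM)%R. Proof. by rewrite le_max lexx orbT. Qed.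

Lemma rho1 z : rho F [set d] z = (- dirder J z (- d))%R.
Proof. by rewrite /rho image_set1 sup1. Qed.

Lemma direction_integrable :
  (lamR R n).-integrable A (fun z => (ray_weight z * - dirder J z (- d) * xi (foot z))%:E).
Proof.
apply: eq_integrable (ray_deriv_integrable Cconv mF F0 r00 F2 FB intF cxi xi01 DM (erefl d) dM mFt FtE).
  exact: measurable_ray_shell.
by move=> z _; rewrite ray_derivE rho1.
Qed.

Hypothesis inv : forall t, (0 < t)%R -> \int[@lam R n]_x (xi x * F (x - t *: d.1))%:E = \int[@lam R n]_x (xi x * F x)%:E.

(** For a single direction the dilate is F translated by t d.1 and multiplied by e^(- t d.2). When
    the horizontal translation leaves the integral against [xi] unchanged, the derivative at 0 can
    be computed directly and compared with the one by rays. *)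
Lemma direction_deriv : fine (\int[lamR R n]_(z in A) (ray_weight z * - dirder J z (- d) * xi (foot z))%:E) =
  (- d.2 * fine (\int[@lam R n]_x (xi x * F x)%:E))%R.
Proof.
have -> : \int[lamR R n]_(z in A) (ray_weight z * - dirder J z (- d) * xi (foot z))%:E =
    \int[lamR R n]_(z in A) (ray_deriv F xi [set d] z)%:E.
  by apply: eq_integral => z _; rewrite ray_derivE rho1.
have h := machine_cvg Cconv mF F0 r00 F2 FB intF cxi xi01 DM (erefl d) dM mFt Ft0 FtE.
apply: (cvg_unique _ h) => //.
set I := fine (\int[@lam R n]_x (xi x * F x)%:E).
apply: (@cvg_trans _ (((expR (t * - d.2) - 1) / t * I)%R @[t --> (0 : R)^'+])); last first.
  by apply: cvgM; [exact: expR_quotient|exact: cvg_cst].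
apply: near_eq_cvg; near=> t; have t0 : (0 < t)%R by near: t; exact: nbhs_right_gt.
have -> : \int[@lam R n]_x (xi x * Ft t x)%:E = (expR (t * - d.2))%:E * \int[@lam R n]_x (xi x * F x)%:E.
  rewrite -(inv t0) -ge0_integralZl//.
  - by apply: eq_integral => x _; rewrite -EFinM /Ft mulrN; congr EFin; ring.
  - by apply/measurable_EFinP; apply: measurable_funM => //; exact: continuous_measurable_rV.
  - by move=> x _; rewrite lee_fin mulr_ge0//; case/andP: (xi01 x).
have Ifin : \int[@lam R n]_x (xi x * F x)%:E \is a fin_num.
  rewrite ge0_fin_numE; last by apply: integral_ge0 => x _; rewrite lee_fin mulr_ge0//; case/andP: (xi01 x).
  apply: le_lt_trans intF; apply: ge0_le_integral => //.
  - by move=> x _; rewrite lee_fin mulr_ge0//; case/andP: (xi01 x).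
  - by apply/measurable_EFinP; apply: measurable_funM => //; exact: continuous_measurable_rV.
  - by apply/measurable_EFinP.
  - by move=> x _; rewrite lee_fin ler_piMl//; case/andP: (xi01 x).
by rewrite fineM// /= -/I; ring.
Unshelve. all: by end_near. Qed.

End one_direction.

Let one : 'rV[R]_n -> R := fun=> 1%R.
Let cone : continuous one. Proof. exact: cst_continuous. Qed.
Let one01 x : (0 <= one x <= 1)%R. Proof. by rewrite /one ler01 lexx. Qed.

(** With [xi] = 1 the derivatives for d and - d are opposite, by translation invariance. Hence the
    sum of the two one-sided derivatives, which is nonnegative by sublinearity, has weighted
    integral 0. The weight is positive wherever [kw] is not 0. *)
Lemma dirder_sym_ae (d : V) : {ae lamR R n, forall z, A z -> kw z.1 != 0%R -> (dirder J z d + dirder J z (- d) = 0)%R}.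
Proof.
have inv (c : V) t : (0 < t)%R -> \int[@lam R n]_x (one x * F (x - t *: c.1))%:E = \int[@lam R n]_x (one x * F x)%:E.
  move=> t0; have h := @ge0_integral_affine R n 1%R (- (t *: c.1))%R (fun x => (F x)%:E).
  transitivity (\int[@lam R n]_x (F (1 *: x + - (t *: c.1)))%:E); first by apply: eq_integral => x _; rewrite /one mul1r scale1r.
  rewrite h ?oner_eq0//; last by apply/measurable_EFinP.
  by rewrite normr1 invr1 expr1n mul1e; apply: eq_integral => x _; rewrite /one mul1r.
have e1 := direction_deriv cone one01 (inv d); have e2 := direction_deriv cone one01 (inv (- d)%R).
have i1 := direction_integrable d cone one01; have i2 := direction_integrable (- d)%R cone one01.
pose f (z : V) := (ray_weight z * (dirder J z d + dirder J z (- d)))%R.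
have f0 z : (0 <= f z)%R by rewrite mulr_ge0 ?ray_weight_ge0// dirder_sym.
have mf : measurable_fun A (fun z => (f z)%:E).
  apply/measurable_EFinP; apply: measurable_funTS; apply: measurable_funM; first exact: measurable_ray_weight.
  by apply: measurable_funD; exact: measurable_dirder.
have : \int[lamR R n]_(z in A) `|(f z)%:E| = 0.
  have -> : \int[lamR R n]_(z in A) `|(f z)%:E| = \int[lamR R n]_(z in A) ((-1)%:E *
     ((ray_weight z * - dirder J z (- d) * one (foot z))%:E + (ray_weight z * - dirder J z (- - d) * one (foot z))%:E)).
    have key (W p q : R) : (W * (p + q) = -1 * (W * - q * 1 + W * - p * 1))%R by ring.
    have dd : (- - d)%R = d := opprK d.
    by apply: eq_integral => z _; rewrite dd gee0_abs ?lee_fin// -EFinD -EFinM; congr EFin; exact: key.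
  rewrite integralZl//; [|exact: measurable_ray_shell|exact: (integrableD measurable_ray_shell i1 i2)].
  have key (a c : \bar R) (x y : R) : a \is a fin_num -> c \is a fin_num -> fine a = x -> fine c = y -> (x + y = 0)%R -> (-1)%:E * (a + c) = 0.
    by move=> /fineK <- /fineK <- /= -> -> xy; rewrite -EFinD xy mule0.
  have f1 := integrable_fin_num measurable_ray_shell i1; have f2 := integrable_fin_num measurable_ray_shell i2.
  have ID := integralD measurable_ray_shell i1 i2.
  apply: etrans (congr1 (fun x => (-1)%:E * x) ID) _; apply: (key _ _ _ _ f1 f2 e1 e2).
  set I := fine _; change (- d.2 * I + - - d.2 * I = 0)%R. by rewrite mulNr [X in (_ + X)%R]mulNr mulNr opprK addNr.
move=> /(ae_eq_integral_abs (lamR R n) measurable_ray_shell mf); apply: filterS => z h Az k0.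
have [] := h Az; move=> /eqP; rewrite mulf_eq0 => /orP[/eqP W0|/eqP//].
exfalso; move: W0; apply/eqP; rewrite /ray_weight mulf_neq0// !mulf_neq0 ?expf_neq0 ?invr_neq0 ?gt_eqF ?expR_gt0//.
Qed.

(** [direction_deriv] for the vertical direction (0, -1), along which any continuous test function
    is admissible. Ramps pass from continuous functions to boxes, uniqueness of measures to Borel
    sets, and simple functions to integrals. *)
Lemma graph_identity (ze : bV R n -> \bar R) : measurable_fun setT ze -> (forall x, 0 <= ze x) ->
  \int[@lam R n]_x ((F x)%:E * ze x) = \int[lamR R n]_(z in A) ((ray_weight z * - dirder J z (0%R, 1%R))%:E * ze (foot z)).
Proof.
pose v (z : V) := (ray_weight z * - dirder J z (0%R, 1%R))%R.
have v0 z : (0 <= v z)%R by rewrite mulr_ge0 ?ray_weight_ge0// oppr_ge0 (dirder_J_up Cconv r00 F2).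
have mv : measurable_fun A (v : bV R n * R -> R).
  apply: measurable_funTS; apply: measurable_funM; first exact: measurable_ray_weight.
  by apply: measurable_funN; exact: measurable_dirder.
have dE : (- (0, -1))%R = (0%R, 1%R) :> V by apply/pair_equal_spec; rewrite oppr0 opprK.
have mA := measurable_ray_shell.
have cont (xi : 'rV[R]_n -> R) : continuous xi -> (forall x, (0 <= xi x <= 1)%R) ->
    \int[@lam R n]_x ((F x)%:E * (xi x)%:E) = \int[lamR R n]_(z in A) ((v z)%:E * (xi (foot z))%:E).
  move=> cxi xi01; pose d : V := (0, -1)%R.
  have inv t : (0 < t)%R -> \int[@lam R n]_x (xi x * F (x - t *: d.1))%:E = \int[@lam R n]_x (xi x * F x)%:E.
    by move=> _; apply: eq_integral => x _; rewrite scaler0 subr0.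
  have := direction_deriv cxi xi01 inv; have ii := direction_integrable d cxi xi01.
  rewrite /d dE in ii *; rewrite /= opprK mul1r => e. have fi : \int[@lam R n]_x (xi x * F x)%:E \is a fin_num.
    rewrite ge0_fin_numE; last by apply: integral_ge0 => x _; rewrite lee_fin mulr_ge0//; case/andP: (xi01 x).
    apply: le_lt_trans intF; apply: ge0_le_integral => //.
    - by move=> x _; rewrite lee_fin mulr_ge0//; case/andP: (xi01 x).
    - by apply/measurable_EFinP; apply: measurable_funM => //; exact: continuous_measurable_rV.
    - by apply/measurable_EFinP.
    - by move=> x _; rewrite lee_fin ler_piMl//; case/andP: (xi01 x).
  transitivity (\int[@lam R n]_x (xi x * F x)%:E); first by apply: eq_integral => x _; rewrite -EFinM mulrC.
  rewrite -(fineK fi) -e fineK; first by apply: eq_integral => z _; rewrite -EFinM. exact: integrable_fin_num ii.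
have vint : (lamR R n).-integrable A (fun z => (v z)%:E).
  apply: eq_integrable (direction_integrable (0, -1)%R cone one01) => // z _. by rewrite dE /one mulr1.
have Fint : (@lam R n).-integrable setT (fun x => (F x)%:E).
  apply/integrableP; split; first exact/measurable_EFinP.
  by rewrite (eq_integral (fun x : bV R n => (F x)%:E)) // => x _; rewrite gee0_abs ?lee_fin.
have mft : measurable_fun A (foot : bV R n * R -> bV R n) by apply: measurable_funTS; exact: measurable_foot.
have hb a c : \int[@lam R n]_x ((F x)%:E * (\1_(hbox a c) x)%:E) = \int[lamR R n]_(z in A) ((v z)%:E * (\1_(hbox a c) (foot z))%:E).
  have l1 := @box_ramp_integral R n _ (bV R n) (@lam R n) setT F (fun x => x) a c measurableT F0 Fint (@measurable_id _ (bV R n) setT).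
  have l2 := @box_ramp_integral R n _ (bV R n * R)%type (lamR R n) A v foot a c mA v0 vint mft.
  apply: (cvg_unique _ l1) => //; apply: cvg_trans l2; apply: near_eq_cvg; apply: nearW => k.
  by rewrite /= cont//; [exact: continuous_box_ramp|exact: box_ramp01].
have [m1 h1] := density_measure (@lam R n) measurableT mF (fun x _ => F0 x) (@measurable_id _ _ setT).
have [m2 h2] := density_measure (lamR R n) mA mv (fun z _ => v0 z) mft.
move=> mze ze0; apply: (weighted_integral_transfer measurableT mA mF mv (fun x _ => F0 x) (fun z _ => v0 z) (@measurable_id _ _ setT) mft) => // B mB.
rewrite -[LHS]h1// -[RHS]h2//; apply: hboxes_measure_unique => // [a c|k].
  by rewrite h1 ?h2 ?hb//; exact: measurable_hbox.
rewrite h1; last exact: measurable_hbox.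
apply: le_lt_trans intF; apply: ge0_le_integral => //.
- by move=> x _; rewrite -EFinM lee_fin mulr_ge0.
- apply: emeasurable_funM; apply/measurable_EFinP => //.
  by apply: measurable_indic; exact: measurable_hbox.
- exact/measurable_EFinP.
- by move=> x _; rewrite -EFinM lee_fin ler_piMr// indicE; case: (_ \in _).
Qed.

End graph_identity.

(** * What a ray meets: the graph of - ln F or a wall over the boundary of its support *)

Section support_functions_of_g.
Variables (R : realType) (n : nat) (g : 'rV[R]_n -> R).
Local Open Scope ereal_scope.

Lemma supp_funE x : supp_fun g x = ereal_sup [set (inner x y + ln (g y))%:E | y in supp g].
Proof.
apply/eqP; rewrite eq_le; apply/andP; split; apply: ge_ereal_sup => _ [y gy <-].
  rewrite /neglog; case: ifPn => gy0; last by rewrite leNye.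
  by apply: ereal_sup_ubound; exists y => //; rewrite -EFinB opprK.
by apply: ereal_sup_ubound; exists y => //; rewrite /neglog gy -EFinB opprK.
Qed.

Lemma supp_fun_setE (K : set 'rV[R]_n) x : supp_fun_set K x = ereal_sup [set (inner y x + 0)%:E | y in K].
Proof.
by congr ereal_sup; apply/seteqP; split => _ [y Ky <-]; exists y => //; rewrite addr0.
Qed.

Lemma measurable_supp_fun : measurable_fun setT (supp_fun g : bV R n -> \bar R).
Proof.
rewrite (_ : supp_fun g = fun x => ereal_sup [set (inner y x + ln (g y))%:E | y in supp g]).
  exact: (@measurable_sup_inner R n _ (supp g) id (fun y => ln (g y))).
apply/funext => x; rewrite supp_funE; congr ereal_sup.
by apply/seteqP; split => _ [y Ky <-]; exists y => //; rewrite innerC.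
Qed.

Lemma measurable_supp_fun_set (K : set 'rV[R]_n) : measurable_fun setT (supp_fun_set K : bV R n -> \bar R).
Proof.
rewrite (_ : supp_fun_set K = fun x => ereal_sup [set (inner y x + 0)%:E | y in K]).
  exact: (@measurable_sup_inner R n _ K id (fun=> 0%R)).
by apply/funext => x; rewrite supp_fun_setE.
Qed.

End support_functions_of_g.

Fact cancel_ray (R : realFieldType) (a b c s : R) : c + s * a <= (1 + s * b) * c -> s * a <= s * (b * c).
Proof. lra. Qed.

Section classification.
Variables (R : realType) (m : nat).
Local Notation n := m.+1.
Local Notation V := ('rV[R]_n * R)%type.
Variables (F g : 'rV[R]_n -> R) (r0 b M : R) (w0 : 'rV[R]_n).
Hypotheses (lF : LC F) (tF : tame F r0 b).
Let Cconv := tame_conv tF.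
Let r00 := tame_r0 tF.
Let F2 := tame_lb tF.
Local Notation C := (epigraph F).
Local Notation J := (gauge C).
Local Notation K := (supp F).
Local Notation j := (gauge K).
Local Notation e_ i := (delta_mx 0 i : 'rV[R]_n).
Let Cabs := epigraph_absorbing r00 F2.
Let J0 := J_ge0 r00 F2.
Let JZ' := JZ Cconv r00 F2.
Let JD' := JD Cconv r00 F2.

Lemma tame_supp_conv x y (l : R) : 0 <= l <= 1 -> K x -> K y -> K ((1 - l) *: x + l *: y).
Proof. exact: (LC_superlevel_convex lF (lexx 0)). Qed.
Let Kconv := tame_supp_conv.

Lemma tame_supp_ball x : enorm x <= r0 -> K x.
Proof. by move=> /F2; apply: lt_le_trans; exact: expR_gt0. Qed.
Let Kball := tame_supp_ball.
Let Kabs := ball_absorbing r00 Kball.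

(** The graph of - ln g over its support: the directions in which sup-convolution with g moves the
    epigraph. *)
Definition dirs : set V := [set (w, - ln (g w)) | w in supp g].
Hypotheses (DM : forall d, dirs d -> J d <= M) (g0 : 0 < g w0).

Lemma j_le_J (z : V) : j z.1 <= J z.
Proof.
apply/ler_addgt0Pr => e e0; have l0 : 0 < J z + e by rewrite ltr_wpDl.
apply: (gauge_le l0); have := gauge_lt Cconv Cabs (ltr_pwDr e0 (lexx (J z))).
by apply: le_lt_trans; exact: expR_ge0.
Qed.

Variable z : V.
Local Notation L := (dirder J z).
Hypothesis Jz : 0 < J z.
Local Notation p := (foot F z).
Local Notation q := ((J z)^-1 * z.2).
Let ze : V := (J z)^-1 *: z.

(** If [J] is stationary upwards at [z], then the tangent inequality bounds J z by the gauge at any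
    greater height over the same horizontal point, and high enough that gauge exceeds the one of the
    support by as little as desired. *)
Lemma side_gauge : L (0, 1) = 0 -> J z = j z.1.
Proof.
move=> L0; apply/eqP; rewrite eq_le j_le_J andbT; apply/ler_addgt0Pr => e e0.
have l0 : 0 < j z.1 + e by rewrite ltr_wpDl ?(gauge_ge0 Kabs).
have Fp : 0 < F ((j z.1 + e)^-1 *: z.1) by exact: (gauge_lt Kconv Kabs (ltr_pwDr e0 (lexx (j z.1)))).
set l := j z.1 + e in l0 Fp *.
pose s := Num.max (z.2 + 1) (l * (1 - ln (F (l^-1 *: z.1)))).
have sz : 0 < s - z.2 by rewrite subr_gt0 lt_max ltrDl ltr01.
have Js : J (z.1, s) <= l.
  apply: (gauge_le l0); rewrite /epigraph /=. rewrite -ltr_ln ?posrE ?expR_gt0// expRK.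
  have : 1 - ln (F (l^-1 *: z.1)) <= l^-1 * s by rewrite ler_pdivlMl// le_max lexx orbT.
  by rewrite -[_ *: s]/(_ * s); lra.
have := dirder_subgrad JZ' JD' z (z.1, s).
have -> : ((z.1, s) : V) - z = (s - z.2) *: ((0, 1) : V).
  by apply/pair_equal_spec; split => /=; rewrite ?subrr ?scaler0// -[_ *: (1 : R)]/(_ * 1) mulr1.
by rewrite (dirderZ JZ' JD')// L0 mulr0 addr0 => h; exact: le_trans Js.
Qed.

(** Otherwise F at the foot would be strictly below e^(-q). By upper semicontinuity it would stay so
    slightly inside along the ray, although those points belong to the epigraph. *)
Lemma side_value : L (0, 1) = 0 -> expR (- q) <= F p.
Proof.
move=> L0; rewrite leNgt; apply/negP => h.
pose a := (F p + expR (- q)) / 2.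
have [aF aq] : F p < a /\ a < expR (- q) by rewrite /a; split; lra.
have [_ uF _] := lF; have /nbhs_enormP[d d0 hd] := uF _ _ aF.
have ciq : continuous (fun l : R => expR (- (l * z.2))).
  move=> l; apply: (@continuous_comp _ _ _ (fun l : R => - (l * z.2)) expR); last exact: continuous_expR.
  by apply: continuousN; apply: continuousM; [exact: cvg_id|exact: cst_continuous].
have e1 : 0 < expR (- q) - a by rewrite subr_gt0.
have /cvgrPdist_lt/(_ _ e1)/nbhs_ballP[d2 /= d20 hd2] := ciq (J z)^-1.
have u0 : 0 < (J z)^-1 by rewrite invr_gt0.
have x1 : 0 < enorm z.1 + 1 by rewrite ltr_wpDl ?enorm_ge0.
pose c := Num.min d2 (Num.min (d / (enorm z.1 + 1)) (J z)^-1).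
have c0 : 0 < c by rewrite !lt_min d20 u0 divr_gt0.
have [c1 c2 c3] : [/\ c <= d2, c * (enorm z.1 + 1) <= d & c <= (J z)^-1].
  by rewrite -ler_pdivlMr//; split; rewrite !ge_min lexx ?orbT.
pose t := (J z)^-1 - c / 2.
have t0 : 0 < t by rewrite /t; lra.
have : C (t *: z).
  apply: (gauge_lt1 Cconv Cabs); rewrite JZ' ?(ltW t0)// -ltr_pdivlMr// mul1r /t; lra.
rewrite /epigraph /= => h1.
have h2 : F (t *: z.1) < a.
  apply: hd; rewrite -scalerBl enormZ /t opprB addrC subrK gtr0_norm; last lra. by have := enorm_ge0 z.1; nra.
have h3 : `|expR (- q) - expR (- (t * z.2))| < expR (- q) - a.
  by apply: hd2; rewrite /ball /= /t opprB addrC subrK gtr0_norm; lra.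
have := lt_trans h1 h2; rewrite -[t *: z.2]/(t * z.2) => h4.
by have := ler_norm (expR (- q) - expR (- (t * z.2))); lra.
Qed.

Hypothesis sym : forall v, L v + L (- v) = 0.

Lemma linD u v : L (u + v) = L u + L v. Proof. exact: dirderD_sym. Qed.
Lemma linZ a v : L (a *: v) = a * L v. Proof. exact: dirderN_of_sym. Qed.
Lemma linN v : L (- v) = - L v. Proof. by rewrite -scaleN1r linZ mulN1r. Qed.

(** Under the hypothesis [sym] the form [L] is linear with coordinates [nu] and [- kappa]: these
    describe the tangent hyperplane of the epigraph at the exit point, with kappa >= 0 since the
    epigraph is closed upwards. *)
Definition normal_part : 'rV[R]_n := \row_i L (e_ i, 0).
Local Notation nu := normal_part.
Local Notation kappa := (- L (0, 1)).

Lemma lin_formula (w : 'rV[R]_n) (s : R) : L (w, s) = inner nu w - kappa * s.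
Proof.
have E : ((w, s) : V) = (\sum_i w ord0 i *: ((e_ i, 0) : V)) + s *: ((0, 1) : V).
  apply: injective_projections => /=.
    rewrite scaler0 addr0 {1}(row_sum_delta w). by elim/big_rec2 : _ => // i x y _ ->.
  rewrite -[s *: (1 : R)]/(s * 1) mulr1 (_ : (\sum_i w ord0 i *: ((e_ i, 0) : V)).2 = 0) ?add0r//.
  by elim/big_rec : _ => // i x _ /=; rewrite scaler0 => ->; rewrite addr0.
rewrite E linD linZ mulNr opprK (mulrC s); congr (_ + _).
rewrite /inner; elim: (index_enum _) => [|i t IH]; first by rewrite !big_nil (dirder0 JZ').
by rewrite !big_cons linD linZ IH mxE mulrC.
Qed.

Lemma linNN v : - L (- v) = L v. Proof. by rewrite linN opprK. Qed.

Lemma lin_le v : L v <= J v.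
Proof. exact: dirder_leJ. Qed.

Lemma lin_ze : L ze = 1.
Proof. by rewrite /ze linZ (dirder_self JZ' JD') mulVf// gt_eqF. Qed.

Lemma lin_foot : inner nu p = 1 + kappa * q.
Proof. by apply: (addIr (- (kappa * q))); rewrite addrK -(lin_formula p q); exact: lin_ze. Qed.

Lemma lin_epigraph v : C v -> L v <= 1.
Proof. by move=> /epigraph_le1; apply: le_trans; exact: lin_le. Qed.

Lemma lin_expand v (e : R) : 0 < e -> exists2 t : R, 0 < t & J (ze + t *: v) <= 1 + t * (L v + e).
Proof.
move=> e0; have [t0 t00 h] := dirder_cvg JZ' JD' z v e0.
exists ((J z)^-1 * t0); first by rewrite mulr_gt0 ?invr_gt0.
have := h t0; rewrite t00 lexx => /(_ isT); rewrite /slope ler_pdivrMr// => h1.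
have -> : ze + ((J z)^-1 * t0) *: v = (J z)^-1 *: (z + t0 *: v) by rewrite /ze scalerDr scalerA.
rewrite JZ' ?invr_ge0 ?(ltW Jz)// ler_pdivrMl// mulrDr mulr1 !mulrA mulfV ?gt_eqF// mul1r; lra.
Qed.

Lemma lin_neg v : L v < 0 -> exists2 t : R, 0 < t & C (ze + t *: v).
Proof.
move=> Lv; have e0 : 0 < - L v / 2 by lra.
have [t t0 h] := lin_expand v e0; exists t => //; apply: (gauge_lt1 Cconv Cabs).
by apply: le_lt_trans h _; have : t * L v < 0; [rewrite pmulr_rlt0|lra].
Qed.

Lemma dirs_value y : - L (- (y, - ln (g y))) = inner nu y + kappa * ln (g y).
Proof. by apply: etrans (linNN _) _; apply: etrans (lin_formula y _) _; rewrite mulrN opprK. Qed.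

Lemma rho_sup : (rho F dirs z)%:E = ereal_sup [set (inner nu y + kappa * ln (g y))%:E | y in supp g].
Proof.
rewrite /rho -ereal_sup_EFin; last 2 first.
- exists M => _ [d Dd <-]; apply: le_trans (DM Dd); rewrite linNN; exact: lin_le.
- by exists (- L (- (w0, - ln (g w0)))), (w0, - ln (g w0)) => //; exists w0.
congr ereal_sup; apply/seteqP; split => [_ [_ [_ [y gy <-] <-] <-]|_ [y gy <-]].
  by exists y => //; congr EFin; exact: esym (dirs_value y).
exists (inner nu y + kappa * ln (g y)) => //; exists (y, - ln (g y)); first by exists y.
exact: dirs_value.
Qed.

(** Here kappa > 0. A direction on which [L] is negative leads into the epigraph, which gives the
    decay rates of F at the foot along both orientations of every axis; the exit point is not above
    the graph, by [Fq]. So the gradient is nu / kappa, and the speed is kappa times the support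
    function of g there. *)
Lemma class_graph : 0 < kappa ->
  [/\ grad_dom F p, grad_neglog F p = kappa^-1 *: nu & (rho F dirs z)%:E = (kappa%:E * supp_fun g (grad_neglog F p))%E].
Proof.
move=> k0.
have Fq : F p <= expR (- q).
  rewrite leNgt; apply/negP => h; have Fp : 0 < F p by apply: lt_trans h; exact: expR_gt0.
  have lq : - q < ln (F p) by rewrite -ltr_expR lnK ?posrE.
  pose s := - (ln (F p) + q) / 2; have s0 : s < 0 by rewrite /s; lra. have : C (ze + (0, s)).
    have h1 : expR (- (q + s)) < F p by rewrite -ltr_ln ?posrE ?expR_gt0// expRK /s; lra.
    by rewrite /epigraph /= addr0; exact: h1.
  move=> /lin_epigraph; rewrite linD lin_ze (lin_formula 0 s) inner0r sub0r.
  have : kappa * s < 0 by rewrite pmulr_rlt0. lra.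
have Fp : 0 < F p.
  have L0 : L (0, 1) < 0 by rewrite -oppr_gt0.
  by have [t t0] := lin_neg L0; rewrite /epigraph /= scaler0 addr0; apply: le_lt_trans; exact: expR_ge0.
have dec (w : 'rV[R]_n) be : inner nu w < kappa * be -> decays F p w be.
  move=> h; have Lw : L (w, be) < 0 by rewrite (lin_formula w be); lra. have [t t0 hC] := lin_neg Lw; exists t => //.
  have {hC} hC : expR (- (q + t * be)) < F (p + t *: w) := hC; apply: le_trans (ltW hC).
  apply: (@le_trans _ _ (expR (- q) * expR (- (t * be)))); first by rewrite ler_wpM2r ?expR_ge0.
  by rewrite -expRD ler_expR opprD.
have sl : slopes F p (kappa^-1 *: nu).
  have kk : kappa != 0 by rewrite gt_eqF. split => // i eta eta0; split; apply: dec; rewrite mxE.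
    by rewrite inner_delta mulrDr mulrA mulfV// mul1r ltrDl mulr_gt0.
  rewrite innerNr inner_delta mulrDr mulrN mulrA mulfV// mul1r ltrDl mulr_gt0//.
have [gd ge] := slopes_grad lF sl; split => //; rewrite ge rho_sup supp_funE -ereal_sup_pZl//.
congr ereal_sup; apply/seteqP; split => [_ [y gy <-]|_ [_ [y gy <-] <-]].
  exists (inner (kappa^-1 *: nu) y + ln (g y))%:E; first by exists y.
  by rewrite -EFinM innerZl mulrDr mulrA mulfV ?mul1r// gt_eqF.
by exists y => //; rewrite -EFinM innerZl mulrDr mulrA mulfV ?mul1r// gt_eqF.
Qed.

(** Here kappa = 0 and the heights of the directions no longer count, so the support function of g
    is replaced by the one of its support. The factor 1 / <p, normal> is the norm of nu, because
    <nu, p> = 1. *)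
Lemma class_side : L (0, 1) = 0 ->
  [/\ gauss_dom K p, 0 < inner p (gauss K p) &
   (rho F dirs z)%:E = ((inner p (gauss K p))^-1%:E * supp_fun_set (supp g) (gauss K p))%E].
Proof.
move=> L0.
have np : inner nu p = 1 by rewrite lin_foot L0 oppr0 mul0r addr0.
have n0 : 0 < enorm nu.
  rewrite lt_neqAle enorm_ge0 andbT; apply/negP => /eqP e. have e0 : nu = 0 by exact: enorm_eq0 (esym e).
  by move: np; rewrite e0 inner0l => /esym/eqP; rewrite oner_eq0.
have pb : bd K p.
  rewrite (bdE Kconv r00 Kball) /= (gaugeZ Kconv Kabs) ?invr_ge0 ?(ltW Jz)//. by rewrite -side_gauge// mulVf// gt_eqF.
pose th := (enorm nu)^-1 *: nu.
have pth : inner p th = (enorm nu)^-1 by rewrite innerZr innerC np mulr1.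
have oth : outer_normals K p th.
  split; first by rewrite enormZ gtr0_norm ?invr_gt0// mulVf// gt_eqF.
  move=> y Ky; rewrite pth innerZr ler_piMr ?invr_ge0 ?(ltW n0)// innerC.
  have : C (y, 1 - ln (F y)) by rewrite /epigraph /= -ltr_ln ?posrE ?expR_gt0// expRK; lra.
  by move=> /lin_epigraph; rewrite (lin_formula y) L0 oppr0 mul0r subr0.
have uth : outer_normals K p = [set th].
  apply/seteqP; split => [t ot|_ ->//]. have pt0 : 0 < inner p t := lt_le_trans r00 (normal_ge_r0 r00 Kball ot).
  (* Any normal t at p defines the form w -> <w, t> / <p, t>. It lies below the gauge of the support
     and touches it at p, hence lies below nu; two linear forms ordered in this way are equal, so
     the normal is unique. *)
  have le w : inner w t / inner p t <= inner nu w.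
    apply/ler_addgt0Pr => e e0; have [s s0 h] := lin_expand (w, 0) e0.
    have h1 := le_trans (j_le_J (ze + s *: (w, 0))) h.
    have := normal_gauge Kconv r00 Kball (p + s *: w) ot; rewrite innerDl innerZl.
    rewrite (lin_formula w 0) mulr0 subr0 in h1. have h2 := le_trans _ (ler_wpM2r (ltW pt0) h1) => /h2 h3.
    by rewrite ler_pdivrMr// -(ler_pM2l s0); exact: cancel_ray.
  have eq w : inner w t / inner p t = inner nu w.
    apply/eqP; rewrite eq_le le/=; have := le (- w); rewrite innerNl innerNr mulNr; lra.
  have tE : (inner p t)^-1 *: t = nu.
    by apply/rowP => i; have := eq (e_ i); rewrite inner_delta innerC inner_delta => <-; rewrite !mxE mulrC.
  have := ot.1; move=> t1. have nE : enorm nu = (inner p t)^-1 by rewrite -tE enormZ t1 mulr1 gtr0_norm// invr_gt0.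
  by rewrite /= /th nE -tE scalerA mulVf ?scale1r// invr_neq0// gt_eqF.
have gd : gauss_dom K p by split => //; exists th.
have gE : gauss K p = th by have := gauss_outer gd; rewrite uth => /seteqP[+ _] => /(_ th erefl).
split => //; rewrite gE pth ?invr_gt0// invrK rho_sup supp_fun_setE -ereal_sup_pZl//.
congr ereal_sup; rewrite L0; apply/seteqP; split => [_ [y gy <-]|_ [_ [y gy <-] <-]].
  exists (inner y th + 0)%:E; first by exists y.
  by rewrite -EFinM addr0 innerZr mulrA mulfV ?gt_eqF// mul1r innerC oppr0 mul0r addr0.
by exists y => //; rewrite -EFinM addr0 innerZr mulrA mulfV ?gt_eqF// mul1r innerC oppr0 mul0r addr0.
Qed.

End classification.

Section sym_everywhere.
Variables (R : realType) (V : lmodType R) (J : V -> R).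
Hypothesis JZ : forall (a : R) v, 0 <= a -> J (a *: v) = a * J v.
Hypothesis JD : forall u v, J (u + v) <= J u + J v.
Variable z : V.
Local Notation sym v := (dirder J z v + dirder J z (- v) = 0).

Lemma dirder_sym0 : sym 0.
Proof. by have h0 := dirder0 JZ JD z; rewrite oppr0 h0 addr0. Qed.

Lemma dirder_symZ a v : sym v -> sym (a *: v).
Proof.
move=> sv; have h := dirderN_of_sym JZ JD sv.
by rewrite -scaleNr !h mulNr subrr.
Qed.

Lemma dirder_symD u v : sym u -> sym v -> sym (u + v).
Proof.
move=> su sv; have sv' : sym (- v) by rewrite opprK addrC.
by rewrite opprD (dirderD_sym JZ JD u sv) (dirderD_sym JZ JD (- u) sv') addrACA su sv addr0.
Qed.

End sym_everywhere.

(** * Splitting the ray derivative into the two integrals of the theorem *)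

Section parts.
Variables (R : realType) (m : nat).
Local Notation n := m.+1.
Local Notation V := ('rV[R]_n * R)%type.
Variables (F g : 'rV[R]_n -> R) (r0 b M : R) (w0 : 'rV[R]_n).
Hypotheses (lF : LC F) (tF : tame F r0 b).
Let Cconv := tame_conv tF.
Let mF := tame_meas tF.
Let F0 := tame_ge0 tF.
Let r00 := tame_r0 tF.
Let F2 := tame_lb tF.
Local Notation C := (epigraph F).
Local Notation J := (gauge C).
Local Notation K := (supp F).
Local Notation j := (gauge K).
Local Notation A := (ray_shell F).
Local Notation e_ i := (delta_mx 0 i : 'rV[R]_n).
Let Cabs := epigraph_absorbing r00 F2.
Let J0 := J_ge0 r00 F2.
Let JZ' := JZ Cconv r00 F2.
Let JD' := JD Cconv r00 F2.
Let Kconv := tame_supp_conv lF.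
Let Kball := tame_supp_ball tF.
Let Kabs := ball_absorbing r00 Kball.
Hypotheses (DM : forall d, dirs g d -> J d <= M) (g0 : 0 < g w0).
Local Open Scope ereal_scope.

Let mK : measurable (K : set (bV R n)).
exact: (measurable_lt_set (measurable_cst _) mF). Qed.

(** [dirder_sym_ae] has an exceptional set for each direction. Finitely many directions suffice:
    those along which the derivatives match form a subspace, and n + 1 of them span. *)
Lemma linear_ae : {ae lamR R n, forall z : V, A z -> kw z.1 != 0%R -> forall v, (dirder J z v + dirder J z (- v) = 0)%R}.
Proof.
have h1 := dirder_sym_ae tF (0, 1)%R.
have h2 : {ae lamR R n, forall z (i : 'I_n), A z -> kw z.1 != 0%R -> (dirder J z (e_ i, 0) + dirder J z (- (e_ i, 0)) = 0)%R}.
  by apply: filter_forall => i; exact: (dirder_sym_ae tF).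
apply: filterS2 h1 h2 => z h1 h2 Az k0 [w s].
have -> : ((w, s) : V) = ((\sum_i w ord0 i *: ((e_ i, 0) : V)) + s *: ((0, 1) : V))%R.
  apply: injective_projections => /=.
    rewrite scaler0 addr0 {1}(row_sum_delta w). by elim/big_rec2 : _ => // i x y _ ->.
  rewrite -[(s *: (1 : R))%R]/(s * 1)%R mulr1 (_ : (\sum_i w ord0 i *: ((e_ i, 0) : V))%R.2 = 0%R) ?add0r//.
  by elim/big_rec : _ => // i x _ /=; rewrite scaler0 => ->; rewrite addr0.
apply: (dirder_symD JZ' JD'); last by apply: (dirder_symZ JZ' JD'); exact: h1.
elim: (index_enum _) => [|i t IH]; first by rewrite big_nil; exact: (dirder_sym0 JZ').
rewrite big_cons; exact: (dirder_symD JZ' JD' (dirder_symZ JZ' JD' (w ord0 i) (h2 i Az k0)) IH).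
Qed.

Let mslice x : measurable_fun setT (fun s : R =>
  (if (0 < J (x, s))%R && (dirder J (x, s) (0, 1) == 0)%R then expR (- ((j x)^-1 * s)) else 0)%:E).
Proof.
apply/measurable_EFinP; apply: measurable_fun_ifT.
  + apply: measurable_and.
      apply: measurable_fun_ltr => //.
      exact: (measurableT_comp (measurable_J Cconv mF r00 F2) (@measurable_pair1 _ _ (bV R n) R x)).
    apply: measurable_fun_eqr => //.
    exact: (measurableT_comp (measurable_dirder tF (0, 1)%R) (@measurable_pair1 _ _ (bV R n) R x)).
  + apply: (measurableT_comp (@measurable_expRN R)); exact: measurable_funM.
  + exact: measurable_cst.
Qed.

(** Over a fixed x the wall consists of the heights s with e^(- s / j x) below F at the boundary
    point, up to one height; [exp_layer] evaluates the integral. *)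
Lemma side_slice (x : 'rV[R]_n) : (0 < j x)%R ->
  \int[@leb R]_s (if (0 < J (x, s))%R && (dirder J (x, s) (0, 1) == 0)%R then expR (- ((j x)^-1 * s)) else 0)%:E =
  (j x * F (radial K x))%:E.
Proof.
move=> jx; set p := radial K x.
pose H (s : R) : \bar R := (if (expR (- s) < F p)%R then expR (- s) else 0)%:E.
have mH : measurable_fun setT H.
  apply/measurable_EFinP; apply: measurable_fun_ifT => //; last exact: measurable_expRN.
  by apply: measurable_fun_ltr => //; exact: measurable_expRN.
have H0 s : 0 <= H s by rewrite /H lee_fin; case: ifP => // _; exact: expR_ge0.
transitivity (\int[@leb R]_s H ((j x)^-1 * s + 0)%R); last first.
  rewrite ge0_integral_leb_affine ?invr_neq0 ?gt_eqF// exp_layer// normfV invrK gtr0_norm//.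
apply: ae_eq_integral => //.
- apply: (measurableT_comp mH); apply: measurable_funD => //; exact: measurable_funM.
(* At the height of the graph itself the weak inequality of [side_value] and the strict one in [H]
   differ; this is a single point. *)
have N : (@leb R).-negligible [set s | s = (- (j x * ln (F p)))%R].
  exists [set (- (j x * ln (F p)))%R]; split => //; exact: leb_set1.
apply: negligibleS N => s /=; apply: contra_notP => ne _.
rewrite /H addr0; congr EFin.
have jJ : (j x <= J (x, s))%R := j_le_J tF (x, s).
have Jp : (0 < J (x, s))%R := lt_le_trans jx jJ.
rewrite Jp /=; case: ifPn => [/eqP L0|Ln].
  have jE := side_gauge lF tF L0; have := side_value lF tF Jp L0.
  rewrite /foot jE /= -/p le_eqVlt => /orP[/eqP e|->//].
  by exfalso; apply: ne; rewrite -e expRK mulrN opprK mulrA mulfV ?mul1r// gt_eqF.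
case: ifPn => // h; exfalso; move/negP: Ln; apply; rewrite eq_le (dirder_J_up Cconv r00 F2)/=.
have Jj : (J (x, s) <= j x)%R.
  apply: (gauge_le jx); exact: h.
apply: le_dirder => t t0; rewrite divr_ge0 ?(ltW t0)// subr_ge0; apply: le_trans Jj _.
apply: le_trans (j_le_J tF _); rewrite /= scaler0 addr0 lexx//.
Qed.

(** [pt] stands for the positive or the negative part. Homogeneity lets it commute with the positive
    factors relating the ray derivative to support functions. *)
Variable pt : \bar R -> \bar R.
Hypotheses (mpt : measurable_fun setT pt) (pt_ge0 : forall x, 0 <= pt x) (pt0 : pt 0 = 0).
Hypothesis ptZ : forall (k : R) x, (0 < k)%R -> pt (k%:E * x) = k%:E * pt x.

Let one : 'rV[R]_n -> R := fun=> 1%R.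
Hypothesis mrd : measurable_fun A (fun z => ray_deriv F one (dirs g) z : R).

Let G (x : bV R n) : \bar R := if x \in grad_dom F then pt (supp_fun g (grad_neglog F x)) else 0.
Let Z (x : bV R n) : \bar R := (((inner x (gauss0 K x))^-1)%:E * pt (supp_fun_set (supp g) (gauss0 K x))).

Let mG : measurable_fun setT G.
Proof.
have -> : G = (fun x => pt (supp_fun g (if x \in grad_dom F then grad_neglog F x else 0%R))) \_ (grad_dom F).
  by apply/funext => x; rewrite patchE /G; case: ifPn.
apply/measurable_restrict => //; first exact: measurable_grad_dom.
apply: measurable_funTS; apply: (measurableT_comp mpt).
apply: (measurableT_comp (f := supp_fun g : bV R n -> \bar R)); first exact: measurable_supp_fun.
exact: measurable_grad.
Qed.

Let minn : measurable_fun setT (fun x : bV R n => inner x (gauss0 K x)).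
Proof.
have mg := measurable_gauss0 Kconv r00 Kball mK; rewrite /inner; apply: measurable_sum => i.
apply: measurable_funM; first exact: measurable_coordi.
exact: (measurableT_comp (@measurable_coordi R n i) mg).
Qed.

Let mZ : measurable_fun setT Z.
Proof.
apply: emeasurable_funM; first by apply/measurable_EFinP; exact: measurable_inv_fun.
apply: (measurableT_comp mpt); apply: (measurableT_comp (f := supp_fun_set (supp g) : bV R n -> \bar R)).
  exact: measurable_supp_fun_set.
exact: (measurable_gauss0 Kconv r00 Kball mK).
Qed.

Let inn0 x : (0 <= inner x (gauss0 K x))%R.
Proof.
rewrite /gauss0; case: asboolP => [h|_]; last by rewrite inner0r.
by apply: le_trans (ltW r00) _; exact: (gauss_ge_r0 r00 Kball).
Qed.

Let Z0 x : 0 <= Z x. Proof. by rewrite /Z mule_ge0// lee_fin invr_ge0. Qed.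
Let G0 x : 0 <= G x. Proof. by rewrite /G; case: ifP. Qed.

Let side (z : V) : bool := [&& (0 < J z)%R, (dirder J z (0, 1) == 0)%R & radial K z.1 \in gauss_dom K].
Let T2 (z : bV R n * R) : \bar R := if side z then (ray_weight F z)%:E * Z (radial K z.1) else 0.

Let mradial : measurable_fun setT (radial K : bV R n -> bV R n).
Proof.
exact: (measurable_radial Kconv r00 Kball mK).
Qed.

Let mgd : measurable (gauss_dom K : set (bV R n)).
exact: (measurable_gauss_dom Kconv r00 Kball mK). Qed.

Let mside : measurable [set z : bV R n * R | side z].
Proof.
have -> : [set z : bV R n * R | side z] = A `&` ([set z | dirder J z (0, 1)%R = 0%R] `&` (fun z => radial K z.1) @^-1` gauss_dom K).
  apply/seteqP; split => z /=; first by move=> /and3P[h1 /eqP h2 /set_mem h3].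
  by move=> [h1 [/eqP h2 h3]]; apply/and3P; split => //; exact/mem_set.
apply: measurableI; first exact: (measurable_ray_shell tF).
apply: measurableI.
  have := measurable_dirder tF (0, 1)%R measurableT (measurable_set1 0%R); rewrite setTI. by congr measurable.
by rewrite -[X in measurable X]setTI; apply: (measurableT_comp mradial measurable_fst).
Qed.

Let mT2 : measurable_fun setT T2.
Proof.
have -> : T2 = (fun z => (ray_weight F z)%:E * Z (radial K z.1)) \_ [set z | side z].
  apply/funext => z; rewrite patchE /T2; have [h|h] := boolP (side z); first by rewrite mem_set.
  by rewrite memNset//; exact/negP.
apply/measurable_restrict => //; apply: measurable_funTS; apply: emeasurable_funM.
  by apply/measurable_EFinP; exact: (measurable_ray_weight tF).
exact: (measurableT_comp mZ (measurableT_comp mradial measurable_fst)).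
Qed.

Let T20 z : 0 <= T2 z.
by rewrite /T2; case: ifP => // _; rewrite mule_ge0// lee_fin (ray_weight_ge0 tF). Qed.

Let T1 (z : bV R n * R) : \bar R := (ray_weight F z * - dirder J z (0, 1))%:E * G (foot F z).

Let T10 z : 0 <= T1 z.
Proof.
by rewrite /T1 mule_ge0// lee_fin mulr_ge0 ?(ray_weight_ge0 tF)// oppr_ge0 (dirder_J_up Cconv r00 F2).
Qed.

Let mT1 : measurable_fun setT T1.
Proof.
apply: emeasurable_funM.
  apply/measurable_EFinP; apply: measurable_funM; first exact: (measurable_ray_weight tF).
  by apply: measurable_funN; exact: (measurable_dirder tF).
exact: (measurableT_comp mG (measurable_foot tF)).
Qed.

(** On almost every ray exactly one of [class_side] and [class_graph] applies, according to whether
    the vertical derivative of the gauge is zero or negative. Where [kw] vanishes all terms are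
    0. *)
Let split_ae : ae_eq (lamR R n) A (fun z => pt (ray_deriv F one (dirs g) z)%:E) (fun z => T1 z + T2 z).
Proof.
apply: negligibleS linear_ae => z /= nz lin; apply: nz => Az.
have Jz : (0 < J z)%R := Az.
have -> : (ray_deriv F one (dirs g) z)%:E = (ray_weight F z)%:E * (rho F (dirs g) z)%:E.
  by rewrite ray_derivE /one mulr1 EFinM.
have [k0|kn] := eqVneq (kw z.1) 0%R.
  have W0 : ray_weight F z = 0%R by rewrite /ray_weight k0 mul0r. rewrite W0 mul0e pt0 /T1 /T2 W0 mul0r !mul0e add0e.
  by case: ifP.
have kp : (0 < kw z.1)%R by rewrite lt_neqAle eq_sym kn kw_ge0.
have Wp : (0 < ray_weight F z)%R.
  by rewrite /ray_weight !mulr_gt0 ?exprn_gt0 ?invr_gt0 ?expR_gt0.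
have sym := lin Az kn.
have := dirder_J_up Cconv r00 F2 z; rewrite le_eqVlt => /orP[/eqP L0|Ln].
  have [gd ip rE] := class_side lF tF DM g0 Jz sym L0.
  have fE : foot F z = radial K z.1 by rewrite /foot (side_gauge lF tF L0).
  rewrite /T1 L0 oppr0 mulr0 mul0e add0e /T2 /side Az L0 eqxx/= mem_set -?fE//.
  rewrite /Z (gauss0E gd) rE muleA -EFinM ptZ; last by apply: (mulr_gt0 Wp); rewrite invr_gt0. by rewrite EFinM muleA.
have kk : (0 < - dirder J z (0, 1))%R by rewrite oppr_gt0.
have [gd ge rE] := class_graph lF tF DM g0 Jz sym kk.
rewrite /T2 /side (lt_eqF Ln) andbF adde0 /T1 /G mem_set// rE muleA -EFinM ptZ//; exact: (mulr_gt0 Wp kk).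
Qed.

Let int_T1 : \int[lamR R n]_(z in A) T1 z = \int[@lam R n]_(x in grad_dom F) (pt (supp_fun g (grad_neglog F x)) * (F x)%:E).
Proof.
rewrite -(graph_identity tF mG)// [RHS]integral_mkcond; apply: eq_integral => x _.
by rewrite patchE /G; case: ifP => _; rewrite ?mule0// muleC.
Qed.

(** Fubini in the height turns the wall term into [side_slice]; what remains over x is the left side
    of [cone_surface], and the factor <x, normal> of the surface side cancels the one in [Z]. *)
Let int_T2 : \int[lamR R n]_(z in A) T2 z = \int[@hm R n m]_(x in gauss_dom K) (pt (supp_fun_set (supp g) (gauss K x)) * (F x)%:E).
Proof.
have -> : \int[lamR R n]_(z in A) T2 z = \int[lamR R n]_z T2 z.
  rewrite integral_mkcond; apply: eq_integral => z _; rewrite patchE; case: ifPn => // /negP Az.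
  by rewrite /T2 /side; case: (boolP (0 < J z)%R) => // h; case: Az; exact/mem_set.
rewrite lamR_fubini//.
transitivity (\int[@lam R n]_(x in [set x | (0 < j x)%R /\ gauss_dom K (radial K x)])
    ((kw x * (j x)^-1 ^+ n)%:E * (Z (radial K x) * (F (radial K x))%:E))).
  rewrite [RHS]integral_mkcond; apply: eq_integral => x _; rewrite patchE; case: ifPn => [/set_mem[jx gd]|nx].
    transitivity (\int[@leb R]_s (((kw x * (j x)^-1 ^+ n.+1)%:E * Z (radial K x)) *
        (if (0 < J (x, s))%R && (dirder J (x, s) (0, 1) == 0)%R then expR (- ((j x)^-1 * s)) else 0)%:E)).
      apply: eq_integral => s _; rewrite /T2 /side /= (mem_set gd) andbT.
      case: ifPn => [/andP[Js /eqP L0]|_]; last by rewrite mule0.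
      rewrite /ray_weight (side_gauge lF tF L0) /= muleAC; congr (_ * _).
      by rewrite -EFinM; congr EFin; rewrite [((j x)^-1 ^+ n.+1)%R]exprS; ring.
    rewrite ge0_integralZl//.
    - rewrite side_slice// muleAC -EFinM [in RHS]muleA [in RHS]muleAC -[in RHS]EFinM; congr (_%:E * _).
      by rewrite exprS; field; rewrite gt_eqF.
    - by move=> s _; rewrite lee_fin; case: ifP => // _; exact: expR_ge0.
    - by rewrite mule_ge0// lee_fin mulr_ge0 ?kw_ge0// exprn_ge0// invr_ge0 (gauge_ge0 Kabs).
  apply: integral0_eq => s _; rewrite /T2 /side /=; case: ifPn => // /and3P[Js /eqP L0 /set_mem gd].
  by move/negP: nx => []; apply/mem_set; split => //; rewrite -(side_gauge lF tF L0 : J (x, s) = j x).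
rewrite (cone_surface Kconv r00 Kball mK (z := fun x => Z x * (F x)%:E)); last 2 first.
- by apply: emeasurable_funM => //; apply/measurable_EFinP.
- by move=> x; rewrite mule_ge0// lee_fin.
apply: eq_integral => x /set_mem gd.
have ip := lt_le_trans r00 (gauss_ge_r0 r00 Kball gd).
by rewrite /Z (gauss0E gd) muleA muleA -EFinM mulfV ?mul1e// gt_eqF.
Qed.

Lemma ray_parts : \int[lamR R n]_(z in A) pt (ray_deriv F one (dirs g) z)%:E =
  \int[@lam R n]_(x in grad_dom F) (pt (supp_fun g (grad_neglog F x)) * (F x)%:E) +
  \int[@hm R n m]_(x in gauss_dom K) (pt (supp_fun_set (supp g) (gauss K x)) * (F x)%:E).
Proof.
have mA := measurable_ray_shell tF.
rewrite -int_T1 -int_T2 -ge0_integralD//; last 2 first.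
- exact: measurable_funTS.
- exact: measurable_funTS.
apply: ge0_ae_eq_integral => //.
- by apply: (measurableT_comp mpt); exact/measurable_EFinP.
- by apply: emeasurable_funD; exact: measurable_funTS.
- by move=> z _; rewrite adde_ge0.
Qed.

End parts.

Lemma compact_eball (R : realType) m (ell : R) : compact [set w : 'rV[R]_m.+1 | enorm w <= ell].
Proof.
apply: bounded_closed_compact.
  exists `|ell|; split => [|M M1 w /= Bw]; first exact: num_real.
  rewrite [leLHS]/Num.norm/= mx_normrE; apply: bigmax_le => [|[i k] _ /=]; first exact: le_trans (ltW M1).
  by rewrite (ord1 i); apply: le_trans (coord_enorm w k) (le_trans Bw (le_trans (ler_norm _) (ltW M1))).
rewrite (_ : [set w | _] = (@enorm R m.+1) @^-1` [set y | y <= ell])//.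
by apply: closed_comp; [move=> z _; exact: continuous_enorm|exact: closed_le].
Qed.

(** * The first variation for bounded g of bounded support *)

Section bounded_g.
Variables (R : realType) (m : nat).
Local Notation n := m.+1.
Local Notation V := ('rV[R]_n * R)%type.
Variables (F g : 'rV[R]_n -> R) (r0 b be ell : R) (w0 : 'rV[R]_n).
Hypotheses (lF : LC F) (tF : tame F r0 b).
Hypotheses (ug : upper_semicontinuous g) (gge0 : forall w, 0 <= g w) (gB : forall w, g w <= expR be).
Hypotheses (gs : forall w, 0 < g w -> enorm w <= ell) (gw0 : 0 < g w0).
Let Cconv := tame_conv tF.
Let F0 := tame_ge0 tF.
Let r00 := tame_r0 tF.
Let F2 := tame_lb tF.
Let FB := tame_ub tF.
Local Notation C := (epigraph F).
Local Notation J := (gauge C).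
Local Notation K := (supp F).
Let Cabs := epigraph_absorbing r00 F2.
Let JD' := JD Cconv r00 F2.

Lemma supconvE (h : 'rV[R]_n -> R) t x : 0 < t ->
  supconv F (lcscale t h) x = ereal_sup [set (F (x - t *: w) * h w `^ t)%:E | w in [set: 'rV[R]_n]].
Proof.
move=> t0; have tn : t != 0 by rewrite gt_eqF.
congr ereal_sup; apply/seteqP; split => _ [y _ <-].
  by exists (t^-1 *: (x - y)) => //; rewrite scalerA mulfV// scale1r opprB addrC subrK.
exists (x - t *: y) => //; rewrite (_ : x - (x - t *: y) = t *: y); last by rewrite opprB addrC subrK.
by rewrite /lcscale scalerA mulVf// scale1r.
Qed.

Definition dilsum t x : R := fine (supconv F (lcscale t g) x).

Let term_le t x w : 0 < t -> F (x - t *: w) * g w `^ t <= expR b * expR be `^ t.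
Proof.
move=> t0; apply: ler_pM => //; rewrite ?powR_ge0//.
by apply: ge0_ler_powR => //; rewrite ?nnegrE ?expR_ge0//; exact: ltW.
Qed.

Lemma supconv_fin t x : 0 < t -> supconv F (lcscale t g) x = (dilsum t x)%:E.
Proof.
move=> t0; rewrite /dilsum fineK// supconvE// fin_numE; apply/andP; split.
  rewrite -ltNye; apply: lt_le_trans (ltNyr (F (x - t *: 0) * g 0 `^ t)) _. by apply: ereal_sup_ubound; exists 0.
rewrite -ltey; apply: le_lt_trans (ltry (expR b * expR be `^ t)).
by apply: ge_ereal_sup => _ [w _ <-]; rewrite lee_fin term_le.
Qed.

Lemma dilsum_ge t x w : 0 < t -> F (x - t *: w) * g w `^ t <= dilsum t x.
Proof.
by move=> t0; rewrite -lee_fin -supconv_fin// supconvE//; apply: ereal_sup_ubound; exists w.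
Qed.

Lemma dilsum_le t x a : 0 < t -> (forall w, F (x - t *: w) * g w `^ t <= a) -> dilsum t x <= a.
Proof.
move=> t0 h; rewrite -lee_fin -supconv_fin// supconvE//.
by apply: ge_ereal_sup => _ [w _ <-]; rewrite lee_fin.
Qed.

Lemma dilsum_lt t x a : 0 < t -> a < dilsum t x -> exists w, a < F (x - t *: w) * g w `^ t.
Proof.
move=> t0; rewrite -lte_fin -supconv_fin// supconvE// => /ereal_sup_gt[_ [w _ <-]].
by rewrite lte_fin => h; exists w.
Qed.

Lemma dilsum_ge0 t x : 0 < t -> 0 <= dilsum t x.
Proof. by move=> t0; apply: le_trans (dilsum_ge x 0 t0); rewrite mulr_ge0 ?powR_ge0. Qed.

(** Only w in the compact ball of radius [ell] matter, so that the local estimates near each w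
    combine into one neighbourhood of x. Near a given w the two factors are bounded separately by p
    and q with p q below the target. *)
Lemma usc_dilsum t : 0 < t -> upper_semicontinuous (dilsum t).
Proof.
move=> t0 x al hal; have tn : t != 0 by rewrite gt_eqF.
pose a := (dilsum t x + al) / 2.
have [a1 a2] : dilsum t x < a /\ a < al by rewrite /a; split; lra.
have a0 : 0 < a := le_lt_trans (dilsum_ge0 x t0) a1.
pose B := [set w : 'rV[R]_n | enorm w <= ell].
have cB : compact B := @compact_eball R m ell.
have [_ uF _] := lF.
have loc w : B w -> \forall w' \near w & x' \near x, F (x' - t *: w') * g w' `^ t < a.
  move=> Bw; have h := le_lt_trans (dilsum_ge x w t0) a1.
  have [p [q [pF qg pq p0 q0]]] : exists p q : R, [/\ F (x - t *: w) < p, g w `^ t < q, p * q <= a, 0 < p & 0 < q].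
    pose u := F (x - t *: w); pose v := g w `^ t; have u0 : 0 <= u := F0 _; have v0 : 0 <= v := powR_ge0 _ _.
    pose e := Num.min 1 ((a - u * v) / (u + v + 1)). have d0 : 0 < u + v + 1 by lra.
    have e0 : 0 < e by rewrite lt_min ltr01 divr_gt0// subr_gt0. have e1 : e <= 1 by rewrite ge_min lexx.
    have e2 : e * (u + v + 1) <= a - u * v by rewrite -ler_pdivlMr// ge_min lexx orbT.
    by exists (u + e), (v + e); split; rewrite ?ltrDl//; nra.
  have gq : g w < q `^ t^-1.
    have := @gt0_ltr_powR _ t^-1 _ (g w `^ t) q; rewrite invr_gt0 => /(_ t0); rewrite !nnegrE powR_ge0 (ltW q0) => /(_ isT isT qg).
    by rewrite -powRrM mulfV// powRr1.
  have n1 := ug gq; have /nbhs_enormP[d d0 hd] := uF _ _ pF.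
  have n2 : \forall w' \near w & x' \near x, F (x' - t *: w') < p.
    have d1 : 0 < d / (2 * (t + 1)) by rewrite divr_gt0// mulr_gt0//; lra. have d2 : 0 < d / 2 by rewrite divr_gt0.
    exists ([set w' | enorm (w - w') < d / (2 * (t + 1))], [set x' | enorm (x - x') < d / 2]).
      by split; apply/nbhs_enormP; [exists (d / (2 * (t + 1)))|exists (d / 2)].
    move=> [w' x'] /= [h1 h2]; apply: hd.
    have -> : x - t *: w - (x' - t *: w') = (x - x') - t *: (w - w') by apply/rowP => i; rewrite !mxE; ring.
    apply: le_lt_trans (enormB _ _) _; rewrite enormZ gtr0_norm//.
    have := h1; rewrite ltr_pdivlMr ?mulr_gt0//; last lra. have := enorm_ge0 (w - w'); nra.
  have n1' : \forall w' \near w & x' \near x, g w' < q `^ t^-1.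
    by exists ([set w' | g w' < q `^ t^-1], setT); [split => //; exact: filterT|case=> w' x' [/=]].
  apply: filterS2 n2 n1' => -[w' x'] /= h1 h2.
  apply: lt_le_trans pq; apply: (@le_lt_trans _ _ (F (x' - t *: w') * q)).
    rewrite ler_wpM2l//; have : g w' `^ t <= (q `^ t^-1) `^ t.
      by apply: ge0_ler_powR => //; rewrite ?nnegrE ?powR_ge0//; exact: ltW.
    by rewrite -powRrM mulVf// powRr1// ltW.
  by rewrite ltr_pM2r.
have /compact_near_coveringP/(_ _ (nbhs x) (fun x' w' => F (x' - t *: w') * g w' `^ t < a)) := cB.
move=> /(_ _ loc); apply: filterS => x' hx'; apply: le_lt_trans a2; apply: dilsum_le => // w.
have [gw|gw] := ltP 0 (g w); first by apply: ltW; apply: hx'; exact: gs.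
have -> : g w = 0 by apply/eqP; rewrite eq_le gw gge0.
by rewrite powR0// mulr0 ltW.
Unshelve. all: by end_near. Qed.

Lemma measurable_dilsum t : 0 < t -> measurable_fun setT (dilsum t : bV R n -> R).
Proof. by move=> t0; apply: usc_measurable; exact: usc_dilsum. Qed.

(** Strict inequality makes this an equivalence even where the supremum is not attained: the
    epigraph of the sup-convolution is exactly the dilated epigraph. *)
Lemma dilsum_epigraph t (z : V) : 0 < t -> expR (- z.2) < dilsum t z.1 <-> shifted F (dirs g) t z.
Proof.
move=> t0; have tn : t != 0 by rewrite gt_eqF.
have E w : 0 < g w -> (expR (- z.2) < F (z.1 - t *: w) * g w `^ t) = (expR (- (z.2 - t * - ln (g w))) < F (z.1 - t *: w)).
  move=> gw; have -> : - (z.2 - t * - ln (g w)) = - z.2 - t * ln (g w) by ring.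
  have -> : g w `^ t = expR (t * ln (g w)) by rewrite /powR gt_eqF.
  by rewrite expRD [expR (- (t * _))]expRN ltr_pdivrMr ?expR_gt0.
split.
  move=> /(dilsum_lt t0)[w h]; have [gw|gw] := ltP 0 (g w); last first.
    have e : g w = 0 by apply/eqP; rewrite eq_le gw gge0. by move: h; rewrite e powR0// mulr0 ltNge expR_ge0.
  by exists (w, - ln (g w)); [exists w|move: h; rewrite E].
move=> [_ [w gw <-] h]; apply: lt_le_trans (dilsum_ge z.1 w t0).
by rewrite E.
Qed.

(** Bounds the gauge of (w, - be) for |w| at most [ell]: dividing by [M0] brings w into the ball of
    radius [r0] and [be] below 1, where F >= e. Greater heights cost nothing by [J_up]. In [M] the
    reversed base direction is added. *)
Let M0 := ell / r0 + `|be| + 1.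
Let M := Num.max M0 (J (- (w0, - ln (g w0)))).

Let DM d : dirs g d -> J d <= M.
Proof.
move=> [w gw <-]; rewrite le_max; apply/orP; left.
have l0 : 0 < M0 by rewrite /M0 ltr_wpDl// addr_ge0// divr_ge0 ?(ltW r00)//; exact: le_trans (enorm_ge0 w) (gs gw).
have lb : ln (g w) <= be by rewrite -[leRHS]expRK ler_ln ?posrE ?expR_gt0.
have -> : ((w, - ln (g w)) : V) = (w, - be) + (0, be - ln (g w)).
  by apply: injective_projections => /=; rewrite ?addr0//; ring.
apply: le_trans (JD' _ _) _; rewrite (J_up r00 F2) ?subr_ge0// addr0.
apply: (gauge_le l0); rewrite /epigraph /=; apply: (@lt_le_trans _ _ (expR 1)).
  rewrite ltr_expR -[M0^-1 *: - be]/(M0^-1 * - be) mulrN opprK mulrC ltr_pdivrMr// mul1r /M0.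
  have := ler_norm be; have : 0 <= ell / r0 by rewrite divr_ge0 ?(ltW r00)//; exact: le_trans (enorm_ge0 w) (gs gw).
  lra.
apply: F2; rewrite enormZ gtr0_norm ?invr_gt0// mulrC ler_pdivrMr//.
apply: (le_trans (gs gw)); rewrite /M0 -ler_pdivrMl// mulrC.
have := normr_ge0 be; lra.
Qed.

Let Dd0 : dirs g (w0, - ln (g w0)). Proof. by exists w0. Qed.
Let d0M : J (- (w0, - ln (g w0))) <= M. Proof. by rewrite le_max lexx orbT. Qed.

Let one : 'rV[R]_n -> R := fun=> 1.
Let cone : continuous one. Proof. exact: cst_continuous. Qed.
Let one01 x : 0 <= one x <= 1. Proof. by rewrite /one ler01 lexx. Qed.

Local Open Scope ereal_scope.

Let mFt t : (0 < t)%R -> measurable_fun setT (dilsum t : bV R n -> R). Proof. exact: measurable_dilsum. Qed.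
Let Ft0 t x : (0 < t)%R -> (0 <= dilsum t x)%R. Proof. exact: dilsum_ge0. Qed.
Let FtE t z : (0 < t)%R -> (expR (- z.2) < dilsum t z.1)%R <-> shifted F (dirs g) t z.
exact: dilsum_epigraph. Qed.

Lemma dilsum_fin : exists2 t0 : R, (0 < t0)%R & forall t, (0 < t < t0)%R -> \int[@lam R n]_x (dilsum t x)%:E \is a fin_num.
Proof.
have M1 : (0 < `|M| + 1)%R by rewrite ltr_wpDl.
exists (2^-1 / (`|M| + 1))%R; first by rewrite divr_gt0.
move=> t /andP[t0 t1].
have tM : (t * M <= 2^-1)%R.
  move: t1; rewrite ltr_pdivlMr// => h; apply: le_trans (ltW h); rewrite ler_pM2l//.
  by apply: le_trans (ler_norm _) _; rewrite lerDl.
have := machine_fin Cconv (tame_meas tF) F0 r00 F2 FB (tame_int tF) cone one01 DM Dd0 d0M mFt Ft0 FtE t0 tM.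
by congr (_ \is a _); apply: eq_integral => x _; rewrite /one mul1r.
Qed.

Local Notation pmu h := (\int[@lam R n]_(x in grad_dom F) (h (supp_fun g (grad_neglog F x)) * (F x)%:E)).
Local Notation pnu h := (\int[@hm R n m]_(x in gauss_dom K) (h (supp_fun_set (supp g) (gauss K x)) * (F x)%:E)).
Local Notation ps := (fun x : \bar R => maxe x 0).
Local Notation ng := (fun x : \bar R => maxe (- x) 0).

Lemma compact_first_variation :
  [/\ ((fine (\int[@lam R n]_x (dilsum t x)%:E) - fine (\int[@lam R n]_x (F x)%:E)) / t)%R @[t --> 0^'+] -->
      fine (pmu ps + pnu ps - (pmu ng + pnu ng)),
    pmu ps + pnu ps \is a fin_num & pmu ng + pnu ng \is a fin_num].
Proof.
have mA := measurable_ray_shell tF.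
have ii := ray_deriv_integrable Cconv (tame_meas tF) F0 r00 F2 FB (tame_int tF) cone one01 DM Dd0 d0M mFt FtE.
have mrd : measurable_fun (ray_shell F) (fun z => ray_deriv F one (dirs g) z : R).
  by apply/measurable_EFinP; case/integrableP: ii.
have P h (mh : measurable_fun setT h) h0 h00 hZ := @ray_parts R m F g r0 b M w0 lF tF DM gw0 h mh h0 h00 hZ mrd.
have Pp : \int[lamR R n]_(z in ray_shell F) ps (ray_deriv F one (dirs g) z)%:E = pmu ps + pnu ps.
  have h1 : measurable_fun setT (ps : \bar R -> \bar R) by exact: measurable_maxe.
  have h2 (x : \bar R) : 0 <= ps x by rewrite le_max lexx orbT. have h3 : ps (0 : \bar R) = 0 by rewrite maxxx.
  have h4 (k : R) (x : \bar R) : (0 < k)%R -> ps (k%:E * x) = k%:E * ps x by move=> k0; rewrite maxe_pMr ?mule0 ?lee_fin ?(ltW k0).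
  exact: (P _ h1 h2 h3 h4).
have Pn : \int[lamR R n]_(z in ray_shell F) ng (ray_deriv F one (dirs g) z)%:E = pmu ng + pnu ng.
  have h1 : measurable_fun setT (ng : \bar R -> \bar R).
    by apply: measurable_maxe => //; exact: measurable_oppe.
  have h2 (x : \bar R) : 0 <= ng x by rewrite le_max lexx orbT. have h3 : ng (0 : \bar R) = 0 by rewrite oppe0 maxxx.
  have h4 (k : R) (x : \bar R) : (0 < k)%R -> ng (k%:E * x) = k%:E * ng x by move=> k0; rewrite -muleN maxe_pMr ?mule0 ?lee_fin ?(ltW k0).
  exact: (P _ h1 h2 h3 h4).
have fp : pmu ps + pnu ps \is a fin_num.
  have := integrable_fin_num mA (integrable_funepos mA ii); rewrite -Pp; congr (_ \is a _).
  by apply: eq_integral => z _; rewrite funeposE.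
have fn : pmu ng + pnu ng \is a fin_num.
  have := integrable_fin_num mA (integrable_funeneg mA ii); rewrite -Pn; congr (_ \is a _).
  by apply: eq_integral => z _; rewrite funenegE.
split => //.
have E : \int[lamR R n]_(z in ray_shell F) (ray_deriv F one (dirs g) z)%:E = pmu ps + pnu ps - (pmu ng + pnu ng).
  rewrite integralE -Pp -Pn; congr (_ - _); apply: eq_integral => z _; [exact: funeposE|exact: funenegE].
have := machine_cvg Cconv (tame_meas tF) F0 r00 F2 FB (tame_int tF) cone one01 DM Dd0 d0M mFt Ft0 FtE.
rewrite E; have oneE (h : 'rV[R]_n -> R) : \int[@lam R n]_x (one x * h x)%:E = \int[@lam R n]_x (h x)%:E.
  by apply: eq_integral => x _; rewrite /one mul1r.
by rewrite oneE; under eq_cvg do rewrite oneE.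
Qed.

End bounded_g.

(** * Log-concavity in t and the uniform growth bound *)

Section truncation.
Variables (R : realType) (n : nat).

(** Prekopa-Leindler was proved for functions supported in a cube; cutting to cubes preserves
    log-concavity and exhausts the integral. *)
Definition box_cut (N : nat) (h : 'rV[R]_n -> R) (x : 'rV[R]_n) : R := if x \in kbox N then h x else 0.

Lemma kbox_conv N (x y : 'rV[R]_n) (l : R) : 0 <= l <= 1 -> kbox N x -> kbox N y -> kbox N ((1 - l) *: x + l *: y).
Proof.
move=> /andP[l0 l1] kx ky i; have := kx i; have := ky i; rewrite !mxE => /andP[a1 a2] /andP[c1 c2].
have l1' : 0 <= 1 - l by lra.
have h1 := ler_wpM2l l1' c1; have h2 := ler_wpM2l l0 a1.
have [l00|lp] := eqVneq l 0; first by rewrite l00; apply/andP; split; lra.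
have lp' : 0 < l by rewrite lt0r lp.
have h3 : l * y ord0 i < l * N%:R by rewrite ltr_pM2l.
have h4 := ler_wpM2l l1' (ltW c2).
by apply/andP; split; lra.
Qed.

Lemma logconcave_open (h : 'rV[R]_n -> R) : (forall x, 0 <= h x) ->
  (forall x y l, 0 < l < 1 -> h x `^ (1 - l) * h y `^ l <= h ((1 - l) *: x + l *: y)) -> logconcave h.
Proof.
move=> h0 H x y l /andP[l0 l1].
have [->|ln0] := eqVneq l 0; first by rewrite subr0 powRr1// powRr0 mulr1 scale1r scale0r addr0.
have [->|ln1] := eqVneq l 1; first by rewrite subrr powRr0 mul1r powRr1// scale1r scale0r add0r.
by apply: H; rewrite lt0r ln0 l0 lt_neqAle ln1.
Qed.

Lemma box_cut_logconcave N (h : 'rV[R]_n -> R) : (forall x, 0 <= h x) -> logconcave h -> logconcave (box_cut N h).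
Proof.
move=> h0 lh.
have b0 z : 0 <= box_cut N h z by rewrite /box_cut; case: ifP.
apply: logconcave_open => // x y l /andP[l0 l1].
have ln0 : l != 0 by rewrite gt_eqF.
have p0 : 1 - l != 0 by rewrite subr_eq0 gt_eqF.
have l01 : 0 <= l <= 1 by rewrite !ltW.
rewrite /box_cut; have [kx|kx] := boolP (x \in kbox N); last by rewrite powR0// mul0r; case: ifP.
have [ky|ky] := boolP (y \in kbox N); last by rewrite powR0// mulr0; case: ifP.
by rewrite mem_set; [exact: lh|apply: kbox_conv => //; exact/set_mem].
Qed.

Lemma measurable_box_cut N (h : 'rV[R]_n -> R) : measurable_fun setT (h : bV R n -> R) ->
  measurable_fun setT (box_cut N h : bV R n -> R).
Proof.
move=> mh; have -> : (box_cut N h : bV R n -> R) = (h : bV R n -> R) \_ (kbox N).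
  by apply/funext => x; rewrite patchE.
apply/measurable_restrict => //; first exact: measurable_hbox.
exact: measurable_funTS.
Qed.

Local Open Scope ereal_scope.

Lemma box_cut_fin N (h : 'rV[R]_n -> R) (B : R) : measurable_fun setT (h : bV R n -> R) ->
  (forall x, (0 <= h x <= B)%R) -> \int[@lam R n]_x (box_cut N h x)%:E \is a fin_num.
Proof.
move=> mh hB; rewrite ge0_fin_numE; last by apply: integral_ge0 => x _; rewrite lee_fin /box_cut; case: ifP => // _; case/andP: (hB x).
have mk : measurable (kbox N : set (bV R n)) by exact: measurable_hbox.
apply: (@le_lt_trans _ _ (\int[@lam R n]_(x in kbox N) B%:E)).
  rewrite [leRHS]integral_mkcond; apply: ge0_le_integral => //.
  - by move=> x _; rewrite lee_fin /box_cut; case: ifP => // _; case/andP: (hB x).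
  - by apply/measurable_EFinP; exact: measurable_box_cut.
  - by apply/measurable_restrict => //; exact: measurable_cst.
  - by move=> x _; rewrite patchE /box_cut; case: ifP => // _; rewrite lee_fin; case/andP: (hB x).
rewrite integral_cst// lte_mul_pinfty ?lee_fin//; last exact: lam_kbox_lty.
by have /andP[h1 h2] := hB 0%R; exact: le_trans h1 h2.
Qed.

Lemma box_cut_cvg (h : 'rV[R]_n -> R) : measurable_fun setT (h : bV R n -> R) -> (forall x, (0 <= h x)%R) ->
  \int[@lam R n]_x (box_cut N h x)%:E @[N --> \oo] --> \int[@lam R n]_x (h x)%:E.
Proof.
move=> mh h0.
have sub (N N' : nat) : (N <= N')%N -> (kbox N : set 'rV[R]_n) `<=` kbox N'.
  move=> NN x kx i; have := kx i; rewrite !mxE => /andP[a1 a2]. have : (N%:R <= N'%:R :> R)%R by rewrite ler_nat.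
  by move=> ?; apply/andP; split; lra.
have -> : \int[@lam R n]_x (h x)%:E = \int[@lam R n]_x limn (fun N => (box_cut N h x)%:E).
  apply: eq_integral => x _; apply/esym; apply/cvg_lim => //; apply: cvg_near_cst.
  have [N hN] : exists N : nat, (enorm x < N%:R)%R by exists (Num.truncn (enorm x)).+1; exact: truncnS_gt.
  exists N => // N' /= NN; rewrite /box_cut mem_set//; apply: (sub _ _ NN) => i.
  have := coord_enorm x i; rewrite !mxE ler_norml => /andP[c1 c2]. by apply/andP; split; lra.
apply: cvg_monotone_convergence => //.
- by move=> N; apply/measurable_EFinP; exact: measurable_box_cut.
- by move=> N x _; rewrite lee_fin /box_cut; case: ifP.
move=> x _ N N' NN; rewrite lee_fin /box_cut; case: ifPn => [/set_mem kx|_]; last by case: ifP.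
by rewrite mem_set//; exact: sub kx.
Qed.

End truncation.

(** A multiplicative inequality tested on strict epigraphs, which is the form in which convex
    combinations of epigraph points deliver it; a vanishing factor makes the left side 0. *)
Lemma powR_epigraph (R : realType) (p q r l : R) : 0 <= p -> 0 <= q -> 0 <= r -> 0 < l < 1 ->
  (forall s1 s2, expR (- s1) < p -> expR (- s2) < q -> expR (- ((1 - l) * s1 + l * s2)) < r) ->
  p `^ (1 - l) * q `^ l <= r.
Proof.
move=> p0 q0 r0 /andP[l0 l1] h.
have [pz|pp] := eqVneq p 0; first by rewrite pz powR0 ?mul0r// gt_eqF// subr_gt0.
have [qz|qp] := eqVneq q 0; first by rewrite qz powR0 ?mulr0// gt_eqF.
have p1 : 0 < p by rewrite lt0r pp.
have q1 : 0 < q by rewrite lt0r qp.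
rewrite leNgt; apply/negP => hr.
have E : p `^ (1 - l) * q `^ l = expR ((1 - l) * ln p + l * ln q) by rewrite /powR !gt_eqF// -expRD.
have e (c : R) : 0 < c -> expR ((1 - l) * ln p + l * ln q - c) < r.
  move=> c0; have := h (- ln p + c) (- ln q + c); rewrite !opprD !opprK.
  have a1 : expR (ln p - c) < p by rewrite -[ltRHS](lnK (p1 : p \is Num.pos)) ltr_expR gtrBl.
  have a2 : expR (ln q - c) < q by rewrite -[ltRHS](lnK (q1 : q \is Num.pos)) ltr_expR gtrBl.
  move=> /(_ a1 a2); congr (expR _ < _); ring.
have rp : 0 < r by apply: lt_trans (e 1 ltr01); exact: expR_gt0.
have lr : ln r < (1 - l) * ln p + l * ln q by rewrite -ltr_expR lnK// -E.
have := e ((1 - l) * ln p + l * ln q - ln r); rewrite subr_gt0 => /(_ lr).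
by rewrite opprB addrC subrK lnK// ltxx.
Qed.

Fact half_sq (R : realType) (u v w p : R) : 0 <= u -> 0 <= v ->
  u `^ (1 - 2^-1) * v `^ 2^-1 <= w -> w <= p -> u * v <= p ^+ 2.
Proof.
move=> u0 v0 uw wp; have i2 : 1 - 2^-1 = 2^-1 :> R by field.
have h0 : 0 <= u `^ (1 - 2^-1) * v `^ 2^-1 by rewrite mulr_ge0 ?powR_ge0.
have -> : u * v = (u `^ (1 - 2^-1) * v `^ 2^-1) ^+ 2 by rewrite i2 !powR12_sqrt// exprMn !sqr_sqrtr.
have hp := le_trans uw wp.
by rewrite lerXn2r// nnegrE; exact: le_trans h0 hp.
Qed.

Fact fineM_le (R : realDomainType) (x y : \bar R) (c : R) : x \is a fin_num -> y \is a fin_num -> (x * y <= c%:E)%E -> fine x * fine y <= c.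
Proof. by case: x => // x _; case: y. Qed.

(** Iterated halving gives Phi(t) / I <= (Phi(t / 2^N) / I)^(2^N), and for large N the inner ratio
    is governed by the derivative at 0. The resulting bound holds for all t and depends on Phi
    through that derivative only, so it passes to the limit along truncations of g. *)
Lemma doubling_growth (R : realType) (Phi : R -> R) (I de : R) : 0 < I -> (forall u, 0 < u -> 0 <= Phi u) ->
  (forall u, 0 < u -> I * Phi u <= Phi (u / 2) ^+ 2) -> ((Phi t - I) / t) @[t --> (0 : R)^'+] --> de ->
  forall t, 0 < t -> Phi t <= I * expR (t * de / I).
Proof.
move=> I0 P0 dbl cde t t0.
have dbl' u : 0 < u -> Phi u / I <= (Phi (u / 2) / I) ^+ 2.
  move=> u0; rewrite ler_pdivrMr// expr_div_n mulrAC ler_pdivlMr ?exprn_gt0//.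
  by rewrite expr2 mulrA ler_pM2r// mulrC dbl.
have iter N : forall u, 0 < u -> Phi u / I <= (Phi (u / 2 ^+ N) / I) ^+ (2 ^ N).
  elim: N => [|N IH] u u0; first by rewrite expr0 divr1 expr1. have u2 : 0 < u / 2 by rewrite divr_gt0.
  apply: le_trans (dbl' _ u0) _; rewrite [(2 ^ N.+1)%N]expnSr exprM.
  have := IH _ u2; rewrite -mulrA -invfM -exprS => hI.
  by rewrite lerXn2r// nnegrE ?exprn_ge0 ?divr_ge0 ?P0 ?(ltW I0)// divr_gt0// exprn_gt0.
rewrite leNgt; apply/negP => hlt.
have Pt : (0 < Phi t) by apply: lt_trans hlt; rewrite mulr_gt0 ?expR_gt0.
pose y := ln (Phi t / I).
have yE : expR y = (Phi t / I) by rewrite lnK// posrE divr_gt0.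
have hy : (t * de / I < y) by rewrite -ltr_expR yE ltr_pdivlMr// mulrC.
(* Half the gap between the growth rate assumed for contradiction and the derivative at 0. *)
pose e := ((y * I / t - de) / 2).
have e0 : (0 < e).
  by rewrite divr_gt0// subr_gt0 ltr_pdivlMr// mulrC -ltr_pdivrMr.
move/cvgrPdist_le : cde => /(_ e e0) [d /= d0 hd].
have [N hN] : exists N : nat, (t / 2 ^+ N < d).
  exists (Num.truncn (t / d)).+1; rewrite ltr_pdivrMr ?exprn_gt0// mulrC -ltr_pdivrMr//.
  apply: lt_trans (truncnS_gt _) _; rewrite -natrX ltr_nat; exact: ltn_expl.
pose s := (t / 2 ^+ N); have s0 : (0 < s) by rewrite divr_gt0// exprn_gt0.
have := hd s; rewrite /ball_ /= sub0r normrN gtr0_norm// => /(_ hN s0).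
rewrite ler_norml => /andP[hs _].
have hs' : (Phi s / I <= expR (s * (de + e) / I)).
  apply: le_trans (expR_ge1Dx _); rewrite ler_pdivrMr// mulrDl mul1r divfK ?gt_eqF//.
  rewrite -lerBlDl mulrC -ler_pdivrMr//; lra.
have := iter N t t0; rewrite -/s => hi.
have : (Phi t / I <= expR (t * (de + e) / I)).
  apply: (le_trans hi); apply: (@le_trans _ _ (expR (s * (de + e) / I) ^+ (2 ^ N))).
    by rewrite lerXn2r// nnegrE ?expR_ge0// divr_ge0 ?P0 ?(ltW I0).
  rewrite -expRM_natl natrX /s le_eqVlt; apply/orP; left; apply/eqP; congr expR. by field; rewrite gt_eqF// expf_neq0.
rewrite -yE ler_expR leNgt => /negP; apply.
rewrite ltr_pdivrMr// mulrC -ltr_pdivlMr//.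
have : (e = (y * I / t - de) / 2) by [].
lra.
Qed.

Section growth.
Variables (R : realType) (m : nat).
Local Notation n := m.+1.
Local Notation V := ('rV[R]_n * R)%type.
Variables (F g : 'rV[R]_n -> R) (r0 b be ell : R) (w0 : 'rV[R]_n).
Hypotheses (lF : LC F) (tF : tame F r0 b).
Hypotheses (ug : upper_semicontinuous g) (gge0 : forall w, 0 <= g w) (gB : forall w, g w <= expR be).
Hypotheses (gs : forall w, 0 < g w -> enorm w <= ell) (gw0 : 0 < g w0).
Hypothesis gconv : forall w w' (l : R), 0 < l < 1 -> 0 < g w -> 0 < g w' ->
  0 < g ((1 - l) *: w + l *: w') /\ (1 - l) * ln (g w) + l * ln (g w') <= ln (g ((1 - l) *: w + l *: w')).
Let Cconv := tame_conv tF.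
Let F0 := tame_ge0 tF.
Let FB := tame_ub tF.
Local Notation C := (epigraph F).
Local Notation S := (dilsum F g).
Let SE t (z : V) (t0 : 0 < t) : expR (- z.2) < S t z.1 <-> shifted F (dirs g) t z :=
  dilsum_epigraph tF gge0 gB z t0.
Let S0 t x (t0 : 0 < t) : 0 <= S t x := dilsum_ge0 tF gge0 gB x t0.

Lemma dilsum_logconcave t : 0 < t -> logconcave (S t).
Proof.
move=> t0; apply: logconcave_open => [x|x y l l01']; first exact: S0.
have l01 : 0 <= l <= 1 by case/andP: l01' => ? ?; rewrite !ltW.
apply: (powR_epigraph (S0 x t0) (S0 y t0) (S0 _ t0) l01') => s1 s2 h1 h2.
have /(SE (x, s1) t0)[_ [w1 gw1 <-] c1] := h1; have /(SE (y, s2) t0)[_ [w2 gw2 <-] c2] := h2.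
have [gw le] := gconv l01' gw1 gw2.
apply/(SE ((1 - l) *: x + l *: y, (1 - l) * s1 + l * s2) t0).
exists ((1 - l) *: w1 + l *: w2, - ln (g ((1 - l) *: w1 + l *: w2))); first by eexists; [exact: gw|].
have cc := Cconv l01 c1 c2.
set G := ln (g ((1 - l) *: w1 + l *: w2)) in le *.
have {cc} : expR (- ((1 - l) * (s1 - t * - ln (g w1)) + l * (s2 - t * - ln (g w2)))) <
   F ((1 - l) *: (x - t *: w1) + l *: (y - t *: w2)) := cc.
have -> : (1 - l) *: (x - t *: w1) + l *: (y - t *: w2) = (1 - l) *: x + l *: y - t *: ((1 - l) *: w1 + l *: w2).
  by apply/rowP => i; rewrite !mxE; ring.
move=> cc; change (expR (- ((1 - l) * s1 + l * s2 - t * - G)) < F ((1 - l) *: x + l *: y - t *: ((1 - l) *: w1 + l *: w2))).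
apply: le_lt_trans cc; rewrite ler_expR.
have -> : - ((1 - l) * (s1 - t * - ln (g w1)) + l * (s2 - t * - ln (g w2))) =
  - ((1 - l) * s1 + l * s2) - t * ((1 - l) * ln (g w1) + l * ln (g w2)) by ring.
by rewrite opprD mulrN opprK lerD2l lerN2 ler_pM2l.
Qed.

(** The midpoint of a point of the epigraph of F and one of its dilate by t lies in the dilate by t
    / 2, with the same direction d. *)
Lemma dilsum_half t x y : 0 < t -> F x `^ (1 - 2^-1) * S t y `^ 2^-1 <= S (t / 2) ((1 - 2^-1) *: x + 2^-1 *: y).
Proof.
move=> t0; have t2 : 0 < t / 2 by rewrite divr_gt0.
have l01 : 0 < (2^-1 : R) < 1 by apply/andP; split; lra.
have l01' : 0 <= (2^-1 : R) <= 1 by apply/andP; split; lra.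
apply: (powR_epigraph (F0 x) (S0 y t0) (S0 _ t2) l01) => s1 s2 h1 h2.
have /(SE (y, s2) t0)[d dd c2] := h2.
apply/(SE ((1 - 2^-1) *: x + 2^-1 *: y, (1 - 2^-1) * s1 + 2^-1 * s2) t2); exists d => //.
have := Cconv l01' (h1 : C (x, s1)) c2; congr C.
apply: injective_projections => /=; last by rewrite -![_ *: (_ : R)]/(_ * _); field.
by apply/rowP => i; rewrite !mxE; field.
Qed.

Local Open Scope ereal_scope.
Local Notation I := (fine (\int[@lam R n]_x (F x)%:E)).
Local Notation Phi t := (fine (\int[@lam R n]_x (S t x)%:E)).
Hypothesis Fpos : 0 < \int[@lam R n]_x (F x)%:E.

Let Ffin : \int[@lam R n]_x (F x)%:E \is a fin_num.
by rewrite ge0_fin_numE ?(tame_int tF)// ltW. Qed.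

Let mS t (t0 : (0 < t)%R) : measurable_fun setT (S t : bV R n -> R) := measurable_dilsum lF tF ug gge0 gB gs t0.

(** Prekopa-Leindler at 1/2 between F and the sup-convolutions at t and t / 2, on growing cubes. The
    integral at t is not assumed finite, so the limit is taken in the extended reals. *)
Lemma dilsum_doubling t : (0 < t)%R -> \int[@lam R n]_x (S (t / 2) x)%:E \is a fin_num ->
  \int[@lam R n]_x (F x)%:E * \int[@lam R n]_x (S t x)%:E <= (Phi (t / 2) ^+ 2)%:E.
Proof.
move=> t0 fin2; have t2 : (0 < t / 2)%R by rewrite divr_gt0.
pose B (u : R) := (expR b * expR be `^ u)%R.
have SB u x : (0 < u)%R -> (S u x <= B u)%R.
  move=> u0; apply: (dilsum_le tF gge0 gB u0) => w; apply: ler_pM => //; rewrite ?powR_ge0//.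
  by apply: ge0_ler_powR => //; rewrite ?nnegrE ?expR_ge0//; exact: ltW.
have c1 := box_cut_cvg (tame_meas tF) F0; have c2 := box_cut_cvg (mS t0) (fun x => S0 x t0).
have S2 x := S0 x t2.
have c3 : \int[@lam R n]_x (box_cut N F x)%:E * \int[@lam R n]_x (box_cut N (S t) x)%:E @[N --> \oo] -->
    \int[@lam R n]_x (F x)%:E * \int[@lam R n]_x (S t x)%:E.
  have md (x y : \bar R) : 0 < x -> x \is a fin_num -> x *? y.
    by case: x => // x x0 _; case: y => //=; rewrite gt_eqF.
  by apply: cvgeM => //; exact: md.
rewrite -(cvg_lim _ c3)//; apply: lime_le; first by apply/cvg_ex; eexists; exact: c3.
apply: nearW => N.
pose BB := Num.max (expR b) (Num.max (B t) (B (t / 2)%R)).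
have pk (h : 'rV[R]_n -> R) : measurable_fun setT (h : bV R n -> R) -> (forall x, (0 <= h x <= BB)%R) -> plok (box_cut N h) BB N.
  move=> mh hB; split; first exact: measurable_box_cut.
    by move=> x; rewrite /box_cut; case: ifP => // _; rewrite lexx/=; case/andP: (hB x); exact: le_trans.
  by move=> x; rewrite /box_cut; case: ifPn => [/set_mem//|_]; rewrite eqxx.
have B1 x : (0 <= F x <= BB)%R by rewrite F0/= le_max FB.
have B2 x : (0 <= S t x <= BB)%R by rewrite S0//= !le_max SB// orbT.
have B3 x : (0 <= S (t / 2) x <= BB)%R by rewrite S2/= !le_max SB// !orbT.
have l01 : (0 < (2^-1 : R) < 1)%R by apply/andP; split; lra.
have lcF : logconcave F by case: lF.
have := prekopa_leindler l01 (pk _ (tame_meas tF) B1) (pk _ (mS t0) B2) (pk _ (mS t2) B3)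
  (@box_cut_logconcave _ _ N _ F0 lcF) (@box_cut_logconcave _ _ N _ (fun x => S0 x t0) (dilsum_logconcave t0)).
have hh x y : (box_cut N F x `^ (1 - 2^-1) * box_cut N (S t) y `^ 2^-1 <= box_cut N (S (t / 2)) ((1 - 2^-1) *: x + 2^-1 *: y))%R.
  have i2 : (1 - 2^-1 = 2^-1 :> R)%R by field. have n2 : (2^-1 : R)%R != 0%R by [].
  rewrite /box_cut; have [kx|kx] := boolP (x \in kbox N); last by rewrite powR0 ?i2// mul0r; case: ifP.
  have [ky|ky] := boolP (y \in kbox N); last by rewrite powR0// mulr0; case: ifP.
  have l01' : (0 <= (2^-1 : R) <= 1)%R by apply/andP; split; lra.
  by rewrite mem_set; [exact: dilsum_half|apply: kbox_conv => //; exact/set_mem].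
move=> /(_ hh) pl.
have f1 := box_cut_fin N (tame_meas tF) B1; have f2 := box_cut_fin N (mS t0) B2; have f3 := box_cut_fin N (mS t2) B3.
rewrite -(fineK f1) -(fineK f2) -EFinM lee_fin.
have b0 (h : 'rV[R]_n -> R) : (forall x, (0 <= h x <= BB)%R) -> 0 <= \int[@lam R n]_x (box_cut N h x)%:E.
  by move=> hB; apply: integral_ge0 => x _; rewrite lee_fin /box_cut; case: ifP => // _; case/andP: (hB x).
have wP : (fine (\int[@lam R n]_x (box_cut N (S (t / 2)) x)%:E) <= Phi (t / 2))%R.
  apply: fine_le => //; apply: ge0_le_integral => //.
  - by move=> x _; rewrite lee_fin /box_cut; case: ifP.
  - by apply/measurable_EFinP; apply: measurable_box_cut; exact: mS.
  - by apply/measurable_EFinP; exact: mS.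
  - by move=> x _; rewrite lee_fin /box_cut; case: ifP.
exact: (half_sq (fine_ge0 (b0 _ B1)) (fine_ge0 (b0 _ B2)) pl wP).
Qed.

Let I0 : (0 < I)%R. Proof. by rewrite -lte_fin fineK. Qed.

(** Finiteness is known for small t; since the integral of F is positive, the doubling inequality
    carries it from t / 2 to t. *)
Lemma dilsum_all_fin t : (0 < t)%R -> \int[@lam R n]_x (S t x)%:E \is a fin_num.
Proof.
have [t1 t10 h] := dilsum_fin lF tF ug gge0 gB gs gw0.
have ind N : forall t, (0 < t < t1 * 2 ^+ N)%R -> \int[@lam R n]_x (S t x)%:E \is a fin_num.
  elim: N => [|N IH] u /andP[u0 u1]; first by apply: h; rewrite u0/= -[ltRHS]mulr1 -(expr0 2).
  have fu : \int[@lam R n]_x (S (u / 2) x)%:E \is a fin_num.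
    apply: IH; rewrite divr_gt0//= ltr_pdivrMr// -mulrA -exprSr//.
  have := dilsum_doubling u0 fu; rewrite -(fineK Ffin) => hd.
  have S0' : 0 <= \int[@lam R n]_x (S u x)%:E by apply: integral_ge0 => x _; rewrite lee_fin S0.
  rewrite ge0_fin_numE// ltNge leye_eq; apply/negP => /eqP e. by move: hd; rewrite e mulry gtr0_sg// mul1e leye_eq.
move=> t0; pose N := Num.truncn (t / t1).
apply: (ind N.+1); rewrite t0/= mulrC -ltr_pdivrMr//.
apply: lt_trans (truncnS_gt _) _; rewrite -/N -natrX ltr_nat; exact: ltn_expl.
Qed.

Lemma dilsum_growth de : ((Phi t - I) / t)%R @[t --> (0 : R)^'+] --> de ->
  forall t, (0 < t)%R -> (Phi t <= I * expR (t * de / I))%R.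
Proof.
have P0 u : (0 < u)%R -> (0 <= Phi u)%R.
  by move=> u0; apply: fine_ge0; apply: integral_ge0 => x _; rewrite lee_fin S0.
have D u : (0 < u)%R -> (I * Phi u <= Phi (u / 2) ^+ 2)%R.
  move=> u0; have u2 : (0 < u / 2)%R by rewrite divr_gt0.
  exact: (fineM_le Ffin (dilsum_all_fin u0) (dilsum_doubling u0 (dilsum_all_fin u2))).
move=> h; exact: (@doubling_growth R (fun t => Phi t) I de I0 P0 D h).
Qed.

End growth.

(** * Exhausting a general g by truncations *)

Section limits_of_parts.
Variable R : realType.
Local Open Scope ereal_scope.
Implicit Types (u : nat -> \bar R) (l : \bar R).

Lemma nondecreasing_pos_cvg u l : {homo u : p q / (p <= q)%N >-> p <= q} -> u k @[k --> \oo] --> l ->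
  maxe (u k) 0 @[k --> \oo] --> maxe l 0.
Proof.
move=> ndu ul; have lE : l = ereal_sup (range u) by apply: (cvg_unique _ ul) => //; exact: ereal_nondecreasing_cvgn.
have nd : {homo (fun k => maxe (u k) 0) : p q / (p <= q)%N >-> p <= q}.
  by move=> p q pq; rewrite ge_max !le_max ndu// lexx orbT.
have := ereal_nondecreasing_cvgn nd; congr (_ --> _); apply/eqP; rewrite eq_le; apply/andP; split.
  apply: ge_ereal_sup => _ [k _ <-]; rewrite ge_max !le_max lexx orbT andbT; apply/orP; left.
  by rewrite lE; apply: ereal_sup_ubound; exists k.
rewrite ge_max; apply/andP; split.
  rewrite lE; apply: ge_ereal_sup => _ [k _ <-]; apply: (@le_trans _ _ (maxe (u k) 0)); first by rewrite le_max lexx.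
  by apply: ereal_sup_ubound; exists k.
apply: (@le_trans _ _ (maxe (u 0%N) 0)); first by rewrite le_max lexx orbT.
by apply: ereal_sup_ubound; exists 0%N.
Qed.

Lemma nondecreasing_neg_cvg u l : {homo u : p q / (p <= q)%N >-> p <= q} -> u k @[k --> \oo] --> l ->
  maxe (- u k) 0 @[k --> \oo] --> maxe (- l) 0.
Proof.
move=> ndu ul; have lE : l = ereal_sup (range u) by apply: (cvg_unique _ ul) => //; exact: ereal_nondecreasing_cvgn.
have ni : {homo (fun k => maxe (- u k) 0) : p q / (p <= q)%N >-> q <= p}.
  by move=> p q pq; rewrite ge_max !le_max leeN2 ndu// lexx orbT.
have := ereal_nonincreasing_cvgn ni; congr (_ --> _); apply/eqP; rewrite eq_le; apply/andP; split.
  rewrite leNgt; apply/negP; set c := ereal_inf _ => hc.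
  have c0 : 0 < c by apply: le_lt_trans hc; rewrite le_max lexx orbT. have : l <= - c.
    rewrite lE; apply: ge_ereal_sup => _ [k _ <-]; rewrite leeNr.
    have : c <= maxe (- u k) 0 by apply: ereal_inf_lbound; exists k. by rewrite le_max => /orP[//|]; rewrite leNgt c0.
  rewrite leeNr => h; move: hc; rewrite ltNge => /negP; apply. by rewrite le_max h.
apply: le_ereal_inf_tmp => _ [k _ <-]; rewrite ge_max !le_max lexx orbT andbT leeN2; apply/orP; left.
by rewrite lE; apply: ereal_sup_ubound; exists k.
Qed.

(** The functions increase with k: positive parts converge by monotone convergence, possibly to +oo,
    and negative parts by dominated convergence, the one of index 0 being the integrable
    majorant. *)
Lemma parts_limit d (T : measurableType d) (mu : {measure set T -> \bar R}) (D : set T)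
  (hs : nat -> T -> \bar R) (h : T -> \bar R) (f : T -> R) :
  measurable D -> (forall k, measurable_fun D (hs k)) -> measurable_fun D f -> (forall x, (0 <= f x)%R) ->
  (forall x, {homo hs^~ x : p q / (p <= q)%N >-> p <= q}) -> (forall x, hs k x @[k --> \oo] --> h x) ->
  \int[mu]_(x in D) (maxe (- hs 0%N x) 0 * (f x)%:E) \is a fin_num ->
  [/\ \int[mu]_(x in D) (maxe (hs k x) 0 * (f x)%:E) @[k --> \oo] --> \int[mu]_(x in D) (maxe (h x) 0 * (f x)%:E),
      \int[mu]_(x in D) (maxe (- hs k x) 0 * (f x)%:E) @[k --> \oo] --> \int[mu]_(x in D) (maxe (- h x) 0 * (f x)%:E) &
      \int[mu]_(x in D) (maxe (- h x) 0 * (f x)%:E) \is a fin_num].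
Proof.
move=> mD mh mf f0 nd cv fin0.
have ge0 (y : \bar R) x : 0 <= maxe y 0 * (f x)%:E by rewrite mule_ge0 ?lee_fin// le_max lexx orbT.
have mps k : measurable_fun D (fun x => maxe (hs k x) 0 * (f x)%:E).
  by apply: emeasurable_funM; [exact: measurable_maxe|exact/measurable_EFinP].
have mng k : measurable_fun D (fun x => maxe (- hs k x) 0 * (f x)%:E).
  apply: emeasurable_funM; last exact/measurable_EFinP.
  by apply: measurable_maxe => //; apply: (measurableT_comp (@oppe_measurable R setT)).
have cps x : maxe (hs k x) 0 * (f x)%:E @[k --> \oo] --> maxe (h x) 0 * (f x)%:E.
  by apply: cvgeZr => //; exact: nondecreasing_pos_cvg.
have cng x : maxe (- hs k x) 0 * (f x)%:E @[k --> \oo] --> maxe (- h x) 0 * (f x)%:E.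
  by apply: cvgeZr => //; exact: nondecreasing_neg_cvg.
have mngl : measurable_fun D (fun x => maxe (- h x) 0 * (f x)%:E).
  by apply: (emeasurable_fun_cvg _ _ mng) => x _; exact: cng.
split.
- have -> : \int[mu]_(x in D) (maxe (h x) 0 * (f x)%:E) = \int[mu]_(x in D) limn (fun k => maxe (hs k x) 0 * (f x)%:E).
    by apply: eq_integral => x _; apply/esym/cvg_lim => //; exact: cps.
  apply: cvg_monotone_convergence => // x _ p q pq. by rewrite lee_wpmul2r ?lee_fin// ge_max !le_max nd// lexx orbT.
- have int0 : mu.-integrable D (fun x => maxe (- hs 0%N x) 0 * (f x)%:E).
    apply/integrableP; split => //; under eq_integral do rewrite gee0_abs//. by rewrite -ge0_fin_numE// integral_ge0.
  have bd : {ae mu, forall x k, D x -> `|maxe (- hs k x) 0 * (f x)%:E| <= maxe (- hs 0%N x) 0 * (f x)%:E}.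
    apply: aeW => x k _; rewrite gee0_abs// lee_wpmul2r ?lee_fin//. by rewrite ge_max !le_max leeN2 nd// lexx orbT.
  by have [] := dominated_convergence mD mng mngl (aeW _ (fun x _ => cng x)) int0 bd.
rewrite ge0_fin_numE ?integral_ge0//; apply: (@le_lt_trans _ _ (\int[mu]_(x in D) (maxe (- hs 0%N x) 0 * (f x)%:E))).
  apply: ge0_le_integral => // x _; rewrite lee_wpmul2r ?lee_fin// ge_max !le_max lexx orbT andbT leeN2; apply/orP; left.
  have lE : h x = ereal_sup (range (hs^~ x)) by apply: (cvg_unique _ (cv x)) => //; exact: ereal_nondecreasing_cvgn.
  by rewrite lE; apply: ereal_sup_ubound; exists 0%N.
by rewrite -ge0_fin_numE// integral_ge0.
Qed.

End limits_of_parts.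

Fact growth_cvg (R : realType) (I t l : R) (u : R^nat) : u k @[k --> \oo] --> l ->
  ((I * expR (t * u k / I))%:E)%R @[k --> \oo] --> ((I * expR (t * l / I))%:E)%R.
Proof.
move=> ul; apply: cvg_EFin; first exact: nearW.
apply: (@cvgM R nat \oo _ (cst I) (fun k => expR (t * u k / I)%R)); first exact: cvg_cst.
have h : (t * u k / I)%R @[k --> \oo] --> (t * l / I)%R.
  by apply: cvgM; [apply: cvgM; [exact: cvg_cst|exact: ul]|exact: cvg_cst].
exact: (cvg_comp _ _ h (@continuous_expR R _)).
Qed.

Fact squeeze_close (R : realFieldType) (l d q p u e : R) : `|l - d|%R <= (e / 2)%R -> `|d - q|%R <= (e / 2)%R ->
  `|l - u|%R <= e -> (q <= p)%R -> (p <= u)%R -> `|l - p|%R <= e.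
Proof.
rewrite !ler_norml => /andP[a1 a2] /andP[b1 b2] /andP[c1 c2] h3 h4.
by apply/andP; split; lra.
Qed.

Section general_g.
Variables (R : realType) (m : nat).
Local Notation n := m.+1.
Variables (F g : 'rV[R]_n -> R) (r0 b : R) (w0 : 'rV[R]_n).
Hypotheses (lF : LC F) (tF : tame F r0 b) (lg : LC g) (gw0 : 0 < g w0).
Let F0 := tame_ge0 tF.
Local Notation K := (supp F).

(** The radius starts at |w0|, so that no truncation is identically zero. Balls are convex, so
    log-concavity is preserved; they are compact, so each truncation is bounded by
    semicontinuity. *)
Definition ball_cut (k : nat) (w : 'rV[R]_n) : R := if enorm w <= enorm w0 + k%:R then g w else 0.
Local Notation gk := ball_cut.

Let g0 w : 0 <= g w := LC_ge0 lg w.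

Lemma ball_cut_ge0 k w : 0 <= gk k w. Proof. by rewrite /gk; case: ifP. Qed.

Lemma ball_cut_w0 k : 0 < gk k w0. Proof. by rewrite /gk lerDl ler0n. Qed.

Lemma ball_cut_supp k w : 0 < gk k w -> enorm w <= enorm w0 + k%:R.
Proof. by rewrite /gk; case: ifP => //; rewrite ltxx. Qed.

Lemma ball_cut_eq k w : 0 < gk k w -> gk k w = g w.
Proof. by rewrite /gk; case: ifP => //; rewrite ltxx. Qed.

Lemma ball_cut_le k w : gk k w <= g w. Proof. by rewrite /gk; case: ifP. Qed.

Lemma ball_cut_homo w : {homo gk^~ w : p q / (p <= q)%N >-> p <= q}.
Proof.
move=> p q pq; rewrite /gk; case: ifPn => [h|_]; last by case: ifP.
by rewrite (le_trans h)// lerD2l ler_nat.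
Qed.

Lemma ball_cut_large w : exists k, gk k w = g w.
Proof.
exists (Num.truncn (enorm w)).+1; rewrite /gk ifT//.
by apply: le_trans (ltW (truncnS_gt _)) _; rewrite lerDr enorm_ge0.
Qed.

Lemma usc_ball_cut k : upper_semicontinuous (gk k).
Proof.
have [_ ug _] := lg; move=> w a; rewrite /gk; case: ifPn => [h|].
  move=> ga; have a0 := le_lt_trans (g0 w) ga. by apply: filterS (ug _ _ ga) => w' ?; case: ifP.
rewrite -ltNge => h a0; apply/nbhs_enormP.
exists (enorm w - (enorm w0 + k%:R)); first by rewrite subr_gt0.
move=> w' ww; rewrite ifN// -ltNge.
by have := enormD (w - w') w'; rewrite subrK; lra.
Qed.

Lemma ball_cut_bounded k : exists be, forall w, gk k w <= expR be.
Proof.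
have [_ ug _] := lg; have cB := @compact_eball R m (enorm w0 + k%:R).
have /compact_near_coveringP/(_ nat \oo (fun N w => g w < N%:R)) := cB.
have loc w : enorm w <= enorm w0 + k%:R -> \forall w' \near w & N \near \oo, g w' < N%:R.
  move=> _; have h : g w < g w + 1 by rewrite ltrDl.
  exists ([set w' | g w' < g w + 1], [set N | (Num.truncn (g w + 1)).+1 <= N]%N).
    by split; [exact: ug|exists (Num.truncn (g w + 1)).+1].
  move=> [w' N] /= [h1 h2]; apply: lt_trans h1 _; apply: lt_le_trans (truncnS_gt _) _. by rewrite ler_nat.
move=> /(_ _ loc) [N _ /(_ N (leqnn N)) hN].
exists N%:R => w; apply: le_trans (expR_ge1Dx _); rewrite /gk; case: ifPn => [h|_]; last by rewrite addr_ge0.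
by apply: le_trans (ltW (hN w h)) _; rewrite lerDr.
Qed.

Lemma ball_cut_conv k w w' (l : R) : 0 < l < 1 -> 0 < gk k w -> 0 < gk k w' ->
  0 < gk k ((1 - l) *: w + l *: w') /\
  (1 - l) * ln (gk k w) + l * ln (gk k w') <= ln (gk k ((1 - l) *: w + l *: w')).
Proof.
move=> /andP[l0 l1] p1 p2; have e1 := ball_cut_supp p1; have e2 := ball_cut_supp p2.
have E1 := ball_cut_eq p1; have E2 := ball_cut_eq p2; rewrite E1 in p1; rewrite E2 in p2; rewrite E1 E2.
have en : enorm ((1 - l) *: w + l *: w') <= enorm w0 + k%:R.
  apply: le_trans (enormD _ _) _; rewrite !enormZ !gtr0_norm//; last lra.
  have := ler_wpM2l (ltW l0) e2; have l1' : 0 <= 1 - l by lra. by have := ler_wpM2l l1' e1; lra.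
have l01 : 0 <= l <= 1 by rewrite !ltW.
have [_ _ /(_ w w' l l01)] := lg.
rewrite /gk en /powR !gt_eqF// -expRD => h.
have hp : 0 < g ((1 - l) *: w + l *: w') by apply: lt_le_trans h; exact: expR_gt0.
by split => //; rewrite -ler_expR [leRHS]lnK.
Qed.

Local Open Scope ereal_scope.
Local Notation pmu g h := (\int[@lam R n]_(x in grad_dom F) (h (supp_fun g (grad_neglog F x)) * (F x)%:E)).
Local Notation pnu g h := (\int[@hm R n m]_(x in gauss_dom K) (h (supp_fun_set (supp g) (gauss K x)) * (F x)%:E)).
Local Notation ps := (fun x : \bar R => maxe x 0).
Local Notation ng := (fun x : \bar R => maxe (- x) 0).
Local Notation S k := (dilsum F (gk k)).

Lemma supp_ball_cut_homo (p q : nat) : (p <= q)%N -> supp (gk p) `<=` supp (gk q).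
Proof. by move=> pq w /= h; apply: lt_le_trans h (ball_cut_homo w pq). Qed.

Let hsub p q (pq : (p <= q)%N) x : supp_fun (gk p) x <= supp_fun (gk q) x.
Proof.
rewrite !supp_funE; apply: ge_ereal_sup => _ [y gy <-]; apply: ereal_sup_ubound.
have gy' := supp_ball_cut_homo pq gy.
by exists y => //; rewrite (ball_cut_eq gy) (ball_cut_eq gy').
Qed.

Let hcvg x : supp_fun (gk k) x @[k --> \oo] --> supp_fun g x.
Proof.
have nd : {homo (fun k => supp_fun (gk k) x) : p q / (p <= q)%N >-> p <= q} by move=> p q pq; exact: hsub.
have := ereal_nondecreasing_cvgn nd; congr (_ --> _); apply/eqP; rewrite eq_le; apply/andP; split.
  apply: ge_ereal_sup => _ [k _ <-]; rewrite !supp_funE; apply: ge_ereal_sup => _ [y gy <-].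
  apply: ereal_sup_ubound; exists y; last by rewrite (ball_cut_eq gy). exact: lt_le_trans gy (ball_cut_le k y).
rewrite {1}supp_funE; apply: ge_ereal_sup => _ [y gy <-]; have [k hk] := ball_cut_large y.
apply: (@le_trans _ _ (supp_fun (gk k) x)); last by apply: ereal_sup_ubound; exists k.
by rewrite supp_funE; apply: ereal_sup_ubound; exists y; [rewrite /supp /= hk|rewrite hk].
Qed.

Let ssub p q (pq : (p <= q)%N) x : supp_fun_set (supp (gk p)) x <= supp_fun_set (supp (gk q)) x.
Proof.
by apply: le_ereal_sup => _ [y gy <-]; exists y => //; exact: supp_ball_cut_homo gy.
Qed.

Let scvg x : supp_fun_set (supp (gk k)) x @[k --> \oo] --> supp_fun_set (supp g) x.
Proof.
have nd : {homo (fun k => supp_fun_set (supp (gk k)) x) : p q / (p <= q)%N >-> p <= q} by move=> p q pq; exact: ssub.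
have := ereal_nondecreasing_cvgn nd; congr (_ --> _); apply/eqP; rewrite eq_le; apply/andP; split.
  apply: ge_ereal_sup => _ [k _ <-]; apply: le_ereal_sup => _ [y gy <-]; exists y => //.
  exact: lt_le_trans gy (ball_cut_le k y).
apply: ge_ereal_sup => _ [y gy <-]; have [k hk] := ball_cut_large y.
apply: (@le_trans _ _ (supp_fun_set (supp (gk k)) x)); last by apply: ereal_sup_ubound; exists k.
by apply: ereal_sup_ubound; exists y => //; rewrite /supp /= hk.
Qed.

Lemma measurable_grad_comp (h : bV R n -> \bar R) : measurable_fun setT h ->
  measurable_fun (grad_dom F : set (bV R n)) (fun x : bV R n => h (grad_neglog F x)).
Proof.
move=> mh; have mg := measurableT_comp mh (measurable_grad lF).
apply: (eq_measurable_fun (fun x : bV R n => h (if x \in grad_dom F then grad_neglog F x else 0%R))).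
  by move=> x xd /=; rewrite xd.
exact: measurable_funTS.
Qed.

Let Kconv := tame_supp_conv lF.
Let Kball := tame_supp_ball tF.
Let mK : measurable (K : set (bV R n)).
exact: (measurable_lt_set (measurable_cst _) (tame_meas tF)). Qed.

Lemma measurable_gauss_dom_tame : measurable (gauss_dom K : set (bV R n)).
Proof. exact: (measurable_gauss_dom Kconv (tame_r0 tF) Kball mK). Qed.

Lemma measurable_gauss_comp (h : bV R n -> \bar R) : measurable_fun setT h ->
  measurable_fun (gauss_dom K : set (bV R n)) (fun x : bV R n => h (gauss K x)).
Proof.
move=> mh; have mg := measurableT_comp mh (measurable_gauss0 Kconv (tame_r0 tF) Kball mK).
apply: (eq_measurable_fun (fun x : bV R n => h (gauss0 K x))).
  by move=> x /set_mem xd /=; rewrite gauss0E.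
exact: measurable_funTS.
Qed.

Let cfv k := let: ex_intro be hbe := ball_cut_bounded k in
  @compact_first_variation R m F (gk k) r0 b be _ w0 lF tF (@usc_ball_cut k) (ball_cut_ge0 k) hbe (@ball_cut_supp k) (ball_cut_w0 k).

Let part_ge0 d (T : measurableType d) (mu : {measure set T -> \bar R}) D (h : T -> \bar R) (f : T -> R) :
  (forall x, 0 <= f x)%R -> 0 <= \int[mu]_(x in D) (maxe (h x) 0 * (f x)%:E).
Proof. by move=> f0; apply: integral_ge0 => x _; rewrite mule_ge0 ?lee_fin// le_max lexx orbT. Qed.

Lemma parts_cvg :
  [/\ pmu (gk k) ps + pnu (gk k) ps @[k --> \oo] --> pmu g ps + pnu g ps,
      pmu (gk k) ng + pnu (gk k) ng @[k --> \oo] --> pmu g ng + pnu g ng,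
      pmu g ng \is a fin_num & pnu g ng \is a fin_num].
Proof.
have [_ _] := cfv 0%N; rewrite fin_numD => /andP[f1 f2].
have [a1 a2 a3] := @parts_limit R _ (bV R n) (@lam R n) (grad_dom F) (fun k x => supp_fun (gk k) (grad_neglog F x))
  (fun x => supp_fun g (grad_neglog F x)) F (measurable_grad_dom lF) (fun k => measurable_grad_comp (@measurable_supp_fun R n (gk k)))
  (measurable_funTS (tame_meas tF)) F0 (fun x p q pq => hsub pq (grad_neglog F x)) (fun x => @hcvg (grad_neglog F x)) f1.
have [b1 b2 b3] := @parts_limit R _ (bV R n) (@hm R n m) (gauss_dom K) (fun k x => supp_fun_set (supp (gk k)) (gauss K x))
  (fun x => supp_fun_set (supp g) (gauss K x)) F measurable_gauss_dom_tame (fun k => measurable_gauss_comp (@measurable_supp_fun_set R n (supp (gk k))))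
  (measurable_funTS (tame_meas tF)) F0 (fun x p q pq => ssub pq (gauss K x)) (fun x => @scvg (gauss K x)) f2.
split => //; last by apply: cvgeD => //; exact: fin_num_adde_defl.
by apply: cvgeD => //; apply: ge0_adde_def; rewrite inE; exact: part_ge0.
Qed.

Lemma supconv_cvg t x : (0 < t)%R -> (S k t x)%:E @[k --> \oo] --> supconv F (lcscale t g) x.
Proof.
move=> t0.
have SE k : (S k t x)%:E = supconv F (lcscale t (gk k)) x.
  by have [be hbe] := ball_cut_bounded k; rewrite (supconv_fin tF (ball_cut_ge0 k) hbe).
have pw p w : (gk p w `^ t <= g w `^ t)%R.
  by have h := ball_cut_le p w; apply: ge0_ler_powR; rewrite ?nnegrE ?ball_cut_ge0 ?g0 ?(ltW t0).
have nd : {homo (fun k => (S k t x)%:E) : p q / (p <= q)%N >-> p <= q}.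
  move=> p q pq; rewrite !SE !supconvE//; apply: ge_ereal_sup => _ [w _ <-].
  apply: (@le_trans _ _ (F (x - t *: w) * gk q w `^ t)%:E); last by apply: ereal_sup_ubound; exists w.
  rewrite lee_fin ler_wpM2l//; apply: ge0_ler_powR; rewrite ?nnegrE ?ball_cut_ge0 ?(ltW t0)//. exact: ball_cut_homo.
have := ereal_nondecreasing_cvgn nd; congr (_ --> _); apply/eqP; rewrite eq_le; apply/andP; split.
  apply: ge_ereal_sup => _ [k _ <-]; rewrite SE !supconvE//; apply: ge_ereal_sup => _ [w _ <-].
  apply: (@le_trans _ _ (F (x - t *: w) * g w `^ t)%:E); last by apply: ereal_sup_ubound; exists w.
  by rewrite lee_fin ler_wpM2l.
rewrite supconvE//; apply: ge_ereal_sup => _ [w _ <-]; have [k hk] := ball_cut_large w.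
apply: (@le_trans _ _ (S k t x)%:E); last by apply: ereal_sup_ubound; exists k.
by rewrite SE supconvE//; apply: ereal_sup_ubound; exists w => //; rewrite hk.
Qed.

Lemma dilsum_homo t x : (0 < t)%R -> {homo (fun k => S k t x) : p q / (p <= q)%N >-> (p <= q)%R}.
Proof.
move=> t0 p q pq; have [be hbe] := ball_cut_bounded p; have [be' hbe'] := ball_cut_bounded q.
apply: (dilsum_le tF (ball_cut_ge0 p) hbe t0) => w.
apply: le_trans (dilsum_ge tF (ball_cut_ge0 q) hbe' x w t0); rewrite ler_wpM2l//.
by apply: ge0_ler_powR; rewrite ?nnegrE ?ball_cut_ge0 ?(ltW t0)//; exact: ball_cut_homo.
Qed.

Let mS k t : (0 < t)%R -> measurable_fun setT (S k t : bV R n -> R).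
Proof.
move=> t0; have [be hbe] := ball_cut_bounded k.
exact: (measurable_dilsum lF tF (@usc_ball_cut k) (ball_cut_ge0 k) hbe (@ball_cut_supp k) t0).
Qed.

Let S0 k t x : (0 < t)%R -> (0 <= S k t x)%R.
by move=> t0; have [be hbe] := ball_cut_bounded k; exact: (dilsum_ge0 tF (ball_cut_ge0 k) hbe x t0). Qed.

Let le_supconv k t x : (0 < t)%R -> (S k t x)%:E <= supconv F (lcscale t g) x.
Proof.
move=> t0; rewrite -(cvg_lim _ (@supconv_cvg _ x t0))//; apply: lime_ge.
  by apply/cvg_ex; eexists; exact: supconv_cvg.
by exists k => // p /= kp; rewrite lee_fin dilsum_homo.
Qed.

Lemma measurable_supconv t : (0 < t)%R -> measurable_fun setT (supconv F (lcscale t g) : bV R n -> \bar R).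
Proof.
move=> t0; apply: (emeasurable_fun_cvg (fun k (x : bV R n) => (S k t x)%:E)) => [k|x _]; last exact: supconv_cvg.
by apply/measurable_EFinP; exact: mS.
Qed.

Lemma integral_supconv_cvg t : (0 < t)%R ->
  \int[@lam R n]_x (S k t x)%:E @[k --> \oo] --> \int[@lam R n]_x supconv F (lcscale t g) x.
Proof.
move=> t0; have -> : \int[@lam R n]_x supconv F (lcscale t g) x = \int[@lam R n]_x limn (fun k => (S k t x)%:E).
  by apply: eq_integral => x _; apply/esym/cvg_lim => //; exact: supconv_cvg.
apply: cvg_monotone_convergence => //.
- by move=> k; apply/measurable_EFinP; exact: mS.
- by move=> k x _; rewrite lee_fin S0.
- by move=> x _ p q pq; rewrite lee_fin dilsum_homo.
Qed.

(** Truncations bound the quotient from below, so its lower limit is at least every [de k], which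
    settles the case P - N = +oo. If the limit l is finite, the growth bound, uniform in k, gives
    Psi t <= I e^(t l / I), whose quotient tends to l as well. *)
Let first_variation_limit P N : 0 <= P -> N \is a fin_num ->
  pmu (gk k) ps + pnu (gk k) ps @[k --> \oo] --> P -> pmu (gk k) ng + pnu (gk k) ng @[k --> \oo] --> N ->
  0 < \int[@lam R n]_x (F x)%:E ->
  ((\int[@lam R n]_x supconv F (lcscale t g) x - \int[@lam R n]_x (F x)%:E) * (t^-1)%:E) @[t --> (0 : R)^'+] --> P - N.
Proof.
move=> P0 Nfin cP cN Fpos.
have Ffin : \int[@lam R n]_x (F x)%:E \is a fin_num by rewrite ge0_fin_numE ?(tame_int tF)// ltW.
set I := fine (\int[@lam R n]_x (F x)%:E); have I0 : (0 < I)%R by rewrite -lte_fin fineK.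
pose Phi k t := fine (\int[@lam R n]_x (S k t x)%:E).
pose Psi t := \int[@lam R n]_x supconv F (lcscale t g) x.
pose de k := fine (pmu (gk k) ps + pnu (gk k) ps - (pmu (gk k) ng + pnu (gk k) ng)).
have deE k : (de k)%:E = pmu (gk k) ps + pnu (gk k) ps - (pmu (gk k) ng + pnu (gk k) ng).
  by have [_ f1 f2] := cfv k; rewrite /de fineK// fin_numB f1.
have cde : (de k)%:E @[k --> \oo] --> P - N.
  under eq_cvg do rewrite deE; apply: cvgeB => //. by apply: fin_num_adde_defl; rewrite fin_numN.
have cq k : ((Phi k t - I) / t)%R @[t --> (0 : R)^'+] --> de k by have [h _ _] := cfv k.
have Pfin k t : (0 < t)%R -> \int[@lam R n]_x (S k t x)%:E \is a fin_num.
  move=> t0; have [be hbe] := ball_cut_bounded k.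
  exact: (dilsum_all_fin lF tF (@usc_ball_cut k) (ball_cut_ge0 k) hbe (@ball_cut_supp k) (ball_cut_w0 k) (@ball_cut_conv k) Fpos t0).
have gr k t : (0 < t)%R -> (Phi k t <= I * expR (t * de k / I))%R.
  move=> t0; have [be hbe] := ball_cut_bounded k.
  exact: (dilsum_growth lF tF (@usc_ball_cut k) (ball_cut_ge0 k) hbe (@ball_cut_supp k) (ball_cut_w0 k) (@ball_cut_conv k) Fpos (cq k) t0).
have PhiPsi k t : (0 < t)%R -> (Phi k t)%:E <= Psi t.
  move=> t0; rewrite fineK; last exact: Pfin. apply: ge0_le_integral => //.
  - by move=> x _; rewrite lee_fin S0.
  - by apply/measurable_EFinP; exact: mS.
  - exact: measurable_supconv.
  - by move=> x _; exact: le_supconv.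
have low k t : (0 < t)%R -> ((Phi k t - I) / t)%:E <= (Psi t - \int[@lam R n]_x (F x)%:E) * (t^-1)%:E.
  move=> t0; rewrite EFinM lee_wpmul2r ?lee_fin ?invr_ge0 ?(ltW t0)//. by rewrite -(fineK Ffin) EFinB leeD2r// PhiPsi.
have PNN : P - N != -oo.
  rewrite -(fineK Nfin) -EFinN adde_eq_ninfty negb_or /= andbT -ltNye. exact: lt_le_trans (ltNyr 0%R) P0.
have [[l lE]|lE] : (exists l : R, P - N = l%:E) \/ P - N = +oo.
  by move: PNN; case: (P - N) => [l| |] //; [left; exists l|right].
- rewrite lE in cde *; have cde' : de k @[k --> \oo] --> l.
    by move/fine_cvgP : cde => [_].
  have up t : (0 < t)%R -> Psi t <= (I * expR (t * l / I))%:E.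
    move=> t0; rewrite /Psi -(cvg_lim _ (integral_supconv_cvg t0))//.
    have cE : (I * expR (t * de k / I))%:E @[k --> \oo] --> (I * expR (t * l / I))%:E.
      exact: growth_cvg.
    rewrite -(cvg_lim _ cE)//; apply: lee_lim.
    + by apply/cvg_ex; eexists; exact: integral_supconv_cvg.
    + by apply/cvg_ex; eexists; exact: cE.
    + by apply: nearW => k; rewrite -(fineK (Pfin k t t0)) lee_fin gr.
  have Psfin t : (0 < t)%R -> Psi t \is a fin_num.
    move=> t0; rewrite fin_numElt; apply/andP; split.
      by apply: lt_le_trans (PhiPsi 0%N t t0); rewrite ltNyr.
    by apply: le_lt_trans (up t t0) _; rewrite ltry.
  apply: (@cvg_trans _ (((fine (Psi t) - I) / t)%:E @[t --> (0 : R)^'+])).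
    apply: near_eq_cvg; near=> t; have t0 : (0 < t)%R by near: t; exact: nbhs_right_gt.
    by rewrite EFinM EFinB !fineK//; exact: Psfin.
  apply: cvg_EFin; first exact: nearW. have cu : (I * ((expR (t * (l / I)) - 1) / t))%R @[t --> (0 : R)^'+] --> l.
    have -> : l = (I * (l / I))%R by rewrite mulrCA mulfV ?mulr1// gt_eqF.
    by apply: cvgM; [exact: cvg_cst|rewrite mulrCA mulfV ?mulr1 ?gt_eqF//; exact: expR_quotient].
  apply/cvgrPdist_le => e e0; have e2 : (0 < e / 2)%R by rewrite divr_gt0.
  move/cvgrPdist_le : (cde') => /(_ _ e2) [k _ /(_ k (leqnn k)) hk]. move/cvgrPdist_le : (cq k) => /(_ _ e2) hq.
  move/cvgrPdist_le : cu => /(_ _ e0) hu. near=> t; have t0 : (0 < t)%R by near: t; exact: nbhs_right_gt.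
  have h1 : (`|de k - (Phi k t - I) / t| <= e / 2)%R by near: t; exact: hq.
  have h2 : (`|l - I * ((expR (t * (l / I)) - 1) / t)| <= e)%R by near: t; exact: hu.
  have h3 : ((Phi k t - I) / t <= (fine (Psi t) - I) / t)%R.
    rewrite ler_pM2r ?invr_gt0// lerD2r -lee_fin (fineK (Psfin t t0)); exact: PhiPsi.
  have h4 : ((fine (Psi t) - I) / t <= I * ((expR (t * (l / I)) - 1) / t))%R.
    rewrite mulrA ler_pM2r ?invr_gt0// mulrBr mulr1 lerD2r mulrA -lee_fin (fineK (Psfin t t0)); exact: up.
  exact: (squeeze_close hk h1 h2 h3 h4).
rewrite lE in cde *; apply/cvgeyPge => A.
move/cvgeyPge : cde => /(_ (A + 1)%R) [k _ /(_ k (leqnn k))]; rewrite lee_fin => hk.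
move/cvgrPdist_le : (cq k) => /(_ _ ltr01) hq.
near=> t; have t0 : (0 < t)%R by near: t; exact: nbhs_right_gt.
apply: le_trans (low k t t0); rewrite lee_fin.
have : (`|de k - (Phi k t - I) / t| <= 1)%R by near: t; exact: hq.
by rewrite ler_norml => /andP[a1 a2]; lra.
Unshelve. all: by end_near. Qed.

Lemma tame_first_variation : 0 < \int[@lam R n]_x (F x)%:E ->
  ((\int[@lam R n]_x supconv F (lcscale t g) x - \int[@lam R n]_x (F x)%:E) * (t^-1)%:E) @[t --> (0 : R)^'+] -->
  pmu g ps + pnu g ps - (pmu g ng + pnu g ng).
Proof.
have [cP cN fN1 fN2] := parts_cvg; apply: first_variation_limit => //.
- by apply: adde_ge0; exact: part_ge0.
- by rewrite fin_numD fN1.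
Qed.

End general_g.

(** * Undoing the normalization *)

Section shifted_measures.
Variables (R : realType) (n : nat).
Local Open Scope ereal_scope.

Lemma ge0_integral_shift (mu : {measure set (bV R n) -> \bar R}) (c : 'rV[R]_n) (s : R) (D E : set (bV R n))
    (u v : bV R n -> \bar R) :
  (forall A : set (bV R n), measurable A -> mu ((fun x : 'rV[R]_n => (1 *: x + c)%R) @^-1` A) = mu A) -> (0 <= s)%R ->
  measurable D -> measurable_fun D u -> (forall x, 0 <= u x) -> E = (fun x : 'rV[R]_n => (1 *: x + c)%R) @^-1` D ->
  (forall x : 'rV[R]_n, E x -> v x = s%:E * u ((1 *: x + c)%R : 'rV[R]_n)) ->
  \int[mu]_(x in E) v x = s%:E * \int[mu]_(x in D) u x.
Proof.
move=> inv s0 mD mu' u0 -> vE; rewrite -ge0_integralZl//.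
transitivity (\int[pushm mu (measurable_affine 1 c)]_(x in D) (s%:E * u x)).
  rewrite [RHS]ge0_integral_pushforward//.
  - by apply: eq_integral => x /set_mem; exact: vE.
  - exact: measurable_affine.
  - exact: measurable_funeM.
  - by move=> y _; apply: mule_ge0.
by apply: eq_measure_integral => A mA _; exact: inv.
Qed.

Lemma lam_shift (c : 'rV[R]_n) (A : set (bV R n)) : measurable A ->
  lam ((fun x : 'rV[R]_n => (1 *: x + c)%R) @^-1` A) = lam A.
Proof. by move=> mA; rewrite lam_affine ?oner_eq0// normr1 invr1 expr1n mul1e. Qed.

Lemma hm_shift k (c : 'rV[R]_n) (A : set (bV R n)) : hm k ((fun x : 'rV[R]_n => (1 *: x + c)%R) @^-1` A) = hm k A.
Proof.
have -> : (fun x : 'rV[R]_n => (1 *: x + c)%R) @^-1` A = [set (x - c)%R | x in A].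
  apply/seteqP; split => [x /= Ax|x /= [y Ay <-]]; last by rewrite scale1r subrK.
  by exists (1 *: x + c)%R => //; rewrite scale1r addrK.
by apply: hausdorff_isometry => x y _ _; congr enorm; rewrite opprB addrA subrK.
Qed.

Lemma integral_parts d (T : measurableType d) (mu : {measure set T -> \bar R}) (D : set T) (h : T -> \bar R)
    (f : T -> R) : (forall x, 0 <= f x)%R ->
  \int[mu]_(x in D) (h x * (f x)%:E) =
  \int[mu]_(x in D) (maxe (h x) 0 * (f x)%:E) - \int[mu]_(x in D) (maxe (- h x) 0 * (f x)%:E).
Proof.
move=> f0; rewrite integralE; congr (_ - _); apply: eq_integral => x _.
  by rewrite funeposE maxe_pMl ?lee_fin// mul0e.
by rewrite funenegE maxe_pMl ?lee_fin// mul0e mulNe.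
Qed.

End shifted_measures.

(** [A] and [B] are positive parts and may be +oo; finiteness of the negative parts [C] and [D]
    rules out an undefined difference and gives the lower bound -oo < of the theorem. *)
Fact parts_scale (R : realType) (s : R) (A B C D : \bar R) : (0 < s)%R -> (0 <= A -> 0 <= B ->
  C \is a fin_num -> D \is a fin_num ->
  s%:E * A - s%:E * C + (s%:E * B - s%:E * D) = s%:E * (A + B - (C + D)) /\ -oo < s%:E * (A + B - (C + D)))%E.
Proof.
move=> s0; case: A => [p| |]//; case: B => [q| |]//; case: C => [u| |]//; case: D => [v| |]// _ _ _ _.
- by split; rewrite ?ltNyr//=; congr EFin; ring.
all: by rewrite /= ?(gt0_muley (_ : (0 < s%:E)%E))//= ?lte_fin.
Qed.

Lemma nbhs_shift (R : realType) (m : nat) (e y : 'rV[R]_m.+1) (A : set 'rV[R]_m.+1) :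
  nbhs (y + e) A -> nbhs y (fun z => A (z + e)).
Proof.
exact: (@cvgD R 'rV[R]_m.+1 'rV[R]_m.+1 (nbhs y) _ id (cst e) y e cvg_id (cvg_cst e) A).
Qed.

Section shifted_functions.
Variables (R : realType) (m : nat).
Local Notation n := m.+1.
Variables (d : 'rV[R]_n) (s : R) (f F : 'rV[R]_n -> R).
Hypotheses (s0 : 0 < s) (fE : forall x, f x = s * F (1 *: x + d)) (lf : LC f) (lF : LC F).
Local Notation tau := (fun x : 'rV[R]_n => 1 *: x + d).

Lemma tauD x v : tau (x + v) = tau x + v. Proof. by rewrite /= !scale1r addrAC. Qed.

Lemma slopes_shift x nu : slopes f x nu <-> slopes F (tau x) nu.
Proof.
have dE v al : decays f x v al <-> decays F (tau x) v al.
  by split=> -[t t0 h]; exists t => //; move: h; rewrite !fE -tauD -mulrA ler_pM2l.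
by rewrite /slopes fE pmulr_rgt0//; split=> -[-> h]; split => // i eta eta0; have [a b] := h i eta eta0;
  split; apply/dE.
Qed.

Lemma grad_dom_shift : grad_dom f = tau @^-1` grad_dom F.
Proof.
apply/seteqP; split => [x gx|x /= gx].
  by have /slopes_shift/(slopesP lF)[] := (slopesP lf x _).2 (conj gx erefl).
by have /slopes_shift/(slopesP lf)[] := (slopesP lF (tau x) _).2 (conj gx erefl).
Qed.

Lemma grad_neglog_shift x : grad_dom f x -> grad_neglog f x = grad_neglog F (tau x).
Proof. by move=> gx; have /slopes_shift/(slopesP lF)[_ ->] := (slopesP lf x _).2 (conj gx erefl). Qed.

Lemma supp_shift : supp f = tau @^-1` supp F.
Proof. by apply/funext => x; rewrite /supp /= fE pmulr_rgt0. Qed.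

Lemma interior_shift (K : set 'rV[R]_n) : interior (tau @^-1` K) = tau @^-1` interior K.
Proof.
apply/seteqP; split => x; rewrite /interior /= => h.
  have h' : nbhs (1 *: x + d) (fun z => (tau @^-1` K) (z - d)) by apply: nbhs_shift; rewrite addrK scale1r.
  suff <- : (fun z => (tau @^-1` K) (z - d)) = K by []. by apply/funext => z /=; rewrite scale1r subrK.
have h' := nbhs_shift h; rewrite scale1r in h'.
suff -> : tau @^-1` K = (fun z => K (z + d)) by [].
by apply/funext => z /=; rewrite scale1r.
Qed.

Lemma bd_shift (K : set 'rV[R]_n) : bd (tau @^-1` K) = tau @^-1` bd K.
Proof.
have cE (A : set 'rV[R]_n) : closure A = ~` interior (~` A) by rewrite interiorC setCK.
rewrite /bd !cE interior_shift.
have -> : ~` (tau @^-1` K) = tau @^-1` (~` K) by [].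
by rewrite interior_shift.
Qed.

Lemma outer_normals_shift (K : set 'rV[R]_n) x : outer_normals (tau @^-1` K) x = outer_normals K (tau x).
Proof.
apply/seteqP; split => th /= [th1 h]; split => // y Ky.
  have := h (y - d); rewrite /= scale1r subrK => /(_ Ky). by rewrite innerBl lerBlDr innerDl scale1r.
by have := h _ Ky; rewrite !innerDl !scale1r lerD2r.
Qed.

Lemma gauss_dom_shift : gauss_dom (supp f) = tau @^-1` gauss_dom (supp F).
Proof. by apply/funext => x; rewrite supp_shift /gauss_dom /= bd_shift outer_normals_shift. Qed.

Lemma gauss_shift x : gauss (supp f) x = gauss (supp F) (tau x).
Proof. by rewrite supp_shift /gauss outer_normals_shift. Qed.

Lemma supconv_shift (h : 'rV[R]_n -> R) x : supconv f h x = (s%:E * supconv F h (tau x))%E.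
Proof.
rewrite /supconv -ereal_sup_pZl//; congr ereal_sup; apply/seteqP; split => v.
  move=> [y _ <-]; exists (F (tau y) * h (tau x - tau y))%:E; first by exists (tau y).
  by rewrite -EFinM mulrA -fE !scale1r opprD addrACA subrr addr0.
move=> [_ [y _ <-] <-]; exists (y - d) => //.
by rewrite fE !scale1r subrK -EFinM mulrA opprB addrA.
Qed.

End shifted_functions.

Section positive_dimension.
Variables (R : realType) (m : nat).
Local Notation n := m.+1.
Variables (f g : 'rV[R]_n -> R).
Hypotheses (lf : LC f) (lg : LC g).

Lemma LC_shift (a : R) (c : 'rV[R]_n) : 0 < a -> LC (fun y => a * f (c + y)).
Proof.
move=> a0; have [f0 usc fc] := lf; split.
- by move=> x; rewrite mulr_ge0 ?f0 ?ltW.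
- move=> x al; rewrite mulrC -ltr_pdivlMr// [c + x]addrC => h.
  have E : (fun z => is_true (a * f (c + z) < al)) = (fun z => is_true (f (z + c) < al / a)).
    by apply/funext => z; rewrite ltr_pdivlMr// mulrC [c + z]addrC.
  by have := nbhs_shift (usc _ _ h); rewrite -E.
- move=> x y l l01; rewrite !powRM ?f0 ?(ltW a0)// mulrACA -powRD; last by rewrite (gt_eqF a0) implybT.
  rewrite subrK powRr1 ?(ltW a0)// ler_pM2l//.
  suff -> : c + ((1 - l) *: x + l *: y) = (1 - l) *: (c + x) + l *: (c + y) by exact: fc.
  by rewrite !scalerDr addrACA -scalerDl subrK scale1r.
Qed.

Local Open Scope ereal_scope.

Theorem first_variation_pos : 0 < \int[@lebesgue_n R n]_x (f x)%:E -> \int[@lebesgue_n R n]_x (f x)%:E < +oo ->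
  (exists x, g x != 0%R) ->
  first_var_quot f g t @[t --> (0 : R)^'+] --> int_mu f (supp_fun g) + int_nu f (supp_fun_set (supp g))
  /\ -oo < int_mu f (supp_fun g) + int_nu f (supp_fun_set (supp g)).
Proof.
have f0 := LC_ge0 lf.
have mEf : measurable_fun setT ((fun x => (f x)%:E) : bV R n -> \bar R) by apply/measurable_EFinP; exact: LC_measurable.
rewrite integral_lebesgue_n// => fpos ffin [w0 gw0'].
have gw0 : (0 < g w0)%R by rewrite lt0r gw0' (LC_ge0 lg).
have [c [a [r [b [a0 r0 hlb hub]]]]] := LC_normalize lf fpos ffin.
pose F y := (a * f (c + y))%R; have lF : LC F by exact: LC_shift.
have F0 := LC_ge0 lF.
have mEF : measurable_fun setT ((fun x => (F x)%:E) : bV R n -> \bar R) by apply/measurable_EFinP; exact: LC_measurable.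
have s0 : (0 < a^-1)%R by rewrite invr_gt0.
have fE x : f x = (a^-1 * F (1 *: x + - c))%R.
  by rewrite /F scale1r [(x - c)%R]addrC addNKr mulrA mulVf ?mul1r// gt_eqF.
have ls := @lam_shift R n (- c).
have ifE : \int[@lam R n]_x (f x)%:E = (a^-1)%:E * \int[@lam R n]_x (F x)%:E.
  by apply: (ge0_integral_shift ls (ltW s0)) => // x _; rewrite ?lee_fin// fE EFinM.
have Fpos : 0 < \int[@lam R n]_x (F x)%:E by move: fpos; rewrite ifE pmule_rgt0// lte_fin.
have Ffin : \int[@lam R n]_x (F x)%:E < +oo.
  rewrite ltNge; apply/negP; rewrite leye_eq => /eqP E. by move: ffin; rewrite ifE E gt0_muley ?lte_fin// ltxx.
have tF : tame F r b.
  have eF : forall (x y : 'rV[R]_n * R) (l : R), (0 <= l <= 1)%R -> epigraph F x -> epigraph F y ->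
    epigraph F ((1 - l) *: x + l *: y)%R := @LC_epigraph_convex R n f lf c a a0.
  exact: (@Tame R m F r b eF (LC_measurable lF) F0 r0 hlb hub Ffin).
have [_ _ Nmu Nnu] := parts_cvg lF tF lg gw0.
have main := tame_first_variation lF tF lg gw0 Fpos.
have NF := tame_int tF.
have ifn : \int[@lam R n]_x (F x)%:E \is a fin_num by rewrite ge0_fin_numE// ltW.
have S0 t x : 0 <= supconv F (lcscale t g) x.
  apply: le_ereal_sup_tmp; exists (F 0 * lcscale t g (x - 0))%:E; first by exists 0%R.
  by rewrite lee_fin mulr_ge0// /lcscale powR_ge0.
have qE t : (0 < t)%R -> (a^-1)%:E * ((\int[@lam R n]_x supconv F (lcscale t g) x - \int[@lam R n]_x (F x)%:E)
    * (t^-1)%:E) = first_var_quot f g t.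
  move=> t0; have mS := measurable_supconv w0 lF tF lg t0.
  have mSf : measurable_fun setT (supconv f (lcscale t g) : bV R n -> \bar R).
    rewrite (_ : supconv f _ = fun x => (a^-1)%:E * supconv F (lcscale t g) (1 *: x + - c)%R).
      apply: measurable_funeM.
      exact: (measurableT_comp (f := supconv F (lcscale t g) : bV R n -> \bar R) mS (measurable_affine 1 (- c))).
    by apply/funext => x; exact: supconv_shift.
  have -> : first_var_quot f g t =
      (\int[@lam R n]_x supconv f (lcscale t g) x - \int[@lam R n]_x (f x)%:E) * (t^-1)%:E.
    by rewrite /first_var_quot (integral_lebesgue_n _ mSf)// (integral_lebesgue_n _ mEf).
  have -> : \int[@lam R n]_x supconv f (lcscale t g) x =
      (a^-1)%:E * \int[@lam R n]_x supconv F (lcscale t g) x.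
    by apply: (ge0_integral_shift ls (ltW s0)) => // x _; exact: supconv_shift.
  rewrite ifE -muleBr// ?muleA//. by apply: fin_num_adde_defl; rewrite fin_numN.
have mps : measurable_fun [set: \bar R] (fun y : \bar R => maxe y 0) by exact: measurable_maxe.
have mng : measurable_fun [set: \bar R] (fun y : \bar R => maxe (- y) 0) by exact: measurable_maxe.
have mh := measurable_supp_fun g; have mhK := measurable_supp_fun_set (supp g).
have muE (k : \bar R -> \bar R) : measurable_fun setT k -> (forall y, 0 <= k y) ->
    \int[@lam R n]_(x in grad_dom f) (k (supp_fun g (grad_neglog f x)) * (f x)%:E) =
    (a^-1)%:E * \int[@lam R n]_(x in grad_dom F) (k (supp_fun g (grad_neglog F x)) * (F x)%:E).
  move=> mk k0; apply: (ge0_integral_shift ls (ltW s0) (measurable_grad_dom lF)).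
  - apply: emeasurable_funM; last exact: measurable_funTS.
    by apply: (measurable_grad_comp lF (h := fun x => k (supp_fun g x))); exact: measurableT_comp.
  - by move=> x; rewrite mule_ge0// lee_fin.
  - exact: (grad_dom_shift s0 fE lf lF).
  - by move=> x gx; rewrite (grad_neglog_shift s0 fE lf lF gx) fE EFinM muleCA.
have mG := measurable_gauss_dom_tame lF tF.
have nuE (k : \bar R -> \bar R) : measurable_fun setT k -> (forall y, 0 <= k y) ->
    \int[@hm R n m]_(x in gauss_dom (supp f)) (k (supp_fun_set (supp g) (gauss (supp f) x)) * (f x)%:E) =
    (a^-1)%:E * \int[@hm R n m]_(x in gauss_dom (supp F)) (k (supp_fun_set (supp g) (gauss (supp F) x)) * (F x)%:E).
  move=> mk k0; apply: (ge0_integral_shift (fun A _ => hm_shift m (- c) A) (ltW s0) mG).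
  - apply: emeasurable_funM; last exact: measurable_funTS.
    by apply: (measurable_gauss_comp lF tF (h := fun x => k (supp_fun_set (supp g) x))); exact: measurableT_comp.
  - by move=> x; rewrite mule_ge0// lee_fin.
  - exact: (gauss_dom_shift s0 fE).
  - by move=> x gx; rewrite (gauss_shift s0 fE) fE EFinM muleCA.
have imE : int_mu f (supp_fun g) = \int[@lam R n]_(x in grad_dom f) (supp_fun g (grad_neglog f x) * (f x)%:E).
  apply: integral_lebesgue_n; first exact: measurable_grad_dom.
  by apply: emeasurable_funM; [exact: measurable_grad_comp|exact: measurable_funTS].
have inE : int_nu f (supp_fun_set (supp g)) =
    \int[@hm R n m]_(x in gauss_dom (supp f)) (supp_fun_set (supp g) (gauss (supp f) x) * (f x)%:E).
  have maf := @measurable_affine R n 1%R (- c). apply: (@integral_hausdorff R n m).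
    by rewrite (gauss_dom_shift s0 fE) -[X in measurable X]setTI; exact: maf.
  apply: emeasurable_funM; last exact: measurable_funTS.
  rewrite (_ : (fun x => _) = (fun x => supp_fun_set (supp g) (gauss (supp F) x)) \o
    (fun x : 'rV[R]_n => (1 *: x + - c)%R)); last by apply/funext => x; rewrite (gauss_shift s0 fE).
  apply: (measurable_comp mG); last exact: measurable_funTS.
    by rewrite (gauss_dom_shift s0 fE) => _ [x gx <-].
  exact: (measurable_gauss_comp lF tF mhK).
have ps0 (y : \bar R) : 0 <= maxe y 0 by rewrite le_max lexx orbT.
have pos d (T : measurableType d) (mu : {measure set T -> \bar R}) D (u : T -> \bar R) v :
    (forall x, 0 <= v x)%R -> 0 <= \int[mu]_(x in D) (maxe (u x) 0 * (v x)%:E).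
  by move=> v0; apply: integral_ge0 => x _; rewrite mule_ge0// lee_fin.
have imP := etrans imE (@integral_parts R _ (bV R n) (@lam R n) (grad_dom f) (fun x => supp_fun g (grad_neglog f x)) f f0).
have inP := etrans inE (@integral_parts R _ (bV R n) (@hm R n m) (gauss_dom (supp f))
  (fun x => supp_fun_set (supp g) (gauss (supp f) x)) f f0).
have imQ := etrans imP (f_equal2 (fun u v => u - v) (muE _ mps ps0) (muE _ mng (fun y => ps0 (- y)))).
have inQ := etrans inP (f_equal2 (fun u v => u - v) (nuE _ mps ps0) (nuE _ mng (fun y => ps0 (- y)))).
rewrite imQ inQ.
have [-> Ny] := parts_scale s0 (pos _ (bV R n) (@lam R n) (grad_dom F) (fun x => supp_fun g (grad_neglog F x)) F F0)
  (pos _ (bV R n) (@hm R n m) (gauss_dom (supp F)) (fun x => supp_fun_set (supp g) (gauss (supp F) x)) F F0) Nmu Nnu.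
split => //; apply: cvg_trans (cvgeZl _ main) => //.
by apply: near_eq_cvg; near=> t; apply: qE; near: t; exact: nbhs_right_gt.
Unshelve. all: by end_near. Qed.

End positive_dimension.

(** * Dimension zero *)

Section dimension_zero.
Variables (R : realType) (f g : 'rV[R]_0 -> R).
Local Open Scope ereal_scope.

Let rV0 (T : Type) (h : 'rV[R]_0 -> T) : h = cst (h 0%R).
by apply/funext => x; rewrite /cst [x]thinmx0. Qed.

Let lam1 : lam (setT : set (bV R 0)) = 1.
Proof.
have -> : setT = hbox (0%R : 'rV[R]_0) 0%R by apply/seteqP; split => // x _ [].
by rewrite lam_hbox ?big_ord0// => -[].
Qed.

Lemma integral_rV0 (u : 'rV[R]_0 -> \bar R) : \int[@lebesgue_n R 0]_x u x = u 0%R.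
Proof.
have -> : u = cst (u 0%R) by exact: rV0.
rewrite (@integral_lebesgue_n R 0 setT (cst (u 0%R)))//.
apply: (etrans (@integral_cst _ _ _ (@lam R 0) setT measurableT (u 0%R))).
by apply: etrans (mule1 (u 0%R)); congr (_ * _); exact: lam1.
Qed.

Let int0 (u : 'rV[R]_0 -> \bar R) : \int[@hausdorff R 0 0.-1]_(x in set0) u x = 0.
Proof.
have h := @integral_hausdorff R 0 0 (set0 : set (bV R 0)) u measurable0 (measurable_fun_set0 (u : bV R 0 -> \bar R)).
exact: etrans h (integral_set0 (@hm R 0 0) _).
Qed.

(** The space is a single point: the support has empty boundary, the gradient is the empty row, and
    the claim is the derivative of f(0) g(0)^t at t = 0. *)
Lemma first_variation0 : LC g -> 0 < \int[@lebesgue_n R 0]_x (f x)%:E -> (exists x, g x != 0%R) ->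
  first_var_quot f g t @[t --> (0 : R)^'+] --> int_mu f (supp_fun g) + int_nu f (supp_fun_set (supp g))
  /\ -oo < int_mu f (supp_fun g) + int_nu f (supp_fun_set (supp g)).
Proof.
move=> lg; rewrite integral_rV0 lte_fin => f0 [w0 gw0].
have g0 : (0 < g 0)%R by move: gw0; rewrite [w0]thinmx0 lt0r => ->; exact: LC_ge0.
have sT : supp f = setT by apply/seteqP; split => // x _; rewrite /supp /= [x]thinmx0.
have gd : grad_dom f = setT.
  apply/seteqP; split => // x _; split; first by rewrite sT interiorT.
  by rewrite (rV0 (fun y => - ln (f y))%R); exact: differentiable_cst.
have sg x : supp_fun g x = (ln (g 0))%:E.
  rewrite supp_funE (_ : [set _ | _ in _] = [set (ln (g 0))%:E]) ?ereal_sup1//.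
  apply/seteqP; split => [_ [y _ <-]|_ ->] /=; first by rewrite /inner big_ord0 add0r [y]thinmx0.
  by exists 0%R => //; rewrite /inner big_ord0 add0r.
have sE t : (0 < t)%R -> supconv f (lcscale t g) 0%R = (f 0 * g 0 `^ t)%:E.
  move=> t0; rewrite /supconv (_ : [set _ | _ in _] = [set (f 0 * g 0 `^ t)%:E]) ?ereal_sup1//.
  apply/seteqP; split => [_ [y _ <-]|_ ->] /=; first by rewrite [y]thinmx0 /lcscale [(_ *: _)%R]thinmx0.
  by exists 0%R => //; rewrite /lcscale [(_ *: _)%R]thinmx0.
have -> : int_nu f (supp_fun_set (supp g)) = 0.
  rewrite /int_nu (_ : gauss_dom (supp f) = set0).
    exact: int0.
  by apply/seteqP; split => // x [[_ nI] _]; case: nI; rewrite sT interiorT.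
have -> : int_mu f (supp_fun g) = (f 0 * ln (g 0))%:E by rewrite /int_mu gd integral_rV0 sg -EFinM mulrC.
rewrite adde0; split; last exact: ltNyr.
apply: (@cvg_trans _ ((f 0 * ((expR (t * ln (g 0)) - 1) / t))%:E @[t --> (0 : R)^'+])).
  apply: near_eq_cvg; near=> t; have t0 : (0 < t)%R by near: t; exact: nbhs_right_gt.
  rewrite /first_var_quot !integral_rV0 sE// -EFinB -EFinM /powR (gt_eqF g0); congr EFin.
  by rewrite mulrA mulrBr mulr1.
apply: cvg_EFin; first exact: nearW.
by apply: cvgM; [exact: cvg_cst|exact: expR_quotient].
Unshelve. all: by end_near. Qed.

End dimension_zero.

Theorem mainTheorem1 (R : realType) (n : nat) (f g : 'rV[R]_n -> R) :
  LC f -> LC g ->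
  (0 < \int[@lebesgue_n R n]_x (f x)%:E)%E ->
  (\int[@lebesgue_n R n]_x (f x)%:E < +oo)%E ->
  (exists x, g x != 0) ->
  first_var_quot f g t @[t --> 0^'+] -->
    (int_mu f (supp_fun g) + int_nu f (supp_fun_set (supp g)))%E
  /\ (-oo < int_mu f (supp_fun g) + int_nu f (supp_fun_set (supp g)))%E.
Proof.
case: n f g => [|m] f g lf lg f0 fy gn; first exact: first_variation0.
exact: first_variation_pos.
Qed.
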